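(* Assume conditions (A1), (A2), (A3), (B1) and (B2) listed in the context, that $\Xi(\theta)>0$ for every $\theta\in\overline\Theta$ with $\theta\ne\theta_0$, that the matrix functions $\theta\mapsto I(\theta)$ and $\theta\mapsto K(\theta)$ defined in the context are continuous on $\Theta$, and that $I(\theta_0)$ is invertible. Then $$\varepsilon^{-1}(\hat\theta_{n,\varepsilon}-\theta_0)\to I^{-1}(\theta_0)\int_0^T\Upsilon(X^0_s,\theta_0)\,dB(s)\quad\text{in probability as }\varepsilon\to0\text{ and }n\to\infty,$$ where $\Upsilon$ is defined in the context.
   Context: Notation. Fix $d,m,p\in\mathbb N$, $r_0>0$, $T>0$. $|\cdot|$ is the Euclidean norm, $\|\cdot\|$ the Hilbert–Schmidt norm of matrices, $A^*$ the transpose of $A$. $\Theta\subset\mathbb R^p$ is open, bounded and convex, with closure $\overline\Theta$. $\mathscr C=C([-r_0,0];\mathbb R^d)$ with norm $\|f\|_\infty=\sup_{-r_0\le s\le0}|f(s)|$; $\mathcal P_2(\mathscr C)$ is the set of probability measures on $\mathscr C$ with finite second moment, and $\mathbb W_2$ is the $L^2$-Wasserstein distance on it induced by $\|\cdot\|_\infty$. $\mathscr L_\zeta$ is the law of a random variable $\zeta$. For a continuous path $f$ on $[-r_0,T]$ and $t\in[0,T]$, $f_t\in\mathscr C$ is $f_t(s)=f(t+s)$, $s\in[-r_0,0]$. $(B(t))_{t\ge0}$ is an $m$-dimensional Brownian motion on a filtered probability space satisfying the usual conditions. $b:\mathscr C\times\mathcal P_2(\mathscr C)\times\Theta\to\mathbb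 R^d$ (with $\overline\Theta$ in place of $\Theta$ where needed) and $\sigma:\mathscr C\times\mathcal P_2(\mathscr C)\to\mathbb R^{d\times m}$. $\theta_0\in\Theta$ is the true parameter and $\xi\in\mathscr C$ a deterministic initial path. Model. For $\varepsilon\in(0,1)$: $dX^\varepsilon(t)=b(X^\varepsilon_t,\mathscr L_{X^\varepsilon_t},\theta)dt+\varepsilon\,\sigma(X^\varepsilon_t,\mathscr L_{X^\varepsilon_t})dB(t)$, $t\in(0,T]$, $X^\varepsilon_0=\xi$, with $\theta=\theta_0$ the true value. Derivatives. $\nabla_\theta b$ is the $d\times p$ Jacobian of $b$ in $\theta$; $\nabla_\theta b^*=(\nabla_\theta b)^*$ is $p\times d$; $\nabla_\theta^{(2)}b^*=\nabla_\theta(\nabla_\theta b^* )=\big(\partial_{\theta_1}(\nabla_\theta b)^*,\dots,\partial_{\theta_p}(\nabla_\theta b)^*\big)$ is $p\times pd$. These derivatives are assumed to exist. For $A=(A_1,\dots,A_p)$ with $A_k\in\mathbb R^{p\times d}$ and $v\in\mathbb R^d$, $A\circ v=(A_1v,\dots,A_pv)\in\mathbb R^{p\times p}$. Conditions, for all $\zeta_1,\zeta_2\in\mathscr C$, $\mu,\nu\in\mathcal P_2(\mathscr C)$: (A1) There are $\alpha_1,\alpha_2,\beta_1,\beta_2>0$ with $\sup_{\theta\in\overline\Theta}|b(\zeta_1,\mu,\theta)-b(\zeta_2,\nu,\theta)|^2\le\alpha_1\|\zeta_1-\zeta_2\|_\infty^2+\alpha_2\mathbb W_2(\mu,\nu)^2$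 and $\|\sigma(\zeta_1,\mu)-\sigma(\zeta_2,\nu)\|^2\le\beta_1\|\zeta_1-\zeta_2\|_\infty^2+\beta_2\mathbb W_2(\mu,\nu)^2$. (A2) For each $\mathscr C$-valued random variable $\zeta$ with $\mathscr L_\zeta\in\mathcal P_2(\mathscr C)$, $(\sigma\sigma^* )(\zeta,\mathscr L_\zeta)$ is invertible, and there is $L_1>0$ with $\|(\sigma\sigma^* )^{-1}(\zeta_1,\mu)-(\sigma\sigma^* )^{-1}(\zeta_2,\nu)\|\le L_1\{\|\zeta_1-\zeta_2\|_\infty+\mathbb W_2(\mu,\nu)\}$ (the inverses appearing being assumed to exist). (A3) There is $L_2>0$ with $|\xi(t)-\xi(s)|\le L_2|t-s|$ for $t,s\in[-r_0,0]$. (B1) There is $K_1>0$ with $\sup_{\theta\in\overline\Theta}\|(\nabla_\theta b)(\zeta_1,\mu,\theta)-(\nabla_\theta b)(\zeta_2,\nu,\theta)\|\le K_1\{\|\zeta_1-\zeta_2\|_\infty+\mathbb W_2(\mu,\nu)\}$. (B2) There is $K_2>0$ with $\sup_{\theta\in\overline\Theta}\|(\nabla_\theta^{(2)}b^* )(\zeta_1,\mu,\theta)-(\nabla_\theta^{(2)}b^* )(\zeta_2,\nu,\theta)\|\le K_2\{\|\zeta_1-\zeta_2\|_\infty+\mathbb W_2(\mu,\nu)\}$. Discretization. The step size is $\delta=T/n=r_0/M$ with $n,M\in\mathbb N$ (so $n$ ranges over integers for which such an $M$ exists), and $t_k=k\delta$. $Y^\varepsilon(t)=\xi(t)$ for $t\in[-r_0,0]$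 and, for $k=1,\dots,n$, $Y^\varepsilon(t_k)=Y^\varepsilon(t_{k-1})+b(\hat Y^\varepsilon_{t_{k-1}},\mathscr L_{\hat Y^\varepsilon_{t_{k-1}}},\theta_0)\delta+\varepsilon\,\sigma(\hat Y^\varepsilon_{t_{k-1}},\mathscr L_{\hat Y^\varepsilon_{t_{k-1}}})(B(t_k)-B(t_{k-1}))$, where $\hat Y^\varepsilon_{k\delta}$ is the $\mathscr C$-valued random variable given by linear interpolation: for $s\in[-(i+1)\delta,-i\delta]$, $i=0,\dots,M-1$, $\hat Y^\varepsilon_{k\delta}(s)=Y^\varepsilon((k-i)\delta)+\frac{s+i\delta}{\delta}\{Y^\varepsilon((k-i)\delta)-Y^\varepsilon((k-i-1)\delta)\}$. Estimator. $P_k(\theta)=Y^\varepsilon(t_k)-Y^\varepsilon(t_{k-1})-b(\hat Y^\varepsilon_{t_{k-1}},\mathscr L_{\hat Y^\varepsilon_{t_{k-1}}},\theta)\delta$; $\hat\sigma(\zeta)=(\sigma\sigma^* )^{-1}(\zeta,\mathscr L_\zeta)$; the contrast function is $\Psi_{n,\varepsilon}(\theta)=\varepsilon^{-2}\delta^{-1}\sum_{k=1}^nP_k^*(\theta)\hat\sigma(\hat Y^\varepsilon_{t_{k-1}})P_k(\theta)$. The least squares estimator $\hat\theta_{n,\varepsilon}$ is a ($\Theta$-valued, random) minimizer: $\Psi_{n,\varepsilon}(\hat\theta_{n,\varepsilon})=\min_{\theta\in\Theta}\Psi_{n,\varepsilon}(\theta)$ (such a minimizer is taken to exist). Limit objects.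 $X^0$ is the (deterministic) solution of $dX^0(t)=b(X^0_t,\mathscr L_{X^0_t},\theta_0)dt$, $t>0$, $X^0_0=\xi$ (so $\mathscr L_{X^0_t}$ is the Dirac mass at $X^0_t$). $\Lambda(\zeta,\theta,\theta_0)=b(\zeta,\mathscr L_\zeta,\theta_0)-b(\zeta,\mathscr L_\zeta,\theta)$. $\Xi(\theta)=\int_0^T\Lambda^*(X^0_t,\theta,\theta_0)\hat\sigma(X^0_t)\Lambda(X^0_t,\theta,\theta_0)\,dt$. $I(\theta)=\int_0^T(\nabla_\theta b)^*(X^0_s,\mathscr L_{X^0_s},\theta)\,\hat\sigma(X^0_s)\,(\nabla_\theta b)(X^0_s,\mathscr L_{X^0_s},\theta)\,ds$. $K(\theta)=-2\int_0^T(\nabla_\theta^{(2)}b^* )(X^0_s,\mathscr L_{X^0_s},\theta)\circ\big(\hat\sigma(X^0_s)\Lambda(X^0_s,\theta,\theta_0)\big)\,ds$. $\Upsilon(\zeta,\theta_0)=(\nabla_\theta b)^*(\zeta,\mathscr L_\zeta,\theta_0)\,\hat\sigma(\zeta)\,\sigma(\zeta,\mathscr L_\zeta)$. *)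

(* Defs.v *)
From HB Require Import structures.
From mathcomp Require Import all_boot all_order all_algebra.
From mathcomp Require Import all_classical all_reals all_analysis.

Set Implicit Arguments.
Unset Strict Implicit.
Unset Printing Implicit Defensive.

Import Order.TTheory GRing.Theory Num.Theory.
Import numFieldNormedType.Exports.

Local Open Scope classical_set_scope.
Local Open Scope ring_scope.

(* Hilbert-Schmidt norm; on column vectors it is the Euclidean norm. The norm
   `|A| that the library puts on matrices is the maximum norm. *)
Definition hsnorm {R : realType} {a c : nat} (A : 'M[R]_(a, c)) : R :=
  Num.sqrt (\sum_(i < a) \sum_(j < c) A i j ^+ 2).

(* A block row (A_1, ..., A_p) is represented by the family of its blocks. *)
Definition block_norm {R : realType} {p a c : nat} (A : 'I_p -> 'M[R]_(a, c)) : R :=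
  Num.sqrt (\sum_(k < p) hsnorm (A k) ^+ 2).

(* A o v = (A_1 v, ..., A_p v) *)
Definition block_circ {R : realType} {p d : nat} (A : 'I_p -> 'M[R]_(p, d))
    (v : 'cV[R]_d) : 'M[R]_p :=
  \matrix_(i < p, k < p) (A k *m v) i 0.

Definition mx_integral {R : realType} {a c : nat} (T : R)
    (f : R -> 'M[R]_(a, c)) : 'M[R]_(a, c) :=
  \matrix_(i < a, j < c) \int[lebesgue_measure]_(t in `[0, T]) f t i j.

(* Differentiability of f at x relative to A, with k-th partial derivative D k;
   at interior points of A this is Frechet differentiability. If A is the
   closure of a nonempty open convex set and x is in A, then D is unique. *)
Definition has_partials_within {R : realType} {p a c : nat} (A : set 'cV[R]_p)
    (f : 'cV[R]_p -> 'M[R]_(a, c)) (x : 'cV[R]_p)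
    (D : 'I_p -> 'M[R]_(a, c)) : Prop :=
  hsnorm (f y - f x - \sum_(k < p) (y - x) k 0 *: D k) / hsnorm (y - x)
    @[y --> within A x^'] --> (0 : R).

(* C([-r0, 0]; R^d): a path is stored as a function on R that is zero outside
   [-r0, 0], so that equality in this type is equality of functions on
   [-r0, 0]. *)
Record cpath (R : realType) (r0 : R) (d : nat) := CPath {
  path_fun :> R -> 'cV[R]_d ;
  path_continuous : {within `[- r0, 0], continuous path_fun} ;
  path_out : forall s, ~ (- r0 <= s <= 0) -> path_fun s = 0 }.

Section path_space.
Context {R : realType} (r0 : R) (d : nat).
Local Notation C := (cpath r0 d).

Definition zero_path : C :=
  @CPath R r0 d (fun=> 0) (fun x => @cvg_cst _ _ _ _ _) (fun _ _ => erefl).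

HB.instance Definition _ := gen_eqMixin C.
HB.instance Definition _ := gen_choiceMixin C.
HB.instance Definition _ := isPointed.Build C zero_path.

Definition supnorm (f : R -> 'cV[R]_d) : R :=
  sup [set hsnorm (f s) | s in `[- r0, 0]].

Definition path_dist (x y : C) : R := supnorm (fun s => x s - y s).

Definition path_open : set (set C) :=
  [set A | forall x, A x ->
    exists2 e : R, 0 < e & forall y, path_dist x y < e -> A y].

HB.instance Definition _ := @isMeasurable.Build (sigma_display path_open) C
  <<s path_open >> (@sigma_algebra0 _ setT path_open)
  (@sigma_algebraC _ path_open) (@sigma_algebra_bigcup _ setT path_open).

Definition finite_moment2 (mu : probability C R) : Prop :=
  (\int[mu]_x ((supnorm x ^+ 2)%:E) < +oo)%E.

Definition couplings (mu nu : probability C R) : set (probability (C * C)%type R) :=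
  [set pi | forall A : set C, measurable A ->
    pi (A `*` setT) = mu A /\ pi (setT `*` A) = nu A].

(* For mu and nu with finite second moment the infimum is finite. *)
Definition W2 (mu nu : probability C R) : R :=
  Num.sqrt (fine (ereal_inf
    [set (\int[pi]_z ((path_dist z.1 z.2 ^+ 2)%:E))%E | pi in couplings mu nu])).

Definition dirac_law (x : C) : probability C R := \d_x.

Definition law {dO : measure_display} {O : measurableType dO}
    {P : probability O R} (X : {RV P >-> C}) : probability C R :=
  distribution P X.

Definition window (f : R -> 'cV[R]_d) (s : R) : 'cV[R]_d :=
  if (- r0 <= s <= 0) then f s else 0.

Lemma window_out f s : ~ (- r0 <= s <= 0) -> window f s = 0.
Proof. by rewrite /window; case: ifP. Qed.

(* The segment f_t : s |-> f (t + s), as an element of C. The default value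
   zero_path is not used when f is continuous on [-r0, T] and 0 <= t <= T (segmentE). *)
Definition segment (f : R -> 'cV[R]_d) (t : R) : C :=
  if pselect {within `[- r0, 0], continuous (window (fun s => f (t + s)))}
    is left cf then CPath cf (@window_out _) else zero_path.

Lemma segmentE (T t s : R) (f : R -> 'cV[R]_d) :
  {within `[- r0, T], continuous f} -> 0 <= t <= T -> - r0 <= s <= 0 ->
  segment f t s = f (t + s).
Proof.
move=> cf /andP[t0 tT] /andP[s0 s1]; have sI : - r0 <= s <= 0 by rewrite s0 s1.
rewrite /segment; case: pselect => [cg /=|[]]; first by rewrite /window sI.
have /subspace_continuousP cft := cf.
suff : {within `[- r0, 0], continuous (fun u => f (t + u))}.
  apply: subspace_eq_continuous => u; rewrite inE /= in_itv /= => uI.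
  by rewrite -[RHS]/(window _ u) /window uI.
apply/subspace_continuousP => x; rewrite /= in_itv /= => /andP[x0 x1].
have xI : (`[- r0, T]%classic : set R) (t + x).
  rewrite /= in_itv /=; apply/andP; split.
    by rewrite -[leLHS]add0r lerD.
  by rewrite -[leRHS]addr0 lerD.
apply: (@cvg_comp _ _ _ (fun u => t + u) f _ _ _ _ (cft _ xI)).
move=> V /= VI; have : nbhs x (fun u => `[- r0, T]%classic (t + u) -> V (t + u)).
  by apply: (@cvgD _ _ _ (nbhs x) _ (fun=> t) id t x) VI;
    [exact: cvg_cst | exact: cvg_id].
apply: filterS => u /= + uI; apply; move: uI.
rewrite !in_itv /= => /andP[u0 u1]; apply/andP; split.
  by rewrite -[leLHS]add0r lerD.
by rewrite -[leRHS]addr0 lerD.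
Qed.

End path_space.

Section model.
Context {R : realType} {r0 : R} {d m p : nat}.
Local Notation C := (cpath r0 d).
Local Notation PC := (probability C R).

Implicit Types (b : C -> PC -> 'cV[R]_p -> 'cV[R]_d).
Implicit Types (sigma : C -> PC -> 'M[R]_(d, m)).
Implicit Types (gradb : C -> PC -> 'cV[R]_p -> 'M[R]_(d, p)).
Implicit Types (hessb : C -> PC -> 'cV[R]_p -> 'I_p -> 'M[R]_(p, d)).

(* The coefficients are total in the measure argument; the conditions bear only
   on measures with finite second moment, and on theta in the closure of Theta. *)

Definition condA1 (Theta : set 'cV[R]_p) b sigma : Prop :=
  exists alpha1 alpha2 beta1 beta2 : R,
    [/\ 0 < alpha1, 0 < alpha2, 0 < beta1, 0 < beta2 &
    forall (x y : C) (mu nu : PC), finite_moment2 mu -> finite_moment2 nu ->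
      (forall theta, closure Theta theta ->
         hsnorm (b x mu theta - b y nu theta) ^+ 2
           <= alpha1 * path_dist x y ^+ 2 + alpha2 * W2 mu nu ^+ 2) /\
      hsnorm (sigma x mu - sigma y nu) ^+ 2
           <= beta1 * path_dist x y ^+ 2 + beta2 * W2 mu nu ^+ 2].

Definition sigma2 sigma (x : C) (mu : PC) : 'M[R]_d :=
  sigma x mu *m (sigma x mu)^T.

Definition sigma_hat sigma (x : C) (mu : PC) : 'M[R]_d :=
  invmx (sigma2 sigma x mu).

(* [invmx A] is A when A is singular, hence the two invertibility premises. *)
Definition condA2 {dO : measure_display} {O : measurableType dO}
    (P : probability O R) sigma : Prop :=
  (forall X : {RV P >-> C}, finite_moment2 (law X) ->
     {ae P, forall w, sigma2 sigma (X w) (law X) \in unitmx}) /\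
  exists2 L1 : R, 0 < L1 &
    forall (x y : C) (mu nu : PC), finite_moment2 mu -> finite_moment2 nu ->
      sigma2 sigma x mu \in unitmx -> sigma2 sigma y nu \in unitmx ->
      hsnorm (sigma_hat sigma x mu - sigma_hat sigma y nu)
        <= L1 * (path_dist x y + W2 mu nu).

Definition condA3 (xi : C) : Prop :=
  exists2 L2 : R, 0 < L2 &
    forall s t, - r0 <= s <= 0 -> - r0 <= t <= 0 ->
      hsnorm (xi t - xi s) <= L2 * `|t - s|.

(* gradb is the Jacobian of b in theta, and hessb x mu theta k the k-th partial
   derivative of its transpose. *)
Definition theta_derivatives (Theta : set 'cV[R]_p) b gradb hessb : Prop :=
  forall (x : C) (mu : PC) theta, finite_moment2 mu -> closure Theta theta ->
    has_partials_within (closure Theta) (b x mu) theta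
      (fun k => col k (gradb x mu theta)) /\
    has_partials_within (closure Theta) (fun th => (gradb x mu th)^T) theta
      (hessb x mu theta).

Definition condB1 (Theta : set 'cV[R]_p) gradb : Prop :=
  exists2 K1 : R, 0 < K1 &
    forall (x y : C) (mu nu : PC), finite_moment2 mu -> finite_moment2 nu ->
      forall theta, closure Theta theta ->
      hsnorm (gradb x mu theta - gradb y nu theta)
        <= K1 * (path_dist x y + W2 mu nu).

Definition condB2 (Theta : set 'cV[R]_p) hessb : Prop :=
  exists2 K2 : R, 0 < K2 &
    forall (x y : C) (mu nu : PC), finite_moment2 mu -> finite_moment2 nu ->
      forall theta, closure Theta theta ->
      block_norm (fun k => hessb x mu theta k - hessb y nu theta k)
        <= K2 * (path_dist x y + W2 mu nu).

Definition limit_ode b (theta0 : 'cV[R]_p) (xi : C) (T : R)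
    (X0 : R -> 'cV[R]_d) : Prop :=
  [/\ {within `[- r0, T], continuous X0},
      forall t, - r0 <= t <= 0 -> X0 t = xi t &
      forall t, 0 <= t <= T ->
        X0 t = xi 0 + mx_integral t
          (fun s => b (segment r0 X0 s) (dirac_law (segment r0 X0 s)) theta0)].

Definition Lambda b (x : C) (mu : PC) (theta theta0 : 'cV[R]_p) : 'cV[R]_d :=
  b x mu theta0 - b x mu theta.

Definition Xi b sigma (theta0 : 'cV[R]_p) (T : R) (X0 : R -> 'cV[R]_d)
    (theta : 'cV[R]_p) : R :=
  \int[lebesgue_measure]_(t in `[0, T])
    (let x := segment r0 X0 t in let mu := dirac_law x in
     ((Lambda b x mu theta theta0)^T *m sigma_hat sigma x mu
        *m Lambda b x mu theta theta0) 0 0).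

Definition Imx gradb sigma (T : R) (X0 : R -> 'cV[R]_d)
    (theta : 'cV[R]_p) : 'M[R]_p :=
  mx_integral T (fun s => let x := segment r0 X0 s in let mu := dirac_law x in
    (gradb x mu theta)^T *m sigma_hat sigma x mu *m gradb x mu theta).

Definition Kmx b hessb sigma (theta0 : 'cV[R]_p) (T : R) (X0 : R -> 'cV[R]_d)
    (theta : 'cV[R]_p) : 'M[R]_p :=
  - 2 *: mx_integral T (fun s => let x := segment r0 X0 s in
    let mu := dirac_law x in
    block_circ (hessb x mu theta)
      (sigma_hat sigma x mu *m Lambda b x mu theta theta0)).

Definition Upsilon gradb sigma (x : C) (mu : PC) (theta0 : 'cV[R]_p) :
    'M[R]_(p, m) :=
  (gradb x mu theta0)^T *m sigma_hat sigma x mu *m sigma x mu.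

End model.

Section brownian_motion.
Context {R : realType} {dO : measure_display} {O : measurableType dO}.
Variable P : probability O R.

Definition usual_filtration (F : R -> set (set O)) : Prop :=
  [/\ forall t, 0 <= t -> sigma_algebra setT (F t) /\ F t `<=` measurable,
      forall s t, 0 <= s -> s <= t -> F s `<=` F t,
      forall t, 0 <= t -> \bigcap_(s in [set s | t < s]) F s `<=` F t &
      negligible P `<=` F 0].

Definition increment_in {m : nat} (B : R -> O -> 'cV[R]_m) (s t : R)
    (A : 'I_m -> set R) : set O :=
  [set w | forall i, A i ((B t w - B s w) i 0)].

(* [normal_prob 0 c] has standard deviation c. *)
Definition brownian {m : nat} (F : R -> set (set O))
    (B : R -> O -> 'cV[R]_m) : Prop :=
  [/\ {ae P, forall w, B 0 w = 0},
      {ae P, forall w, {within `[0, +oo[, continuous (fun t => B t w)}},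
      forall t i (A : set R), 0 <= t -> measurable A ->
        F t ((fun w => B t w i 0) @^-1` A),
      forall s t (A : 'I_m -> set R), 0 <= s -> s < t ->
        (forall i, measurable (A i)) ->
        P (increment_in B s t A)
          = (\prod_(i < m) fine (normal_prob 0 (Num.sqrt (t - s)) (A i)))%:E &
      forall s t (A : 'I_m -> set R) (G : set O), 0 <= s -> s < t ->
        (forall i, measurable (A i)) -> F s G ->
        P (G `&` increment_in B s t A) = (P G * P (increment_in B s t A))%E].

(* A step function on ]0, T] is a list of triples ((u, v), c), each standing
   for the function equal to c on ]u, v] and to 0 elsewhere. *)
Definition step_fun {a m : nat} (S : seq (R * R * 'M[R]_(a, m))) (t : R) :
    'M[R]_(a, m) :=
  \sum_(q <- S | q.1.1 < t <= q.1.2) q.2.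

Definition step_integral {a m : nat} (B : R -> O -> 'cV[R]_m)
    (S : seq (R * R * 'M[R]_(a, m))) (w : O) : 'cV[R]_a :=
  \sum_(q <- S) q.2 *m (B q.1.2 w - B q.1.1 w).

(* Z is (a version of) the Ito integral over [0, T] of the deterministic
   integrand f: the L^2 limit of the integrals of step functions that converge
   to f in L^2([0, T]). *)
Definition is_ito_integral {a m : nat} (B : R -> O -> 'cV[R]_m) (T : R)
    (f : R -> 'M[R]_(a, m)) (Z : O -> 'cV[R]_a) : Prop :=
  (forall i, measurable_fun setT (fun w => Z w i 0)) /\
  exists S : nat -> seq (R * R * 'M[R]_(a, m)),
  [/\ forall k, all (fun q : R * R * _ =>
         [&& 0 <= q.1.1, q.1.1 <= q.1.2 & q.1.2 <= T]) (S k),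
      (\int[lebesgue_measure]_(t in `[0%R, T])
         ((hsnorm (step_fun (S k) t - f t) ^+ 2)%:E))%E @[k --> \oo] --> 0%E &
      (\int[P]_w ((hsnorm (step_integral B (S k) w - Z w) ^+ 2)%:E))%E
         @[k --> \oo] --> 0%E].

End brownian_motion.

Definition admissible {R : realType} (T r0 : R) (n M : nat) : Prop :=
  [/\ (0 < n)%N, (0 < M)%N & T / n%:R = r0 / M%:R].

Section scheme.
Context {R : realType} {r0 : R} {d m p : nat}.
Context {dO : measure_display} {O : measurableType dO} {P : probability O R}.
Local Notation C := (cpath r0 d).
Local Notation PC := (probability C R).

Variables (b : C -> PC -> 'cV[R]_p -> 'cV[R]_d) (sigma : C -> PC -> 'M[R]_(d, m)).

(* Y j is the value of the scheme at time j * (T / n), for - M <= j <= n, and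
   Yhat k the interpolated segment at time k * (T / n). *)
Definition euler_scheme (B : R -> O -> 'cV[R]_m) (theta0 : 'cV[R]_p) (xi : C)
    (T eps : R) (n M : nat) (Y : int -> O -> 'cV[R]_d)
    (Yhat : nat -> {RV P >-> C}) : Prop :=
  let delta := T / n%:R in
  [/\ forall (j : int) w, - M%:Z <= j <= 0 -> Y j w = xi (j%:~R * delta),
      forall (k : nat) w, (k < n)%N ->
        Y k.+1%:Z w = Y k%:Z w + delta *: b (Yhat k w) (law (Yhat k)) theta0
          + eps *: (sigma (Yhat k w) (law (Yhat k))
                      *m (B (k.+1%:R * delta) w - B (k%:R * delta) w)) &
      forall (k i : nat) w (s : R), (k < n)%N -> (i < M)%N ->
        - (i.+1%:R * delta) <= s <= - (i%:R * delta) ->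
        Yhat k w s = Y (k%:Z - i%:Z) w
          + ((s + i%:R * delta) / delta)
              *: (Y (k%:Z - i%:Z) w - Y (k%:Z - i%:Z - 1) w)].

(* The residual over the step from k * delta to (k + 1) * delta; k starts at 0. *)
Definition residual (delta : R) (Y : int -> O -> 'cV[R]_d)
    (Yhat : nat -> {RV P >-> C}) (k : nat) (theta : 'cV[R]_p) (w : O) :
    'cV[R]_d :=
  Y k.+1%:Z w - Y k%:Z w - delta *: b (Yhat k w) (law (Yhat k)) theta.

Definition contrast (T eps : R) (n : nat) (Y : int -> O -> 'cV[R]_d)
    (Yhat : nat -> {RV P >-> C}) (theta : 'cV[R]_p) (w : O) : R :=
  let delta := T / n%:R in
  eps ^- 2 * delta^-1 * \sum_(k < n)
    ((residual delta Y Yhat k theta w)^T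
       *m sigma_hat sigma (Yhat k w) (law (Yhat k))
       *m residual delta Y Yhat k theta w) 0 0.

Definition least_squares_estimator (Theta : set 'cV[R]_p) (T eps : R) (n : nat)
    (Y : int -> O -> 'cV[R]_d) (Yhat : nat -> {RV P >-> C})
    (thetahat : O -> 'cV[R]_p) : Prop :=
  [/\ forall i, measurable_fun setT (fun w => thetahat w i 0),
      forall w, Theta (thetahat w) &
      {ae P, forall w, forall theta, Theta theta ->
        contrast T eps n Y Yhat (thetahat w) w
          <= contrast T eps n Y Yhat theta w}].

End scheme.

(* Main.v *)
Require Import Defs.
From HB Require Import structures.
From mathcomp Require Import all_boot all_order all_algebra.
From mathcomp Require Import all_classical all_reals all_analysis.
From mathcomp Require Import measurable_realfun.
From mathcomp Require Import ring lra zify.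

(* Put h = theta - theta0. Up to a term free of theta, eps^2 times the contrast is
   J(theta) - 2 eps (h . zeta + r(theta) . v + |h| N(theta)), where J is a Riemann sum of
   Xi, zeta the sum of Upsilon against the Brownian increments, r the Taylor remainder of
   the drift at the initial segment, and N collects the differences of remainders, divided
   by |h|. Those differences are Lipschitz in theta by (B2), although r need not be: hence
   the increments of N are sub-Gaussian, and chaining makes N uniformly bounded, and small
   near theta0, with high probability. As Xi(theta) >= c |h|^2 on the compact closure of
   Theta, the minimizer satisfies |h| = O(eps). On that scale the contrast is close to the
   quadratic h . I h - 2 eps h . zeta, so h / eps is close to I^-1 zeta, and zeta tends in
   L^2 to the Ito integral. Gronwall's inequality gives
   E max_k |Y(t_k) - X0(t_k)|^2 = O(eps^2 + delta^2). *)

Set Implicit Arguments.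
Unset Strict Implicit.
Unset Printing Implicit Defensive.

Import Order.TTheory GRing.Theory Num.Theory.
Import numFieldNormedType.Exports.

Local Open Scope classical_set_scope.
Local Open Scope ring_scope.

(** * Hilbert-Schmidt norm *)

Section hsnorm_theory.
Context {R : realType}.
Implicit Types (a b c : nat).

(** The derivatives in theta come without a modulus of continuity common to all paths: (B2) compares
    two points of path space at the same theta. This dictates the splitting of the remainder. Its
    value at the initial segment is deterministic and leaves the stochastic sum, where it multiplies
    a single random vector bounded in L^2, so that r = O(|h|) on Theta and r = o(|h|) at theta0
    suffice. The rest is divided by |h| because the comparison of J with the noise must cancel one
    factor |h| to give the rate eps; for the same reason the error in J is kept proportional to
    |h|^2. Sub-Gaussian increments call for bounded integrands while the coefficients grow linearly,
    hence a truncation. The law of the segment is deterministic and close to a Dirac mass, so it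
    enters the estimates as one more error of the same order as the path. Martingale facts are
    derived from independence read as a product law, without conditional expectations. Outside a
    null set and finitely many small events, the conclusion is a deterministic statement on
    minimizers. *)

Lemma sum_cauchy_schwarz (I : finType) (x y : I -> R) :
  (\sum_i x i * y i) ^+ 2 <= (\sum_i x i ^+ 2) * (\sum_i y i ^+ 2).
Proof.
have : 0 <= \sum_i \sum_j (x i * y j - x j * y i) ^+ 2.
  by apply: sumr_ge0 => i _; apply: sumr_ge0 => j _; exact: sqr_ge0.
(* Lagrange's identity. *)
have -> : \sum_i \sum_j (x i * y j - x j * y i) ^+ 2 =
    2 * ((\sum_i x i ^+ 2) * (\sum_i y i ^+ 2)) - 2 * (\sum_i x i * y i) ^+ 2.
  transitivity (\sum_i \sum_j (x i ^+ 2 * y j ^+ 2 + y i ^+ 2 * x j ^+ 2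
      - 2 * (x i * y i) * (x j * y j))).
    by apply: eq_bigr => i _; apply: eq_bigr => j _; ring.
  have E (f g : I -> R) : (\sum_i f i) * (\sum_j g j) = \sum_i \sum_j f i * g j.
    by rewrite big_distrl; apply: eq_bigr => i _; rewrite big_distrr.
  under eq_bigr do rewrite sumrB big_split /=.
  rewrite sumrB big_split /= -!E.
  by rewrite -mulr_sumr; ring.
by rewrite -mulrBr pmulr_rge0 // subr_ge0.
Qed.

Lemma sqr_hsnorm a c (A : 'M[R]_(a, c)) :
  hsnorm A ^+ 2 = \sum_i \sum_j A i j ^+ 2.
Proof.
rewrite sqr_sqrtr //.
by apply: sumr_ge0 => i _; apply: sumr_ge0 => j _; exact: sqr_ge0.
Qed.

Lemma hsnorm_ge0 a c (A : 'M[R]_(a, c)) : 0 <= hsnorm A.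
Proof. exact: sqrtr_ge0. Qed.
Hint Resolve hsnorm_ge0 : core.

Lemma hsnorm0 a c : hsnorm (0 : 'M[R]_(a, c)) = 0.
Proof.
rewrite /hsnorm big1 ?sqrtr0 // => i _; rewrite big1 // => j _.
by rewrite mxE expr0n.
Qed.

Lemma hsnormZ a c (k : R) (A : 'M[R]_(a, c)) : hsnorm (k *: A) = `|k| * hsnorm A.
Proof.
apply/eqP; rewrite -(@eqrXn2 _ 2) // ?mulr_ge0 // exprMn !sqr_hsnorm.
rewrite real_normK ?num_real // big_distrr /=; apply/eqP/eq_bigr => i _.
by rewrite big_distrr; apply: eq_bigr => j _; rewrite mxE exprMn.
Qed.

Lemma hsnormN a c (A : 'M[R]_(a, c)) : hsnorm (- A) = hsnorm A.
Proof. by rewrite -scaleN1r hsnormZ normrN1 mul1r. Qed.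

Lemma hsnormBC a c (A B : 'M[R]_(a, c)) : hsnorm (A - B) = hsnorm (B - A).
Proof. by rewrite -hsnormN opprB. Qed.

Lemma hsnorm_tr a c (A : 'M[R]_(a, c)) : hsnorm A^T = hsnorm A.
Proof.
rewrite /hsnorm exchange_big /=; congr Num.sqrt.
by apply: eq_bigr => i _; apply: eq_bigr => j _; rewrite mxE.
Qed.

Lemma hsnormD a c (A B : 'M[R]_(a, c)) : hsnorm (A + B) <= hsnorm A + hsnorm B.
Proof.
rewrite -(@ler_pXn2r _ 2) ?nnegrE ?addr_ge0 // sqrrD !sqr_hsnorm.
rewrite !(pair_bigA _ (fun i j => _)) /=.
set X := fun u : 'I_a * 'I_c => A u.1 u.2; set Y := fun u => B u.1 u.2.
have -> : \sum_u (A + B) u.1 u.2 ^+ 2 =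
    \sum_u X u ^+ 2 + (\sum_u X u * Y u) *+ 2 + \sum_u Y u ^+ 2.
  rewrite -sumrMnl -!big_split; apply: eq_bigr => u _ /=.
  by rewrite mxE sqrrD.
rewrite lerD2r lerD2l lerMn2r /=.
have [h|/ltW h] := leP (\sum_u X u * Y u) 0.
  by apply: (le_trans h); exact: mulr_ge0.
rewrite -(@ler_pXn2r _ 2) ?nnegrE ?mulr_ge0 // exprMn !sqr_hsnorm.
by rewrite !(pair_bigA _ (fun i j => _ ^+ 2)) /=; exact: sum_cauchy_schwarz.
Qed.

Lemma hsnormB a c (A B : 'M[R]_(a, c)) : hsnorm (A - B) <= hsnorm A + hsnorm B.
Proof. by rewrite -[X in _ <= _ + X]hsnormN; exact: hsnormD. Qed.

Lemma hsnorm_triB a c (A B C : 'M[R]_(a, c)) :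
  hsnorm (A - C) <= hsnorm (A - B) + hsnorm (B - C).
Proof. by rewrite -[X in hsnorm X <= _](subrKA B); exact: hsnormD. Qed.

Lemma hsnorm_sub_le a c (A B : 'M[R]_(a, c)) :
  hsnorm A <= hsnorm (A - B) + hsnorm B.
Proof. by rewrite -[X in hsnorm X <= _](subrK B) hsnormD. Qed.

Lemma hsnorm_distB a c (A B : 'M[R]_(a, c)) :
  `|hsnorm A - hsnorm B| <= hsnorm (A - B).
Proof.
have := hsnorm_sub_le A B; have := hsnorm_sub_le B A.
by rewrite (hsnormBC B A) ler_norml; lra.
Qed.

Lemma hsnorm_sum a c (I : Type) (r : seq I) (Q : pred I) (A : I -> 'M[R]_(a, c)) :
  hsnorm (\sum_(i <- r | Q i) A i) <= \sum_(i <- r | Q i) hsnorm (A i).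
Proof.
elim/big_ind2 : _ => [|x u y v ux vy|//]; first by rewrite hsnorm0.
by rewrite (le_trans (hsnormD _ _)) // lerD.
Qed.

Lemma hsnorm_eq0 a c (A : 'M[R]_(a, c)) : (hsnorm A == 0) = (A == 0).
Proof.
apply/eqP/eqP => [A0|->]; last exact: hsnorm0.
have : \sum_i \sum_j A i j ^+ 2 = 0 by rewrite -sqr_hsnorm A0 expr0n.
rewrite pair_bigA /= => /eqP; rewrite psumr_eq0 => [/allP A00|u _]; last exact: sqr_ge0.
apply/matrixP => i j; rewrite mxE.
by have := A00 (i, j); rewrite mem_index_enum sqrf_eq0 => /(_ isT)/eqP.
Qed.

Lemma hsnorm_gt0 a c (A : 'M[R]_(a, c)) : (0 < hsnorm A) = (A != 0).
Proof. by rewrite lt_def hsnorm_ge0 andbT hsnorm_eq0. Qed.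

Lemma hsnorm_entry a c (A : 'M[R]_(a, c)) i j : `|A i j| <= hsnorm A.
Proof.
rewrite -(@ler_pXn2r _ 2) ?nnegrE // real_normK ?num_real // sqr_hsnorm.
rewrite (bigD1 i) //= (bigD1 j) //= -addrA lerDl addr_ge0 // sumr_ge0 // => *.
  exact: sqr_ge0.
by apply: sumr_ge0 => *; exact: sqr_ge0.
Qed.

Lemma hsnorm_le_sum a c (A : 'M[R]_(a, c)) :
  hsnorm A <= \sum_i \sum_j `|A i j|.
Proof.
have -> : A = \sum_i \sum_j A i j *: delta_mx i j by exact: matrix_sum_delta.
apply: (le_trans (hsnorm_sum _ _ _)); apply: ler_sum => i _.
rewrite -matrix_sum_delta.
apply: (le_trans (hsnorm_sum _ _ _)); apply: ler_sum => j _.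
rewrite hsnormZ -[leRHS]mulr1 ler_wpM2l //.
rewrite -(@ler_pXn2r _ 2) ?nnegrE // sqr_hsnorm expr1n (bigD1 i) //= (bigD1 j) //=.
rewrite !big1 => [|k /negPf ki|k /negPf kj]; rewrite ?mxE ?eqxx ?expr1n ?addr0 //.
  by rewrite big1 // => l _; rewrite mxE ki expr0n.
by rewrite kj andbF expr0n.
Qed.

Lemma hsnormM a b c (A : 'M[R]_(a, b)) (B : 'M[R]_(b, c)) :
  hsnorm (A *m B) <= hsnorm A * hsnorm B.
Proof.
rewrite -(@ler_pXn2r _ 2) ?nnegrE ?mulr_ge0 // exprMn !sqr_hsnorm.
rewrite [X in _ * X]exchange_big big_distrl /=; apply: ler_sum => i _.
rewrite big_distrr /=; apply: ler_sum => k _.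
by rewrite mxE; exact: sum_cauchy_schwarz.
Qed.

Lemma hsnorm_bilin a b (x : 'cV[R]_a) (A : 'M[R]_(a, b)) (y : 'cV[R]_b) :
  `|(x^T *m A *m y) 0 0| <= hsnorm x * hsnorm A * hsnorm y.
Proof.
apply: (le_trans (hsnorm_entry _ _ _)); apply: (le_trans (hsnormM _ _)).
by apply: ler_wpM2r => //; rewrite -(hsnorm_tr x); exact: hsnormM.
Qed.

Lemma hsnorm_dot a (x y : 'cV[R]_a) : `|(x^T *m y) 0 0| <= hsnorm x * hsnorm y.
Proof.
apply: (le_trans (hsnorm_entry _ _ _)); apply: (le_trans (hsnormM _ _)).
by rewrite hsnorm_tr.
Qed.

Lemma sqr_hsnorm_dot a (x : 'cV[R]_a) : (x^T *m x) 0 0 = hsnorm x ^+ 2.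
Proof.
rewrite sqr_hsnorm mxE; apply: eq_bigr => i _; rewrite mxE.
by rewrite big_ord1 expr2.
Qed.

Lemma sqr_hsnormD_le a c (A B : 'M[R]_(a, c)) :
  hsnorm (A + B) ^+ 2 <= 2 * hsnorm A ^+ 2 + 2 * hsnorm B ^+ 2.
Proof.
have h := hsnormD A B; have h0 := hsnorm_ge0 (A + B).
have : hsnorm (A + B) ^+ 2 <= (hsnorm A + hsnorm B) ^+ 2.
  by rewrite lerXn2r ?nnegrE ?addr_ge0.
have := sqr_ge0 (hsnorm A - hsnorm B); rewrite sqrrB sqrrD; lra.
Qed.

Lemma le_mx_norm_hsnorm a c (A : 'M[R]_(a, c)) : `|A| <= hsnorm A.
Proof.
rewrite [leLHS]/Num.norm /= mx_normrE; apply/bigmax_leP; split=> // u _.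
exact: hsnorm_entry.
Qed.

Lemma entry_le_mx_norm a c (A : 'M[R]_(a, c)) i j : `|A i j| <= `|A|.
Proof.
rewrite [leRHS]/Num.norm /= mx_normrE.
by apply/bigmax_geP; right; exists (i, j).
Qed.

(** With [le_mx_norm_hsnorm] this makes the two norms equivalent, so that topological facts about
    matrices can be read through [hsnorm]. *)
Lemma hsnorm_le_mx_norm a c (A : 'M[R]_(a, c)) : hsnorm A <= (a * c)%:R * `|A|.
Proof.
apply: (le_trans (hsnorm_le_sum _)).
have -> : (a * c)%:R * `|A| = \sum_(i < a) \sum_(j < c) `|A|.
  by rewrite !sumr_const !card_ord -mulrnA mulnC mulr_natl.
by apply: ler_sum => i _; apply: ler_sum => j _; exact: entry_le_mx_norm.
Qed.

End hsnorm_theory.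
#[global] Hint Extern 0 (is_true (_ <= hsnorm _)) => (apply: hsnorm_ge0) : core.

(** * Path space *)

Section path_space_theory.
Context {R : realType} (r0 : R) (d : nat).
Hypothesis r0_gt0 : 0 < r0.
Local Notation C := (cpath r0 d).
Implicit Types (x y z : C).

Lemma hsnorm_continuous_within a c (A : set R) (f : R -> 'M[R]_(a, c)) :
  {within A, continuous f} -> {within A, continuous (fun s => hsnorm (f s))}.
Proof.
move=> cf; apply/subspace_continuousP => s As.
have /subspace_continuousP/(_ s As) cfs := cf.
apply/cvgrPdist_le => e e0.
have e1 : 0 < e / ((a * c)%:R + 1) by rewrite divr_gt0 // ltr_wpDl.
have /cvgrPdist_lt/(_ _ e1) := cfs.
apply: filterS => t ht; apply: (le_trans (hsnorm_distB _ _)).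
apply: (le_trans (hsnorm_le_mx_norm _)).
have := ltW ht; rewrite ler_pdivlMr ?ltr_wpDl //.
by have := normr_ge0 (f s - f t); nra.
Qed.

Lemma supnorm_le (f : R -> 'cV[R]_d) (K : R) :
  (forall s, - r0 <= s <= 0 -> hsnorm (f s) <= K) -> supnorm r0 f <= K.
Proof.
move=> fK; apply: ge_sup.
  exists (hsnorm (f 0)); exists 0 => //=.
  by rewrite in_itv /= lexx andbT oppr_le0 ltW.
by move=> _ [s + <-]; rewrite /= in_itv; exact: fK.
Qed.

Lemma hsnorm_le_supnorm (f : R -> 'cV[R]_d) s :
  {within `[- r0, 0], continuous f} -> - r0 <= s <= 0 ->
  hsnorm (f s) <= supnorm r0 f.
Proof.
move=> cf sI; apply: ub_le_sup; last by exists s => //=; rewrite in_itv.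
have r0le : - r0 <= 0 by rewrite oppr_le0 ltW.
have [c _ cmax] := EVT_max r0le (hsnorm_continuous_within cf).
by exists (hsnorm (f c)) => _ [t /= tI <-]; exact: cmax.
Qed.

Lemma hsnorm_le_dist x y s : hsnorm (x s - y s) <= path_dist x y.
Proof.
have [sI|/negP sI] := boolP (- r0 <= s <= 0).
  apply: (@hsnorm_le_supnorm (fun s => x s - y s)) => //.
  by apply: within_continuousB; exact: path_continuous.
rewrite !path_out // subrr hsnorm0.
apply: (le_trans (hsnorm_ge0 (x 0 - y 0))).
apply: (@hsnorm_le_supnorm (fun s => x s - y s)).
  by apply: within_continuousB; exact: path_continuous.
by rewrite lexx andbT oppr_le0 ltW.
Qed.

Lemma path_dist_le x y K :
  (forall s, - r0 <= s <= 0 -> hsnorm (x s - y s) <= K) -> path_dist x y <= K.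
Proof. by move=> h; exact: supnorm_le. Qed.

Lemma path_dist_ge0 x y : 0 <= path_dist x y.
Proof. exact: le_trans (hsnorm_ge0 _) (hsnorm_le_dist x y 0). Qed.
Hint Resolve path_dist_ge0 : core.

Lemma path_dist_xx x : path_dist x x = 0.
Proof.
apply/le_anti; rewrite path_dist_ge0 andbT.
by apply: path_dist_le => s _; rewrite subrr hsnorm0.
Qed.

Lemma path_distC x y : path_dist x y = path_dist y x.
Proof.
have h (u v : C) : path_dist u v <= path_dist v u.
  by apply: path_dist_le => s _; rewrite hsnormBC hsnorm_le_dist.
by apply/le_anti; rewrite !h.
Qed.

Lemma path_dist_tri x y z : path_dist x z <= path_dist x y + path_dist y z.
Proof.
apply: path_dist_le => s _; apply: (le_trans (hsnorm_triB _ (y s) _)).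
by apply: lerD; exact: hsnorm_le_dist.
Qed.

Lemma supnormE x : supnorm r0 x = path_dist x (zero_path r0 d).
Proof.
apply/le_anti/andP; split.
  apply: supnorm_le => s _; rewrite -[x s]subr0.
  exact: (hsnorm_le_dist x (zero_path r0 d)).
apply: path_dist_le => s sI; rewrite subr0.
by apply: hsnorm_le_supnorm => //; exact: path_continuous.
Qed.

Definition path_lipschitz (f : C -> R) :=
  exists L : R, forall x y, `|f x - f y| <= L * path_dist x y.

(** The sigma-algebra of paths is generated by the open sets of [path_dist], and the superlevel sets
    of a Lipschitz function are open. *)
Lemma measurable_path_lipschitz (f : C -> R) :
  path_lipschitz f -> measurable_fun setT f.
Proof.
move=> [L fL].
apply: (@measurability _ _ _ _ _ _ _ (RGenOInfty.measurableE R)).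
move=> _ [_ [a ->] <-]; rewrite setTI; apply: sub_sigma_algebra => x /=.
rewrite in_itv /= andbT => ax.
have L0 : 0 < `|L| + 1 by rewrite ltr_wpDl.
exists ((f x - a) / (`|L| + 1)) => [|y].
  by apply: divr_gt0 => //; rewrite subr_gt0.
rewrite ltr_pdivlMr // => xy.
rewrite /= in_itv /= andbT.
have := fL x y; have := ler_norm (f x - f y); have := ler_norm L.
by have := path_dist_ge0 x y; nra.
Qed.

Lemma path_lipschitz_dist x : path_lipschitz (fun y => path_dist y x).
Proof.
exists 1 => y z; rewrite mul1r ler_norml.
have := path_dist_tri y z x; have := path_dist_tri z y x.
by rewrite (path_distC z y); lra.
Qed.

Lemma measurable_path_dist x : measurable_fun setT (fun y => path_dist y x).
Proof. by apply: measurable_path_lipschitz; exact: path_lipschitz_dist. Qed.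

Lemma measurable_eval s i : measurable_fun setT (fun x : C => x s i 0).
Proof.
apply: measurable_path_lipschitz; exists 1 => x y; rewrite mul1r.
apply: le_trans _ (hsnorm_le_dist x y s).
by have := hsnorm_entry (x s - y s) i 0; rewrite !mxE.
Qed.

(** Serves to show that an interpolated path is measurable without any separability of the path
    space: a map controlled by finitely many real variables pulls an open set back to a countable
    union of boxes with rational centres and radii. *)
Lemma measurable_finitely_determined dO (O : measurableType dO) (J : finType)
    (u : J -> O -> R) (X : O -> C) (K : R) :
  (forall j, measurable_fun setT (u j)) ->
  (forall v w, path_dist (X v) (X w) <= K * \sum_j `|u j v - u j w|) ->
  measurable_fun setT X.
Proof.
move=> mu XK.
apply: (@measurability _ _ _ _ _ _ (path_open (r0:=r0) (d:=d))) => //.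
move=> _ [A oA <-]; rewrite setTI.
pose box (c : {ffun J -> rat} * rat) :=
  [set w | forall j, `|u j w - ratr (c.1 j)| < ratr c.2].
pose good := [set c | box c `<=` X @^-1` A].
have -> : X @^-1` A = \bigcup_(c in good) box c.
  apply/seteqP; split => [w Aw|w [c gc]]; last exact: gc.
  have [e e0 eA] := oA _ Aw.
  pose k : R := #|J|%:R + 1.
  have k0 : 0 < k by rewrite ltr_wpDl.
  pose K1 : R := `|K| + 1.
  have K10 : 0 < K1 by rewrite ltr_wpDl.
  have [r /[!in_itv] /= /andP[r1 r2]] :
    exists q : rat, ratr q \in `](0:R), e / (K1 * (k * 2))[.
    by apply: rat_in_itvoo; rewrite divr_gt0 // !mulr_gt0.
  have /choice[c cP] j : exists q : rat, `|u j w - ratr q| < ratr r.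
    have [q /[!in_itv] /= /andP[q1 q2]] :
        exists q : rat, ratr q \in `](u j w - ratr r), (u j w + ratr r)[.
      by apply: rat_in_itvoo; lra.
    by exists q; rewrite ltr_norml; lra.
  exists ([ffun j => c j], r) => [v /= vb|j /=]; last by rewrite ffunE.
  apply: eA.
  apply: (le_lt_trans (XK _ _)).
  have h1 : \sum_j `|u j w - u j v| <= k * (2 * ratr r).
    apply: (@le_trans _ _ (\sum_(j : J) 2 * ratr r)).
      apply: ler_sum => j _; have := vb j; rewrite ffunE => /ltW h.
      rewrite -(subrKA (ratr (c j))).
      by apply: (le_trans (ler_normD _ _)); rewrite [X in _ + X]distrC;
        have := ltW (cP j); lra.
    rewrite sumr_const -[X in X <= _]mulr_natl ler_wpM2r //; last first.
      by rewrite /k lerDl.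
    by rewrite mulr_ge0 // ltW.
  have h0 : 0 <= \sum_j `|u j w - u j v| by apply: sumr_ge0.
  move: r2; rewrite ltr_pdivlMr ?mulr_gt0 // => r2.
  by have := ler_norm K; rewrite /K1 in r2 K10 *; nra.
rewrite bigcup_mkcond; apply: countable_bigcupT_measurable => // c.
case: ifP => // _.
have -> : box c = ~` \bigcup_(j : J) [set w | ratr c.2 <= `|u j w - ratr (c.1 j)|].
  apply/seteqP; split => [w bw [j _ /=]|w bw j]; first by rewrite leNgt bw.
  by rewrite ltNge; apply/negP => h; apply: bw; exists j.
apply/measurableC/countable_bigcupT_measurable => // j.
rewrite -[X in measurable X]setTI.
apply: (@measurable_fun_le _ _ _ setT (cst _) (fun w => `|u j w - ratr (c.1 j)|)) => //.
by apply: measurableT_comp => //; exact: measurable_funB.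
Qed.

End path_space_theory.
#[global] Hint Extern 0 (is_true (0 <= path_dist _ _)) => (apply: path_dist_ge0) : core.

(** * Measurability, laws and Wasserstein distance *)

Section measurable_matrices.
Context {R : realType} {dO : measure_display} {O : measurableType dO}.

Definition measurable_mx {a c : nat} (f : O -> 'M[R]_(a, c)) :=
  forall i j, measurable_fun setT (fun w => f w i j).

Lemma measurable_mx_cst a c (A : 'M[R]_(a, c)) : measurable_mx (cst A).
Proof. by move=> i j; exact: measurable_cst. Qed.

Lemma measurable_mxD a c (f g : O -> 'M[R]_(a, c)) :
  measurable_mx f -> measurable_mx g -> measurable_mx (fun w => f w + g w).
Proof.
move=> mf mg i j; under eq_fun do rewrite mxE.
exact: measurable_funD.
Qed.

Lemma measurable_mxN a c (f : O -> 'M[R]_(a, c)) :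
  measurable_mx f -> measurable_mx (fun w => - f w).
Proof.
move=> mf i j; under eq_fun do rewrite mxE.
exact: measurableT_comp.
Qed.

Lemma measurable_mxB a c (f g : O -> 'M[R]_(a, c)) :
  measurable_mx f -> measurable_mx g -> measurable_mx (fun w => f w - g w).
Proof. by move=> mf mg; apply: measurable_mxD => //; exact: measurable_mxN. Qed.

Lemma measurable_mxZ a c (k : O -> R) (f : O -> 'M[R]_(a, c)) :
  measurable_fun setT k -> measurable_mx f -> measurable_mx (fun w => k w *: f w).
Proof.
move=> mk mf i j; under eq_fun do rewrite mxE.
exact: measurable_funM.
Qed.

Lemma measurable_mxT a c (f : O -> 'M[R]_(a, c)) :
  measurable_mx f -> measurable_mx (fun w => (f w)^T).
Proof. by move=> mf i j; under eq_fun do rewrite mxE; exact: mf. Qed.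

Lemma measurable_mxM a b c (f : O -> 'M[R]_(a, b)) (g : O -> 'M[R]_(b, c)) :
  measurable_mx f -> measurable_mx g -> measurable_mx (fun w => f w *m g w).
Proof.
move=> mf mg i j; under eq_fun do rewrite mxE.
by apply: measurable_sum => k; exact: measurable_funM.
Qed.

Lemma measurable_det a (f : O -> 'M[R]_a) :
  measurable_mx f -> measurable_fun setT (fun w => \det (f w)).
Proof.
move=> mf; rewrite /determinant.
apply: measurable_sum => s; apply: measurable_funM; first exact: measurable_cst.
by apply: measurable_prod => i _; exact: mf.
Qed.

Lemma measurable_unitmx a (f : O -> 'M[R]_a) :
  measurable_mx f -> measurable_fun setT (fun w => f w \in unitmx).
Proof.
move=> mf; under eq_fun do rewrite unitmxE unitfE.
apply: measurableT_comp => //.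
by apply: measurable_fun_eqr; [exact: measurable_det|exact: measurable_cst].
Qed.

Lemma measurable_inv : measurable_fun setT (@GRing.inv R).
Proof.
have -> : [set: R] = [set 0] `|` ~` [set 0] by rewrite setUv.
apply/measurable_funU => //; first exact: measurableC.
split; first exact: measurable_fun_set1.
apply: open_continuous_measurable_fun.
  by apply: closed_openC; apply: accessible_closed_set1; exact: hausdorff_accessible.
move=> x; rewrite inE /= => /eqP x0; exact: inv_continuous.
Qed.

(** Cramer's formula on invertible matrices; on singular ones [invmx] returns its argument, whence
    the case split. *)
Lemma measurable_invmx a (f : O -> 'M[R]_a) :
  measurable_mx f -> measurable_mx (fun w => invmx (f w)).
Proof.
move=> mf i j; rewrite /invmx.
have -> : (fun w => (if f w \in unitmx then (\det (f w))^-1 *: \adj (f w)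
    else f w) i j) =
    (fun w => if f w \in unitmx then (\det (f w))^-1 * \adj (f w) i j else f w i j).
  by apply: funext => w; case: ifP => // _; rewrite mxE.
apply: measurable_fun_ifT; [exact: measurable_unitmx| |exact: mf].
apply: measurable_funM.
  by apply: (measurableT_comp measurable_inv); exact: measurable_det.
under eq_fun do rewrite mxE /cofactor.
apply: measurable_funM; first exact: measurable_cst.
apply: (@measurable_det _ (fun w => row' j (col' i (f w)))) => k l.
by under eq_fun do rewrite !mxE; exact: mf.
Qed.

Lemma measurable_hsnorm a c (f : O -> 'M[R]_(a, c)) :
  measurable_mx f -> measurable_fun setT (fun w => hsnorm (f w)).
Proof.
move=> mf; rewrite /hsnorm.
apply: (measurableT_comp (continuous_measurable_fun (@sqrt_continuous R))).
apply: measurable_sum => i; apply: measurable_sum => j.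
exact: measurable_funX.
Qed.

End measurable_matrices.

(** The coefficients take a [probability] record as argument, so an equality of laws must hold
    between records; their proof fields agree by proof irrelevance. *)
Lemma eq_probability d (T : measurableType d) (R : realType)
    (P Q : probability T R) : P = Q :> (set T -> \bar R) -> P = Q.
Proof.
case: P Q => [P [[a1 a2] [a3] [a4] [a5] [a6] [a7] [a8]]].
move=> [Q [[b1 b2] [b3] [b4] [b5] [b6] [b7] [b8]]] /= PQ; subst Q.
rewrite (Prop_irrelevance a1 b1) (Prop_irrelevance a2 b2) in a3 *.
rewrite (Prop_irrelevance a3 b3) (Prop_irrelevance a4 b4) (Prop_irrelevance a5 b5).
by rewrite (Prop_irrelevance a6 b6) (Prop_irrelevance a7 b7) (Prop_irrelevance a8 b8).
Qed.

Lemma integral_probability_cst d (T : measurableType d) (R : realType)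
    (P : probability T R) (c : R) : (\int[P]_x c%:E = c%:E)%E.
Proof.
rewrite integral_cst //; transitivity (c%:E * 1)%E; last by rewrite mule1.
by congr (_ * _)%E; exact: probability_setT.
Qed.

Section law_theory.
Context {R : realType} (r0 : R) (d : nat).
Hypothesis r0_gt0 : 0 < r0.
Local Notation C := (cpath r0 d).
Local Notation PC := (probability C R).
Implicit Types (x y z : C).

Lemma measurable_supnorm : measurable_fun setT (fun x : C => supnorm r0 x).
Proof.
have -> : (fun x : C => supnorm r0 x) = (fun x => path_dist x (zero_path r0 d)).
  by apply: funext => x; exact: supnormE.
exact: measurable_path_dist.
Qed.

Lemma measurable_mx_path a c (f : C -> 'M[R]_(a, c)) (L : R) :
  (forall x y, hsnorm (f x - f y) <= L * path_dist x y) -> measurable_mx f.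
Proof.
move=> fL i j; apply: measurable_path_lipschitz => //; exists L => x y.
apply: le_trans _ (fL x y).
by have := hsnorm_entry (f x - f y) i j; rewrite !mxE.
Qed.

Lemma finite_moment2_dirac x : finite_moment2 (dirac_law x).
Proof.
rewrite /finite_moment2 integral_dirac //=; last first.
  apply/measurable_EFinP; apply: measurable_funX; exact: measurable_supnorm.
by rewrite diracT mul1e ltry.
Qed.

(** The pair space carries the product sigma-algebra, so openness for the distance is not enough. By
    continuity of paths the supremum can be restricted to rational times, and evaluations are
    measurable. *)
Lemma measurable_path_dist2 : measurable_fun setT (fun z : C * C => path_dist z.1 z.2).
Proof.
apply: (@measurability _ _ _ _ _ _ _ (RGenOInfty.measurableE R)).
move=> _ [_ [a ->] <-]; rewrite setTI.
pose D := [set q : rat | - r0 <= (ratr q : R) <= 0].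
have -> : (fun z : C * C => path_dist z.1 z.2) @^-1` `]a, +oo[ =
    \bigcup_(q in D) [set z : C * C | a < hsnorm (z.1 (ratr q) - z.2 (ratr q))].
  apply/seteqP; split => [z|z [q Dq]] /=; rewrite in_itv /= andbT; last first.
    by move=> h; apply: lt_le_trans h _; exact: hsnorm_le_dist.
  move=> az; have [s sI sa] : exists2 s : R, - r0 <= s <= 0 & a < hsnorm (z.1 s - z.2 s).
    apply: contrapT => h; move: az; rewrite ltNge => /negP; apply.
    apply: path_dist_le => // s sI; rewrite leNgt; apply/negP => az; apply: h.
    by exists s.
  have cf : {within `[- r0, 0], continuous (fun s => hsnorm (z.1 s - z.2 s))}.
    apply: hsnorm_continuous_within.
    by apply: within_continuousB; exact: path_continuous.
  have /subspace_continuousP/(_ s) := cf.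
  rewrite /= in_itv /= => /(_ sI)/cvgrPdist_lt/(_ (hsnorm (z.1 s - z.2 s) - a)).
  rewrite subr_gt0 => /(_ sa) [e /= e0 he].
  (* The window around [s] is cut to [[- r0, 0]] so that the rational time found in it lies in the
     domain; it is nonempty even when [s] is an endpoint. *)
  have lt1 : Num.max (- r0) (s - e) < Num.min 0 (s + e).
    case/andP: sI => s1 s2.
    rewrite gt_max !lt_min; apply/andP; split; apply/andP; split; rewrite ?oppr_lt0 //; lra.
  have [q /[!in_itv] /= /andP[]] := rat_in_itvoo lt1.
  rewrite gt_max lt_min => /andP[q1 q2] /andP[q3 q4].
  exists q; first by rewrite /D /= !ltW.
  move: q1 q2 q3 q4; move: (ratr q : R) => t q1 q2 q3 q4.
  have := he t; rewrite /= in_itv /= !ltW // => /(_ _ isT)h.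
  have /h : `|s - t| < e by rewrite ltr_norml; lra.
  by move=> /(le_lt_trans (ler_norm _)); rewrite /from_subspace /=; lra.
rewrite bigcup_mkcond; apply: bigcupT_measurable_rat => q; case: ifP => // _.
rewrite -[X in measurable X]setTI.
apply: (@measurable_fun_ltr _ _ _ setT (cst a)
  (fun z : C * C => hsnorm (z.1 (ratr q) - z.2 (ratr q)))) => //.
apply: measurable_hsnorm; apply: measurable_mxB => i j; rewrite ord1.
  by apply: (@measurableT_comp _ _ _ _ _ _ (fun x : C => x (ratr q) i 0));
    [exact: measurable_eval|exact: measurable_fst].
by apply: (@measurableT_comp _ _ _ _ _ _ (fun x : C => x (ratr q) i 0));
  [exact: measurable_eval|exact: measurable_snd].
Qed.

Lemma W2_ge0 (mu nu : PC) : 0 <= W2 mu nu.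
Proof. exact: sqrtr_ge0. Qed.

(** The finite bound makes the infimum finite, so that [fine] in [W2] loses nothing. *)
Lemma sqr_W2_le (mu nu : PC) (pi : probability (C * C)%type R) (a : R) :
  couplings mu nu pi ->
  (\int[pi]_z ((path_dist z.1 z.2 ^+ 2)%:E) <= a%:E)%E -> W2 mu nu ^+ 2 <= a.
Proof.
move=> cpi pia; rewrite /W2.
set S := (X in ereal_inf X).
have S0 : (0 <= ereal_inf S)%E.
  apply: le_ereal_inf_tmp => _ [q _ <-]; apply: integral_ge0 => z _.
  by rewrite lee_fin sqr_ge0.
have Sa : (ereal_inf S <= a%:E)%E.
  by apply: le_trans _ pia; apply: ereal_inf_lbound; exists pi.
have Sf : ereal_inf S \is a fin_num.
  by rewrite ge0_fin_numE // (le_lt_trans Sa) // ltry.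
rewrite sqr_sqrtr ?fine_ge0 // -lee_fin fineK //.
Qed.

Lemma W2_dirac x y : W2 (dirac_law x) (dirac_law y) <= path_dist x y.
Proof.
rewrite -(@ler_pXn2r _ 2) ?nnegrE ?W2_ge0 ?path_dist_ge0 //.
apply: (@sqr_W2_le _ _ (\d_(x, y))) => [A mA|].
  rewrite /dirac_law /= !diracE; split.
    by congr (_%:E); congr (_%:R); congr nat_of_bool; apply/idP/idP; rewrite !inE /=; tauto.
  by congr (_%:E); congr (_%:R); congr nat_of_bool; apply/idP/idP; rewrite !inE /=; tauto.
rewrite integral_dirac //= ?diracT ?mul1e //.
apply/measurable_EFinP; apply: measurable_funX; exact: measurable_path_dist2.
Qed.

Lemma W2_xx (mu : PC) : W2 mu mu = 0.
Proof.
have md : measurable_fun setT (fun x : C => (x, x)) by exact: measurable_fun_pair.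
pose D : {mfun C >-> (C * C)%type} := HB.pack (fun x : C => (x, x))
  (isMeasurableFun.Build _ _ _ _ _ md).
apply/eqP; rewrite -[_ == 0](@sqrf_eq0 R) eq_le sqr_ge0 andbT.
apply: (@sqr_W2_le _ _ (distribution mu D)) => [A mA|].
  by split; rewrite /distribution /pushforward /=; congr (mu _); apply/seteqP; split => w /=; tauto.
rewrite ge0_integral_distribution //=.
- under eq_integral do rewrite path_dist_xx // expr0n.
  by rewrite integral0.
- by apply/measurable_EFinP; apply: measurable_funX; exact: measurable_path_dist2.
by move=> z; rewrite lee_fin sqr_ge0.
Qed.

Context {dO : measure_display} {O : measurableType dO} (P : probability O R).

(** The coupling is the law of the pair [(X, x)]. This is how the law of the scheme is compared with
    the Dirac mass of the limit path. *)
Lemma W2_law_dirac (X : {RV P >-> C}) x (a : R) :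
  (\int[P]_w ((path_dist (X w) x ^+ 2)%:E) <= a%:E)%E ->
  W2 (law X) (dirac_law x) ^+ 2 <= a.
Proof.
move=> Xa.
have mXx : measurable_fun setT (fun w => (X w, x)).
  by apply: measurable_fun_pair => //; exact: measurable_cst.
pose Xx : {mfun O >-> (C * C)%type} := HB.pack (fun w => (X w, x))
  (isMeasurableFun.Build _ _ _ _ _ mXx).
apply: (@sqr_W2_le _ _ (distribution P Xx)) => [A mA|].
  split.
    rewrite /law /= /distribution /pushforward /=; congr (P _).
    by apply/seteqP; split => w /=; tauto.
  rewrite /distribution /pushforward /dirac_law /= diracE.
  have [xA|xA] := boolP (x \in A).
    transitivity (P setT); [congr (P _)|exact: probability_setT].
    by apply/seteqP; split => w //= _; split => //; rewrite inE in xA.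
  transitivity (P set0); [congr (P _)|exact: measure0].
  by apply/seteqP; split => w //= [_ xA']; move/negP: xA; apply; rewrite inE.
rewrite ge0_integral_distribution //.
apply/measurable_EFinP; apply: measurable_funX; exact: measurable_path_dist2.
by move=> z; rewrite lee_fin sqr_ge0.
Qed.

Lemma finite_moment2_law (X : {RV P >-> C}) x :
  (\int[P]_w ((path_dist (X w) x ^+ 2)%:E) < +oo)%E -> finite_moment2 (law X).
Proof.
move=> Xx; rewrite /finite_moment2 /law ge0_integral_distribution //; last first.
  by move=> z; rewrite lee_fin sqr_ge0.
  apply/measurable_EFinP; apply: measurable_funX; exact: measurable_supnorm.
pose k := path_dist x (zero_path r0 d).
have md : measurable_fun setT (fun w => path_dist (X w) x).
  by apply: (@measurableT_comp _ _ _ _ _ _ (fun y : C => path_dist y x)) => //;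
    exact: measurable_path_dist.
apply: (@le_lt_trans _ _ (\int[P]_w (2%:E * (path_dist (X w) x ^+ 2)%:E + (2 * k ^+ 2)%:E))%E).
  apply: ge0_le_integral => //.
  - by move=> w _; rewrite lee_fin sqr_ge0.
  - apply/measurable_EFinP; apply: measurable_funX => /=.
    by apply: (@measurableT_comp _ _ _ _ _ _ (fun y : C => supnorm r0 y)) => //;
      exact: measurable_supnorm.
  - apply: emeasurable_funD; last exact: measurable_cst.
    apply/measurable_EFinP/measurable_funM => //; exact: measurable_funX.
  move=> w _; rewrite -EFinM -EFinD lee_fin /= supnormE //.
  have h := path_dist_tri r0_gt0 (X w) x (zero_path r0 d).
  have h0 := path_dist_ge0 r0_gt0 (X w) (zero_path r0 d).
  have := sqr_ge0 (path_dist (X w) x - k); rewrite sqrrB.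
  have : path_dist (X w) (zero_path r0 d) ^+ 2 <= (path_dist (X w) x + k) ^+ 2.
    by rewrite lerXn2r ?nnegrE // addr_ge0 // path_dist_ge0.
  by rewrite sqrrD; lra.
have md2 : measurable_fun setT (fun w => (path_dist (X w) x ^+ 2)%:E).
  by apply/measurable_EFinP; exact: measurable_funX.
have d20 w : (0 <= (path_dist (X w) x ^+ 2)%:E)%E by rewrite lee_fin sqr_ge0.
rewrite ge0_integralD //.
- rewrite ge0_integralZl // integral_probability_cst.
  by rewrite lte_add_pinfty ?ltry // lte_mul_pinfty.
- by move=> w _; rewrite mule_ge0.
- exact: measurable_funeM.
- by move=> w _; rewrite lee_fin mulr_ge0 // sqr_ge0.
Qed.

(** Lets (A2), which speaks of random variables, be read at Dirac masses. *)
Lemma law_cst x : law (cst x : {RV P >-> C}) = dirac_law x.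
Proof.
apply: eq_probability; apply: funext => A.
rewrite /law /= /distribution /pushforward /dirac_law /= diracE.
have [xA|xA] := boolP (x \in A).
  transitivity (P setT); [congr (P _)|exact: probability_setT].
  by apply/seteqP; split => w //= _; rewrite inE in xA.
transitivity (P set0); [congr (P _)|exact: measure0].
by apply/seteqP; split => w //= xA'; move/negP: xA; apply; rewrite inE.
Qed.

End law_theory.

(** * Square-integrable and Gaussian variables *)

Section expectation_algebra.
Context {d} {T : measurableType d} {R : realType} (P : probability T R).
Implicit Types f g : T -> R.

Definition intble f : Prop := P.-integrable setT (EFin \o f).
(** A [fine] of the extended integral, hence 0 when that integral is infinite: it is meaningful
    together with [intble]. *)
Definition Ex f : R := \int[P]_x f x.

Lemma intble_meas f : intble f -> measurable_fun setT f.
Proof. by move=> /(measurable_int P)/measurable_EFinP. Qed.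

Lemma intbleP f : intble f <->
  measurable_fun setT f /\ (\int[P]_x (`|f x|)%:E < +oo)%E.
Proof.
by split=> [/integrableP[/measurable_EFinP mf fi]|[mf fi]] //;
  apply/integrableP; split => //; exact/measurable_EFinP.
Qed.

Lemma Ex_EFin f : intble f -> (\int[P]_x (f x)%:E = (Ex f)%:E)%E.
Proof. by move=> fi; rewrite /Ex /Rintegral fineK //; exact: integrable_fin_num. Qed.

Lemma intble_le f g : measurable_fun setT f -> (forall x, `|f x| <= g x) ->
  intble g -> intble f.
Proof.
move=> mf fg /intbleP[mg gi]; apply/intbleP; split=> //.
apply: le_lt_trans gi; apply: ge0_le_integral => //.
- by apply/measurable_EFinP; exact: measurableT_comp.
- by apply/measurable_EFinP; exact: measurableT_comp.
by move=> x _; rewrite lee_fin (le_trans (fg x)) // ler_norm.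
Qed.

Lemma intble_norm f : intble f -> intble (fun x => `|f x|).
Proof.
move=> /intbleP[mf fi]; apply/intbleP; split; first exact: measurableT_comp.
by under eq_integral do rewrite normr_id.
Qed.

Lemma intble_cst c : intble (fun=> c).
Proof. exact: finite_measure_integrable_cst. Qed.

Lemma intbleD f g : intble f -> intble g -> intble (fun x => f x + g x).
Proof. by move=> fi gi; exact: (integrableD measurableT fi gi). Qed.

Lemma intbleZ c f : intble f -> intble (fun x => c * f x).
Proof. by move=> fi; exact: (integrableZl measurableT c fi). Qed.

Lemma intbleB f g : intble f -> intble g -> intble (fun x => f x - g x).
Proof. by move=> fi gi; exact: (integrableB measurableT fi gi). Qed.

Lemma intble_sum (I : Type) (r : seq I) (f : I -> T -> R) :
  (forall i, intble (f i)) -> intble (fun x => \sum_(i <- r) f i x).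
Proof.
move=> fi; elim: r => [|i r ih].
  by under eq_fun do rewrite big_nil; exact: intble_cst.
by under eq_fun do rewrite big_cons; exact: intbleD.
Qed.

Lemma ExD f g : intble f -> intble g -> Ex (fun x => f x + g x) = Ex f + Ex g.
Proof. by move=> fi gi; exact: (RintegralD measurableT fi gi). Qed.

Lemma ExB f g : intble f -> intble g -> Ex (fun x => f x - g x) = Ex f - Ex g.
Proof. by move=> fi gi; exact: (RintegralB measurableT fi gi). Qed.

Lemma ExZ c f : intble f -> Ex (fun x => c * f x) = c * Ex f.
Proof. by move=> fi; exact: (RintegralZl c measurableT fi). Qed.

Lemma Ex_cst c : Ex (fun=> c) = c.
Proof. by rewrite /Ex /Rintegral (integral_probability_cst P c). Qed.

Lemma Ex_sum (I : Type) (r : seq I) (f : I -> T -> R) :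
  (forall i, intble (f i)) ->
  Ex (fun x => \sum_(i <- r) f i x) = \sum_(i <- r) Ex (f i).
Proof.
move=> fi; elim: r => [|i r ih].
  by rewrite big_nil; under [X in Ex X]eq_fun do rewrite big_nil; exact: Ex_cst.
rewrite big_cons; under [X in Ex X]eq_fun do rewrite big_cons.
by rewrite ExD ?ih //; exact: intble_sum.
Qed.

Lemma Ex_le f g : intble f -> intble g -> (forall x, f x <= g x) -> Ex f <= Ex g.
Proof. by move=> fi gi fg; apply: (le_Rintegral measurableT fi gi) => x _. Qed.

Lemma Ex_ge0 f : (forall x, 0 <= f x) -> 0 <= Ex f.
Proof. by move=> f0; apply: Rintegral_ge0 => x _. Qed.

Lemma intble_ge0P f : measurable_fun setT f -> (forall x, 0 <= f x) ->
  (\int[P]_x (f x)%:E < +oo)%E -> intble f.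
Proof.
move=> mf f0 fi; apply/intbleP; split=> //.
by under eq_integral do rewrite ger0_norm //.
Qed.

Lemma intble_ub f (a : R) : measurable_fun setT f -> (forall x, 0 <= f x) ->
  (\int[P]_x (f x)%:E <= a%:E)%E -> intble f /\ Ex f <= a.
Proof.
move=> mf f0 fa; have fi : intble f.
  by apply: intble_ge0P => //; apply: le_lt_trans fa _; rewrite ltry.
by split=> //; rewrite -lee_fin -Ex_EFin.
Qed.

(** Measurability is required of [f] itself, since that of the square does not imply it. *)
Definition sqint f := measurable_fun setT f /\ intble (fun x => f x ^+ 2).

Lemma sqint_le f g : measurable_fun setT f -> (forall x, `|f x| <= g x) ->
  sqint g -> sqint f.
Proof.
move=> mf fg [mg g2]; split=> //; apply: intble_le g2.
  exact: measurable_funX.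
move=> x; rewrite normrX lerXn2r ?nnegrE //.
by rewrite (le_trans _ (fg x)).
Qed.

Lemma intbleM f g : sqint f -> sqint g -> intble (fun x => f x * g x).
Proof.
move=> [mf f2] [mg g2]; apply: intble_le (intbleD f2 g2).
  exact: measurable_funM.
move=> x; rewrite normrM -[f x ^+ 2]real_normK ?num_real // -[g x ^+ 2]real_normK ?num_real //.
have := sqr_ge0 (`|f x| - `|g x|); rewrite sqrrB.
have := mulr_ge0 (normr_ge0 (f x)) (normr_ge0 (g x)); lra.
Qed.

Lemma sqintD f g : sqint f -> sqint g -> sqint (fun x => f x + g x).
Proof.
move=> sf sg; have [mf f2] := sf; have [mg g2] := sg.
split; first exact: measurable_funD.
under eq_fun do rewrite sqrrD -mulr_natl.
by apply: intbleD => //; apply: intbleD => //; apply: intbleZ; exact: intbleM.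
Qed.

Lemma sqint_norm f : sqint f -> sqint (fun x => `|f x|).
Proof.
move=> [mf f2]; split; first exact: measurableT_comp.
by rewrite (_ : (fun x => `|f x| ^+ 2) = (fun x => f x ^+ 2)) //;
  apply: funext => x; rewrite real_normK ?num_real.
Qed.

Lemma sqint_cst c : sqint (fun=> c).
Proof. by split; [exact: measurable_cst|exact: intble_cst]. Qed.

Lemma sqintZ c f : sqint f -> sqint (fun x => c * f x).
Proof.
move=> [mf f2]; split; first exact: measurable_funM.
by under eq_fun do rewrite exprMn; exact: intbleZ.
Qed.

Lemma sqint_sum (I : Type) (r : seq I) (f : I -> T -> R) :
  (forall i, sqint (f i)) -> sqint (fun x => \sum_(i <- r) f i x).
Proof.
move=> fi; elim: r => [|i r ih].
  by under eq_fun do rewrite big_nil; exact: sqint_cst.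
by under eq_fun do rewrite big_cons; exact: sqintD.
Qed.

Lemma markov_prob f (a c : R) : intble f -> (forall x, 0 <= f x) -> 0 < a ->
  Ex f <= c -> (P [set x | a <= f x]%R <= (c / a)%:E)%E.
Proof.
move=> fi f0 a0 fc.
have mf := intble_meas fi.
have mA : measurable [set x | a <= f x].
  rewrite -[X in measurable X]setTI.
  by apply: (@measurable_fun_le _ _ _ setT (cst a) f) => //; exact: measurable_cst.
rewrite EFinM lee_pdivlMr // muleC.
apply: (@le_trans _ _ (\int[P]_x (f x)%:E)%E); last by rewrite Ex_EFin // lee_fin.
rewrite -[X in P X]setIT -integral_indic // -ge0_integralZl //.
- apply: ge0_le_integral => //.
  + by move=> x _; rewrite mule_ge0 // ?lee_fin // ltW.
  + by apply: measurable_funeM; apply/measurable_EFinP; exact: measurable_indic.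
  + exact/measurable_EFinP.
  move=> x _; rewrite -EFinM lee_fin indicE.
  have [|] := boolP (x \in _); first by rewrite inE /= mulr1.
  by rewrite mulr0.
- by apply/measurable_EFinP; exact: measurable_indic.
- by rewrite lee_fin ltW.
Qed.

End expectation_algebra.

Section gaussian_moments.
Context {R : realType}.
Local Notation mu := lebesgue_measure.

(** The Radon-Nikodym derivative of the normal law agrees almost everywhere with the explicit
    density, because both have the same integral over every measurable set. *)
Lemma ge0_integral_normal_prob (m s : R) (f : R -> \bar R) :
  measurable_fun setT f -> (forall x, 0 <= f x)%E ->
  (\int[normal_prob m s]_x f x = \int[mu]_x (f x * (normal_pdf m s x)%:E))%E.
Proof.
move=> mf f0.
have dom := @normal_prob_dominates R m s.
rewrite -(Radon_Nikodym_SigmaFinite.change_of_variables dom f0 measurableT mf).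
have mp : measurable_fun setT (fun x => (normal_pdf m s x)%:E).
  by apply/measurable_EFinP; exact: measurable_normal_pdf.
have fi := Radon_Nikodym_SigmaFinite.f_integrable dom.
apply: ae_eq_integral => //.
- by apply: emeasurable_funM => //; exact: (measurable_int _ fi).
- exact: emeasurable_funM.
have : ae_eq mu setT (Radon_Nikodym_SigmaFinite.f (normal_prob m s) mu)
    (fun x => (normal_pdf m s x)%:E).
  apply: integral_ae_eq => // E _ mE.
  by rewrite -Radon_Nikodym_SigmaFinite.f_integral.
by apply: filterS => x /= h _; rewrite h.
Qed.

Variable s : R.
Hypothesis s0 : s != 0.
Local Notation nu := (normal_prob 0 s).

Lemma measurable_expRM (l : R) : measurable_fun setT (fun y => expR (l * y)).
Proof. by apply: measurableT_comp => //; exact: measurable_funM. Qed.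

Lemma normal_mgf (l : R) :
  (\int[nu]_y (expR (l * y))%:E = (expR (l ^+ 2 * s ^+ 2 / 2))%:E)%E.
Proof.
rewrite ge0_integral_normal_prob; last 2 first.
- by apply/measurable_EFinP; exact: measurable_expRM.
- by move=> x; rewrite lee_fin expR_ge0.
(* Completing the square moves the mean to [l * s ^+ 2]. *)
transitivity (\int[mu]_x ((expR (l ^+ 2 * s ^+ 2 / 2))%:E *
    (normal_pdf (l * s ^+ 2) s x)%:E))%E.
  apply: eq_integral => x _; rewrite -!EFinM; congr (_%:E).
  rewrite !normal_pdfE // /normal_fun mulrCA [RHS]mulrCA.
  congr (_ * _); rewrite -!expRD; congr expR.
  by rewrite -mulr_natr; field.
rewrite ge0_integralZl //.
- by rewrite integral_normal_pdf mule1.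
- by apply/measurable_EFinP; exact: measurable_normal_pdf.
- by move=> x _; rewrite lee_fin normal_pdf_ge0.
Qed.

Lemma intble_normal_exp (l : R) : intble nu (fun y => expR (l * y)).
Proof.
apply: intble_ge0P; first exact: measurable_expRM.
  by move=> y; exact: expR_ge0.
by rewrite normal_mgf ltry.
Qed.

Lemma Ex_normal_exp (l : R) : Ex nu (fun y => expR (l * y)) = expR (l ^+ 2 * s ^+ 2 / 2).
Proof. by rewrite /Ex /Rintegral normal_mgf. Qed.

Lemma intble_normal_bound (f : R -> R) (c k : R) : measurable_fun setT f ->
  (forall y, `|f y| <= c * (expR (k * y) + expR (- k * y))) -> intble nu f.
Proof.
move=> mf fk; apply: (@intble_le _ _ _ nu f _ mf fk); apply: intbleZ.
by apply: intbleD; exact: intble_normal_exp.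
Qed.

Lemma expR_normr_le (y : R) : expR `|y| <= expR y + expR (- y).
Proof.
have [h|h] := leP 0 y; first by rewrite ger0_norm // lerDl expR_ge0.
by rewrite ltr0_norm // lerDr expR_ge0.
Qed.

Lemma normr_le_exp (y : R) : `|y| <= 1 * (expR (1 * y) + expR (- 1 * y)).
Proof.
rewrite !mul1r mulN1r; apply: le_trans _ (expR_normr_le y).
by have := expR_ge1Dx `|y|; lra.
Qed.

Lemma sqr_le_exp (y : R) : `|y ^+ 2| <= 2 * (expR (1 * y) + expR (- 1 * y)).
Proof.
rewrite !mul1r mulN1r ger0_norm ?sqr_ge0 //.
have := @expR_ge1Dxn R `|y| 1 (normr_ge0 _); have := expR_normr_le y.
rewrite real_normK ?num_real //; have -> : (1.+1)`!%:R = 2 :> R by [].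
by have := sqr_ge0 y; lra.
Qed.

Lemma cube_le_exp (y : R) : `| `|y| ^+ 3 * expR `|y| | <= 6 * (expR (2 * y) + expR (- 2 * y)).
Proof.
have e0 := expR_ge0 `|y|.
rewrite ger0_norm ?mulr_ge0 ?exprn_ge0 //.
have h := @expR_ge1Dxn R `|y| 2 (normr_ge0 _); have := expR_normr_le (2 * y).
rewrite normrM ger0_norm // mulrDl mul1r expRD mulNr.
have : `|y| ^+ 3 <= 6 * expR `|y|.
  by move: h; have -> : (2.+1)`!%:R = 6 :> R by []; lra.
by nra.
Qed.

Lemma expR_sub1_le (x : R) : 0 <= x -> expR x - 1 <= x * expR x.
Proof.
move=> x0; have := expR_ge1Dx (- x); rewrite expRN => h.
have e0 := expR_gt0 x.
have : (1 - x) * expR x <= 1 by rewrite -ler_pdivlMr // div1r.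
by lra.
Qed.

(* [sinh] is squeezed between [v exp(-v)] and [v exp v], using [1 + x <= exp x] only. *)
Lemma sqr_sinh_bounds (u : R) :
  u ^+ 2 * expR (- `|u|) <= expR u + expR (- u) - 2 <= u ^+ 2 * expR `|u|.
Proof.
wlog u0 : u / 0 <= u.
  move=> h; have [/h//|/ltW u0] := leP 0 u.
  have := h (- u); rewrite oppr_ge0 => /(_ u0).
  by rewrite normrN sqrrN opprK (addrC (expR (- u))).
rewrite ger0_norm //.
set a := expR (u / 2); have a0 : 0 < a := expR_gt0 _.
have aV : expR (- (u / 2)) = a^-1 by rewrite expRN.
have eu : expR u = a ^+ 2 by rewrite /a expr2 -expRD -splitr.
have euN : expR (- u) = a^-1 ^+ 2 by rewrite expRN eu exprVn.
have aa : a * a^-1 = 1 by rewrite divff ?gt_eqF.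
have b0 : 0 < a^-1 by rewrite invr_gt0.
set b := a^-1 in aa b0 euN aV *.
have -> : expR u + expR (- u) - 2 = (a - b) ^+ 2.
  by rewrite eu euN sqrrB aa; lra.
have h1 : u * b <= a - b.
  have : 1 + u <= a ^+ 2 by rewrite -eu expR_ge1Dx.
  by nra.
have h2 : a - b <= u * a.
  have : 1 - u <= b ^+ 2 by rewrite -euN expR_ge1Dx.
  by nra.
have ub : 0 <= u * b by rewrite mulr_ge0 // ltW.
have ab0 : 0 <= a - b := le_trans ub h1.
have ua0 : 0 <= u * a := le_trans ab0 h2.
by rewrite eu euN -!exprMn !lerXn2r ?nnegrE.
Qed.

Lemma intble_normal_id : intble nu id.
Proof. by apply: (@intble_normal_bound _ 1 1) => //; exact: normr_le_exp. Qed.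

Lemma intble_normal_sqr : intble nu (fun y => y ^+ 2).
Proof.
by apply: (@intble_normal_bound _ 2 1); [exact: measurable_funX|exact: sqr_le_exp].
Qed.

(** Read off from the exponential moments: integrating [1 + l y <= exp (l y)] gives
    [1 + l m <= exp (l ^ 2 s ^ 2 / 2)] for both signs of [l], so [|m|] is of order [l] for small
    [l]. *)
Lemma normal_mean : Ex nu id = 0.
Proof.
have iid := intble_normal_id.
set m := Ex _ _.
have key l : 1 + l * m <= expR (l ^+ 2 * s ^+ 2 / 2).
  rewrite -Ex_normal_exp -(Ex_cst nu 1) -ExZ // -ExD; last 2 first.
  - exact: intble_cst.
  - exact: intbleZ.
  apply: Ex_le; [|exact: intble_normal_exp|by move=> y; exact: expR_ge1Dx].
  by apply: intbleD; [exact: intble_cst|exact: intbleZ].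
apply/eqP; rewrite -normr_le0; apply/ler_addgt0Pr => e e0; rewrite add0r.
pose K := s ^+ 2 / 2 * expR (s ^+ 2 / 2).
have K0 : 0 <= K by rewrite mulr_ge0 ?expR_ge0 // divr_ge0 // sqr_ge0.
(* For [t <= 1] one has [exp (t ^ 2 s ^ 2 / 2) - 1 <= t ^ 2 K], which this choice makes at most
   [t e]. *)
pose t := Num.min 1 (e / (K + 1)).
have K1 : 0 < K + 1 by rewrite ltr_wpDl.
have t0 : 0 < t by rewrite lt_min ltr01 divr_gt0.
have t1 : t <= 1 by rewrite ge_min lexx.
have te : t * (K + 1) <= e by rewrite -ler_pdivlMr // ge_min lexx orbT.
have bound : expR (t ^+ 2 * s ^+ 2 / 2) - 1 <= t * e.
  have s20 : 0 <= s ^+ 2 / 2 by rewrite divr_ge0 // sqr_ge0.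
  have t2 : 0 <= t ^+ 2 <= 1 by rewrite sqr_ge0 expr_le1 // ltW.
  apply: (le_trans (expR_sub1_le _)).
    by rewrite -mulrA mulr_ge0 // sqr_ge0.
  apply: (@le_trans _ _ (t ^+ 2 * K)).
    have -> : t ^+ 2 * s ^+ 2 / 2 = t ^+ 2 * (s ^+ 2 / 2) by ring.
    rewrite /K [leRHS]mulrA.
    apply: ler_wpM2l; first by rewrite mulr_ge0 // sqr_ge0.
    by rewrite ler_expR; case/andP: t2; nra.
  by have := ltW t0; nra.
have h1 := key t; have h2 := key (- t).
have : t * `|m| <= t * e.
  rewrite -[X in X * _](gtr0_norm t0) -normrM ler_norml.
  by rewrite sqrrN in h2; lra.
by rewrite ler_pM2l.
Qed.

(** Second differences of the exponential moments: [exp (l y) + exp (- l y) - 2] equals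
    [l ^ 2 y ^ 2] up to [l ^ 3 |y| ^ 3 exp |y|] for [0 < l <= 1], while its mean is
    [2 (exp (l ^ 2 s ^ 2 / 2) - 1)]. Dividing by [l ^ 2] and letting [l] be small identifies the
    variance. *)
Lemma normal_variance : Ex nu (fun y => y ^+ 2) = s ^+ 2.
Proof.
have i2 := intble_normal_sqr.
set v := Ex _ _.
pose c3 (y : R) := `|y| ^+ 3 * expR `|y|.
have mc3 : measurable_fun setT c3.
  apply: measurable_funM; first exact: measurable_funX.
  exact: measurableT_comp.
have i3 : intble nu c3 by apply: (intble_normal_bound mc3); exact: cube_le_exp.
set w := Ex nu c3.
have w0 : 0 <= w by apply: Ex_ge0 => y; rewrite mulr_ge0 ?expR_ge0 ?exprn_ge0.
pose q l (y : R) := expR (l * y) + expR (- l * y) - 2.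
have iq l : intble nu (q l).
  by apply: intbleB; [apply: intbleD; exact: intble_normal_exp|exact: intble_cst].
have Eq l : Ex nu (q l) = 2 * (expR (l ^+ 2 * s ^+ 2 / 2) - 1).
  rewrite ExB; [|by apply: intbleD; exact: intble_normal_exp|exact: intble_cst].
  rewrite ExD; try exact: intble_normal_exp.
  by rewrite !Ex_normal_exp sqrrN Ex_cst; ring.
have key l : 0 < l <= 1 ->
    l ^+ 2 * (v - l * w) <= 2 * (expR (l ^+ 2 * s ^+ 2 / 2) - 1) <= l ^+ 2 * (v + l * w).
  move=> /andP[l0 l1].
  have ilin c : intble nu (fun y : R => l ^+ 2 * (y ^+ 2 + c * c3 y)).
    by apply: intbleZ; apply: intbleD => //; exact: intbleZ.
  have Elin c : Ex nu (fun y => l ^+ 2 * (y ^+ 2 + c * c3 y)) = l ^+ 2 * (v + c * w).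
    rewrite ExZ; last by apply: intbleD => //; exact: intbleZ.
    by rewrite ExD //; [rewrite ExZ|exact: intbleZ].
  have ptw y : l ^+ 2 * (y ^+ 2 + - l * c3 y) <= q l y <= l ^+ 2 * (y ^+ 2 + l * c3 y).
    have := sqr_sinh_bounds (l * y); rewrite -mulNr -/(q l y) exprMn normrM (gtr0_norm l0).
    have y0 := normr_ge0 y.
    have := expR_ge1Dx (- (l * `|y|)).
    have := expR_ge1Dx (- (l * `|y|)).
    have e1 : 1 <= expR `|y| by apply: le_trans _ (expR_ge1Dx _); lra.
    have e2 : expR (l * `|y|) <= expR `|y| by rewrite ler_expR; nra.
    have e3 : expR (l * `|y|) <= 1 + l * `|y| * expR `|y|.
      have := @expR_sub1_le (l * `|y|); rewrite mulr_ge0 ?(ltW l0) // => /(_ isT).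
      have : l * `|y| * expR (l * `|y|) <= l * `|y| * expR `|y|.
        by rewrite ler_wpM2l // mulr_ge0 // ltW.
      lra.
    have e4 : y ^+ 2 = `|y| ^+ 2 by rewrite real_normK ?num_real.
    rewrite /c3 e4 => e5 _ /andP[b1 b2]; apply/andP; split.
      apply: le_trans _ b1; rewrite -[leRHS]mulrA; apply: ler_wpM2l; first exact: sqr_ge0.
      have -> : `|y| ^+ 2 + - l * (`|y| ^+ 3 * expR `|y|) =
        `|y| ^+ 2 * (1 - l * `|y| * expR `|y|) by ring.
      rewrite ler_wpM2l ?sqr_ge0 //; apply: le_trans _ e5.
      by have : 0 <= l * `|y| by [rewrite mulr_ge0 // ltW]; nra.
    apply: (le_trans b2); rewrite -[leLHS]mulrA; apply: ler_wpM2l; first exact: sqr_ge0.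
    have -> : `|y| ^+ 2 + l * (`|y| ^+ 3 * expR `|y|) =
      `|y| ^+ 2 * (1 + l * `|y| * expR `|y|) by ring.
    by rewrite ler_wpM2l ?sqr_ge0.
  rewrite -Eq -Elin -mulNr -Elin; apply/andP; split.
    by apply: Ex_le => // y; case/andP: (ptw y).
  by apply: Ex_le => // y; case/andP: (ptw y).
pose a := s ^+ 2 / 2; pose ea := expR a.
have a0 : 0 <= a by rewrite divr_ge0 // sqr_ge0.
have ea0 : 0 <= ea := expR_ge0 a.
have s2a : s ^+ 2 = 2 * a by rewrite /a; field.
(* Bounds the second order part of the exponential: [2 (exp (L a) - 1) <= L (2 a + L K)] for
   [0 <= L <= 1]. *)
pose K := 2 * a ^+ 2 * ea.
have K0 : 0 <= K by apply: mulr_ge0 => //; apply: mulr_ge0 => //; exact: sqr_ge0.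
apply/eqP; rewrite -subr_eq0 -normr_le0; apply/ler_addgt0Pr => e e0; rewrite add0r.
pose l := Num.min 1 (e / (w + K + 1)).
have K1 : 0 < w + K + 1 by rewrite ltr_wpDl // addr_ge0.
have l0 : 0 < l by rewrite lt_min ltr01 divr_gt0.
have l1 : l <= 1 by rewrite ge_min lexx.
have le_e : l * (w + K + 1) <= e by rewrite -ler_pdivlMr // ge_min lexx orbT.
have l2 : 0 < l ^+ 2 by rewrite exprn_gt0.
have l21 : l ^+ 2 <= l by rewrite expr2; nra.
have := key l; rewrite l0 l1 => /(_ isT).
have -> : l ^+ 2 * s ^+ 2 / 2 = l ^+ 2 * a by rewrite s2a; field.
rewrite s2a; move=> {key Eq iq q} /andP[k1 k2].
move: k1 k2; set L := l ^+ 2 in l2 l21 *; set E := expR _ => k1 k2.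
have E1 : L * a <= E - 1 by have := expR_ge1Dx (L * a); rewrite -/E; lra.
have La0 : 0 <= L * a by rewrite mulr_ge0 // ltW.
have E2 : E - 1 <= L * a * E by exact: expR_sub1_le.
have E3 : E <= ea by rewrite ler_expR; nra.
have E4 : E <= 1 + L * a * ea by nra.
have E5 : 2 * (E - 1) <= L * (2 * a + L * K).
  have : L * a * E <= L * a * (1 + L * a * ea) by rewrite ler_wpM2l.
  by rewrite /K; lra.
have Kl : L * (v - 2 * a) <= L * (l * w + L * K) by lra.
have Kr : L * (2 * a - v) <= L * (l * w) by lra.
rewrite !ler_pM2l // in Kl Kr.
have lw : 0 <= l * w by rewrite mulr_ge0 // ltW.
have lK : 0 <= l * K by rewrite mulr_ge0 // ltW.
have LK : L * K <= l * K by rewrite ler_wpM2r.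
by rewrite ler_norml; lra.
Qed.

End gaussian_moments.

(** * Freezing lemma *)

(** Measurability for the sub-sigma-algebra [G] is expressed as measurability on the type carrying
    the sigma-algebra generated by [G], so that the closure properties of measurable functions apply
    as they are. It coincides with [G] when [G] is a sigma-algebra. *)
Definition adapted {d} {O : measurableType d} (G : set (set O))
    {dU} {U : measurableType dU} (f : O -> U) : Prop :=
  @measurable_fun _ _ (g_sigma_algebraType G) U setT f.

Section adapted_theory.
Context {d} {O : measurableType d} {dU} {U : measurableType dU}.
Implicit Types (G : set (set O)) (f : O -> U).

Lemma sigma_algebra_sigmaE G : sigma_algebra setT G -> <<s G >> = G.
Proof. by move=> sG; exact: sigma_algebra_id. Qed.

Lemma adaptedP G f : sigma_algebra setT G ->
  (forall B, measurable B -> G (f @^-1` B)) -> adapted G f.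
Proof.
move=> sG Gf _ B mB; rewrite setTI; apply: sub_sigma_algebra; exact: Gf.
Qed.

Lemma adapted_mono G H f : G `<=` H -> adapted G f -> adapted H f.
Proof.
move=> GH Gf _ B mB; have := Gf measurableT B mB.
exact: sub_sigma_algebra2.
Qed.

Lemma adapted_measurable G f : sigma_algebra setT G -> G `<=` measurable ->
  adapted G f -> measurable_fun setT f.
Proof.
move=> sG Gm Gf _ B mB; have /= := Gf measurableT B mB.
by rewrite {1}/measurable /= sigma_algebra_sigmaE // => /Gm.
Qed.

End adapted_theory.

Section freezing.
Context {d} {O : measurableType d} {R : realType} (P : probability O R).
Context {dU} {U : measurableType dU}.
Variables (G : set (set O)) (nu : probability U R) (xi : O -> U).
Hypotheses (sG : sigma_algebra setT G) (Gm : G `<=` measurable).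
Hypothesis mxi : measurable_fun setT xi.
Hypothesis indep : forall A B, G A -> measurable B ->
  P (A `&` xi @^-1` B) = (P A * nu B)%E.

Local Notation OG := (g_sigma_algebraType G).

Lemma measurable_toOG : measurable_fun setT (fun w : O => w : OG).
Proof.
move=> _ B; rewrite {1}/measurable /= sigma_algebra_sigmaE // => GB.
by rewrite setTI; exact: Gm.
Qed.

(* As [xi] is independent of [G], the pair made of a [G]-measurable object
   and [xi] is distributed as a product. *)
Lemma freezing (f : OG * U -> \bar R) : measurable_fun setT f ->
  (forall z, 0 <= f z)%E ->
  (\int[P]_w f (w, xi w) = \int[P]_w \int[nu]_y f (w, y))%E.
Proof.
move=> mf f0.
have mpair : measurable_fun setT (fun w : O => (w : OG, xi w)).
  by apply: measurable_fun_pair => //; exact: measurable_toOG.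
pose X : {mfun O >-> (OG * U)%type} := HB.pack (fun w : O => (w : OG, xi w))
  (isMeasurableFun.Build _ _ _ _ _ mpair).
pose I : {mfun O >-> OG} := HB.pack (fun w : O => w : OG)
  (isMeasurableFun.Build _ _ _ _ _ measurable_toOG).
transitivity (\int[distribution P X]_z f z)%E.
  by rewrite ge0_integral_distribution.
transitivity (\int[(distribution P I \x nu)%E]_z f z)%E.
  apply: eq_measure_integral => A mA _; apply/esym.
  apply: (@product_measure_unique _ _ _ _ _ (distribution P I) nu (distribution P X)) => //.
  move=> B C mB mC; rewrite /distribution /pushforward /=.
  by rewrite -indep //; move: mB; rewrite {1}/measurable /= sigma_algebra_sigmaE.
rewrite fubini_tonelli1 // ge0_integral_distribution //.
  exact: (@measurable_fun_fubini_tonelli_F _ _ _ _ _ nu f).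
by move=> x; apply: integral_ge0.
Qed.

Lemma Ex_freezing (f : OG * U -> R) : measurable_fun setT f -> (forall z, 0 <= f z) ->
  forall g : O -> R, (forall w, (\int[nu]_y (f (w, y))%:E = (g w)%:E)%E) ->
  (\int[P]_w (f (w, xi w))%:E = \int[P]_w (g w)%:E)%E.
Proof.
move=> mf f0 g fg; rewrite (@freezing (EFin \o f)) //=; last exact/measurable_EFinP.
by apply: eq_integral => w _.
Qed.

End freezing.

Section gaussian_step.
Context {d} {O : measurableType d} {R : realType} (P : probability O R).
Variables (G : set (set O)) (s : R) (xi : O -> R).
Hypotheses (sG : sigma_algebra setT G) (Gm : G `<=` measurable).
Hypothesis mxi : measurable_fun setT xi.
Hypothesis s0 : s != 0.
Hypothesis indep : forall A B, G A -> measurable B ->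
  P (A `&` xi @^-1` B) = (P A * normal_prob 0 s B)%E.
Local Notation OG := (g_sigma_algebraType G).
Local Notation nu := (normal_prob 0 s).
Local Notation RR := (measurableTypeR R).

Lemma measurable_fst_adapted (X : O -> R) :
  adapted G X -> measurable_fun setT (fun z : OG * RR => X z.1).
Proof. by move=> GX; apply: (measurableT_comp GX); exact: measurable_fst. Qed.

Lemma measurable_snd_real : measurable_fun setT (fun z : OG * RR => z.2).
Proof. exact: measurable_snd. Qed.

Lemma gaussian_step_sqr (X : O -> R) : adapted G X -> sqint P X ->
  sqint P (fun w => X w * xi w) /\
  Ex P (fun w => (X w * xi w) ^+ 2) = s ^+ 2 * Ex P (fun w => X w ^+ 2).
Proof.
move=> GX [mX X2].
have mXxi : measurable_fun setT (fun w => X w * xi w) by exact: measurable_funM.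
have E : (\int[P]_w ((X w * xi w) ^+ 2)%:E = \int[P]_w (s ^+ 2 * X w ^+ 2)%:E)%E.
  refine (@Ex_freezing _ _ _ P _ _ G nu xi sG Gm mxi indep (fun z => (X z.1 * z.2) ^+ 2) _ _ (fun w => s ^+ 2 * X w ^+ 2) _).
  - apply: measurable_funX; apply: measurable_funM; last exact: measurable_snd_real.
    exact: measurable_fst_adapted.
  - by move=> z; exact: sqr_ge0.
  move=> w; rewrite /=; under eq_integral do rewrite exprMn.
  rewrite (@Ex_EFin _ _ _ nu (fun y => X w ^+ 2 * y ^+ 2)); last first.
    by apply: intbleZ; exact: intble_normal_sqr.
  rewrite ExZ; last exact: intble_normal_sqr.
  by rewrite (normal_variance s0) mulrC.
have i2 : intble P (fun w => s ^+ 2 * X w ^+ 2) by exact: intbleZ.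
rewrite (Ex_EFin i2) in E.
have i3 : intble P (fun w => (X w * xi w) ^+ 2).
  apply: intble_ge0P; first exact: measurable_funX.
    by move=> w; exact: sqr_ge0.
  by rewrite E ltry.
by split; [split|apply: EFin_inj; rewrite -(Ex_EFin i3) E ExZ].
Qed.

(** [freezing] is stated for nonnegative integrands, so the product is split into its positive and
    negative parts. For frozen [x] the two have the same Gaussian mean, because their difference is
    [x] times a centred variable. *)
Lemma gaussian_step_orth (X : O -> R) : adapted G X -> intble P X ->
  intble P (fun w => X w * xi w) /\ Ex P (fun w => X w * xi w) = 0.
Proof.
move=> GX iX; have mX := intble_meas iX.
have mXxi : measurable_fun setT (fun w => X w * xi w) by exact: measurable_funM.
pose c := Ex nu (fun y => `|y|).
have iabs : intble nu (fun y => `|y|).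
  apply: (intble_normal_bound s0 (c := 1) (k := 1)); first exact: measurableT_comp.
  by move=> y; rewrite normr_id; exact: normr_le_exp.
have E : (\int[P]_w (`|X w * xi w|)%:E = \int[P]_w (c * `|X w|)%:E)%E.
  apply: (@Ex_freezing _ _ _ P _ _ G nu xi sG Gm mxi indep (fun z => `|X z.1 * z.2|)) => //.
  - apply: measurableT_comp => //; apply: measurable_funM; last exact: measurable_snd_real.
    exact: measurable_fst_adapted.
  move=> w; rewrite /=; under eq_integral do rewrite normrM.
  rewrite (@Ex_EFin _ _ _ nu (fun y => `|X w| * `|y|)); last exact: intbleZ.
  by rewrite ExZ // mulrC.
have iXabs : intble P (fun w => `|X w|).
  exact: intble_norm.
have iXxi : intble P (fun w => X w * xi w).
  apply/intbleP; split=> //; rewrite E Ex_EFin ?ltry //; exact: intbleZ.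
split=> //.
pose pos (e : R) (x : R) := Num.max (e * x) 0.
have pos_ge0 e x : 0 <= pos e x by rewrite le_max lexx orbT.
have mpos e (Y : O -> R) : measurable_fun setT Y -> measurable_fun setT (fun w => pos e (Y w)).
  by move=> mY; apply: measurable_maxr => //; exact: measurable_funM.
have iposle e x : `|e| = 1 -> `|pos e x| <= `|x|.
  move=> e1; rewrite ger0_norm // ge_max normr_ge0 andbT.
  by rewrite (le_trans (ler_norm _)) // normrM e1 mul1r.
have i_pos e : `|e| = 1 -> intble P (fun w => pos e (X w * xi w)).
  move=> e1; apply: (@intble_le _ _ _ P _ (fun w => `|X w * xi w|)).
  - exact: (mpos e (fun w => X w * xi w)).
  - by move=> w; exact: iposle.
  exact: intble_norm.
have iposnu e x : `|e| = 1 -> intble nu (fun y => pos e (x * y)).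
  move=> e1; apply: (@intble_le _ _ _ nu _ (fun y => `|x| * `|y|)).
  - by apply: measurable_maxr => //; do 2 apply: measurable_funM => //.
  - by move=> y; rewrite -normrM; exact: iposle.
  exact: intbleZ.
have split_pos x : x = pos 1 x - pos (-1) x.
  rewrite /pos mul1r mulN1r; have /orP[h|h] := le_total 0 x.
    by rewrite (max_l h) max_r ?subr0 // oppr_le0.
  by rewrite (max_r h) max_l ?oppr_ge0 // sub0r opprK.
have n1 : `|1 : R| = 1 := normr1 _.
have n2 : `|-1 : R| = 1 := normrN1 _.
have eqpm x : Ex nu (fun y => pos 1 (x * y)) = Ex nu (fun y => pos (-1) (x * y)).
  apply/eqP; rewrite -subr_eq0 -ExB; [|exact: iposnu|exact: iposnu].
  under [X in Ex _ X]eq_fun do rewrite -split_pos.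
  have := @ExZ _ _ _ nu x id (intble_normal_id s0).
  by rewrite (normal_mean s0) mulr0 => ->.
have -> : (fun w => X w * xi w) =
    (fun w => pos 1 (X w * xi w) - pos (-1) (X w * xi w)).
  by apply: funext => w; exact: split_pos.
rewrite ExB; [|exact: i_pos|exact: i_pos].
apply/eqP; rewrite subr_eq0; apply/eqP; apply: EFin_inj.
rewrite -!Ex_EFin; [|exact: i_pos|exact: i_pos].
have mz e : measurable_fun setT (fun z : OG * RR => pos e (X z.1 * z.2)).
  apply: measurable_maxr => //; apply: measurable_funM => //.
  apply: measurable_funM; last exact: measurable_snd_real.
  exact: measurable_fst_adapted.
have Ee e : `|e| = 1 -> (\int[P]_w (pos e (X w * xi w))%:E =
    \int[P]_w (Ex nu (fun y => pos e (X w * y)))%:E)%E.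
  move=> e1.
  apply: (@Ex_freezing _ _ _ P _ _ G nu xi sG Gm mxi indep (fun z => pos e (X z.1 * z.2))) => //.
  by move=> w /=; rewrite (@Ex_EFin _ _ _ nu (fun y => pos e (X w * y))) //; exact: iposnu.
by rewrite (Ee 1 n1) (Ee (-1) n2); apply: eq_integral => w _; rewrite eqpm.
Qed.

(** One step of the exponential supermartingale: with [X] and [H] frozen, the Gaussian factor
    integrates to [exp (H ^ 2 s ^ 2 / 2)], where [|H| <= c]. *)
Lemma gaussian_step_exp (X H : O -> R) (c : R) : adapted G X -> adapted G H ->
  (forall w, `|H w| <= c) ->
  intble P (fun w => expR (X w)) ->
  intble P (fun w => expR (X w + H w * xi w)) /\
  Ex P (fun w => expR (X w + H w * xi w)) <=
    expR (c ^+ 2 * s ^+ 2 / 2) * Ex P (fun w => expR (X w)).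
Proof.
move=> GX GH Hc iX.
have mX := adapted_measurable sG Gm GX; have mH := adapted_measurable sG Gm GH.
have mf : measurable_fun setT (fun w => expR (X w + H w * xi w)).
  apply: measurableT_comp => //; apply: measurable_funD => //.
  exact: measurable_funM.
have E : (\int[P]_w (expR (X w + H w * xi w))%:E =
    \int[P]_w (expR (X w) * expR (H w ^+ 2 * s ^+ 2 / 2))%:E)%E.
  apply: (@Ex_freezing _ _ _ P _ _ G nu xi sG Gm mxi indep
    (fun z => expR (X z.1 + H z.1 * z.2))) => //.
  - apply: measurableT_comp => //; apply: measurable_funD.
      exact: measurable_fst_adapted.
    apply: measurable_funM; last exact: measurable_snd_real.
    exact: measurable_fst_adapted.
  move=> w; rewrite /=; under eq_integral do rewrite expRD.
  rewrite (@Ex_EFin _ _ _ nu (fun y => expR (X w) * expR (H w * y))); last first.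
    by apply: intbleZ; exact: intble_normal_exp.
  by rewrite ExZ ?Ex_normal_exp //; exact: intble_normal_exp.
apply: (intble_ub mf (fun w => expR_ge0 _)).
rewrite E -ExZ // -Ex_EFin; last exact: intbleZ.
apply: ge0_le_integral => //.
- apply/measurable_EFinP; apply: measurable_funM; first exact: measurableT_comp.
  apply: measurableT_comp => //; do 2 apply: measurable_funM => //; exact: measurable_funX.
- by apply/measurable_EFinP; apply: measurable_funM => //; exact: measurableT_comp.
move=> w _; rewrite lee_fin mulrC ler_wpM2r ?expR_ge0 // ler_expR.
rewrite ler_wpM2r // ler_wpM2r ?sqr_ge0 // -[H w ^+ 2]real_normK ?num_real //.
by rewrite lerXn2r ?nnegrE // (le_trans _ (Hc w)).
Qed.

End gaussian_step.

(** * Discrete stochastic integrals *)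

Section discrete_martingale.
Context {d} {O : measurableType d} {R : realType} (P : probability O R).
Variables (n : nat) (G : nat -> set (set O)) (xi : nat -> O -> R) (s : R).

(** The last clause gives at once the law of [xi k] and its independence of [G k], in the form that
    [freezing] uses. *)
Definition gaussian_noise : Prop :=
  [/\ s != 0,
      forall k, (k <= n)%N -> sigma_algebra setT (G k) /\ G k `<=` measurable,
      forall k, (k < n)%N -> G k `<=` G k.+1,
      forall k, (k < n)%N -> adapted (G k.+1) (xi k) &
      forall k A D, (k < n)%N -> G k A -> measurable D ->
        P (A `&` xi k @^-1` D) = (P A * normal_prob 0 s D)%E].

Hypothesis noise : gaussian_noise.

Definition msum (H : nat -> O -> R) (j : nat) (w : O) : R :=
  \sum_(k < j) H k w * xi k w.

Lemma msum0 H w : msum H 0 w = 0.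
Proof. by rewrite /msum big_ord0. Qed.

Lemma msumS H j w : msum H j.+1 w = msum H j w + H j w * xi j w.
Proof. by rewrite /msum big_ord_recr. Qed.

Variable H : nat -> O -> R.
Hypothesis GH : forall k, (k < n)%N -> adapted (G k) (H k).

Lemma measurable_noise k : (k < n)%N -> measurable_fun setT (xi k).
Proof.
have [_ Gs _ Gxi _] := noise; move=> kn.
have [sG Gm] := Gs k.+1 kn.
exact: (adapted_measurable sG Gm (Gxi k kn)).
Qed.

Lemma msum_adapted j : (j <= n)%N -> adapted (G j) (msum H j).
Proof.
have [_ Gs Gmono Gxi _] := noise.
elim: j => [|j ih] jn.
  rewrite (_ : msum H 0 = cst 0); first exact: measurable_cst.
  by apply: funext => w; exact: msum0.
rewrite (_ : msum H j.+1 = (fun w => msum H j w + H j w * xi j w)); last first.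
  by apply: funext => w; exact: msumS.
apply: measurable_funD.
  by apply: adapted_mono (Gmono _ jn) _; exact: ih (ltnW jn).
apply: measurable_funM; last exact: Gxi.
by apply: adapted_mono (Gmono _ jn) _; exact: GH.
Qed.

Lemma msum_sqr : (forall k, (k < n)%N -> sqint P (H k)) -> forall j, (j <= n)%N ->
  sqint P (msum H j) /\
  Ex P (fun w => msum H j w ^+ 2) = s ^+ 2 * \sum_(k < j) Ex P (fun w => H k w ^+ 2).
Proof.
have [s0 Gs Gmono Gxi ind] := noise; move=> H2; elim=> [|j ih] jn.
  have -> : msum H 0 = cst 0 by apply: funext => w; exact: msum0.
  rewrite big_ord0 mulr0; split; first exact: sqint_cst.
  by under [X in Ex _ X]eq_fun do rewrite expr0n; exact: Ex_cst.
have [sM EM] := ih (ltnW jn).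
have [sG Gm] := Gs j (ltnW jn).
have mxi := measurable_noise jn.
have indj : forall A D, G j A -> measurable D ->
  P (A `&` xi j @^-1` D) = (P A * normal_prob 0 s D)%E by move=> A D; exact: ind.
have [sHx EHx] := gaussian_step_sqr sG Gm mxi s0 indj (GH jn) (H2 _ jn).
have GMH : adapted (G j) (fun w => msum H j w * H j w).
  by apply: measurable_funM; [exact: msum_adapted (ltnW jn)|exact: GH].
have [iMHx EMHx] := gaussian_step_orth sG Gm mxi s0 indj GMH (intbleM sM (H2 _ jn)).
have -> : msum H j.+1 = (fun w => msum H j w + H j w * xi j w).
  by apply: funext => w; exact: msumS.
split; first exact: sqintD.
have -> : (fun w => (msum H j w + H j w * xi j w) ^+ 2) = (fun w =>
    (msum H j w ^+ 2 + 2 * (msum H j w * H j w * xi j w)) + (H j w * xi j w) ^+ 2).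
  by apply: funext => w; ring.
rewrite ExD; last 2 first.
- by apply: intbleD; [exact: sM.2|exact: intbleZ].
- exact: sHx.2.
rewrite ExD; [|exact: sM.2|exact: intbleZ].
by rewrite ExZ // EMHx EHx EM big_ord_recr /= mulr0 addr0 mulrDr.
Qed.

(** The maximum is one-sided and starts from 0, which is also the initial value of the martingale
    sums. *)
Fixpoint runmax (M : nat -> O -> R) (j : nat) (w : O) : R :=
  if j is j'.+1 then Num.max (runmax M j' w) (M j w) else 0.

Lemma runmax_ge0 M j w : 0 <= runmax M j w.
Proof. by elim: j => [|j ih] //=; rewrite le_max ih. Qed.

Lemma runmax_ge M j k w : (0 < k <= j)%N -> M k w <= runmax M j w.
Proof.
elim: j => [|j ih]; first by case: k.
case/andP=> k0; rewrite leq_eqVlt => /predU1P[->|kj] /=.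
  by rewrite le_max lexx orbT.
by rewrite le_max ih // k0.
Qed.

Lemma runmax_adapted M : (forall k, (k <= n)%N -> adapted (G k) (M k)) ->
  forall j, (j <= n)%N -> adapted (G j) (runmax M j).
Proof.
have [_ Gs Gmono _ _] := noise; move=> GM; elim=> [|j ih] jn.
  exact: measurable_cst.
apply: measurable_maxr; last exact: GM.
by apply: adapted_mono (Gmono _ jn) _; exact: ih (ltnW jn).
Qed.

(* Trajectorial form of Doob's L2 inequality: the integral of the running maximum
   against the martingale is at most [S_n M_n - S_n^2 / 2]. *)
Lemma runmax_sqr_le j w : runmax (msum H) j w ^+ 2 <=
  4 * msum H j w ^+ 2 - 4 * \sum_(k < j) runmax (msum H) k w * H k w * xi k w.
Proof.
(* Discrete integration by parts: at a new maximum the right side gains an extra half square,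
   otherwise the running maximum does not move and the two increments agree. *)
have key : \sum_(k < j) runmax (msum H) k w * H k w * xi k w <=
    runmax (msum H) j w * msum H j w - runmax (msum H) j w ^+ 2 / 2.
  elim: j => [|j ih].
    by rewrite big_ord0 /= expr0n /= mul0r mul0r subr0.
  rewrite big_ord_recr; apply: (le_trans (lerD ih (lexx _))).
  rewrite /= msumS; set S := runmax _ j w; set M := msum H j w.
  rewrite -mulrA; set D := H j w * xi j w.
  have [h|h] := leP S (M + D); last by rewrite -/S; lra.
  by have := sqr_ge0 (M + D - S); rewrite -/S; nra.
(* Young's inequality [2 S M <= S ^ 2 / 2 + 2 M ^ 2] absorbs half of the square of the maximum; this
   is the origin of the constant 4. *)
have := sqr_ge0 (runmax (msum H) j w - 2 * msum H j w); nra.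
Qed.

Lemma runmax_sqint : (forall k, (k < n)%N -> sqint P (H k)) -> forall j, (j <= n)%N ->
  sqint P (runmax (msum H) j).
Proof.
move=> H2; elim=> [|j ih] jn; first exact: sqint_cst.
have sM := (msum_sqr H2 jn).1; have sS := ih (ltnW jn).
apply: (@sqint_le _ _ _ P _ (fun w => `|runmax (msum H) j w| + `|msum H j.+1 w|)).
- by apply: measurable_maxr; [exact: sS.1|exact: sM.1].
- move=> w /=; have [h|h] := leP (runmax (msum H) j w) (msum H j.+1 w).
    by rewrite lerDr.
  by rewrite lerDl.
by apply: sqintD; exact: sqint_norm.
Qed.

(** The sum in [runmax_sqr_le] has mean zero, since the running maximum up to time [k] is known
    before the increment [xi k]. *)
Lemma doob_one_sided : (forall k, (k < n)%N -> sqint P (H k)) ->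
  Ex P (fun w => runmax (msum H) n w ^+ 2) <=
  4 * (s ^+ 2 * \sum_(k < n) Ex P (fun w => H k w ^+ 2)).
Proof.
have [s0 Gs Gmono Gxi ind] := noise; move=> H2.
have [sM EM] := msum_sqr H2 (leqnn n).
have step (k : 'I_n) :
    intble P (fun w => runmax (msum H) k w * H k w * xi k w) /\
    Ex P (fun w => runmax (msum H) k w * H k w * xi k w) = 0.
  have kn := ltn_ord k; have [sG Gm] := Gs k (ltnW kn).
  apply: (gaussian_step_orth sG Gm (measurable_noise kn) s0) => //.
  - by move=> A D; exact: ind.
  - apply: measurable_funM; last exact: GH.
    by apply: runmax_adapted (ltnW kn) => j; exact: msum_adapted.
  - by apply: intbleM; [exact: runmax_sqint (ltnW kn)|exact: H2].
rewrite -EM -(ExZ 4); last exact: sM.2.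
rewrite -[leRHS]subr0 -(mulr0 4).
have <- : Ex P (fun w => \sum_(k < n) runmax (msum H) k w * H k w * xi k w) = 0.
  rewrite Ex_sum; last by move=> k; exact: (step k).1.
  by rewrite big1 // => k _; exact: (step k).2.
have iS : intble P (fun w => \sum_(k < n) runmax (msum H) k w * H k w * xi k w).
  by apply: intble_sum => k; exact: (step k).1.
rewrite -ExZ // -ExB; [|by apply: intbleZ; exact: sM.2|exact: intbleZ].
apply: Ex_le; [exact: (runmax_sqint H2 (leqnn n)).2| |by move=> w; exact: runmax_sqr_le].
by apply: intbleB; apply: intbleZ => //; exact: sM.2.
Qed.

Lemma msum_exp (c l : R) : (forall k w, (k < n)%N -> `|H k w| <= c) ->
  forall j, (j <= n)%N ->
  intble P (fun w => expR (l * msum H j w)) /\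
  Ex P (fun w => expR (l * msum H j w)) <= expR (j%:R * ((l * c) ^+ 2 * s ^+ 2 / 2)).
Proof.
have [s0 Gs Gmono Gxi ind] := noise; move=> Hc; elim=> [|j ih] jn.
  have -> : (fun w => expR (l * msum H 0 w)) = (fun=> 1).
    by apply: funext => w; rewrite msum0 mulr0 expR0.
  by rewrite Ex_cst mul0r expR0; split; [exact: intble_cst|].
have [iM EM] := ih (ltnW jn).
have [sG Gm] := Gs j (ltnW jn).
have -> : (fun w => expR (l * msum H j.+1 w)) =
    (fun w => expR (l * msum H j w + l * H j w * xi j w)).
  by apply: funext => w; rewrite msumS mulrDr mulrA.
have GM : adapted (G j) (fun w => l * msum H j w).
  by apply: measurable_funM => //; exact: msum_adapted (ltnW jn).
have GlH : adapted (G j) (fun w => l * H j w).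
  by apply: measurable_funM => //; exact: GH.
have lHc w : `|l * H j w| <= `|l| * c by rewrite normrM ler_wpM2l // Hc.
have indj : forall A D, G j A -> measurable D ->
  P (A `&` xi j @^-1` D) = (P A * normal_prob 0 s D)%E by move=> A D; exact: ind.
have [iE EE] := gaussian_step_exp sG Gm (measurable_noise jn) s0 indj GM GlH lHc iM.
split=> //; apply: (le_trans EE).
rewrite -[j.+1%:R]natr1 mulrDl mul1r addrC expRD exprMn real_normK ?num_real // -exprMn.
by rewrite ler_wpM2l ?expR_ge0.
Qed.

(** Chernoff's bound for the martingale and its opposite; [l] is left free and later taken to be the
    inverse of [c]. *)
Lemma msum_tail (c l u : R) : 0 < l -> (forall k w, (k < n)%N -> `|H k w| <= c) ->
  (P [set w | u <= `|msum H n w|]%R <=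
    (2 * expR (n%:R * ((l * c) ^+ 2 * s ^+ 2 / 2) - l * u))%:E)%E.
Proof.
move=> l0 Hc.
have [i1 E1] := msum_exp l Hc (leqnn n).
have [i2 E2] := msum_exp (- l) Hc (leqnn n).
pose f w := expR (l * msum H n w) + expR (- l * msum H n w).
have If : intble P f by exact: intbleD.
have Ef : Ex P f <= 2 * expR (n%:R * ((l * c) ^+ 2 * s ^+ 2 / 2)).
  rewrite ExD //; move: E2; rewrite mulNr sqrrN => E2.
  by rewrite mulr_natl mulr2n lerD.
have f0 w : 0 <= f w by rewrite addr_ge0 ?expR_ge0.
have mk := markov_prob If f0 (expR_gt0 (l * u)) Ef.
rewrite expRB mulrA; apply: le_trans _ mk.
have mM : measurable_fun setT (msum H n).
  have [_ Gs _ _ _] := noise; have [sG Gm] := Gs n (leqnn n).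
  exact: (adapted_measurable sG Gm (msum_adapted (leqnn n))).
apply: le_measure; rewrite ?inE.
- rewrite -[X in measurable X]setTI.
  apply: (@measurable_fun_le _ _ _ setT (cst u) (fun w => `|msum H n w|)) => //.
  exact: measurableT_comp.
- rewrite -[X in measurable X]setTI.
  apply: (@measurable_fun_le _ _ _ setT (cst _) f) => //.
  exact: intble_meas If.
move=> w /= uw; rewrite /f.
have e1 := expR_ge0 (l * msum H n w); have e2 := expR_ge0 (- l * msum H n w).
have : expR (l * u) <= expR (l * `|msum H n w|) by rewrite ler_expR ler_wpM2l // ltW.
have [h|h] := leP 0 (msum H n w); first by rewrite ger0_norm //; lra.
by rewrite ltr0_norm // mulrN -mulNr; lra.
Qed.

End discrete_martingale.

(** The dominating variable is the sum of the squared one-sided maxima of the martingale and of its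
    opposite, whence 8, twice the one-sided constant. *)
Lemma doob_bound d (O : measurableType d) (R : realType) (P : probability O R)
    n (G : nat -> set (set O)) (xi : nat -> O -> R) (s : R) (H : nat -> O -> R) :
  gaussian_noise P n G xi s ->
  (forall k, (k < n)%N -> adapted (G k) (H k)) ->
  (forall k, (k < n)%N -> sqint P (H k)) ->
  exists U : O -> R, [/\ intble P U,
    forall j w, (j <= n)%N -> msum xi H j w ^+ 2 <= U w &
    Ex P U <= 8 * (s ^+ 2 * \sum_(k < n) Ex P (fun w => H k w ^+ 2))].
Proof.
move=> noise GH H2.
pose H' k w := - H k w.
have GH' k : (k < n)%N -> adapted (G k) (H' k).
  by move=> kn; apply: measurableT_comp => //; exact: GH.
have EH' k : (fun w => H' k w ^+ 2) = (fun w => H k w ^+ 2).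
  by apply: funext => w; rewrite sqrrN.
have H2' k : (k < n)%N -> sqint P (H' k).
  move=> kn; split; first by apply: measurableT_comp => //; exact: (H2 k kn).1.
  by rewrite EH'; exact: (H2 k kn).2.
have sS := runmax_sqint noise GH H2 (leqnn n).
have sS' := runmax_sqint noise GH' H2' (leqnn n).
exists (fun w => runmax (msum xi H) n w ^+ 2 + runmax (msum xi H') n w ^+ 2); split.
- by apply: intbleD; [exact: sS.2|exact: sS'.2].
- case=> [|j] w jn; first by rewrite msum0 expr0n addr_ge0 // sqr_ge0.
  have h1 : msum xi H j.+1 w <= runmax (msum xi H) n w by exact: runmax_ge.
  have h2 : msum xi H' j.+1 w <= runmax (msum xi H') n w by exact: runmax_ge.
  have : msum xi H' j.+1 w = - msum xi H j.+1 w.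
    by rewrite /msum -sumrN; apply: eq_bigr => k _; rewrite mulNr.
  have := runmax_ge0 (msum xi H) n w; have := runmax_ge0 (msum xi H') n w.
  by move=> a b c; rewrite c in h2; have [h|/ltW h] := leP 0 (msum xi H j.+1 w); nra.
rewrite ExD; [|exact: sS.2|exact: sS'.2].
have := doob_one_sided noise GH H2; have := doob_one_sided noise GH' H2'.
under [X in _ <= 4 * (_ * X) -> _]eq_bigr do rewrite EH'.
lra.
Qed.

(** * Brownian increments and the Ito isometry *)

Section brownian_noise.
Context {R : realType} {dO : measure_display} {O : measurableType dO}.
Variables (P : probability O R) (F : R -> set (set O)).
Context {m : nat} (B : R -> O -> 'cV[R]_m).
Hypotheses (uF : usual_filtration P F) (bB : brownian P F B).

Lemma filtration_sigma t : 0 <= t -> sigma_algebra setT (F t) /\ F t `<=` measurable.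
Proof. by have [h _ _ _] := uF; exact: h. Qed.

Lemma brownian_adapted t i : 0 <= t -> adapted (F t) (fun w => B t w i 0).
Proof.
move=> t0; have [_ _ h _ _] := bB.
by apply: adaptedP => [|D mD]; [exact: (filtration_sigma t0).1|exact: h].
Qed.

Lemma brownian_increment_adapted s t i : 0 <= s -> s <= t ->
  adapted (F t) (fun w => (B t w - B s w) i 0).
Proof.
move=> s0 st; have t0 : 0 <= t := le_trans s0 st.
have -> : (fun w => (B t w - B s w) i 0) = (fun w => B t w i 0 - B s w i 0).
  by apply: funext => w; rewrite !mxE.
apply: measurable_funB; first exact: brownian_adapted.
apply: (adapted_mono _ (brownian_adapted i s0)).
by have [_ h _ _] := uF; exact: h.
Qed.

Lemma brownian_increment_indep s t i A D : 0 <= s -> s < t -> F s A -> measurable D ->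
  P (A `&` (fun w => (B t w - B s w) i 0) @^-1` D) =
  (P A * normal_prob 0 (Num.sqrt (t - s)) D)%E.
Proof.
move=> s0 st FA mD; have [_ _ _ hN hI] := bB.
(* The Brownian law is given for all coordinates jointly; one coordinate is isolated by leaving the
   others unconstrained. *)
pose V j : set R := if j == i then D else setT.
have mV j : measurable (V j) by rewrite /V; case: ifP.
have eV : increment_in B s t V = (fun w => (B t w - B s w) i 0) @^-1` D.
  apply/seteqP; split => [w /(_ i)|w Dw j]; first by rewrite /V eqxx.
  by rewrite /V; case: eqP => // ->.
rewrite -eV hI // hN //; congr (_ * _)%E.
rewrite (bigD1 i) //= {1}/V eqxx big1; last first.
  move=> j ji; rewrite /V (negPf ji).
  by transitivity (fine (1 : \bar R)); [congr fine; exact: probability_setT|].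
by rewrite mulr1 fineK //; exact: fin_num_measure.
Qed.

Lemma brownian_gaussian_noise (n : nat) (delta : R) (i : 'I_m) : 0 < delta ->
  gaussian_noise P n (fun k => F (k%:R * delta))
    (fun k w => (B (k.+1%:R * delta) w - B (k%:R * delta) w) i 0) (Num.sqrt delta).
Proof.
move=> d0.
have k0 (k : nat) : 0 <= k%:R * delta by rewrite mulr_ge0 // ltW.
have kS (k : nat) : k%:R * delta < k.+1%:R * delta by rewrite ltr_pM2r // ltr_nat.
split.
- by rewrite gt_eqF // sqrtr_gt0.
- by move=> k _; exact: filtration_sigma.
- by move=> k _; have [_ h _ _] := uF; apply: h => //; exact: ltW.
- by move=> k _; apply: brownian_increment_adapted => //; exact: ltW.
move=> k A D _ FA mD.
have := brownian_increment_indep i (k0 k) (kS k) FA mD.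
have -> : k.+1%:R * delta - k%:R * delta = delta.
  by rewrite -mulrBl -natrB ?leqnSn // subSnn mul1r.
exact.
Qed.

Section ito_isometry.
Variables (i : 'I_m) (T : R).

(** [W] and the indicator [e] below are put to 0 outside []0, T]] so that their Gram matrices agree
    for all real [s] and [t], without side conditions. *)
Let W (s : R) (w : O) : R := if 0 < s <= T then (B s w - B 0 w) i 0 else 0.

Let e (s t : R) : R := if 0 < s <= T then \1_`]0, s] t else 0.

Lemma brownian_increment_moments s t : 0 <= s -> s < t ->
  sqint P (fun w => (B t w - B s w) i 0) /\
  Ex P (fun w => (B t w - B s w) i 0 ^+ 2) = t - s.
Proof.
move=> s0 st; have t0 : 0 <= t := le_trans s0 (ltW st).
have [sG Gm] := filtration_sigma s0.
have [sGt Gmt] := filtration_sigma t0.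
have mxi := adapted_measurable sGt Gmt (brownian_increment_adapted i s0 (ltW st)).
have v0 : Num.sqrt (t - s) != 0 by rewrite gt_eqF // sqrtr_gt0 subr_gt0.
have ind A D : F s A -> measurable D -> _ := brownian_increment_indep i s0 st.
have ac : adapted (F s) (fun=> 1 : R) by exact: measurable_cst.
have [h1 h2] := gaussian_step_sqr sG Gm mxi v0 ind ac (sqint_cst P 1).
have E : (fun w => 1 * (B t w - B s w) i 0) = (fun w => (B t w - B s w) i 0).
  by apply: funext => w; rewrite mul1r.
rewrite E in h1; split=> //.
transitivity (Ex P (fun w => (1 * (B t w - B s w) i 0) ^+ 2)).
  by congr Ex; apply: funext => w; rewrite mul1r.
rewrite h2 sqr_sqrtr ?subr_ge0 ?(ltW st) //.
by under [X in Ex _ X]eq_fun do rewrite expr1n; rewrite Ex_cst mulr1.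
Qed.

Lemma sqint_W s : sqint P (W s).
Proof.
rewrite /W; have [/andP[s0 _]|_] := boolP (0 < s <= T); last exact: sqint_cst.
exact: (brownian_increment_moments (lexx 0) s0).1.
Qed.

Let cov (s t : R) : R := if (0 < s <= T) && (0 < t <= T) then Num.min s t else 0.

Lemma Ex_W s t : Ex P (fun w => W s w * W t w) = cov s t.
Proof.
wlog st : s t / s <= t.
  move=> h; have /orP[/h//|/h] := le_total s t.
  under [X in Ex _ X]eq_fun do rewrite mulrC.
  by rewrite /cov andbC minC.
rewrite /cov /W; have [/andP[s0 sT]|_] := boolP (0 < s <= T); last first.
  by under [X in Ex _ X]eq_fun do rewrite mul0r; exact: Ex_cst.
have [/andP[t0 tT]|_] /= := boolP (0 < t <= T); last first.
  by under [X in Ex _ X]eq_fun do rewrite mulr0; exact: Ex_cst.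
have [h1 h2] := brownian_increment_moments (lexx 0) s0.
rewrite subr0 in h2.
rewrite min_l //; move: st; rewrite le_eqVlt => /predU1P[<-|st].
  by rewrite -[RHS]h2; congr Ex; apply: funext => w; rewrite expr2.
have [sG Gm] := filtration_sigma (ltW s0).
have [sGt Gmt] := filtration_sigma (ltW t0).
have mxi := adapted_measurable sGt Gmt (brownian_increment_adapted i (ltW s0) (ltW st)).
have v0 : Num.sqrt (t - s) != 0 by rewrite gt_eqF // sqrtr_gt0 subr_gt0.
have ind A D : F s A -> measurable D -> _ := brownian_increment_indep i (ltW s0) st.
have aW := brownian_increment_adapted i (lexx 0) (ltW s0).
have iW : intble P (fun w => (B s w - B 0 w) i 0).
  have := intbleM h1 (sqint_cst P 1).
  by under eq_fun do rewrite mulr1.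
have [g1 g2] := gaussian_step_orth sG Gm mxi v0 ind aW iW.
have -> : (fun w => (B s w - B 0 w) i 0 * (B t w - B 0 w) i 0) =
    (fun w => (B s w - B 0 w) i 0 ^+ 2 + (B s w - B 0 w) i 0 * (B t w - B s w) i 0).
  by apply: funext => w; rewrite !mxE; ring.
by rewrite ExD ?h2 ?g2 ?addr0 //; exact: h1.2.
Qed.

Lemma measurable_e s : measurable_fun setT (e s).
Proof.
rewrite /e; have [_|_] := boolP (0 < s <= T); last exact: measurable_cst.
by apply: measurable_indic.
Qed.

Lemma integral_e s t : (\int[lebesgue_measure]_(x in `[0%R, T]) (e s x * e t x)%:E =
  (cov s t)%:E)%E.
Proof.
rewrite /cov /e.
have [/andP[s0 sT]|_] := boolP (0 < s <= T); last first.
  by under eq_integral do rewrite mul0r; rewrite integral0.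
have [/andP[t0 tT]|_] /= := boolP (0 < t <= T); last first.
  by under eq_integral do rewrite mulr0; rewrite integral0.
transitivity (\int[lebesgue_measure]_(x in `[0%R, T])
    (\1_(`]0, s]%classic `&` `]0, t]%classic) x)%:E)%E.
  by apply: eq_integral => x _; rewrite indicI.
rewrite integral_indic //; last exact: measurableI.
have -> : `]0, s] `&` `]0, t] `&` `[0, T] = `]0, Num.min s t]%classic :> set R.
  apply/seteqP; split => x /=; rewrite !in_itv /= le_min.
    by move=> [[/andP[-> ->] /andP[_ ->]]].
  move=> /and3P[x0 xs xt]; rewrite x0 xs xt (ltW x0) /=.
  by rewrite (le_trans xs sT).
transitivity (lebesgue_measure [set` `]0, Num.min s t]]) => //.
by rewrite lebesgue_measure_itv /= lte_fin lt_min s0 t0 /= oppr0 adde0.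
Qed.

Lemma integrable_e s t : lebesgue_measure.-integrable `[0, T] (fun x => (e s x * e t x)%:E).
Proof.
apply/integrableP; split.
  apply/measurable_EFinP; apply: measurable_funTS.
  by apply: measurable_funM; exact: measurable_e.
have e0 u x : 0 <= e u x by rewrite /e; case: ifP => // _; rewrite indicE.
under eq_integral do rewrite /= ger0_norm ?mulr_ge0 //.
by rewrite integral_e ltry.
Qed.

(** The variables [W s] and the indicators of []0, s]] have the same Gram matrix, so the same linear
    combinations have the same norm. The intervals of a step function may therefore overlap, and no
    common refinement is needed. *)
Lemma ito_isometry_gram (l : seq (R * R)) :
  let I w := \sum_(q <- l) q.2 * W q.1 w in
  sqint P I /\ ((Ex P (fun w => I w ^+ 2))%:E =
    \int[lebesgue_measure]_(t in `[0%R, T]) ((\sum_(q <- l) q.2 * e q.1 t) ^+ 2)%:E)%E.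
Proof.
move=> I.
have sI : sqint P I by apply: sqint_sum => q; apply: sqintZ; exact: sqint_W.
split=> //.
have iW q q' : intble P (fun w => q.2 * q'.2 * (W q.1 w * W q'.1 w)).
  by apply: intbleZ; apply: intbleM; exact: sqint_W.
transitivity ((\sum_(q <- l) \sum_(q' <- l) q.2 * q'.2 * cov q.1 q'.1)%:E).
  congr (_%:E).
  transitivity (Ex P (fun w => \sum_(q <- l) \sum_(q' <- l) q.2 * q'.2 * (W q.1 w * W q'.1 w))).
    congr Ex; apply: funext => w; rewrite expr2 /I big_distrlr /=.
    by apply: eq_bigr => q _; apply: eq_bigr => q' _; ring.
  rewrite Ex_sum; last by move=> q; exact: intble_sum.
  apply: eq_bigr => q _; rewrite Ex_sum //; apply: eq_bigr => q' _.
  by rewrite ExZ ?Ex_W //; apply: intbleM; exact: sqint_W.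
have ie q q' : lebesgue_measure.-integrable `[0, T]
    (fun x => (q.2 * q'.2)%:E * (e q.1 x * e q'.1 x)%:E)%E.
  by apply: integrableZl => //; exact: integrable_e.
transitivity (\int[lebesgue_measure]_(t in `[0%R, T])
   (\sum_(q <- l) \sum_(q' <- l) (q.2 * q'.2)%:E * (e q.1 t * e q'.1 t)%:E))%E; last first.
  apply: eq_integral => t _; rewrite expr2 big_distrlr /= -sumEFin.
  apply: eq_bigr => q _; rewrite -sumEFin; apply: eq_bigr => q' _.
  by rewrite -EFinM; congr (_%:E); ring.
rewrite integral_sum //; last first.
  by move=> q; apply: integrable_sum => // q' _; exact: ie.
rewrite -sumEFin; apply: eq_bigr => q _; rewrite integral_sum // -sumEFin.
apply: eq_bigr => q' _; rewrite integralZl // ?integral_e ?EFinM //.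
exact: integrable_e.
Qed.

Lemma ito_isometry_scalar (l : seq (R * R * R)) :
  all (fun q => [&& 0 <= q.1.1, q.1.1 <= q.1.2 & q.1.2 <= T]) l ->
  let I w := \sum_(q <- l) q.2 * (B q.1.2 w - B q.1.1 w) i 0 in
  sqint P I /\ ((Ex P (fun w => I w ^+ 2))%:E =
    \int[lebesgue_measure]_(t in `[0%R, T])
      ((\sum_(q <- l) q.2 * (q.1.1 < t <= q.1.2)%R%:R) ^+ 2)%:E)%E.
Proof.
move=> /allP al I.
(* The indicator of []u, v]] is a difference of indicators from 0, so each triple contributes [c] at
   [v] and [- c] at [u]. *)
pose l' := [seq (q.1.2, q.2) | q <- l] ++ [seq (q.1.1, - q.2) | q <- l].
have := ito_isometry_gram l'; rewrite /l' /=.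
have EW s : 0 <= s -> s <= T -> W s = (fun w => (B s w - B 0 w) i 0).
  move=> s0 sT; apply: funext => w; rewrite /W sT andbT.
  by move: s0; rewrite le_eqVlt => /predU1P[<-|->] //; rewrite ltxx subrr mxE.
have Ee s t : 0 <= s -> s <= T -> e s t = (0 < t <= s)%R%:R.
  move=> s0 sT; rewrite /e sT andbT indicE; case: ifP => [h|/negbT].
    by congr (_%:R); congr nat_of_bool; rewrite mem_setE in_itv.
  by rewrite -leNgt => h; case: andP => // -[t0 ts]; move: (lt_le_trans t0 (le_trans ts h)); rewrite ltxx.
have -> : (fun w => \sum_(q <- [seq (q.1.2, q.2) | q <- l] ++ [seq (q.1.1, - q.2) | q <- l])
    q.2 * W q.1 w) = I.
  apply: funext => w; rewrite big_cat !big_map /= -big_split /=.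
  apply: eq_big_seq => q /al/and3P[u0 uv vT].
  rewrite !EW ?(le_trans u0 uv) ?(le_trans uv vT) // !mxE; ring.
move=> [sI EI]; split=> //.
transitivity (\int[lebesgue_measure]_(t in `[0%R, T])
  ((\sum_(q <- [seq (q.1.2, q.2) | q <- l] ++ [seq (q.1.1, - q.2) | q <- l]) q.2 * e q.1 t) ^+ 2)%:E)%E.
  rewrite -EI; congr (_%:E); congr Ex; apply: funext => w; congr (_ ^+ 2).
  rewrite /I big_cat !big_map /= -big_split /=.
  apply: eq_big_seq => q /al/and3P[u0 uv vT].
  rewrite !EW ?(le_trans u0 uv) ?(le_trans uv vT) // !mxE; ring.
apply: eq_integral => t; rewrite inE /= in_itv /= => /andP[t0 tT].
congr ((_ ^+ 2)%:E); rewrite big_cat !big_map /= -big_split /=.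
apply: eq_big_seq => q /al/and3P[u0 uv vT].
rewrite !Ee ?(le_trans u0 uv) ?(le_trans uv vT) // mulNr -mulrBr; congr (_ * _).
rewrite (ltNge q.1.1 t).
have [tu|ut] := leP t q.1.1.
  by rewrite (le_trans tu uv) andbT subrr.
by rewrite (le_lt_trans u0 ut) /= subr0.
Qed.

End ito_isometry.

(** The isometry is applied to each coordinate of the Brownian motion; the coordinates are then
    added by the Cauchy-Schwarz inequality, which costs the factor [m]. *)
Lemma step_integral_sqr a (T : R) (S : seq (R * R * 'M[R]_(a, m))) :
  all (fun q : R * R * _ => [&& 0 <= q.1.1, q.1.1 <= q.1.2 & q.1.2 <= T]) S ->
  intble P (fun w => hsnorm (step_integral B S w) ^+ 2) /\
  ((Ex P (fun w => hsnorm (step_integral B S w) ^+ 2))%:E <=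
    m%:R%:E * \int[lebesgue_measure]_(t in `[0%R, T]) (hsnorm (step_fun S t) ^+ 2)%:E)%E.
Proof.
move=> aS.
pose I (k : 'I_a) (j : 'I_m) w := \sum_(q <- S) q.2 k j * (B q.1.2 w - B q.1.1 w) j 0.
pose f (k : 'I_a) (j : 'I_m) t := \sum_(q <- S) q.2 k j * (q.1.1 < t <= q.1.2)%R%:R.
have iso k j : sqint P (I k j) /\ ((Ex P (fun w => I k j w ^+ 2))%:E =
    \int[lebesgue_measure]_(t in `[0%R, T]) (f k j t ^+ 2)%:E)%E.
  have := @ito_isometry_scalar j T [seq (q.1, (q.2 : 'M[R]_(a, m)) k j) | q : R * R * 'M[R]_(a, m) <- S].
  rewrite all_map => /(_ aS) /= [sI EI].
  have E1 : (fun w => \sum_(q <- [seq (q.1, (q.2 : 'M[R]_(a, m)) k j) | q : R * R * 'M[R]_(a, m) <- S]) q.2 * (B q.1.2 w - B q.1.1 w) j 0) = I k j.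
    by apply: funext => w; rewrite big_map.
  rewrite E1 in sI; split=> //.
  transitivity ((Ex P (fun w => (\sum_(q <- [seq (q.1, (q.2 : 'M[R]_(a, m)) k j) | q : R * R * 'M[R]_(a, m) <- S]) q.2 * (B q.1.2 w - B q.1.1 w) j 0) ^+ 2))%:E).
    by congr (_%:E); congr Ex; apply: funext => w; rewrite big_map.
  by rewrite EI; apply: eq_integral => t _; rewrite big_map.
have Ef t k j : step_fun S t k j = f k j t.
  rewrite /step_fun summxE big_mkcond /=; apply: eq_bigr => q _.
  by case: ifP => _; rewrite ?mulr1 ?mulr0.
have EI w k : step_integral B S w k 0 = \sum_j I k j w.
  rewrite /step_integral summxE exchange_big /=; apply: eq_bigr => q _.
  by rewrite mxE.
have mI : measurable_fun setT (fun w => hsnorm (step_integral B S w) ^+ 2).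
  apply: measurable_funX; apply: measurable_hsnorm => k j; rewrite ord1.
  under eq_fun do rewrite EI.
  by apply: measurable_sum => j'; exact: (iso k j').1.1.
have ub w : hsnorm (step_integral B S w) ^+ 2 <= m%:R * \sum_k \sum_j I k j w ^+ 2.
  rewrite sqr_hsnorm mulr_sumr; apply: ler_sum => k _; rewrite big_ord1 EI.
  have := sum_cauchy_schwarz (fun=> 1 : R) (fun j : 'I_m => I k j w).
  under eq_bigr do rewrite mul1r; move=> /le_trans; apply.
  by under eq_bigr do rewrite expr1n; rewrite sumr_const card_ord.
have iub : intble P (fun w => m%:R * \sum_k \sum_j I k j w ^+ 2).
  apply: intbleZ; apply: intble_sum => k; apply: intble_sum => j.
  exact: (iso k j).1.2.
have i1 : intble P (fun w => hsnorm (step_integral B S w) ^+ 2).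
  by apply: (intble_le mI _ iub) => w; rewrite ger0_norm ?sqr_ge0.
split=> //.
apply: (@le_trans _ _ ((m%:R * \sum_k \sum_j Ex P (fun w => I k j w ^+ 2))%:E)).
  rewrite lee_fin; apply: (le_trans (Ex_le i1 iub ub)).
  rewrite ExZ; last first.
    by apply: intble_sum => k; apply: intble_sum => j; exact: (iso k j).1.2.
  rewrite Ex_sum; last by move=> k; apply: intble_sum => j; exact: (iso k j).1.2.
  rewrite ler_wpM2l //; apply: ler_sum => k _; rewrite Ex_sum // => j.
  exact: (iso k j).1.2.
rewrite EFinM; apply: lee_wpmul2l; first by rewrite lee_fin.
have mf k j : measurable_fun (`[0, T]%classic : set R) (fun t => (f k j t ^+ 2)%:E).
  apply/measurable_EFinP; apply: measurable_funTS; apply: measurable_funX.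
  apply: measurable_sum => q; apply: measurable_funM => //.
  rewrite (_ : (fun t => _) = \1_`]q.1.1, q.1.2]); first exact: measurable_indic.
  by apply: funext => t; rewrite indicE mem_setE in_itv.
rewrite -sumEFin.
apply: (@le_trans _ _ (\sum_k \int[lebesgue_measure]_(t in `[0%R, T]) \sum_j (f k j t ^+ 2)%:E)%E).
  apply: lee_sum => k _; rewrite -sumEFin ge0_integral_sum //.
  - by apply: lee_sum => j _; rewrite (iso k j).2.
  - by move=> j; exact: mf.
  - by move=> j t _; rewrite lee_fin sqr_ge0.
have E : (\int[lebesgue_measure]_(t in `[0%R, T]) \sum_k \sum_j (f k j t ^+ 2)%:E =
    \sum_k \int[lebesgue_measure]_(t in `[0%R, T]) \sum_j (f k j t ^+ 2)%:E)%E.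
  rewrite ge0_integral_sum //.
  - by move=> k; apply: emeasurable_sum => j; exact: mf.
  - by move=> k t _; apply: sume_ge0 => j _; rewrite lee_fin sqr_ge0.
rewrite -E.
have Es t : (\sum_k \sum_j (f k j t ^+ 2)%:E)%E = (hsnorm (step_fun S t) ^+ 2)%:E.
  rewrite sqr_hsnorm -sumEFin; apply: eq_bigr => k _.
  by rewrite -sumEFin; apply: eq_bigr => j _; rewrite Ef.
by rewrite le_eqVlt; apply/orP; left; apply/eqP; apply: eq_integral => t _.
Qed.

End brownian_noise.

(** * Chaining *)

Section chaining.
Context {R : realType}.

(** The cube of side [2 * D] around [a0] is cut into cells of side [2 * D / 4 ^ j], and a point of
    [A] is picked in each cell that meets [A]; [a0] is the default for the others. The index runs to
    [4 ^ j] included because the upper face is attained. *)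
Lemma dyadic_net p (A : set 'cV[R]_p) (a0 : 'cV[R]_p) (D : R) (j : nat) : 0 < D ->
  A a0 -> (forall a i, A a -> `|a i 0 - a0 i 0| <= D) ->
  exists net : {ffun 'I_p -> 'I_(4 ^ j).+1} -> 'cV[R]_p, (forall c, A (net c)) /\
    forall a, A a -> exists c, hsnorm (a - net c) <= p%:R * (2 * D) / 4 ^+ j.
Proof.
move=> D0 Aa0 AD.
pose v (a : 'cV[R]_p) (i : 'I_p) := (a i 0 - a0 i 0 + D) / (2 * D) * 4 ^+ j.
have q0 : 0 < 4 ^+ j :> R by rewrite exprn_gt0.
have v0 a i : A a -> 0 <= v a i <= 4 ^+ j.
  move=> Aa; have := AD a i Aa; rewrite ler_norml => h.
  rewrite /v mulr_ge0 ?(ltW q0) ?divr_ge0 //=; try lra.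
  by rewrite ler_piMl ?(ltW q0) // ler_pdivrMr; lra.
pose idx (a : 'cV[R]_p) : {ffun 'I_p -> 'I_(4 ^ j).+1} := [ffun i => inord (Num.truncn (v a i))].
pose net c := xget a0 [set a | A a /\ idx a = c].
exists net; split=> [c|a Aa].
  by rewrite /net; case: xgetP => // a -> [].
exists (idx a).
have [Ab ba] : A (net (idx a)) /\ idx (net (idx a)) = idx a.
  by apply: (@xgetPex _ a0 [set b | A b /\ idx b = idx a]); exists a.
set b := net (idx a) in Ab ba *.
apply: (le_trans (hsnorm_le_sum _)).
apply: (@le_trans _ _ (\sum_(i < p) 2 * D / 4 ^+ j)); last first.
  by rewrite sumr_const card_ord -[leLHS]mulr_natl mulrA.
apply: ler_sum => i _; rewrite big_ord1 !mxE.
have /(congr1 (fun f : {ffun 'I_p -> 'I_(4 ^ j).+1} => nat_of_ord (f i))) := ba; rewrite !ffunE.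
have idxlt c : A c -> (Num.truncn (v c i) < (4 ^ j).+1)%N.
  move=> Ac; have /andP[c0 c1] := v0 c i Ac.
  by rewrite truncn_lt_nat // (le_lt_trans c1) // -natrX ltr_nat.
rewrite !inordK ?idxlt // => tE.
have /andP[a1 _] := v0 a i Aa; have /andP[b1 _] := v0 b i Ab.
have /andP[ta ta'] := truncn_itv a1; have /andP[tb tb'] := truncn_itv b1.
rewrite tE in tb tb'.
have h : `|v a i - v b i| <= 1.
  by rewrite ler_norml; move: ta' tb'; rewrite -!natr1; lra.
have -> : a i 0 - b i 0 = (2 * D) / 4 ^+ j * (v a i - v b i).
  by rewrite /v; field; rewrite !gt_eqF.
rewrite normrM ger0_norm; last by rewrite divr_ge0 ?(ltW q0) // mulr_ge0 // ltW.
by rewrite ler_piMr // divr_ge0 ?(ltW q0) // mulr_ge0 // ltW.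
Qed.

(** Trades an exponential tail for a power of any prescribed degree, which is then compared with the
    number of pairs of net points. *)
Lemma expRN_le (N : nat) (y : R) : 0 < y -> expR (- y) <= N.+1`!%:R / y ^+ N.+1.
Proof.
move=> y0; have := expR_ge1Dxn N (ltW y0); rewrite expRN => h.
have f0 : 0 < N.+1`!%:R :> R by rewrite ltr0n fact_gt0.
have yN : 0 < y ^+ N.+1 by rewrite exprn_gt0.
rewrite -[leRHS]invf_div lef_pV2 ?posrE ?expR_gt0 ?divr_gt0 //; lra.
Qed.

Context {d} {O : measurableType d} (P : probability O R).

Lemma finite_Boole (J : finType) (E : J -> set O) (c : R) :
  (forall j, measurable (E j)) -> (forall j, (P (E j) <= c%:E)%E) ->
  measurable (\bigcup_j E j) /\ (P (\bigcup_j E j) <= (#|J|%:R * c)%:E)%E.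
Proof.
move=> mE Ec.
have -> : \bigcup_j E j = \big[setU/set0]_(j <- enum J) E j.
  rewrite -bigcup_seq; apply/seteqP; split => w [j _ Ej]; exists j => //=.
  by rewrite mem_enum.
rewrite cardE; elim: (enum J) => [|j s [ms Ps]].
  by rewrite big_nil measure0 mul0r.
rewrite big_cons; split; first exact: measurableU.
apply: (le_trans (measureU2 _ _ _)) => //.
by rewrite /= -natr1 mulrDl mul1r addrC EFinD; apply: leeD.
Qed.

(** Here [x] stands for [2 ^ j]: the two factors bound the numbers of points at levels [j] and
    [j + 1], and the count of pairs grows like [x ^ (4 p)]. *)
Lemma net_count (x : R) p :
  (2 * (2 * (x * x)) ^+ p) * (2 * (2 * (4 * (x * x))) ^+ p) = 4 * 16 ^+ p * x ^+ (4 * p).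
Proof.
rewrite exprM mulrACA -exprMn -[RHS]mulrA -exprMn.
by congr (_ * _ ^+ _); ring.
Qed.

(* The increments of [N] at scale [r 4^-j] are controlled at level [2^-j] on all
   pairs of neighbouring net points; exponential tails beat the number of pairs. *)
Lemma chaining p (D C kappa gamma : R) : (0 < p)%N -> 0 < D -> 0 < C -> 0 < kappa ->
  0 < gamma ->
  exists2 K : R, 0 < K & forall (A : set 'cV[R]_p) (a0 : 'cV[R]_p) (N : 'cV[R]_p -> O -> R),
    A a0 -> (forall a i, A a -> `|a i 0 - a0 i 0| <= D) ->
    (forall a, A a -> measurable_fun setT (N a)) ->
    (forall w, exists L, forall a b, A a -> A b -> `|N a w - N b w| <= L * hsnorm (a - b)) ->
    (forall a b rho u, A a -> A b -> 0 < rho -> hsnorm (a - b) <= rho ->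
      (P [set w | u <= `|N a w - N b w|]%R <= (C * expR (- (u / (kappa * rho))))%:E)%E) ->
    exists E : set O, [/\ measurable E, (P E <= gamma%:E)%E &
      forall w, ~ E w -> forall J a, A a -> hsnorm (a - a0) <= p%:R * (2 * D) / 4 ^+ J ->
        `|N a w - N a0 w| <= K / 2 ^+ J].
Proof.
move=> p0 D0 C0 k0 g0.
have [r r0 rE] : exists2 r : R, 0 < r & p%:R * (2 * D) = r.
  by exists (p%:R * (2 * D)) => //; rewrite !mulr_gt0 // ltr0n.
rewrite rE.
(* One degree more than the growth of the number of pairs: the bad probability at level [j] keeps a
   factor [2 ^- j] and is summable. *)
pose M : nat := (4 * p).+1.
pose c1 : R := (4 * 16 ^+ p) * C * (M`!%:R * (2 * kappa * r) ^+ M).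
have c10 : 0 < c1.
  have kr : 0 < 2 * kappa * r by rewrite !mulr_gt0.
  apply: mulr_gt0; last by apply: mulr_gt0; rewrite ?ltr0n ?fact_gt0 ?exprn_gt0.
  by apply: mulr_gt0 => //; apply: mulr_gt0 => //; exact: exprn_gt0.
(* Chosen so that [2 c1 <= gamma K1], which brings level [j] below [gamma / 2 ^ (j + 1)]; [1 <= K1]
   bounds [K1 ^ M] from below by [K1]. *)
pose K1 : R := 1 + 2 * c1 / gamma.
have K10 : 1 <= K1 by rewrite lerDl divr_ge0 ?(ltW g0) // mulr_ge0 // ltW.
have K1p : 0 < K1 := lt_le_trans ltr01 K10.
exists (3 * K1); first by rewrite mulr_gt0.
move=> A a0 N Aa0 AD mN lipN tail.
have := fun j => dyadic_net j D0 Aa0 AD.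
rewrite rE => netE.
pose net j := projT1 (cid (netE j)); have netP j : (forall c, A (net j c)) /\ (forall a, A a -> exists c, hsnorm (a - net j c) <= r / 4 ^+ j) :=
  projT2 (cid (netE j)).
(* The value [None] stands for [a0], which thus belongs to the net at every level. *)
pose Cell j := option {ffun 'I_p -> 'I_(4 ^ j).+1}.
pose pt j (c : Cell j) := if c is Some c' then net j c' else a0.
have Apt j c : A (pt j c) by case: c => [c|] //=; exact: (netP j).1.
pose B j (cc : Cell j * Cell j.+1) : set O :=
  if hsnorm (pt _ cc.1 - pt _ cc.2) <= 2 * r / 4 ^+ j
  then [set w | K1 / 2 ^+ j <= `|N (pt _ cc.1) w - N (pt _ cc.2) w|] else set0.
pose bd (j : nat) : R := C * expR (- ((K1 / 2 ^+ j) / (kappa * (2 * r / 4 ^+ j)))).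
have mB j cc : measurable (B j cc).
  rewrite /B; case: ifP => // _; rewrite -[X in measurable X]setTI.
  apply: (@measurable_fun_le _ _ _ setT (cst _) (fun w => `|N (pt j cc.1) w - N (pt _ cc.2) w|)) => //.
  by apply: measurableT_comp => //; apply: measurable_funB; apply: mN.
have PB j cc : (P (B j cc) <= (bd j)%:E)%E.
  rewrite /B; case: ifP => [h|_]; last first.
    by rewrite measure0 lee_fin mulr_ge0 ?expR_ge0 // ltW.
  by apply: tail => //; rewrite divr_gt0 ?exprn_gt0 // mulr_gt0.
pose Bad j := \bigcup_cc B j cc.
have BadP j : measurable (Bad j) /\ (P (Bad j) <= (gamma / (2 ^ j.+1)%:R)%:E)%E.
  have [mBad PBad] := finite_Boole (mB j) (PB j); split=> //.
  apply: (le_trans PBad); rewrite lee_fin.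
  have twoj : 0 < 2 ^+ j :> R by rewrite exprn_gt0.
  have fourj : 4 ^+ j = 2 ^+ j * 2 ^+ j :> R by rewrite -exprMn; congr (_ ^+ _); lra.
  have card_le : #|{: Cell j * Cell j.+1}|%:R <= 4 * 16 ^+ p * (2 ^+ j) ^+ (4 * p) :> R.
    have card1 k : #|{: Cell k}|%:R <= 2 * (2 * 4 ^+ k) ^+ p :> R.
      rewrite card_option card_ffun !card_ord -natr1 natrX -natr1 natrX.
      have q1 : 1 <= 4 ^+ k :> R by rewrite exprn_ege1 // ler1n.
      have h1 : (4 ^+ k + 1) ^+ p <= (2 * 4 ^+ k) ^+ p :> R.
        by rewrite lerXn2r ?nnegrE ?addr_ge0 ?mulr_ge0 //; try lra.
      have h2 : 1 <= (2 * 4 ^+ k) ^+ p :> R by rewrite exprn_ege1 //; lra.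
      lra.
    rewrite card_prod natrM.
    apply: (@le_trans _ _ ((2 * (2 * 4 ^+ j) ^+ p) * (2 * (2 * 4 ^+ j.+1) ^+ p))).
      by rewrite ler_pM.
    by rewrite exprS fourj net_count.
  set y := (K1 / 2 ^+ j) / (kappa * (2 * r / 4 ^+ j)).
  have yE : y = K1 * 2 ^+ j / (2 * kappa * r).
    by rewrite /y fourj; field; rewrite !gt_eqF.
  have y0 : 0 < y by rewrite yE divr_gt0 // !mulr_gt0.
  have bdle : bd j <= C * (M`!%:R / y ^+ M).
    by rewrite /bd -/y ler_wpM2l ?(ltW C0) //; exact: expRN_le.
  have b0 : 0 <= bd j by rewrite mulr_ge0 ?expR_ge0 // ltW.
  apply: (@le_trans _ _ (4 * 16 ^+ p * (2 ^+ j) ^+ (4 * p) * (C * (M`!%:R / y ^+ M)))).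
    by rewrite ler_pM.
  have -> : 4 * 16 ^+ p * (2 ^+ j) ^+ (4 * p) * (C * (M`!%:R / y ^+ M)) =
      c1 / (K1 ^+ M * 2 ^+ j).
    rewrite yE /c1 !expr_div_n !exprMn /M exprS.
    rewrite [(2 ^+ j) ^+ (4 * p).+1]exprS.
    by field; rewrite !expf_neq0 ?gt_eqF.
  have KM : K1 <= K1 ^+ M by rewrite /M exprS ler_peMr ?(ltW K1p) // exprn_ege1.
  apply: (@le_trans _ _ (c1 / (K1 * 2 ^+ j))).
    rewrite ler_wpM2l ?(ltW c10) // lef_pV2 ?posrE ?mulr_gt0 ?exprn_gt0 //.
    by rewrite ler_wpM2r // ltW.
  rewrite natrX exprS ler_pdivrMr ?mulr_gt0 // mulrAC ler_pdivlMr ?mulr_gt0 //.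
  have : 2 * c1 <= gamma * K1.
    have -> : gamma * K1 = gamma + 2 * c1 by rewrite /K1; field; rewrite gt_eqF.
    by rewrite lerDr ltW.
  by move=> h; nra.
exists (\bigcup_j Bad j); split.
- by apply: bigcup_measurable => j _; exact: (BadP j).1.
- apply: (le_trans (generalized_Boole_inequality _ _ _)) => [j|| ].
  + exact: (BadP j).1.
  + by apply: bigcup_measurable => j _; exact: (BadP j).1.
  apply: le_trans _ (@epsilon_trick0 R gamma xpredT (ltW g0)).
  by apply: lee_nneseries => j _ //; exact: (BadP j).2.
move=> w nE J a Aa aJ.
have good j (c : Cell j) (c' : Cell j.+1) : hsnorm (pt _ c - pt _ c') <= 2 * r / 4 ^+ j ->
    `|N (pt _ c) w - N (pt _ c') w| <= K1 / 2 ^+ j.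
  move=> h; rewrite leNgt; apply/negP => /ltW h'; apply: nE; exists j => //.
  by exists (c, c') => //; rewrite /B /= h.
have cellE j : exists c : Cell j, hsnorm (a - pt _ c) <= r / 4 ^+ j.
  by have [c cP] := (netP j).2 a Aa; exists (Some c).
pose cell j := projT1 (cid (cellE j)).
have cellP j : hsnorm (a - pt _ (cell j)) <= r / 4 ^+ j := projT2 (cid (cellE j)).
have f0 j : 0 < 4 ^+ j :> R by rewrite exprn_gt0.
have t0 j : 0 < 2 ^+ j :> R by rewrite exprn_gt0.
have h1 : `|N (pt _ (cell J)) w - N a0 w| <= K1 / 2 ^+ J.
  apply: (good J (cell J) None); apply: (le_trans (hsnorm_triB _ a _)).
  by rewrite hsnormBC -mulrA mulr_natl mulr2n lerD.
(* Telescoping along the nearest net points: the first link to [a0] and the geometric series add up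
   to less than [3 * K1 / 2 ^ J]. *)
have h2 n : `|N (pt _ (cell (J + n)%N)) w - N a0 w| <= K1 / 2 ^+ J * (3 - 2 / 2 ^+ n).
  elim: n => [|n ih]; first by rewrite addn0 expr0 divr1; move: h1; lra.
  have := good (J + n)%N (cell (J + n)%N) (cell (J + n).+1).
  move=> /(_ _)/wrap[].
    apply: (le_trans (hsnorm_triB _ a _)).
    rewrite hsnormBC -mulrA mulr_natl mulr2n lerD //.
    apply: (le_trans (cellP _)); rewrite ler_wpM2l ?(ltW r0) // lef_pV2 ?posrE //.
    by rewrite exprS ler_peMl ?ltW // ltr1n.
  rewrite addnS => h3.
  rewrite -(subrKA (N (pt _ (cell (J + n)%N)) w)).
  apply: (le_trans (ler_normD _ _)); rewrite distrC in h3.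
  apply: (le_trans (lerD h3 ih)).
  rewrite exprD exprS le_eqVlt; apply/orP; left; apply/eqP.
  by field; rewrite !gt_eqF.
(* The Lipschitz constant depends on the outcome without control; it only serves to pass from the
   net points to [a] in the limit. *)
have [L LP] := lipN w.
apply/ler_addgt0Pr => e e0.
pose n := (Num.truncn (`|L| * r / e)).+1.
have nP : `|L| * r / 4 ^+ n <= e.
  rewrite ler_pdivrMr // [leRHS]mulrC -ler_pdivrMr //.
  have Lr : 0 <= `|L| * r / e by rewrite divr_ge0 ?(ltW e0) // mulr_ge0 // ltW.
  have /andP[_ /ltW h] := truncn_itv Lr; apply: (le_trans h).
  by rewrite -natrX ler_nat ltnW // ltn_expl.
have h3 : `|N a w - N (pt _ (cell (J + n)%N)) w| <= e.
  apply: (le_trans (LP _ _ Aa (Apt _ _))); apply: le_trans _ nP.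
  apply: (@le_trans _ _ (`|L| * hsnorm (a - pt _ (cell (J + n)%N)))).
    by apply: ler_wpM2r; [exact: hsnorm_ge0|exact: ler_norm].
  rewrite -mulrA ler_wpM2l //; apply: (le_trans (cellP _)).
  rewrite ler_wpM2l ?(ltW r0) // lef_pV2 ?posrE // exprD ler_peMl ?(ltW (f0 _)) //.
  by rewrite exprn_ege1 // ler1n.
rewrite -(subrKA (N (pt _ (cell (J + n)%N)) w)).
apply: (le_trans (ler_normD _ _)); rewrite addrC lerD //.
apply: (le_trans (h2 n)).
have : 0 <= 2 / 2 ^+ n :> R by rewrite divr_ge0 // ltW.
have : 0 <= K1 / 2 ^+ J by rewrite divr_ge0 // ltW.
by move=> u v; nra.
Qed.

End chaining.

(** * Differentiability relative to a set *)

Section matrix_topology.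
Context {R : realType} {p : nat}.
Implicit Types (x y : 'cV[R]_p) (A : set 'cV[R]_p).

Lemma nbhs_hsnorm x (e : R) : 0 < e -> \forall y \near x, hsnorm (y - x) < e.
Proof.
move=> e0; apply/nbhs_ballP; exists (e / ((p * 1)%:R + 1)) => /=.
  by rewrite divr_gt0 // ltr_wpDl.
move=> y; rewrite mx_norm_ball /ball_ /= distrC ltr_pdivlMr ?ltr_wpDl // => h.
apply: (le_lt_trans (hsnorm_le_mx_norm _)); apply: le_lt_trans h.
by have := normr_ge0 (y - x); lra.
Qed.

Lemma nbhs_hsnormP x (V : set 'cV[R]_p) : nbhs x V ->
  exists2 e : R, 0 < e & forall y, hsnorm (y - x) < e -> V y.
Proof.
move=> /nbhs_ballP[e /= e0 eV]; exists e => // y h; apply: eV.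
rewrite mx_norm_ball /ball_ /= distrC.
exact: le_lt_trans (le_mx_norm_hsnorm _) h.
Qed.

Lemma closure_hsnormP A x : closure A x <->
  forall e : R, 0 < e -> exists2 a, A a & hsnorm (a - x) < e.
Proof.
split=> [cA e e0|h V /nbhs_hsnormP[e e0 eV]].
  by have [a [Aa /= ha]] := cA _ (nbhs_hsnorm x e0); exists a.
by have [a Aa /eV Va] := h e e0; exists a.
Qed.

Lemma closure_segment A x y (t : R) :
  convex_set (A : set (convex_lmodType 'cV[R]_p)) ->
  closure A x -> closure A y -> 0 <= t <= 1 -> closure A (x + t *: (y - x)).
Proof.
move=> cvA /closure_hsnormP cx /closure_hsnormP cy /andP[t0 t1].
apply/closure_hsnormP => e e0.
have [a Aa ax] := cx e e0; have [b Ab bx] := cy e e0.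
have tP : (0 <= t)%R && (t <= 1)%R by rewrite t0 t1.
pose l : {i01 R} := Itv01 t0 t1.
have := cvA b a l; rewrite !inE => /(_ Ab Aa) Aba.
exists (t *: b + (1 - t) *: a); first exact: Aba.
have -> : t *: b + (1 - t) *: a - (x + t *: (y - x)) = t *: (b - y) + (1 - t) *: (a - x).
  by apply/matrixP => i j; rewrite !mxE; ring.
apply: (le_lt_trans (hsnormD _ _)); rewrite !hsnormZ ger0_norm // ger0_norm; last by lra.
have [t00|t00] := eqVneq t 0; first by rewrite t00; lra.
have : 0 < t by rewrite lt_def t00.
by nra.
Qed.

(** The compactness criterion is applied to row vectors and carried to column vectors by
    transposition. *)
Lemma closed_bounded_compact A : bounded_set A -> compact (closure A).
Proof.
move=> bA.
pose K := [set v : 'rV[R]_p | closure A v^T].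
have ctr : continuous (fun v : 'rV[R]_p => v^T).
  move=> v V /nbhs_ballP[e /= e0 eV].
  apply/nbhs_ballP; exists e => //= u [_ uv]; apply: eV; split=> // i j.
  by rewrite !mxE; exact: uv.
have cK : closed K by apply: (closed_comp (fun v _ => ctr v)); exact: closed_closure.
have bK : bounded_set K.
  have [M [Mr MA]] := bA; exists (Num.max M 0 + 1); split; first exact: num_real.
  move=> N MN v Kv.
  have := MA (Num.max M 0 + 1); rewrite (@le_lt_trans _ _ (Num.max M 0)) ?ltrDl ?le_max ?lexx //.
  move=> /(_ isT) {}MA.
  have /closure_hsnormP/(_ _ (_ : 0 < N - (Num.max M 0 + 1))) := Kv.
  rewrite subr_gt0 => /(_ MN)[a /MA /= aM ha].
  have h1 : `|v| <= `|v^T|.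
    rewrite [leLHS]/Num.norm /= mx_normrE; apply/bigmax_leP; split=> // -[i j] _ /=.
    by have := entry_le_mx_norm v^T j i; rewrite mxE.
  apply: (le_trans h1); rewrite -(subrK a v^T); apply: (le_trans (ler_normD _ _)).
  have := le_mx_norm_hsnorm (v^T - a); rewrite hsnormBC; lra.
have : compact [set v^T | v in K].
  apply: continuous_compact; first exact: continuous_subspaceT.
  exact: bounded_closed_compact.
congr compact; apply/seteqP; split => [_ [v Kv <-]|x cx] //.
by exists x^T; rewrite ?trmxK // /K /= trmxK.
Qed.

(** Used to turn local bounds by an integer into a bound valid on the whole compact set. *)
Lemma compact_uniform A (Q : nat -> 'cV[R]_p -> Prop) : compact A ->
  (forall x, A x -> exists e : R, exists N : nat, 0 < e /\
     forall n y, (N <= n)%N -> hsnorm (y - x) < e -> Q n y) ->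
  exists N, forall n x, (N <= n)%N -> A x -> Q n x.
Proof.
move=> /compact_near_coveringP cA AQ.
have [N _ NP] : \forall n \near \oo, A `<=` Q n.
  apply: cA => x Ax; have [e [N [e0 eN]]] := AQ x Ax.
  exists ([set y | hsnorm (y - x) < e], [set n | (N <= n)%N]) => /=.
    by split; [exact: nbhs_hsnorm|exists N].
  by move=> [y n] /= [h1 h2]; exact: eN.
by exists N => n x Nn Ax; exact: NP.
Qed.

End matrix_topology.

(** * Mean value inequality relative to a convex set *)

Section mean_value.
Context {R : realType} {p a c : nat}.
Implicit Types (A : set 'cV[R]_p) (f g : 'cV[R]_p -> 'M[R]_(a, c)).
Implicit Types (D E : 'I_p -> 'M[R]_(a, c)) (x y : 'cV[R]_p).

Definition diff_within A f x D : Prop :=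
  forall e : R, 0 < e -> exists2 r : R, 0 < r & forall y, A y -> hsnorm (y - x) < r ->
    hsnorm (f y - f x - \sum_(k < p) (y - x) k 0 *: D k) <= e * hsnorm (y - x).

Lemma has_partials_diff A f x D : has_partials_within A f x D -> diff_within A f x D.
Proof.
move=> h e e0; have /cvgrPdist_lt/(_ e e0) := h.
move=> /nbhs_hsnormP[r r0 rP]; exists r => // y Ay yr.
have [->|yx] := eqVneq y x.
  rewrite !subrr hsnorm0 mulr0 sub0r hsnormN big1 ?hsnorm0 // => k _.
  by rewrite mxE scale0r.
have yx0 : 0 < hsnorm (y - x) by rewrite hsnorm_gt0 subr_eq0.
have := rP y yr yx Ay; rewrite sub0r normrN ger0_norm ?divr_ge0 // => /ltW.
by rewrite ler_pdivrMr.
Qed.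

Lemma diff_withinS A B f x D : A `<=` B -> diff_within B f x D -> diff_within A f x D.
Proof.
move=> AB h e e0; have [r r0 rP] := h e e0; exists r => // y /AB; exact: rP.
Qed.

Lemma diff_withinB A f g x D E : diff_within A f x D -> diff_within A g x E ->
  diff_within A (fun y => f y - g y) x (fun k => D k - E k).
Proof.
move=> hf hg e e0; have e2 : 0 < e / 2 by rewrite divr_gt0.
have [r r0 rP] := hf _ e2; have [s s0 sP] := hg _ e2.
exists (Num.min r s) => [|y Ay]; rewrite lt_min ?r0 ?s0 // => /andP[yr ys].
have -> : f y - g y - (f x - g x) - \sum_(k < p) (y - x) k 0 *: (D k - E k) =
    (f y - f x - \sum_(k < p) (y - x) k 0 *: D k) -
    (g y - g x - \sum_(k < p) (y - x) k 0 *: E k).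
  under eq_bigr do rewrite scalerBr.
  rewrite sumrB; move: (\sum_(k < p) _ *: D k) (\sum_(k < p) _ *: E k) => S1 S2.
  by apply/matrixP => i j; rewrite !mxE; ring.
apply: (le_trans (hsnormB _ _)).
by have := rP y Ay yr; have := sP y Ay ys; lra.
Qed.

(** The vector increment is reduced to a scalar one by pairing [f] with the fixed matrix [f y - f x]
    along the segment from [x] to [y]. The mean value theorem then needs a derivative in the
    interior of the segment only, and no continuity of [D]. *)
Lemma mean_value_ineq A f (D : 'cV[R]_p -> 'I_p -> 'M[R]_(a, c)) (L : R) : 0 <= L ->
  (forall x y (t : R), A x -> A y -> 0 <= t <= 1 -> A (x + t *: (y - x))) ->
  (forall x, A x -> diff_within A f x (D x)) ->
  (forall x (v : 'cV[R]_p), A x -> hsnorm (\sum_(k < p) v k 0 *: D x k) <= L * hsnorm v) ->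
  forall x y, A x -> A y -> hsnorm (f y - f x) <= L * hsnorm (y - x).
Proof.
move=> L0 cvA dA bA x y Ax Ay.
have [->|xy] := eqVneq y x; first by rewrite !subrr !hsnorm0 mulr0.
pose v := y - x; have v0 : 0 < hsnorm v by rewrite hsnorm_gt0 subr_eq0.
pose w := f y - f x.
pose dot (M : 'M[R]_(a, c)) : R := \sum_i \sum_j w i j * M i j.
have dotB M N : dot (M - N) = dot M - dot N.
  rewrite /dot -sumrB; apply: eq_bigr => i _; rewrite -sumrB; apply: eq_bigr => j _.
  by rewrite !mxE mulrBr.
have dotZ k M : dot (k *: M) = k * dot M.
  rewrite /dot mulr_sumr; apply: eq_bigr => i _; rewrite mulr_sumr.
  by apply: eq_bigr => j _; rewrite [(k *: M) i j]mxE; ring.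
have dot_le M : `|dot M| <= hsnorm w * hsnorm M.
  rewrite -(@ler_pXn2r _ 2) ?nnegrE ?mulr_ge0 // exprMn !sqr_hsnorm.
  rewrite real_normK ?num_real // /dot !pair_bigA /=.
  exact: (sum_cauchy_schwarz (fun u : 'I_a * 'I_c => w u.1 u.2) (fun u => M u.1 u.2)).
have dotw : dot w = hsnorm w ^+ 2.
  by rewrite sqr_hsnorm; apply: eq_bigr => i _; apply: eq_bigr => j _; rewrite expr2.
pose z (t : R) := x + t *: v.
have zA (t : R) : 0 <= t <= 1 -> A (z t) by exact: cvA.
pose phi (t : R) : R := dot (f (z t)).
pose dphi (t : R) : R := dot (\sum_(k < p) v k 0 *: D (z t) k).
have zB s t : z s - z t = (s - t) *: v.
  by rewrite /z scalerBl; apply/matrixP => i j; rewrite !mxE; ring.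
have key (t e : R) : 0 <= t <= 1 -> 0 < e -> exists2 r : R, 0 < r &
    forall s, 0 <= s <= 1 -> `|s - t| < r -> `|phi s - phi t - (s - t) * dphi t| <= e * `|s - t|.
  move=> tI e0.
  have e1 : 0 < e / (hsnorm w * hsnorm v + 1).
    by rewrite divr_gt0 // ltr_wpDl // mulr_ge0.
  have [r r0 rP] := dA (z t) (zA t tI) _ e1.
  exists (r / hsnorm v) => [|s sI st]; first exact: divr_gt0.
  have h := rP (z s) (zA s sI); rewrite zB hsnormZ in h.
  have {}h := h (_ : `|s - t| * hsnorm v < r).
  have : `|s - t| * hsnorm v < r by rewrite -ltr_pdivlMr.
  move=> /h {}h.
  have -> : phi s - phi t - (s - t) * dphi t =
      dot (f (z s) - f (z t) - \sum_(k < p) ((s - t) *: v) k 0 *: D (z t) k).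
    rewrite !dotB /phi /dphi -dotZ; congr (_ - dot _).
    by rewrite scaler_sumr; apply: eq_bigr => k _; rewrite !mxE scalerA.
  apply: (le_trans (dot_le _)); apply: (le_trans (ler_wpM2l (hsnorm_ge0 w) h)).
  have wv : 0 < hsnorm w * hsnorm v + 1 by rewrite ltr_wpDl // mulr_ge0.
  have -> : hsnorm w * (e / (hsnorm w * hsnorm v + 1) * (`|s - t| * hsnorm v)) =
    e * `|s - t| * (hsnorm w * hsnorm v / (hsnorm w * hsnorm v + 1)).
    by field; rewrite gt_eqF.
  rewrite ler_piMr // ?mulr_ge0 // ?(ltW e0) // ler_pdivrMr // mul1r; lra.
have dphi_le (t : R) : 0 <= t <= 1 -> `|dphi t| <= hsnorm w * (L * hsnorm v).
  move=> tI; apply: (le_trans (dot_le _)); rewrite ler_wpM2l //.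
  by apply: bA; exact: zA.
have der (t : R) : t \in `]0, 1[ -> is_derive t 1 phi (dphi t).
  rewrite in_itv /= => /andP[t0 t1].
  have tI : 0 <= t <= 1 by rewrite !ltW.
  have lim1 : (fun h => h^-1 *: ((phi \o shift t) (h *: (1 : R^o)) - phi t)) @ 0^' --> dphi t.
    apply/cvgrPdist_le => e e0; have [r r0 rP] := key t e tI e0.
    have d0 : 0 < Num.min r (Num.min t (1 - t)) by rewrite !lt_min r0 t0 subr_gt0.
    near=> h.
    have h0 : h != 0 by near: h; exact: nbhs_dnbhs_neq.
    have hd : `|h| < Num.min r (Num.min t (1 - t)) by near: h; exact: dnbhs0_lt.
    move: hd; rewrite !lt_min => /and3P[hr ht ht1].
    have hh : h *: (1 : R^o) = h by rewrite /GRing.scale /= mulr1.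
    rewrite /= hh; have hn0 : 0 < `|h| by rewrite normr_gt0.
    have := rP (h + t) _ _; rewrite addrK => /(_ _ hr)/wrap[].
      by move: ht ht1; rewrite !ltr_norml; lra.
    rewrite [h^-1 *: _]/(h^-1 * (phi (h + t) - phi t)) => q.
    have -> : dphi t - h^-1 * (phi (h + t) - phi t) =
      - (h^-1 * (phi (h + t) - phi t - h * dphi t)) by field.
    by rewrite normrN normrM normfV ler_pdivrMl // [leRHS]mulrC.
  by apply: DeriveDef; [exact: cvgP lim1|exact: cvg_lim lim1].
(* At the endpoints differentiability relative to [A] still gives one-sided continuity. *)
have cont : {within `[0, 1], continuous phi}.
  apply/subspace_continuousP => t; rewrite /= in_itv /= => tI.
  apply/cvgrPdist_le => e e0; have [r r0 rP] := key t 1 tI ltr01.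
  have d0 : 0 < Num.min r (e / (1 + `|dphi t|)) by rewrite lt_min r0 divr_gt0 // ltr_pwDl.
  exists (Num.min r (e / (1 + `|dphi t|))) => //= s.
  rewrite /ball_ /= distrC lt_min => /andP[sr se] sI.
  have := rP s sI sr; rewrite mul1r => h.
  rewrite distrC -(subrK ((s - t) * dphi t) (phi s - phi t)).
  apply: (le_trans (ler_normD _ _)); rewrite normrM.
  move: se; rewrite ltr_pdivlMr ?ltr_pwDl // => /ltW; lra.
have [t t01] := MVT ltr01 der cont.
rewrite subr0 mulr1 => E.
have {}E : hsnorm w ^+ 2 = dphi t.
  have z1 : z 1 = y by rewrite /z scale1r /v addrC subrK.
  have z0 : z 0 = x by rewrite /z scale0r addr0.
  by rewrite -dotw -E /phi -dotB z1 z0.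
have tI : 0 <= t <= 1 by move: t01; rewrite in_itv /= => /andP[? ?]; rewrite !ltW.
have := dphi_le t tI; rewrite -E ger0_norm ?sqr_ge0 // expr2 -/v -/w.
have [->|w0] := eqVneq (hsnorm w) 0; first by rewrite mulr_ge0.
by rewrite ler_pM2l // lt_def w0 hsnorm_ge0.
Unshelve. all: by end_near. Qed.

End mean_value.

(** * Taylor remainders of the drift *)

Section taylor_remainder.
Context {R : realType} {r0 : R} {d p : nat}.
Local Notation C := (cpath r0 d).
Local Notation PC := (probability C R).
Variables (Theta : set 'cV[R]_p) (theta0 : 'cV[R]_p).
Variables (b : C -> PC -> 'cV[R]_p -> 'cV[R]_d) (gradb : C -> PC -> 'cV[R]_p -> 'M[R]_(d, p)).
Variable hessb : C -> PC -> 'cV[R]_p -> 'I_p -> 'M[R]_(p, d).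
Hypothesis r0_gt0 : 0 < r0.
Hypothesis cvTheta : convex_set (Theta : set (convex_lmodType 'cV[R]_p)).
Hypothesis Theta0 : Theta theta0.
Hypothesis derb : theta_derivatives Theta b gradb hessb.
Variable K2 : R.
Hypothesis K2_ge0 : 0 <= K2.
Hypothesis B2 : forall (x y : C) (mu nu : PC), finite_moment2 mu -> finite_moment2 nu ->
  forall theta, closure Theta theta ->
  block_norm (fun k => hessb x mu theta k - hessb y nu theta k) <= K2 * (path_dist x y + W2 mu nu).

Lemma sum_scale_col a (M : 'M[R]_(a, p)) (v : 'cV[R]_p) :
  \sum_(k < p) v k 0 *: col k M = M *m v.
Proof.
apply/matrixP => i j; rewrite summxE mxE; apply: eq_bigr => k _.
by rewrite !mxE ord1 mulrC.
Qed.

Lemma block_norm_sum a c (E : 'I_p -> 'M[R]_(a, c)) (v : 'cV[R]_p) :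
  hsnorm (\sum_(k < p) v k 0 *: E k) <= block_norm E * hsnorm v.
Proof.
apply: (le_trans (hsnorm_sum _ _ _)).
under eq_bigr do rewrite hsnormZ.
have b0 : 0 <= block_norm E by exact: sqrtr_ge0.
have s0 : 0 <= \sum_(k < p) `|v k 0| * hsnorm (E k).
  by apply: sumr_ge0 => k _; exact: mulr_ge0.
rewrite -(@ler_pXn2r _ 2) ?nnegrE ?mulr_ge0 // exprMn.
apply: (le_trans (sum_cauchy_schwarz _ _)); rewrite mulrC.
rewrite /block_norm sqr_sqrtr; last by apply: sumr_ge0 => k _; exact: sqr_ge0.
rewrite ler_wpM2l //; first by apply: sumr_ge0 => k _; exact: sqr_ge0.
rewrite sqr_hsnorm; apply: ler_sum => k _.
by rewrite big_ord1 real_normK ?num_real.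
Qed.

Lemma closure_theta0 : closure Theta theta0.
Proof. exact: subset_closure. Qed.

Lemma diff_within_cst a c (A : set 'cV[R]_p) (M : 'M[R]_(a, c)) (x : 'cV[R]_p) :
  diff_within A (fun=> M) x (fun=> 0).
Proof.
move=> e e0; exists 1 => // y _ _; rewrite subrr sub0r hsnormN big1.
  by rewrite hsnorm0 mulr_ge0 // ltW.
by move=> k _; rewrite scaler0.
Qed.

Lemma diff_within_linear a (A : set 'cV[R]_p) (M : 'M[R]_(a, p)) (x z : 'cV[R]_p) :
  diff_within A (fun y => M *m (y - z)) x (fun k => col k M).
Proof.
move=> e e0; exists 1 => // y _ _; rewrite sum_scale_col -!mulmxBr.
by rewrite opprB addrA subrK subrr mulmx0 hsnorm0 mulr_ge0 // ltW.
Qed.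

Definition rem (x : C) (mu : PC) (theta : 'cV[R]_p) : 'cV[R]_d :=
  b x mu theta - b x mu theta0 - gradb x mu theta0 *m (theta - theta0).

Lemma rem0 x mu : rem x mu theta0 = 0.
Proof. by rewrite /rem !subrr mulmx0 subr0. Qed.

Section two_points.
Variables (x y : C) (mu nu : PC).
Hypotheses (fmu : finite_moment2 mu) (fnu : finite_moment2 nu).

Let kap := path_dist x y + W2 mu nu.

Let kap_ge0 : 0 <= kap.
Proof. by rewrite addr_ge0 ?path_dist_ge0 ?W2_ge0. Qed.

(** (B2) bounds the difference of the two Hessians, not each of them; so the mean value inequality
    is applied to the difference of the gradients at two points of path space. *)
Lemma gradb_diff_lip theta theta' : closure Theta theta -> closure Theta theta' ->
  hsnorm (gradb x mu theta - gradb y nu theta - (gradb x mu theta' - gradb y nu theta'))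
    <= K2 * kap * hsnorm (theta - theta').
Proof.
move=> ct ct'.
have := @mean_value_ineq _ _ _ _ (closure Theta)
  (fun th => (gradb x mu th)^T - (gradb y nu th)^T)
  (fun th k => hessb x mu th k - hessb y nu th k) (K2 * kap).
rewrite mulr_ge0 // => /(_ isT).
move=> /(_ _)/wrap[]; first by move=> u v t cu cv tI; exact: closure_segment.
move=> /(_ _)/wrap[].
  move=> th cth; apply: diff_withinB; apply: has_partials_diff.
    by have [] := derb x fmu cth.
  by have [] := derb y fnu cth.
move=> /(_ _)/wrap[].
  move=> th v cth; apply: (le_trans (block_norm_sum _ _)).
  by apply: ler_wpM2r => //; exact: B2.
move=> /(_ _ _ ct' ct).
by rewrite -!linearB /= hsnorm_tr.
Qed.

(** The derivative of the difference of remainders is the difference of gradients recentred at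
    [theta0], of size [K2 * kap * rho] by [gradb_diff_lip]. The ball of radius [rho] intersected
    with the closure of [Theta] is convex, as the mean value inequality demands. *)
Lemma rem_diff_lip theta theta' (rho : R) :
  closure Theta theta -> closure Theta theta' ->
  hsnorm (theta - theta0) <= rho -> hsnorm (theta' - theta0) <= rho ->
  hsnorm (rem x mu theta - rem y nu theta - (rem x mu theta' - rem y nu theta'))
    <= K2 * kap * rho * hsnorm (theta - theta').
Proof.
move=> ct ct' tr tr'.
have rho0 : 0 <= rho := le_trans (hsnorm_ge0 _) tr.
pose A := closure Theta `&` [set th | hsnorm (th - theta0) <= rho].
pose G th := gradb x mu th - gradb y nu th - (gradb x mu theta0 - gradb y nu theta0).
have := @mean_value_ineq _ _ _ _ A (fun th => rem x mu th - rem y nu th)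
  (fun th k => (col k (gradb x mu th) - 0 - col k (gradb x mu theta0))
    - (col k (gradb y nu th) - 0 - col k (gradb y nu theta0))) (K2 * kap * rho).
rewrite !mulr_ge0 // => /(_ isT).
move=> /(_ _)/wrap[].
  move=> u v t [cu ur] [cv vr] /andP[t0 t1]; split.
    by apply: closure_segment => //; rewrite t0.
  rewrite /=; have -> : u + t *: (v - u) - theta0 = (1 - t) *: (u - theta0) + t *: (v - theta0).
    by apply/matrixP => i j; rewrite !mxE; ring.
  apply: (le_trans (hsnormD _ _)); rewrite !hsnormZ.
  rewrite ger0_norm ?subr_ge0 // ger0_norm //.
  by move: ur vr => /= ur vr; nra.
move=> /(_ _)/wrap[].
  have dr (z : C) (ka : PC) th : finite_moment2 ka -> A th ->
      diff_within A (rem z ka) th (fun k => col k (gradb z ka th) - 0 - col k (gradb z ka theta0)).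
    move=> fka [cth _]; apply: diff_withinB; last exact: diff_within_linear.
    apply: diff_withinB; last exact: diff_within_cst.
    apply: (@diff_withinS _ _ _ _ _ (closure Theta)); first by move=> ? [].
    by apply: has_partials_diff; have [] := derb z fka cth.
  by move=> th Ath; apply: diff_withinB; exact: dr.
move=> /(_ _)/wrap[].
  move=> th v [cth thr].
  have -> : \sum_(k < p) v k 0 *: ((col k (gradb x mu th) - 0 - col k (gradb x mu theta0))
      - (col k (gradb y nu th) - 0 - col k (gradb y nu theta0))) = G th *m v.
    rewrite -sum_scale_col; apply: eq_bigr => k _; congr (_ *: _).
    by apply/matrixP => i j; rewrite !mxE; ring.
  apply: (le_trans (hsnormM _ _)); apply: ler_wpM2r => //.
  apply: (le_trans (gradb_diff_lip cth closure_theta0)).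
  by apply: ler_wpM2l => //; exact: mulr_ge0.
by move=> /(_ theta' theta); apply.
Qed.

(* The difference of two remainders, divided by [|theta - theta0|], is still
   Lipschitz in theta (the value at theta0 is 0). *)
Definition nrem theta : 'cV[R]_d :=
  (hsnorm (theta - theta0))^-1 *: (rem x mu theta - rem y nu theta).

Lemma nremE theta :
  rem x mu theta - rem y nu theta = hsnorm (theta - theta0) *: nrem theta.
Proof.
rewrite /nrem; have [->|h] := eqVneq theta theta0.
  by rewrite !rem0 !subrr !scaler0.
by rewrite scalerA divff ?scale1r // hsnorm_eq0 subr_eq0.
Qed.

Lemma rem_diff_le theta : closure Theta theta ->
  hsnorm (rem x mu theta - rem y nu theta) <= K2 * kap * hsnorm (theta - theta0) ^+ 2.
Proof.
move=> ct; have h0 : hsnorm (theta0 - theta0) <= hsnorm (theta - theta0).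
  by rewrite subrr hsnorm0.
have := rem_diff_lip ct closure_theta0 (lexx _) h0.
by rewrite !rem0 !subrr !subr0 expr2 mulrA.
Qed.

Lemma nrem_le theta : closure Theta theta ->
  hsnorm (nrem theta) <= K2 * kap * hsnorm (theta - theta0).
Proof.
move=> ct; have [->|h] := eqVneq theta theta0.
  by rewrite /nrem !rem0 !subrr scaler0 !hsnorm0 mulr0.
have h0 : 0 < hsnorm (theta - theta0) by rewrite hsnorm_gt0 subr_eq0.
have := rem_diff_le ct; rewrite nremE hsnormZ ger0_norm // expr2 mulrCA.
by rewrite ler_pM2l.
Qed.

(** One constant [K2 * kap] comes from the variation of the numerator, the other from that of the
    denominator. Taking [theta] farther from [theta0] lets its distance dominate both remainder
    bounds and cancel the division. *)
Lemma nrem_lip theta theta' : closure Theta theta -> closure Theta theta' ->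
  hsnorm (nrem theta - nrem theta') <= 2 * (K2 * kap) * hsnorm (theta - theta').
Proof.
wlog le : theta theta' / hsnorm (theta' - theta0) <= hsnorm (theta - theta0).
  move=> h ct ct'.
  have /orP[?|?] := le_total (hsnorm (theta' - theta0)) (hsnorm (theta - theta0)).
    exact: h.
  by rewrite hsnormBC (hsnormBC theta); exact: h.
move=> ct ct'.
have kk : 0 <= K2 * kap by exact: mulr_ge0.
have [e|tn] := eqVneq theta theta0.
  have e' : theta' = theta0.
    apply/eqP; rewrite -subr_eq0 -hsnorm_eq0 eq_le hsnorm_ge0 andbT.
    by apply: (le_trans le); rewrite e subrr hsnorm0.
  by rewrite e e' subrr hsnorm0 subrr hsnorm0 mulr0.
have h0 : 0 < hsnorm (theta - theta0) by rewrite hsnorm_gt0 subr_eq0.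
have tri : `|hsnorm (theta - theta0) - hsnorm (theta' - theta0)| <= hsnorm (theta - theta').
  apply: (le_trans (hsnorm_distB _ _)).
  by rewrite opprB addrA subrK.
have h1 := rem_diff_lip ct ct' (lexx _) le.
have h2 := nrem_le ct'.
move: tri h1 h2 le h0; rewrite /nrem.
set q := rem x mu theta - _; set s := hsnorm (theta - theta0).
set s' := hsnorm (theta' - theta0); set D := hsnorm (theta - theta').
rewrite -/(nrem theta') => tri h1 h2 le h0.
have D0 : 0 <= D by exact: hsnorm_ge0.
have -> : s^-1 *: q - nrem theta' = s^-1 *: (q - s' *: nrem theta' + (s' - s) *: nrem theta').
  have ns : nrem theta' = s^-1 *: (s *: nrem theta').
    by rewrite scalerA mulVf ?gt_eqF // scale1r.
  by rewrite [in LHS]ns -scalerBr scalerBl addrA subrK.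
rewrite hsnormZ normfV (gtr0_norm h0) ler_pdivrMl //.
apply: (le_trans (hsnormD _ _)).
rewrite -nremE hsnormZ distrC.
have := ler_pM (normr_ge0 (s - s')) (hsnorm_ge0 (nrem theta')) tri h2.
have : D * (K2 * kap * s') <= D * (K2 * kap * s).
  by rewrite ler_wpM2l // ler_wpM2l.
move: h1; lra.
Qed.

End two_points.

(** The radius depends on the point of path space; uniformity along the limit path is recovered
    later by comparing all segments with the initial one. *)
Lemma rem_small (x : C) (mu : PC) : finite_moment2 mu ->
  forall e : R, 0 < e -> exists2 r : R, 0 < r & forall theta, closure Theta theta ->
    hsnorm (theta - theta0) < r -> hsnorm (rem x mu theta) <= e * hsnorm (theta - theta0).
Proof.
move=> fmu e e0; have [h _] := derb x fmu closure_theta0.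
have [r r0' rP] := has_partials_diff h e0; exists r => // theta ct tr.
by have := rP theta ct tr; rewrite sum_scale_col.
Qed.

Lemma b_theta_continuous (x : C) (mu : PC) theta : finite_moment2 mu ->
  closure Theta theta -> forall e : R, 0 < e -> exists2 r : R, 0 < r &
    forall theta', closure Theta theta' -> hsnorm (theta' - theta) < r ->
      hsnorm (b x mu theta' - b x mu theta) <= e.
Proof.
move=> fmu ct e e0; have [/has_partials_diff/(_ _ ltr01)[r r0' rP] _] := derb x fmu ct.
pose L := 1 + hsnorm (gradb x mu theta).
have L0 : 0 < L by rewrite ltr_pwDl.
exists (Num.min r (e / L)); first by rewrite lt_min r0' divr_gt0.
move=> theta' ct'; rewrite lt_min => /andP[h1 h2].
have := rP _ ct' h1; rewrite sum_scale_col mul1r => h.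
apply: (le_trans (hsnorm_sub_le _ (gradb x mu theta *m (theta' - theta)))).
have h3 := hsnormM (gradb x mu theta) (theta' - theta).
move: h2; rewrite ltr_pdivlMr // /L => h2.
by move: h h3; lra.
Qed.

(** Near [theta0] differentiability gives the linear bound; elsewhere [b] is locally bounded in
    [theta] while the distance to [theta0] is bounded below. Compactness joins the two. *)
Lemma rem_bound (x : C) (mu : PC) : bounded_set Theta -> finite_moment2 mu ->
  exists2 c : R, 0 < c & forall theta, closure Theta theta ->
    hsnorm (rem x mu theta) <= c * hsnorm (theta - theta0).
Proof.
move=> bT fmu.
have [|N NP] := @compact_uniform R p (closure Theta) (fun n theta => closure Theta theta ->
  hsnorm (rem x mu theta) <= n%:R * hsnorm (theta - theta0)) (closed_bounded_compact bT).
  move=> theta ct; have [->|tn] := eqVneq theta theta0.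
    have [r r0' rP] := rem_small x fmu ltr01.
    exists r, 1%N; split=> // n th n1 thr cth.
    apply: (le_trans (rP th cth thr)).
    by rewrite ler_wpM2r // ler1n.
  have h0 : 0 < hsnorm (theta - theta0) by rewrite hsnorm_gt0 subr_eq0.
  have [r r0' rP] := b_theta_continuous x fmu ct ltr01.
  pose s := hsnorm (theta - theta0) / 2.
  have s0 : 0 < s by rewrite divr_gt0.
  pose G := hsnorm (gradb x mu theta0).
  have G0 : 0 <= G by exact: hsnorm_ge0.
  pose M := (1 + hsnorm (b x mu theta - b x mu theta0)) / s + G.
  have M0 : 0 <= M by rewrite addr_ge0 // divr_ge0 ?(ltW s0) // addr_ge0.
  exists (Num.min r s), (Num.truncn M).+1; split; first by rewrite lt_min r0'.
  move=> n th nM; rewrite lt_min => /andP[thr ths] cth.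
  have /andP[_ /ltW Mt] := truncn_itv M0.
  have Mn : M <= n%:R by rewrite (le_trans Mt) // ler_nat.
  have sth : s <= hsnorm (th - theta0).
    by have := hsnorm_triB theta th theta0; rewrite (hsnormBC theta th) /s in ths *; lra.
  have h1 := rP th cth thr.
  have h2 := hsnorm_triB (b x mu th) (b x mu theta) (b x mu theta0).
  have h3 := hsnormM (gradb x mu theta0) (th - theta0).
  apply: (le_trans (hsnormB _ _)).
  apply: (@le_trans _ _ (M * hsnorm (th - theta0))); last by rewrite ler_wpM2r.
  rewrite /M mulrDl; apply: lerD => //.
  apply: (@le_trans _ _ ((1 + hsnorm (b x mu theta - b x mu theta0)) / s * s)).
    by rewrite divfK ?gt_eqF //; lra.
  by rewrite ler_wpM2l // divr_ge0 ?(ltW s0) // addr_ge0.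
exists N.+1%:R; first by rewrite ltr0n.
by move=> theta ct; exact: NP.
Qed.

End taylor_remainder.

(** * Riemann sums and the limit path *)

Section riemann_sums.
Context {R : realType} (T : R) (g : R -> R).
Hypothesis cg : {within `[0, T], continuous g}.
Local Notation mu := (@lebesgue_measure R).

Lemma continuous_integrable (s t : R) : 0 <= s -> t <= T ->
  mu.-integrable `[s, t] (EFin \o g).
Proof.
move=> s0 tT; apply: continuous_compact_integrable; first exact: segment_compact.
apply: continuous_subspaceW cg => x /=; rewrite !in_itv /= => /andP[sx xt].
by rewrite (le_trans s0) // (le_trans xt).
Qed.

Lemma integral_increment (s t a tau : R) : 0 <= s -> s <= t -> t <= T ->
  (forall u, s <= u <= t -> `|g u - a| <= tau) ->
  `|\int[mu]_(u in `[0, t]) g u - \int[mu]_(u in `[0, s]) g u - a * (t - s)|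
    <= tau * (t - s).
Proof.
move=> s0 st tT ga; have t0 : 0 <= t := le_trans s0 st.
have ig := continuous_integrable (lexx 0) tT.
have ist := continuous_integrable s0 tT.
rewrite (Rintegral_itvB ig) ?bnd_simp // (Rintegral_itv_obnd_cbnd); last first.
  by apply: integrableS ist => //; apply: subset_itv; rewrite bnd_simp.
have mlen : fine (mu `[s, t]) = t - s.
  rewrite lebesgue_measure_itv /= lte_fin; have [h|h] := ltP s t => //=.
  by apply/esym/eqP; rewrite subr_eq0 eq_le st h.
have iac c : mu.-integrable `[s, t] (EFin \o cst c).
  apply: continuous_compact_integrable; first exact: segment_compact.
  by apply: continuous_subspaceT => x; exact: cvg_cst.
have -> : a * (t - s) = \int[mu]_(u in `[s, t]) a by rewrite Rintegral_cst // mlen.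
rewrite -RintegralB //; last exact: (iac a).
have iB : mu.-integrable `[s, t] (EFin \o (fun u => g u - a)).
  by apply: (@integrableB _ _ _ mu `[s, t]%classic _ (EFin \o g) (EFin \o cst a)).
apply: (le_trans (le_normr_Rintegral _ iB)) => //.
have -> : tau * (t - s) = \int[mu]_(u in `[s, t]) tau by rewrite Rintegral_cst // mlen.
apply: le_Rintegral => //.
- exact: (integrable_norm iB).
- exact: (iac tau).
Qed.

(** The numbers [a k] are arbitrary approximations of [g] on the k-th cell, such as coefficients of
    the scheme, so that the discretization error and the error of the scheme are handled
    together. *)
Lemma riemann_sum_bound (delta : R) (n : nat) (a tau : nat -> R) : 0 < delta ->
  n%:R * delta <= T ->
  (forall k u, (k < n)%N -> k%:R * delta <= u <= k.+1%:R * delta -> `|g u - a k| <= tau k) ->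
  forall j, (j <= n)%N ->
  `|\int[mu]_(u in `[0, j%:R * delta]) g u - delta * \sum_(k < j) a k|
    <= delta * \sum_(k < j) tau k.
Proof.
move=> d0 nT ga; elim=> [|j ih] jn.
  by rewrite !big_ord0 !mulr0 mul0r set_itv1 Rintegral_set1 subrr normr0.
have j0 : 0 <= j%:R * delta by rewrite mulr_ge0 // ltW.
have jS : j%:R * delta <= j.+1%:R * delta by rewrite ler_pM2r // ler_nat.
have jT : j.+1%:R * delta <= T by apply: le_trans _ nT; rewrite ler_pM2r // ler_nat.
have := integral_increment j0 jS jT (fun u => ga j u jn).
have -> : j.+1%:R * delta - j%:R * delta = delta.
  by rewrite -mulrBl -natrB ?leqnSn // subSnn mul1r.
rewrite !big_ord_recr /= => h1; have h2 := ih (ltnW jn).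
move: h1 h2; rewrite !mulrDr !ler_norml; lra.
Qed.

End riemann_sums.

Section lipschitz_on.
Context {R : realType} (T : R).

Definition lip_on a c (g : R -> 'M[R]_(a, c)) : Prop :=
  exists2 L : R, 0 <= L & forall s t, 0 <= s <= T -> 0 <= t <= T ->
    hsnorm (g s - g t) <= L * `|s - t|.

Lemma lip_on_cst a c (M : 'M[R]_(a, c)) : lip_on (fun=> M).
Proof. by exists 0 => // s t _ _; rewrite subrr hsnorm0 mul0r. Qed.

Lemma lip_onB a c (f g : R -> 'M[R]_(a, c)) :
  lip_on f -> lip_on g -> lip_on (fun t => f t - g t).
Proof.
move=> [L L0 fL] [K K0 gK]; exists (L + K); first exact: addr_ge0.
move=> s t sT tT.
have -> : f s - g s - (f t - g t) = (f s - f t) - (g s - g t).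
  by rewrite !opprB addrACA [RHS]addrACA; congr (_ + _); rewrite addrC.
rewrite mulrDl; apply: (le_trans (hsnormB _ _)).
by apply: lerD; [exact: fL|exact: gK].
Qed.

Lemma lip_onT a c (f : R -> 'M[R]_(a, c)) : lip_on f -> lip_on (fun t => (f t)^T).
Proof.
move=> [L L0 fL]; exists L => // s t sT tT.
by rewrite -linearB /= hsnorm_tr; exact: fL.
Qed.

Lemma lip_on_bounded a c (f : R -> 'M[R]_(a, c)) : 0 <= T -> lip_on f ->
  exists2 K : R, 0 <= K & forall t, 0 <= t <= T -> hsnorm (f t) <= K.
Proof.
move=> T0 [L L0 fL]; exists (L * T + hsnorm (f 0)).
  by rewrite addr_ge0 // mulr_ge0.
move=> t tT; apply: (le_trans (hsnorm_sub_le _ (f 0))); rewrite lerD2r.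
apply: (le_trans (fL t 0 tT _)); first by rewrite lexx.
by case/andP: tT => t0 tT; rewrite subr0 ger0_norm // ler_wpM2l.
Qed.

Lemma lip_onM a b c (f : R -> 'M[R]_(a, b)) (g : R -> 'M[R]_(b, c)) : 0 <= T ->
  lip_on f -> lip_on g -> lip_on (fun t => f t *m g t).
Proof.
move=> T0 lf lg; have [F F0 fF] := lip_on_bounded T0 lf.
have [G G0 gG] := lip_on_bounded T0 lg.
have [L L0 fL] := lf; have [K K0 gK] := lg.
exists (L * G + F * K); first by rewrite addr_ge0 // mulr_ge0.
move=> s t sT tT.
have -> : f s *m g s - f t *m g t = (f s - f t) *m g s + f t *m (g s - g t).
  by rewrite mulmxBl mulmxBr addrA subrK.
apply: (le_trans (hsnormD _ _)); rewrite mulrDl; apply: lerD.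
  apply: (le_trans (hsnormM _ _)); rewrite mulrAC.
  by apply: ler_pM => //; [exact: fL|exact: gG].
apply: (le_trans (hsnormM _ _)); rewrite -mulrA.
by apply: ler_pM => //; [exact: fF|exact: gK].
Qed.

Lemma lip_on_continuous a c (f : R -> 'M[R]_(a, c)) i j : lip_on f ->
  {within `[0, T], continuous (fun t => f t i j)}.
Proof.
move=> [L L0 fL]; apply/subspace_continuousP => t; rewrite /= in_itv /= => tT.
apply/cvgrPdist_le => e e0.
have d0 : 0 < e / (L + 1) by rewrite divr_gt0 // ltr_wpDl.
exists (e / (L + 1)) => //= s; rewrite /ball_ /= => st; rewrite in_itv /= => sT.
have := hsnorm_entry (f t - f s) i j; rewrite !mxE => /le_trans; apply.
apply: (le_trans (fL t s tT sT)).
move: st; rewrite ltr_pdivlMr ?ltr_wpDl // => /ltW.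
by have := normr_ge0 (t - s); nra.
Qed.

End lipschitz_on.

(** * Coefficients along the limit path *)

Section coefficients.
Context {R : realType} {r0 : R} {d : nat}.
Hypothesis r0_gt0 : 0 < r0.
Local Notation C := (cpath r0 d).
Local Notation PC := (probability C R).

Definition lip_coef a c (f : C -> PC -> 'M[R]_(a, c)) (L : R) : Prop :=
  forall x y mu nu, finite_moment2 mu -> finite_moment2 nu ->
    hsnorm (f x mu - f y nu) <= L * (path_dist x y + W2 mu nu).

(** Converts the squared form of (A1) into the linear Lipschitz form [lip_coef] shared by all
    coefficients. *)
Lemma sqr_le_sum_lip (z x y a b : R) : 0 <= z -> 0 <= x -> 0 <= y -> 0 <= a -> 0 <= b ->
  z ^+ 2 <= a * x ^+ 2 + b * y ^+ 2 -> z <= (Num.sqrt a + Num.sqrt b) * (x + y).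
Proof.
move=> z0 x0 y0 a0 b0 h; have sa := sqrtr_ge0 a; have sb := sqrtr_ge0 b.
rewrite -(@ler_pXn2r _ 2) ?nnegrE ?mulr_ge0 ?addr_ge0 //.
apply: (le_trans h).
have -> : a = Num.sqrt a ^+ 2 by rewrite sqr_sqrtr.
have -> : b = Num.sqrt b ^+ 2 by rewrite sqr_sqrtr.
rewrite !sqrtr_sqr !ger0_norm //.
set u := Num.sqrt a in sa *; set v := Num.sqrt b in sb *.
have -> : (u + v) * (x + y) = u * x + v * y + (u * y + v * x) by ring.
have h1 : 0 <= u * y + v * x by rewrite addr_ge0 // mulr_ge0.
have h2 : 0 <= u * x by rewrite mulr_ge0.
have h3 : 0 <= v * y by rewrite mulr_ge0.
rewrite -!exprMn; move: (u * x) (v * y) (u * y + v * x) h1 h2 h3 => A B E h1 h2 h3.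
by nra.
Qed.

Section along_path.
Variables (T L : R) (X0 : R -> 'cV[R]_d).
Hypothesis cX0 : {within `[- r0, T], continuous X0}.
Hypothesis T_gt0 : 0 < T.
Local Notation seg := (segment r0 X0).

Lemma dirac_coef a c (f : C -> PC -> 'M[R]_(a, c)) (x y : C) : 0 <= L -> lip_coef f L ->
  hsnorm (f x (dirac_law x) - f y (dirac_law y)) <= 2 * L * path_dist x y.
Proof.
move=> L0 fL.
have := fL x y _ _ (finite_moment2_dirac r0_gt0 x) (finite_moment2_dirac r0_gt0 y).
move=> /le_trans; apply; rewrite -mulrA mulrCA ler_wpM2l //.
by have := W2_dirac r0_gt0 x y; lra.
Qed.

Lemma uniform_continuity (e : R) : 0 < e -> exists2 r : R, 0 < r & forall s t,
  - r0 <= s <= T -> - r0 <= t <= T -> `|s - t| <= r -> hsnorm (X0 s - X0 t) <= e.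
Proof.
move=> e0.
have /compact_near_coveringP := @segment_compact R (- r0) T.
move=> /(_ nat \oo (fun n s => - r0 <= s <= T -> forall t, - r0 <= t <= T ->
  `|s - t| <= n.+1%:R^-1 -> hsnorm (X0 s - X0 t) <= e) _)[].
  move=> x; rewrite /= in_itv /= => xI.
  have /subspace_continuousP/(_ x) := cX0; rewrite /= in_itv /= => /(_ xI).
  have e1 : 0 < e / 2 / ((d * 1)%:R + 1) by rewrite !divr_gt0 // ltr_wpDl.
  move=> /cvgrPdist_lt/(_ _ e1)[r /= r0' rP].
  have close u : - r0 <= u <= T -> `|x - u| < r -> hsnorm (X0 x - X0 u) <= e / 2.
    move=> uI xu; apply: (le_trans (hsnorm_le_mx_norm _)).
    have := rP u xu; rewrite /= in_itv => /(_ uI) /ltW.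
    rewrite ler_pdivlMr ?ltr_wpDl // /from_subspace /=.
    by have := normr_ge0 (X0 x - X0 u); lra.
  have r2 : 0 < r / 2 by rewrite divr_gt0.
  exists ([set s | `|x - s| < r / 2], [set n | (Num.truncn (2 / r) <= n)%N]).
    split; last by exists (Num.truncn (2 / r)).
    by exists (r / 2) => //=.
  move=> [s n] /= [xs nr] sI t tI st.
  have nP : n.+1%:R^-1 < r / 2.
    have h0 : 0 <= 2 / r by rewrite divr_ge0 // ltW.
    have /andP[_ h] := truncn_itv h0.
    rewrite -[ltRHS]invf_div ltf_pV2 ?posrE ?divr_gt0 ?ltr0n //.
    by rewrite (lt_le_trans h) // ler_nat.
  have xt : `|x - t| < r.
    rewrite -(subrKA s); apply: (le_lt_trans (ler_normD _ _)).
    by rewrite [X in _ < X]splitr; apply: ltrD => //; exact: le_lt_trans nP.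
  have xs' : `|x - s| < r by rewrite (lt_trans xs) // ltr_pdivrMr // ltr_pMr // ltr1n.
  apply: (le_trans (hsnorm_triB _ (X0 x) _)).
  by rewrite hsnormBC [X in _ <= X]splitr; apply: lerD; exact: close.
move=> N _ NP; exists N.+1%:R^-1; first by rewrite invr_gt0 ltr0n.
move=> s t sI tI st; by apply: (NP N) => //=; rewrite ?in_itv.
Qed.

Lemma segment_dist_le s t (e : R) : 0 <= s <= T -> 0 <= t <= T ->
  (forall u, - r0 <= u <= 0 -> hsnorm (X0 (s + u) - X0 (t + u)) <= e) ->
  path_dist (seg s) (seg t) <= e.
Proof.
move=> sT tT h; apply: path_dist_le => // u uI.
have e1 := segmentE cX0 sT uI.
have e2 := segmentE cX0 tT uI.
by have := h u uI; rewrite -e1 -e2.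
Qed.

Lemma shift_in s u : 0 <= s <= T -> - r0 <= u <= 0 -> - r0 <= s + u <= T.
Proof. by move=> /andP[? ?] /andP[? ?]; apply/andP; split; lra. Qed.

Lemma along_path_continuous a c (f : C -> PC -> 'M[R]_(a, c)) : 0 <= L -> lip_coef f L ->
  {within `[0, T], continuous (fun t => f (seg t) (dirac_law (seg t)))}.
Proof.
move=> L0 fL; apply/subspace_continuousP => t; rewrite /= in_itv /= => tT.
apply/cvgrPdist_le => e e0.
have e1 : 0 < e / (2 * L + 1) by rewrite divr_gt0 // ltr_wpDl // mulr_ge0.
have [r r_gt0 rP] := uniform_continuity e1.
exists r => //= s; rewrite /ball_ /= => st; rewrite in_itv /= => sT.
apply: (le_trans (le_mx_norm_hsnorm _)).
apply: (le_trans (dirac_coef _ _ L0 fL)).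
have : path_dist (seg t) (seg s) <= e / (2 * L + 1).
  apply: segment_dist_le => // u uI; apply: rP; try exact: shift_in.
  by rewrite opprD addrACA subrr addr0 ltW.
rewrite ler_pdivlMr; last by rewrite ltr_wpDl // mulr_ge0.
by have := path_dist_ge0 r0_gt0 (seg t) (seg s); lra.
Qed.

Lemma entry_continuous_within a c (A : set R) (f : R -> 'M[R]_(a, c)) i j :
  {within A, continuous f} -> {within A, continuous (fun s => f s i j)}.
Proof.
move=> /subspace_continuousP cf; apply/subspace_continuousP => t At.
apply/cvgrPdist_lt => e e0; have /cvgrPdist_lt/(_ e e0) := cf t At.
apply: filterS => s; apply: le_lt_trans.
by have := entry_le_mx_norm (f t - f s) i j; rewrite !mxE.
Qed.

End along_path.

(** Before 0 this is (A3); after 0 the drift is continuous along the path, hence bounded by some [M]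
    on [[0, T]]. The integral is estimated entry by entry, whence the factor [d], and the two
    regimes are glued at 0. *)
Lemma limit_ode_lipschitz p (b : C -> PC -> 'cV[R]_p -> 'cV[R]_d) (theta0 : 'cV[R]_p)
    (xi : C) (T L : R) (X0 : R -> 'cV[R]_d) : 0 < T -> 0 <= L ->
  lip_coef (fun x mu => b x mu theta0) L -> condA3 xi -> limit_ode b theta0 xi T X0 ->
  exists2 K : R, 0 <= K & forall s t, - r0 <= s <= T -> - r0 <= t <= T ->
    hsnorm (X0 s - X0 t) <= K * `|s - t|.
Proof.
move=> T0 L0 bL [L2 L20 xiL] [cX0 X0xi X0E].
pose f t := b (segment r0 X0 t) (dirac_law (segment r0 X0 t)) theta0.
have cf : {within `[0, T], continuous f} := along_path_continuous cX0 L0 bL.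
have [c _ fc] := EVT_max (ltW T0) (hsnorm_continuous_within cf).
pose M := hsnorm (f c); have M0 : 0 <= M by exact: hsnorm_ge0.
have fM t : 0 <= t <= T -> hsnorm (f t) <= M by move=> tT; apply: fc; rewrite in_itv.
pose K := L2 + d%:R * M.
have K0 : 0 <= K by rewrite addr_ge0 ?(ltW L20) // mulr_ge0.
have dM : 0 <= d%:R * M by rewrite mulr_ge0.
have pos (s t : R) : 0 <= s -> s <= t -> t <= T -> hsnorm (X0 s - X0 t) <= K * (t - s).
  move=> s0 st tT; apply: (@le_trans _ _ (d%:R * M * (t - s))); last first.
    by rewrite ler_wpM2r ?subr_ge0 // lerDr ltW.
  apply: (le_trans (hsnorm_le_sum _)).
  have -> : d%:R * M * (t - s) = \sum_(i < d) M * (t - s).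
    by rewrite sumr_const card_ord -mulrA mulr_natl.
  apply: ler_sum => i _; rewrite big_ord1.
  have t0 := le_trans s0 st; have sT := le_trans st tT.
  rewrite (X0E s) ?s0 // (X0E t) ?t0 // !mxE opprD addrACA subrr add0r distrC.
  have := @integral_increment R T (fun u => f u i 0) (entry_continuous_within cf) s t 0 M s0 st tT.
  rewrite mul0r subr0; apply=> u /andP[su ut].
  rewrite subr0; apply: (le_trans (hsnorm_entry _ _ _)); apply: fM.
  by rewrite (le_trans s0) // (le_trans ut).
have main (s t : R) : - r0 <= s -> s <= t -> t <= T -> hsnorm (X0 s - X0 t) <= K * (t - s).
  move=> rs st tT; have [t0|t0] := leP t 0.
    rewrite !X0xi ?rs ?(le_trans st) ?(le_trans rs st) //.
    rewrite hsnormBC in xiL *.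
    have := xiL s t; rewrite rs (le_trans st t0) (le_trans rs st) t0 => /(_ isT isT).
    rewrite ger0_norm ?subr_ge0 // => /le_trans; apply.
    by rewrite ler_wpM2r ?subr_ge0 // lerDl.
  have [s0|s0] := leP 0 s; first exact: pos.
  apply: (le_trans (hsnorm_triB _ (X0 0) _)).
  have h1 : hsnorm (X0 s - X0 0) <= K * (0 - s).
    rewrite !X0xi ?rs ?(ltW s0) ?lexx ?oppr_le0 ?(ltW r0_gt0) // hsnormBC.
    have := xiL s 0; rewrite rs (ltW s0) lexx oppr_le0 (ltW r0_gt0) => /(_ isT isT).
    rewrite ger0_norm ?subr_ge0 ?(ltW s0) // => /le_trans; apply.
    by rewrite ler_wpM2r ?subr_ge0 ?(ltW s0) // lerDl.
  have := pos 0 t (lexx 0) (ltW t0) tT; lra.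
exists K => // s t /andP[s1 s2] /andP[t1 t2].
have /orP[st|ts] := le_total s t.
  by rewrite distrC ger0_norm ?subr_ge0 //; exact: main.
by rewrite hsnormBC ger0_norm ?subr_ge0 //; exact: main.
Qed.

End coefficients.

(** * Error of the Euler scheme *)

Section discrete_gronwall.
Context {R : realType}.

(** The induction carries a bound of the whole right side by [D * q ^ k] with [q = 1 + c * delta],
    not only of [a k]; then [q <= exp (c * delta)]. *)
Lemma discrete_gronwall (a : nat -> R) (c D delta : R) (n : nat) :
  0 <= c -> 0 <= D -> 0 <= delta ->
  (forall k, (k <= n)%N -> a k <= c * (delta * \sum_(i < k) a i) + D) ->
  forall k, (k <= n)%N -> a k <= D * expR (c * (k%:R * delta)).
Proof.
move=> c0 D0 d0 ak.
pose q := 1 + c * delta; have q0 : 0 <= q by rewrite addr_ge0 // mulr_ge0.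
have key k : (k <= n)%N -> a k <= D * q ^+ k /\
    c * (delta * \sum_(i < k) a i) + D <= D * q ^+ k.
  elim: k => [|k ih] kn.
    by have := ak 0%N kn; rewrite big_ord0 !mulr0 add0r expr0 mulr1.
  have [h1 h2] := ih (ltnW kn).
  have h3 : c * (delta * \sum_(i < k.+1) a i) + D <= D * q ^+ k.+1.
    rewrite big_ord_recr /= exprS /q.
    have := ler_wpM2l (mulr_ge0 c0 d0) h1; rewrite /q in h2 *; lra.
  by split=> //; apply: le_trans h3; exact: ak.
move=> k kn; apply: (le_trans (key k kn).1); rewrite ler_wpM2l //.
rewrite mulrCA expRM_natl lerXn2r ?nnegrE ?expR_ge0 //.
exact: expR_ge1Dx.
Qed.

Fixpoint pmax (f : nat -> R) (k : nat) : R :=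
  if k is k'.+1 then Num.max (pmax f k') (f k) else f 0%N.

Lemma le_pmax f j k : (j <= k)%N -> f j <= pmax f k.
Proof.
elim: k => [|k ih]; first by rewrite leqn0 => /eqP ->.
rewrite leq_eqVlt => /predU1P[->|jk] /=; first by rewrite le_max lexx orbT.
by rewrite le_max ih.
Qed.

Lemma pmax_le f k c : (forall j, (j <= k)%N -> f j <= c) -> pmax f k <= c.
Proof.
elim: k => [|k ih] h /=; first exact: h.
rewrite ge_max h // andbT; apply: ih => j jk; apply: h; exact: leqW.
Qed.

Lemma pmax_mono f j k : (j <= k)%N -> pmax f j <= pmax f k.
Proof. by move=> jk; apply: pmax_le => i ij; apply: le_pmax; exact: leq_trans jk. Qed.

End discrete_gronwall.

Lemma cell_index (k i M : nat) : (i < M)%N ->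
  (- M%:Z <= k%:Z - i%:Z <= k%:Z) /\ (- M%:Z <= k%:Z - i%:Z - 1 <= k%:Z).
Proof. by lia. Qed.

Lemma int_subS (k i : nat) : k%:Z - i%:Z - 1 = k%:Z - i.+1%:Z.
Proof. by lia. Qed.

(** The numerical end of the recursion for the mean square error: [t1] is the drift part, [t2] the
    noise part, [M] the sum of the previous errors. Factors [k * delta] are replaced by [T], and the
    noise part loses its [eps ^+ 2] where it multiplies [M]. *)
Lemma mse_arith {R : realType} (k dd mm T delta eps L2 X2 A2 M t1 t2 : R) :
  0 <= dd -> 0 <= mm -> 0 <= T -> 0 <= delta -> 0 <= eps -> 0 <= L2 -> 0 <= X2 -> 0 <= A2 ->
  0 <= M -> 0 <= k * delta <= T -> delta <= T -> eps <= 1 ->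
  t1 <= 12 * L2 * M + k * (24 * L2 * X2 * delta ^+ 2) ->
  t2 <= 8 * delta * (12 * L2 * M + k * (3 * A2 + 12 * L2 * X2 * delta ^+ 2)) ->
  2 * dd * T * (delta * t1) + 2 * eps ^+ 2 * mm * t2 <=
  (24 * dd * T * L2 + 192 * mm * L2) * (delta * M) +
  (48 * dd * T ^+ 2 * L2 * X2 + 16 * mm * T * (3 * A2 + 12 * L2 * X2 * T ^+ 2)) *
    (delta ^+ 2 + eps ^+ 2).
Proof.
move=> dd0 mm0 T0 d0 e0 L0 X0 A0 M0 /andP[kd0 kdT] dT e1 h1 h2.
have e2 : eps ^+ 2 <= 1 by rewrite expr_le1.
have e2' : 0 <= eps ^+ 2 by exact: sqr_ge0.
have d2 : delta ^+ 2 <= T ^+ 2 by rewrite lerXn2r ?nnegrE.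
have c1 : 0 <= 2 * dd * T * delta by rewrite !mulr_ge0.
have c2 : 0 <= 2 * eps ^+ 2 * mm by rewrite !mulr_ge0.
have g1 := ler_wpM2l c1 h1; have g2 := ler_wpM2l c2 h2.
have LX0 : 0 <= L2 * X2 by exact: mulr_ge0.
have f1 : 48 * dd * T * (L2 * X2) * delta ^+ 2 * (k * delta) <=
    48 * dd * T * (L2 * X2) * delta ^+ 2 * T.
  by apply: ler_wpM2l => //; rewrite mulr_ge0 ?sqr_ge0 // mulr_ge0 // !mulr_ge0.
have f2 : 192 * mm * L2 * (delta * M) * eps ^+ 2 <= 192 * mm * L2 * (delta * M) * 1.
  apply: ler_wpM2l; last exact: e2.
  by apply: mulr_ge0; apply: mulr_ge0 => //; apply: mulr_ge0; [exact: ler0n|exact: mm0].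
have f3 : 16 * mm * eps ^+ 2 * ((k * delta) * (3 * A2 + 12 * (L2 * X2) * delta ^+ 2)) <=
    16 * mm * eps ^+ 2 * (T * (3 * A2 + 12 * (L2 * X2) * T ^+ 2)).
  rewrite ler_wpM2l ?mulr_ge0 //; apply: ler_pM => //.
    by rewrite addr_ge0 // !mulr_ge0 // sqr_ge0.
  by rewrite lerD2l ler_wpM2l // mulr_ge0.
have f4 : 0 <= 48 * dd * T ^+ 2 * (L2 * X2) * eps ^+ 2 by rewrite !mulr_ge0 // sqr_ge0.
have f5 : 0 <= 16 * mm * T * (3 * A2 + 12 * (L2 * X2) * T ^+ 2) * delta ^+ 2.
  by rewrite !mulr_ge0 ?sqr_ge0 // addr_ge0 // !mulr_ge0 // sqr_ge0.
by lra.
Qed.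

Section scheme_analysis.
Context {R : realType} {r0 : R} {d m p : nat}.
Context {dO : measure_display} {O : measurableType dO} {P : probability O R}.
Local Notation C := (cpath r0 d).
Local Notation PC := (probability C R).
Variables (F : R -> set (set O)) (B : R -> O -> 'cV[R]_m).
Hypotheses (uF : usual_filtration P F) (bB : brownian P F B).
Variables (T : R) (b : C -> PC -> 'cV[R]_p -> 'cV[R]_d) (sigma : C -> PC -> 'M[R]_(d, m)).
Variables (theta0 : 'cV[R]_p) (xi : C) (X0 : R -> 'cV[R]_d).
Hypotheses (r0_gt0 : 0 < r0) (T_gt0 : 0 < T).
Hypothesis ode : limit_ode b theta0 xi T X0.
Variables (L LX A0 : R).
Hypotheses (L_ge0 : 0 <= L) (LX_ge0 : 0 <= LX) (A0_ge0 : 0 <= A0).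
Hypothesis lipb : lip_coef (fun x mu => b x mu theta0) L.
Hypothesis lips : lip_coef sigma L.
Hypothesis lipX : forall s t, - r0 <= s <= T -> - r0 <= t <= T ->
  hsnorm (X0 s - X0 t) <= LX * `|s - t|.
Local Notation seg := (segment r0 X0).
Hypothesis sig0 : forall t, 0 <= t <= T -> hsnorm (sigma (seg t) (dirac_law (seg t))) <= A0.
Variables (eps delta : R) (n M : nat).
Hypotheses (eps01 : 0 < eps < 1) (n_gt0 : (0 < n)%N) (M_gt0 : (0 < M)%N).
Hypotheses (nT : n%:R * delta = T) (Mr0 : M%:R * delta = r0).
Variables (Y : int -> O -> 'cV[R]_d) (Yhat : nat -> {RV P >-> C}).
Hypothesis Yinit : forall (j : int) w, - M%:Z <= j <= 0 -> Y j w = xi (j%:~R * delta).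
Hypothesis Ystep : forall (k : nat) w, (k < n)%N ->
  Y k.+1%:Z w = Y k%:Z w + delta *: b (Yhat k w) (law (Yhat k)) theta0
    + eps *: (sigma (Yhat k w) (law (Yhat k))
                *m (B (k.+1%:R * delta) w - B (k%:R * delta) w)).
Hypothesis Yinterp : forall (k i : nat) w (s : R), (k < n)%N -> (i < M)%N ->
  - (i.+1%:R * delta) <= s <= - (i%:R * delta) ->
  Yhat k w s = Y (k%:Z - i%:Z) w
    + ((s + i%:R * delta) / delta) *: (Y (k%:Z - i%:Z) w - Y (k%:Z - i%:Z - 1) w).

Lemma delta_gt0 : 0 < delta.
Proof. by rewrite -(@pmulr_rgt0 _ n%:R) ?ltr0n // nT. Qed.

Local Notation tt k := (k%:R * delta).

Lemma grid_ge0 k : 0 <= tt k.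
Proof. by rewrite mulr_ge0 // ltW // delta_gt0. Qed.

Lemma grid_le_T k : (k <= n)%N -> 0 <= tt k <= T.
Proof. by move=> kn; rewrite grid_ge0 -nT ler_pM2r ?delta_gt0 // ler_nat. Qed.

Definition err (w : O) (j : nat) : R := hsnorm (Y j%:Z w - X0 (tt j)).

Lemma X0_past t : - r0 <= t <= 0 -> X0 t = xi t.
Proof. by have [_ h _] := ode; exact: h. Qed.

Lemma err0 w : err w 0 = 0.
Proof.
rewrite /err Yinit ?lexx ?andbT ?oppr_le0 // !mul0r X0_past ?subrr ?hsnorm0 //.
by rewrite lexx oppr_le0 ltW.
Qed.

Lemma pmax_err_ge0 w k : 0 <= pmax (err w) k.
Proof. by rewrite -(err0 w); exact: le_pmax. Qed.

Lemma Y_past_err (j : int) w (k : nat) : - M%:Z <= j <= k%:Z ->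
  hsnorm (Y j w - X0 (j%:~R * delta)) <= pmax (err w) k.
Proof.
move=> /andP[j1 j2]; have [j0|j0] := lerP 0 j.
  have jE : j = `|j|%N%:Z by rewrite gez0_abs.
  rewrite jE in j2 *; apply: (le_pmax (err w)); exact: j2.
have jI : - M%:Z <= j <= 0 by rewrite j1 (ltW j0).
have j1' : - M%:R <= j%:~R :> R by rewrite -(ler_int R) rmorphN in j1.
have j0' : j%:~R <= 0 :> R by rewrite lerz0 ltW.
have jr : - r0 <= j%:~R * delta <= 0.
  by have := delta_gt0; rewrite -Mr0 => d0; apply/andP; split; nra.
by rewrite (Yinit _ jI) (X0_past jr) subrr hsnorm0 pmax_err_ge0.
Qed.

Lemma find_cell s : - r0 <= s <= 0 -> exists2 i, (i < M)%N &
  - (i.+1%:R * delta) <= s <= - (i%:R * delta).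
Proof.
move=> /andP[s1 s2]; have d0 := delta_gt0.
have v0 : 0 <= - s / delta by rewrite divr_ge0 ?oppr_ge0 // ltW.
have /andP[h1 h2] := truncn_itv v0.
set i := Num.truncn (- s / delta) in h1 h2.
rewrite ler_pdivlMr // in h1; rewrite ltr_pdivrMr // in h2.
(* At [s = - r0] the truncated quotient is [M], and the last cell serves. *)
have [iM|Mi] := ltnP i M.
  by exists i => //; apply/andP; split; lra.
have M1 : (M.-1 < M)%N by rewrite prednK.
exists M.-1 => //; rewrite prednK // Mr0 s1 /=.
have : M%:R * delta <= i%:R * delta by rewrite ler_pM2r // ler_nat.
have : M.-1%:R * delta <= M%:R * delta by rewrite ler_pM2r // ler_nat leq_pred.
lra.
Qed.

(** The explicit weight shows that it does not depend on [w], so two outcomes can be compared with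
    the same convex combination. *)
Lemma interp_convex k i w s : (k < n)%N -> (i < M)%N ->
  - (i.+1%:R * delta) <= s <= - (i%:R * delta) ->
  exists2 l : R, 0 <= l <= 1 &
    Yhat k w s = (1 - l) *: Y (k%:Z - i%:Z) w + l *: Y (k%:Z - i%:Z - 1) w /\
    l = - (s + i%:R * delta) / delta.
Proof.
move=> kn iM sI; have d0 := delta_gt0.
exists (- (s + i%:R * delta) / delta).
  case/andP: sI; rewrite -natr1 mulrDl mul1r => s1 s2.
  rewrite divr_ge0 ?(ltW d0) //=; last by lra.
  by rewrite ler_pdivrMr // mul1r; lra.
split=> //; rewrite (Yinterp _ kn iM sI) mulNr.
move: (_ / delta) => l; apply/matrixP => u v; rewrite !mxE; ring.
Qed.

(** Both grid points used by the interpolation are within [delta] of the time considered; each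
    carries the grid error plus the variation [LX * delta] of the limit, and convexity keeps the
    bound. *)
Lemma Yhat_dist k w : (k < n)%N ->
  path_dist (Yhat k w) (seg (tt k)) <= pmax (err w) k + LX * delta.
Proof.
move=> kn; have d0 := delta_gt0; have tk := grid_le_T (ltnW kn).
have [cX0 _ _] := ode.
apply: path_dist_le => // s sI.
have e1 := segmentE cX0 tk sI.
have [i iM siI] := find_cell sI.
have [l /andP[l0 l1] [lE lv]] := interp_convex w kn iM siI.
have {lv} lv : l * delta = - (s + i%:R * delta) by rewrite lv divfK // gt_eqF.
have hi : forall j : int, - M%:Z <= j <= k%:Z -> `|j%:~R * delta - (tt k + s)| <= delta ->
    hsnorm (Y j w - X0 (tt k + s)) <= pmax (err w) k + LX * delta.
  move=> j jI js; apply: (le_trans (hsnorm_triB _ (X0 (j%:~R * delta)) _)).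
  apply: lerD; first exact: Y_past_err.
  have jI' : - r0 <= j%:~R * delta <= T.
    have /andP[j1 j2] := jI.
    have j1' : - M%:R <= j%:~R :> R by rewrite -(ler_int R) rmorphN in j1.
    have j2' : j%:~R <= k%:R :> R by rewrite -(ler_int R) in j2.
    have kn' : k%:R <= n%:R :> R by rewrite ler_nat ltnW.
    by rewrite -Mr0 -nT; apply/andP; split; nra.
  apply: (le_trans (lipX jI' _)); last by rewrite ler_wpM2l.
  exact: shift_in.
rewrite -e1 in hi; rewrite lE.
have -> : (1 - l) *: Y (k%:Z - i%:Z) w + l *: Y (k%:Z - i%:Z - 1) w - seg (tt k) s =
    (1 - l) *: (Y (k%:Z - i%:Z) w - seg (tt k) s) + l *: (Y (k%:Z - i%:Z - 1) w - seg (tt k) s).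
  by apply/matrixP => u v; rewrite !mxE; ring.
apply: (le_trans (hsnormD _ _)); rewrite !hsnormZ ger0_norm ?subr_ge0 // ger0_norm //.
have cast1 : (k%:Z - i%:Z)%:~R = k%:R - i%:R :> R by rewrite rmorphB.
have cast2 : (k%:Z - i%:Z - 1)%:~R = k%:R - i%:R - 1 :> R by rewrite !rmorphB.
case/andP: siI; rewrite -natr1 mulrDl mul1r => si1 si2.
have h1 : hsnorm (Y (k%:Z - i%:Z) w - seg (tt k) s) <= pmax (err w) k + LX * delta.
  apply: hi; first exact: (cell_index k iM).1.
  by rewrite cast1 mulrBl ler_norml; lra.
have h2 : hsnorm (Y (k%:Z - i%:Z - 1) w - seg (tt k) s) <= pmax (err w) k + LX * delta.
  apply: hi; first exact: (cell_index k iM).2.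
  by rewrite cast2 !mulrBl mul1r ler_norml; lra.
have l1' : 0 <= 1 - l by rewrite subr_ge0.
by have := ler_wpM2l l1' h1; have := ler_wpM2l l0 h2; lra.
Qed.

Definition scheme_good k : Prop :=
  forall i, adapted (F (tt k)) (fun w => Y k%:Z w i 0) /\ sqint P (fun w => Y k%:Z w i 0).

Lemma F_grid_mono j k : (j <= k)%N -> F (tt j) `<=` F (tt k).
Proof.
move=> jk; have [_ h _ _] := uF; apply: h; first exact: grid_ge0.
by rewrite ler_pM2r ?delta_gt0 // ler_nat.
Qed.

Section at_step.
Variable k : nat.
Hypothesis kn : (k < n)%N.
Hypothesis good : forall j, (j <= k)%N -> scheme_good j.

(** The interpolated segment depends on [M + 1] grid values through convex combinations, hence with
    Lipschitz constant 1. *)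
Lemma Yhat_adapted : adapted (F (tt k)) (Yhat k).
Proof.
pose u (a : 'I_M.+1 * 'I_d) (w : O) := Y (k%:Z - a.1%:Z) w a.2 0.
rewrite /adapted; apply: (@measurable_finitely_determined R r0 d _
  (g_sigma_algebraType (F (tt k))) _ u _ 1).
  move=> [a i]; rewrite /u /=.
  have [ak|ka] := leqP a k.
    have -> : k%:Z - a%:Z = (k - a)%N%:Z by rewrite subzn.
    apply: (adapted_mono (F_grid_mono (leq_subr a k))).
    by have [] := good (leq_subr a k) i.
  (* Grid values before time 0 are those of the deterministic initial path. *)
  rewrite (_ : (fun w => _) = cst (xi ((k%:Z - a%:Z)%:~R * delta) i 0)); last first.
    apply: funext => w; rewrite Yinit //; have := ltn_ord a; lia.
  exact: measurable_cst.
move=> v w; rewrite mul1r; apply: path_dist_le => // s sI.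
have [i iM siI] := find_cell sI.
have [l l01 [lE lv]] := interp_convex v kn iM siI.
have [l' l01' [lE' lv']] := interp_convex w kn iM siI.
rewrite lE lE' lv' -lv => {lE lE' lv' lv l01' l'}.
case/andP: l01 => l0 l1.
have i1 : (i < M.+1)%N by exact: ltnW.
have i2 : (i.+1 < M.+1)%N by [].
have e2 : k%:Z - i%:Z - 1 = k%:Z - (Ordinal i2)%:Z := int_subS k i.
have e1 : k%:Z - i%:Z = k%:Z - (Ordinal i1)%:Z by [].
have -> : (1 - l) *: Y (k%:Z - i%:Z) v + l *: Y (k%:Z - i%:Z - 1) v -
    ((1 - l) *: Y (k%:Z - i%:Z) w + l *: Y (k%:Z - i%:Z - 1) w) =
    (1 - l) *: (Y (k%:Z - i%:Z) v - Y (k%:Z - i%:Z) w) +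
    l *: (Y (k%:Z - i%:Z - 1) v - Y (k%:Z - i%:Z - 1) w).
  by apply/matrixP => x y; rewrite !mxE; ring.
pose S := \sum_j `|u j v - u j w|.
have hS (a : 'I_M.+1) : hsnorm (Y (k%:Z - a%:Z) v - Y (k%:Z - a%:Z) w) <= S.
  apply: (le_trans (hsnorm_le_sum _)); rewrite /S -(pair_bigA _ (fun a i => `|u (a, i) v - u (a, i) w|)) /=.
  rewrite (bigD1 a) //= -[leLHS]addr0; apply: lerD.
    by apply: ler_sum => j _; rewrite big_ord1 !mxE.
  by apply: sumr_ge0 => ? _; apply: sumr_ge0.
apply: (le_trans (hsnormD _ _)); rewrite !hsnormZ ger0_norm ?subr_ge0 // ger0_norm //.
by rewrite -/S e2 e1; have := hS (Ordinal i1); have := hS (Ordinal i2); nra.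
Qed.

Lemma err_adapted j : (j <= k)%N -> adapted (F (tt k)) (fun w => err w j).
Proof.
move=> jk; apply: measurable_hsnorm; apply: measurable_mxB => [i i'|]; last exact: measurable_mx_cst.
rewrite ord1; apply: (adapted_mono (F_grid_mono jk)).
by have [] := good jk i.
Qed.

Lemma pmax_err_adapted j : (j <= k)%N -> adapted (F (tt k)) (fun w => pmax (err w) j).
Proof.
elim: j => [|j ih] jk; first exact: err_adapted.
apply: measurable_maxr; [exact: ih (ltnW jk)|exact: err_adapted].
Qed.

Lemma F_grid_sigma j : sigma_algebra setT (F (tt j)) /\ F (tt j) `<=` measurable.
Proof. exact: (filtration_sigma uF (grid_ge0 j)). Qed.

Lemma adapted_grid_measurable j dU (U : measurableType dU) (f : O -> U) :
  adapted (F (tt j)) f -> measurable_fun setT f.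
Proof. by have [sG Gm] := F_grid_sigma j; exact: adapted_measurable. Qed.

Lemma err_sqint j : (j <= k)%N -> sqint P (fun w => err w j).
Proof.
move=> jk.
apply: (@sqint_le _ _ _ P _ (fun w => \sum_i `|Y j%:Z w i 0 - X0 (tt j) i 0|)).
- exact: adapted_grid_measurable (err_adapted jk).
- move=> w; rewrite /err ger0_norm //; apply: (le_trans (hsnorm_le_sum _)).
  by apply: ler_sum => i _; rewrite big_ord1 !mxE.
apply: sqint_sum => i; apply: sqint_norm.
have [_ sY] := good jk i.
exact: (sqintD sY (sqint_cst P (- X0 (tt j) i 0))).
Qed.

Lemma pmax_err_sqint j : (j <= k)%N -> sqint P (fun w => pmax (err w) j).
Proof.
elim: j => [|j ih] jk; first exact: err_sqint.
apply: (@sqint_le _ _ _ P _ (fun w => pmax (err w) j + err w j.+1)).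
- exact: adapted_grid_measurable (pmax_err_adapted jk).
- move=> w; rewrite ger0_norm ?pmax_err_ge0 //= ge_max.
  by rewrite lerDl lerDr pmax_err_ge0 hsnorm_ge0.
by apply: sqintD; [exact: ih (ltnW jk)|exact: err_sqint].
Qed.

Let dist w := path_dist (Yhat k w) (seg (tt k)).

Lemma dist_adapted : adapted (F (tt k)) dist.
Proof.
by apply: (measurableT_comp (measurable_path_dist r0_gt0 (seg (tt k)))); exact: Yhat_adapted.
Qed.

Lemma dist_sqint : sqint P dist.
Proof.
apply: (@sqint_le _ _ _ P _ (fun w => pmax (err w) k + LX * delta)).
- exact: adapted_grid_measurable dist_adapted.
- by move=> w; rewrite ger0_norm ?path_dist_ge0 //; exact: Yhat_dist.
by apply: sqintD; [exact: pmax_err_sqint|exact: sqint_cst].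
Qed.

Lemma Ex_dist2 : Ex P (fun w => dist w ^+ 2) <=
  2 * Ex P (fun w => pmax (err w) k ^+ 2) + 2 * LX ^+ 2 * delta ^+ 2.
Proof.
have i1 := (pmax_err_sqint (leqnn k)).2.
rewrite -ExZ // -[X in _ + X](Ex_cst P) -ExD; [|exact: intbleZ|exact: intble_cst].
apply: Ex_le; [exact: dist_sqint.2| |].
  by apply: intbleD; [exact: intbleZ|exact: intble_cst].
move=> w; have h := Yhat_dist w kn; have h0 : 0 <= dist w by exact: path_dist_ge0.
have := sqr_ge0 (pmax (err w) k - LX * delta); rewrite /dist in h0 *; nra.
Qed.

Lemma Yhat_moment : finite_moment2 (law (Yhat k)).
Proof.
apply: (finite_moment2_law r0_gt0 (x := seg (tt k))).
by rewrite Ex_EFin ?ltry //; exact: dist_sqint.2.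
Qed.

(** The measure argument is controlled by the same mean square error as the path, so the dependence
    on the law closes within a single Gronwall argument. *)
Lemma W2_Yhat : W2 (law (Yhat k)) (dirac_law (seg (tt k))) ^+ 2 <= Ex P (fun w => dist w ^+ 2).
Proof.
apply: W2_law_dirac => //; rewrite (Ex_EFin (f := fun w => dist w ^+ 2)) //.
exact: dist_sqint.2.
Qed.

Lemma coef_diff a c (f : C -> PC -> 'M[R]_(a, c)) (K : R) w : lip_coef f K ->
  hsnorm (f (Yhat k w) (law (Yhat k)) - f (seg (tt k)) (dirac_law (seg (tt k)))) <=
    K * (dist w + W2 (law (Yhat k)) (dirac_law (seg (tt k)))).
Proof.
move=> fK; apply: fK; [exact: Yhat_moment|exact: finite_moment2_dirac].
Qed.

(** At fixed [k] the law is deterministic and only the path varies; since [W2] of a law with itself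
    is 0, the coefficient is Lipschitz, hence measurable, on path space. *)
Lemma coef_adapted a c (f : C -> PC -> 'M[R]_(a, c)) (K : R) i j : lip_coef f K ->
  adapted (F (tt k)) (fun w => f (Yhat k w) (law (Yhat k)) i j).
Proof.
move=> fK.
have mf : measurable_mx (fun x : C => f x (law (Yhat k))).
  apply: (@measurable_mx_path R r0 d r0_gt0 _ _ _ `|K|) => x y.
  have := fK x y _ _ Yhat_moment Yhat_moment.
  rewrite W2_xx // addr0 => /le_trans; apply; rewrite ler_wpM2r // ?ler_norm //.
  exact: path_dist_ge0.
by apply: (measurableT_comp (mf i j)); exact: Yhat_adapted.
Qed.

Lemma coef_sqint a c (f : C -> PC -> 'M[R]_(a, c)) (K : R) i j : lip_coef f K ->
  sqint P (fun w => f (Yhat k w) (law (Yhat k)) i j).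
Proof.
move=> fK; set W := W2 (law (Yhat k)) (dirac_law (seg (tt k))).
(* A negative constant may be replaced by 0. *)
have [K0|/ltW K0] := leP 0 K; last first.
  have fK0 : lip_coef f 0.
    move=> x y mu nu fm fn; apply: (le_trans (fK x y mu nu fm fn)).
    by rewrite mul0r mulr_le0_ge0 // addr_ge0 ?path_dist_ge0 ?W2_ge0.
  apply: (@sqint_le _ _ _ P _ (fun=> hsnorm (f (seg (tt k)) (dirac_law (seg (tt k)))))).
  - exact: adapted_grid_measurable (coef_adapted i j fK).
  - move=> w; apply: (le_trans (hsnorm_entry _ _ _)).
    apply: (le_trans (hsnorm_sub_le _ (f (seg (tt k)) (dirac_law (seg (tt k)))))).
    by rewrite -[leRHS]add0r lerD2r; have := coef_diff w fK0; rewrite mul0r.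
  exact: sqint_cst.
apply: (@sqint_le _ _ _ P _ (fun w => K * dist w +
  (K * W + hsnorm (f (seg (tt k)) (dirac_law (seg (tt k))))))).
- exact: adapted_grid_measurable (coef_adapted i j fK).
- move=> w; apply: (le_trans (hsnorm_entry _ _ _)).
  apply: (le_trans (hsnorm_sub_le _ (f (seg (tt k)) (dirac_law (seg (tt k)))))).
  by rewrite addrA lerD2r -mulrDr; exact: coef_diff.
apply: sqintD; [exact: sqintZ dist_sqint|exact: sqint_cst].
Qed.

Definition dB (a : 'I_m) (j : nat) (w : O) : R := (B (tt j.+1) w - B (tt j) w) a 0.

Lemma Ystep_entry w i : Y k.+1%:Z w i 0 = Y k%:Z w i 0
  + delta * b (Yhat k w) (law (Yhat k)) theta0 i 0
  + eps * \sum_a sigma (Yhat k w) (law (Yhat k)) i a * dB a k w.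
Proof.
rewrite (Ystep _ kn) mxE; congr (_ + _); first by rewrite !mxE.
by rewrite !mxE; congr (_ * _); apply: eq_bigr => a _.
Qed.

Lemma scheme_good_step : scheme_good k.+1.
Proof.
move=> i; have [aY sY] := good (leqnn k) i.
have noise a := brownian_gaussian_noise uF bB n a delta_gt0.
have step a : adapted (F (tt k.+1)) (fun w => sigma (Yhat k w) (law (Yhat k)) i a * dB a k w) /\
    sqint P (fun w => sigma (Yhat k w) (law (Yhat k)) i a * dB a k w).
  have [s0 Gs Gm Gx ind] := noise a.
  have [sG Gms] := F_grid_sigma k.
  split.
    apply: measurable_funM; last exact: Gx.
    exact: adapted_mono (F_grid_mono (leqnSn k)) (coef_adapted i a lips).
  apply: (gaussian_step_sqr sG Gms (measurable_noise (noise a) kn) s0 _ (coef_adapted i a lips) (coef_sqint i a lips)).1.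
  by move=> A D; exact: ind.
have -> : (fun w => Y k.+1%:Z w i 0) = (fun w => Y k%:Z w i 0
  + delta * b (Yhat k w) (law (Yhat k)) theta0 i 0
  + eps * \sum_a sigma (Yhat k w) (law (Yhat k)) i a * dB a k w).
  by apply: funext => w; exact: Ystep_entry.
split.
  apply: measurable_funD; last first.
    by apply: measurable_funM => //; apply: measurable_sum => a; exact: (step a).1.
  apply: (adapted_mono (F_grid_mono (leqnSn k))).
  apply: measurable_funD => //; apply: measurable_funM => //.
  exact: (coef_adapted i 0 lipb).
apply: sqintD; last by apply: sqintZ; apply: sqint_sum => a; exact: (step a).2.
by apply: sqintD => //; apply: sqintZ; exact: (coef_sqint i 0 lipb).
Qed.

End at_step.

Lemma scheme_good_all k : (k <= n)%N -> scheme_good k.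
Proof.
elim/ltn_ind: k => -[|k] ih kn.
  move=> i; rewrite (_ : (fun w => _) = cst (xi (0%:~R * delta) i 0)).
    by split; [exact: measurable_cst|exact: sqint_cst].
  by apply: funext => w; rewrite Yinit // lexx andbT oppr_le0.
apply: scheme_good_step => // j jk; apply: ih => //.
exact: leq_trans jk (ltnW kn).
Qed.

Lemma good_upto k : (k < n)%N -> forall j, (j <= k)%N -> scheme_good j.
Proof. by move=> kn j jk; apply: scheme_good_all; exact: leq_trans jk (ltnW kn). Qed.

Lemma pmax_err_sqint_all k : (k <= n)%N -> sqint P (fun w => pmax (err w) k).
Proof.
by move=> kn; apply: (@pmax_err_sqint k) => // j jk; apply: scheme_good_all; exact: leq_trans kn.
Qed.

Definition mse k := Ex P (fun w => pmax (err w) k ^+ 2).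

Lemma mse_ge0 k : 0 <= mse k.
Proof. by apply: Ex_ge0 => w; exact: sqr_ge0. Qed.

Let W i := W2 (law (Yhat i)) (dirac_law (seg (tt i))).
Let dist i w := path_dist (Yhat i w) (seg (tt i)).
(** Mismatch of the drift over the i-th step: distance of the scheme from the limit at the grid
    time, for the path and for the law, plus the motion of the limit segment during the step. *)
Let tau i w := L * (dist i w + W i) + 2 * L * (LX * delta).
Let f (t : R) := b (seg t) (dirac_law (seg t)) theta0.

Lemma Ex_dist_le i : (i < n)%N ->
  Ex P (fun w => dist i w ^+ 2) <= 2 * mse i + 2 * LX ^+ 2 * delta ^+ 2.
Proof. by move=> ik; apply: Ex_dist2 => //; exact: good_upto. Qed.

Lemma W_sqr_le i : (i < n)%N -> W i ^+ 2 <= 2 * mse i + 2 * LX ^+ 2 * delta ^+ 2.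
Proof.
move=> ik; apply: le_trans (Ex_dist_le ik); apply: W2_Yhat => //; exact: good_upto.
Qed.

Lemma segment_grid_dist i u : (i < n)%N -> tt i <= u <= tt i.+1 ->
  path_dist (seg (tt i)) (seg u) <= LX * delta.
Proof.
move=> ik /andP[u1 u2]; have [cX0 _ _] := ode.
have d0 := delta_gt0.
have t1 := grid_le_T (ltnW ik); have /andP[_ t2] := grid_le_T ik.
have uT : 0 <= u <= T by rewrite (le_trans (grid_ge0 i)) // (le_trans u2).
apply: (segment_dist_le r0_gt0 cX0 t1 uT) => s sI.
apply: (le_trans (lipX (shift_in t1 sI) (shift_in uT sI))).
rewrite ler_wpM2l // opprD addrACA subrr addr0 distrC ger0_norm ?subr_ge0 //.
by move: u2; rewrite -natr1 mulrDl mul1r; lra.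
Qed.

Lemma drift_error i w u l : (i < n)%N -> tt i <= u <= tt i.+1 ->
  `|f u l 0 - b (Yhat i w) (law (Yhat i)) theta0 l 0| <= tau i w.
Proof.
move=> ik uI.
have h1 := coef_diff ik (good_upto ik) w lipb.
have h2 := dirac_coef r0_gt0 (seg (tt i)) (seg u) L_ge0 lipb.
have h3 := segment_grid_dist ik uI.
have := hsnorm_entry (f u - b (Yhat i w) (law (Yhat i)) theta0) l 0; rewrite !mxE.
move=> /le_trans; apply; rewrite hsnormBC.
apply: (le_trans (hsnorm_triB _ (f (tt i)) _)); apply: lerD; first exact: h1.
by apply: (le_trans h2); rewrite ler_wpM2l // mulr_ge0.
Qed.

Lemma tau_ge0 i w : 0 <= tau i w.
Proof.
rewrite addr_ge0 // mulr_ge0 // ?mulr_ge0 ?(ltW delta_gt0) // addr_ge0 ?W2_ge0 //.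
exact: path_dist_ge0.
Qed.

Let S (l : 'I_d) (a : 'I_m) i w := sigma (Yhat i w) (law (Yhat i)) l a.

Lemma Y_expansion j w l : (j <= n)%N -> Y j%:Z w l 0 = xi 0 l 0
  + delta * \sum_(i < j) b (Yhat i w) (law (Yhat i)) theta0 l 0
  + eps * \sum_a msum (dB a) (S l a) j w.
Proof.
elim: j => [|j ih] jn.
  rewrite big_ord0 mulr0 addr0 big1; last by move=> a _; rewrite msum0.
  by rewrite mulr0 addr0 Yinit ?mul0r // lexx andbT oppr_le0.
rewrite Ystep_entry // ih ?(ltnW jn) // big_ord_recr /=.
under [X in _ = _ + eps * X]eq_bigr do rewrite msumS.
by rewrite big_split /=; ring.
Qed.

Lemma err_entry j w l : (j <= n)%N ->
  `|Y j%:Z w l 0 - X0 (tt j) l 0| <=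
    delta * \sum_(i < j) tau i w + eps * `|\sum_a msum (dB a) (S l a) j w|.
Proof.
move=> jn; have [cX0 _ X0E] := ode; have d0 := delta_gt0.
rewrite (Y_expansion w l jn) X0E ?grid_le_T // !mxE.
have cf : {within `[0, T], continuous (fun t => f t l 0)}.
  apply: entry_continuous_within.
  exact: (along_path_continuous r0_gt0 cX0 L_ge0 lipb).
have := @riemann_sum_bound R T (fun t => f t l 0) cf delta n
  (fun i => b (Yhat i w) (law (Yhat i)) theta0 l 0) (tau ^~ w) d0.
rewrite nT lexx => /(_ isT) h.
have {}h := h _ j jn; rewrite -/f.
set A := \sum_(i < j) b _ _ _ _ _; set E := eps * \sum_a _.
set I := \int[_]_(x in _) _ in h *.
have -> : xi 0 l 0 + delta * A + E - (xi 0 l 0 + I) = - (I - delta * A) + E by ring.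
apply: (le_trans (ler_normD _ _)); rewrite normrN; apply: lerD.
  by apply: h => i u ik uI; exact: drift_error.
by rewrite /E normrM ger0_norm // ltW; case/andP: eps01.
Qed.

Lemma sqr_sum_le (k : nat) (x : nat -> R) :
  (\sum_(i < k) x i) ^+ 2 <= k%:R * \sum_(i < k) x i ^+ 2.
Proof.
have := sum_cauchy_schwarz (fun=> 1 : R) (fun i : 'I_k => x i).
under eq_bigr do rewrite mul1r; move=> /le_trans; apply.
by under eq_bigr do rewrite expr1n; rewrite sumr_const card_ord.
Qed.

(** The variables [U] dominate the squared martingales at time [j]; when they do so for all [j] up
    to [k], the resulting bound does not depend on [j] and passes to the maximum. *)
Lemma err_sqr_le j k w (U : 'I_d -> 'I_m -> O -> R) : (j <= k)%N -> (k <= n)%N ->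
  (forall l a, msum (dB a) (S l a) j w ^+ 2 <= U l a w) ->
  err w j ^+ 2 <= 2 * d%:R * T * (delta * \sum_(i < k) tau i w ^+ 2)
    + 2 * eps ^+ 2 * m%:R * \sum_l \sum_a U l a w.
Proof.
move=> jk kn hU; have jn := leq_trans jk kn; have d0 := delta_gt0.
have main l : (Y j%:Z w - X0 (tt j)) l 0 ^+ 2 <=
    2 * T * (delta * \sum_(i < k) tau i w ^+ 2) + 2 * eps ^+ 2 * m%:R * \sum_a U l a w.
  have := err_entry w l jn; rewrite !mxE.
  set D := delta * \sum_(i < j) _; set E := \sum_a _ => h.
  have D2 : D ^+ 2 <= T * (delta * \sum_(i < k) tau i w ^+ 2).
    rewrite /D exprMn.
    have h1 := sqr_sum_le j (tau ^~ w).
    have h2 : \sum_(i < j) tau i w ^+ 2 <= \sum_(i < k) tau i w ^+ 2.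
      rewrite -(subnKC jk) big_split_ord /= lerDl; apply: sumr_ge0 => i _; exact: sqr_ge0.
    have h3 : j%:R * delta <= T by have /andP[] := grid_le_T jn.
    have h4 : 0 <= \sum_(i < j) tau i w ^+ 2 by apply: sumr_ge0 => i _; exact: sqr_ge0.
    apply: (@le_trans _ _ (j%:R * delta * (delta * \sum_(i < j) tau i w ^+ 2))).
      by have := ler_wpM2l (sqr_ge0 delta) h1; lra.
    apply: ler_pM => //; [exact: grid_ge0|by rewrite mulr_ge0 // ltW|].
    by rewrite ler_wpM2l // ltW.
  have E2 : E ^+ 2 <= m%:R * \sum_a U l a w.
    have := sum_cauchy_schwarz (fun=> 1 : R) (fun a : 'I_m => msum (dB a) (S l a) j w).
    under eq_bigr do rewrite mul1r; move=> /le_trans; apply.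
    under eq_bigr do rewrite expr1n; rewrite sumr_const card_ord.
    by rewrite ler_wpM2l //; apply: ler_sum => a _.
  have e0 : 0 <= eps by rewrite ltW; case/andP: eps01.
  have D0 : 0 <= D by rewrite mulr_ge0 ?(ltW d0) // sumr_ge0 // => i _; exact: tau_ge0.
  have h5 : (Y j%:Z w l 0 - X0 (tt j) l 0) ^+ 2 <= (D + eps * `|E|) ^+ 2.
    rewrite -[leLHS]real_normK ?num_real //.
    by rewrite lerXn2r ?nnegrE // addr_ge0 // mulr_ge0.
  apply: (le_trans h5).
  have h6 : (D + eps * `|E|) ^+ 2 <= 2 * D ^+ 2 + 2 * eps ^+ 2 * E ^+ 2.
    have -> : E ^+ 2 = `|E| ^+ 2 by rewrite real_normK ?num_real.
    by have := sqr_ge0 (D - eps * `|E|); lra.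
  apply: (le_trans h6).
  by have := ler_wpM2l (sqr_ge0 eps) E2; lra.
rewrite /err sqr_hsnorm.
apply: (@le_trans _ _ (\sum_(l < d) (2 * T * (delta * \sum_(i < k) tau i w ^+ 2)
   + 2 * eps ^+ 2 * m%:R * \sum_a U l a w))).
  by apply: ler_sum => l _; rewrite big_ord1.
rewrite big_split /= sumr_const card_ord -mulr_sumr -[X in X + _]mulr_natl.
by rewrite le_eqVlt; apply/orP; left; apply/eqP; ring.
Qed.

(** The constants are [24 = 2 * 12] from the drift and [192 = 2 * 8 * 12] from the noise, 8 being
    the constant of [doob_bound]; 12 collects the squares of a sum of three terms and the bounds of
    [Ex_dist_le] and [W_sqr_le]. *)
Definition gron_rate : R := 24 * d%:R * T * L ^+ 2 + 192 * m%:R * L ^+ 2.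
Definition gron_const : R :=
  (48 * d%:R * T ^+ 2 * L ^+ 2 * LX ^+ 2 + 16 * m%:R * T * (3 * A0 ^+ 2 + 12 * L ^+ 2 * LX ^+ 2 * T ^+ 2))
  * expR (gron_rate * T).

Lemma Ex_tau_sqr i : (i < n)%N -> intble P (fun w => tau i w ^+ 2) /\
  Ex P (fun w => tau i w ^+ 2) <= 12 * L ^+ 2 * (mse i + 2 * LX ^+ 2 * delta ^+ 2).
Proof.
move=> ik.
have sd := dist_sqint ik (good_upto ik).
have st : sqint P (tau i).
  apply: sqintD; last exact: sqint_cst.
  by apply: sqintZ; apply: sqintD; [exact: sd|exact: sqint_cst].
split; first exact: st.2.
have h1 := Ex_dist_le ik; have h2 := W_sqr_le ik.
apply: (@le_trans _ _ (Ex P (fun w => 3 * L ^+ 2 * dist i w ^+ 2 +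
    (3 * L ^+ 2 * W i ^+ 2 + 12 * L ^+ 2 * LX ^+ 2 * delta ^+ 2)))).
  apply: Ex_le; [exact: st.2|apply: intbleD; [exact: intbleZ sd.2|exact: intble_cst]|].
  move=> w; rewrite /tau.
  set x := L * dist i w; set y := L * W i; set z := 2 * L * (LX * delta).
  have := sqr_ge0 (x - y); have := sqr_ge0 (x - z); have := sqr_ge0 (y - z).
  rewrite /x /y /z; nra.
rewrite ExD; [|exact: intbleZ sd.2|exact: intble_cst].
rewrite ExZ ?Ex_cst; last exact: sd.2.
by have L2 := sqr_ge0 L; have := ler_wpM2l L2 h1; have := ler_wpM2l L2 h2; lra.
Qed.

Lemma Ex_sigma_sqr i : (i < n)%N ->
  \sum_l \sum_a Ex P (fun w => S l a i w ^+ 2) <=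
    3 * A0 ^+ 2 + 12 * L ^+ 2 * (mse i + LX ^+ 2 * delta ^+ 2).
Proof.
move=> ik.
have sS l a : sqint P (S l a i) by exact: (coef_sqint ik (good_upto ik) l a lips).
have sd := dist_sqint ik (good_upto ik).
have -> : \sum_l \sum_a Ex P (fun w => S l a i w ^+ 2) =
    Ex P (fun w => \sum_l \sum_a S l a i w ^+ 2).
  rewrite Ex_sum => [|l]; last by apply: intble_sum => a; exact: (sS l a).2.
  by apply: eq_bigr => l _; rewrite Ex_sum // => a; exact: (sS l a).2.
have h1 := Ex_dist_le ik; have h2 := W_sqr_le ik.
apply: (@le_trans _ _ (Ex P (fun w => 3 * L ^+ 2 * dist i w ^+ 2 +
    (3 * L ^+ 2 * W i ^+ 2 + 3 * A0 ^+ 2)))).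
  apply: Ex_le.
  - by apply: intble_sum => l; apply: intble_sum => a; exact: (sS l a).2.
  - by apply: intbleD; [exact: intbleZ sd.2|exact: intble_cst].
  move=> w; rewrite -sqr_hsnorm.
  have h3 := coef_diff ik (good_upto ik) w lips.
  have h4 := sig0 (grid_le_T (ltnW ik)).
  have h5 := hsnorm_sub_le (sigma (Yhat i w) (law (Yhat i))) (sigma (seg (tt i)) (dirac_law (seg (tt i)))).
  rewrite -/(dist i w) -/(W i) in h3.
  have h0 := hsnorm_ge0 (sigma (Yhat i w) (law (Yhat i))).
  have h6 : hsnorm (sigma (Yhat i w) (law (Yhat i))) <= L * dist i w + L * W i + A0 by lra.
  have x0 : 0 <= L * dist i w by rewrite mulr_ge0 // path_dist_ge0.
  have y0 : 0 <= L * W i by rewrite mulr_ge0 // W2_ge0.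
  apply: (@le_trans _ _ ((L * dist i w + L * W i + A0) ^+ 2)).
    by rewrite lerXn2r // nnegrE !addr_ge0.
  set x := L * dist i w; set y := L * W i.
  have := sqr_ge0 (x - y); have := sqr_ge0 (x - A0); have := sqr_ge0 (y - A0).
  rewrite /x /y; nra.
rewrite ExD; [|exact: intbleZ sd.2|exact: intble_cst].
rewrite ExZ ?Ex_cst; last exact: sd.2.
by have L2 := sqr_ge0 L; have := ler_wpM2l L2 h1; have := ler_wpM2l L2 h2; lra.
Qed.

(** The running maximum is inside the expectation, so each martingale is replaced by the variable of
    [doob_bound], which dominates its square at all times up to [k]. *)
Lemma mse_recursion k : (k <= n)%N -> mse k <=
  gron_rate * (delta * \sum_(i < k) mse i) +
  (48 * d%:R * T ^+ 2 * L ^+ 2 * LX ^+ 2 +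
    16 * m%:R * T * (3 * A0 ^+ 2 + 12 * L ^+ 2 * LX ^+ 2 * T ^+ 2)) * (delta ^+ 2 + eps ^+ 2).
Proof.
move=> kn; have d0 := delta_gt0; have e0 : 0 <= eps by rewrite ltW; case/andP: eps01.
have sdel : Num.sqrt delta ^+ 2 = delta by rewrite sqr_sqrtr // ltW.
have lt_n (i : 'I_k) : (i < n)%N by exact: leq_trans (ltn_ord i) kn.
have noise a := brownian_gaussian_noise uF bB k a delta_gt0.
have /choice[U UP] (la : 'I_d * 'I_m) : exists U : O -> R, [/\ intble P U,
    forall j w, (j <= k)%N -> msum (dB la.2) (S la.1 la.2) j w ^+ 2 <= U w &
    Ex P U <= 8 * (delta * \sum_(i < k) Ex P (fun w => S la.1 la.2 i w ^+ 2))].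
  rewrite -{1}sdel; apply: (doob_bound (noise la.2)) => i ik.
    by apply: (coef_adapted _ _ la.1 la.2 lips); [exact: leq_trans kn|apply: good_upto; exact: leq_trans kn].
  by apply: (coef_sqint _ _ la.1 la.2 lips); [exact: leq_trans kn|apply: good_upto; exact: leq_trans kn].
pose V w := 2 * d%:R * T * (delta * \sum_(i < k) tau i w ^+ 2)
    + 2 * eps ^+ 2 * m%:R * \sum_l \sum_a U (l, a) w.
have hV w : pmax (err w) k ^+ 2 <= V w.
  have : pmax (err w) k <= Num.sqrt (V w).
    apply: pmax_le => j jk; rewrite -[err w j]ger0_norm ?hsnorm_ge0 // -sqrtr_sqr.
    apply: ler_wsqrtr; apply: (@err_sqr_le j k w (fun l a => U (l, a))) => // l a.
    by have [_ h _] := UP (l, a); exact: h.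
  have V0 : 0 <= V w.
    apply: le_trans (sqr_ge0 (err w 0)) _.
    by apply: (@err_sqr_le 0 k w (fun l a => U (l, a))) => // l a; have [_ h _] := UP (l, a); exact: h.
  by move=> h; rewrite -[V w]sqr_sqrtr // lerXn2r ?nnegrE ?pmax_err_ge0 ?sqrtr_ge0.
have itau : intble P (fun w => \sum_(i < k) tau i w ^+ 2).
  by apply: intble_sum => i; exact: (Ex_tau_sqr (lt_n i)).1.
have iU : intble P (fun w => \sum_l \sum_a U (l, a) w).
  by apply: intble_sum => l; apply: intble_sum => a; have [] := UP (l, a).
have iV : intble P V by apply: intbleD; do ?apply: intbleZ.
have mV : mse k <= Ex P V by apply: Ex_le => //; exact: (pmax_err_sqint_all kn).2.
apply: (le_trans mV); rewrite /V ExD; [|by do ?apply: intbleZ|by do ?apply: intbleZ].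
rewrite !ExZ //; last exact: intbleZ.
rewrite Ex_sum; last by move=> i; exact: (Ex_tau_sqr (lt_n i)).1.
have E1 : \sum_(i < k) Ex P (fun w => tau i w ^+ 2) <=
    12 * L ^+ 2 * \sum_(i < k) mse i + k%:R * (24 * L ^+ 2 * LX ^+ 2 * delta ^+ 2).
  have -> : k%:R * (24 * L ^+ 2 * LX ^+ 2 * delta ^+ 2) = \sum_(i < k) (24 * L ^+ 2 * LX ^+ 2 * delta ^+ 2).
    by rewrite sumr_const card_ord mulr_natl.
  rewrite mulr_sumr -big_split /=; apply: ler_sum => i _.
  by apply: (le_trans (Ex_tau_sqr (lt_n i)).2); rewrite le_eqVlt; apply/orP; left; apply/eqP; ring.
have E2 : Ex P (fun w => \sum_l \sum_a U (l, a) w) <=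
    8 * delta * (12 * L ^+ 2 * \sum_(i < k) mse i + k%:R * (3 * A0 ^+ 2 + 12 * L ^+ 2 * LX ^+ 2 * delta ^+ 2)).
  rewrite Ex_sum; last by move=> l; apply: intble_sum => a; have [] := UP (l, a).
  apply: (@le_trans _ _ (\sum_l \sum_a 8 * (delta * \sum_(i < k) Ex P (fun w => S l a i w ^+ 2)))).
    apply: ler_sum => l _; rewrite Ex_sum; last by move=> a; have [] := UP (l, a).
    by apply: ler_sum => a _; have [] := UP (l, a).
  have -> : \sum_l \sum_a 8 * (delta * \sum_(i < k) Ex P (fun w => S l a i w ^+ 2)) =
     8 * delta * \sum_(i < k) \sum_l \sum_a Ex P (fun w => S l a i w ^+ 2).
    rewrite exchange_big /= mulr_sumr exchange_big /=.
    rewrite [in RHS](eq_bigr (fun i : 'I_k => \sum_l \sum_a 8 * delta * Ex P (fun w => S l a i w ^+ 2))); last first.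
      by move=> i _; rewrite mulr_sumr; apply: eq_bigr => l _; rewrite mulr_sumr.
    rewrite [RHS]exchange_big /=; apply: eq_bigr => l _.
    rewrite [RHS]exchange_big /=; apply: eq_bigr => a _.
    by rewrite -mulr_sumr mulrA.
  rewrite ler_wpM2l ?mulr_ge0 ?(ltW d0) //.
  have -> : k%:R * (3 * A0 ^+ 2 + 12 * L ^+ 2 * LX ^+ 2 * delta ^+ 2) =
      \sum_(i < k) (3 * A0 ^+ 2 + 12 * L ^+ 2 * LX ^+ 2 * delta ^+ 2).
    by rewrite sumr_const card_ord mulr_natl.
  rewrite mulr_sumr -big_split /=; apply: ler_sum => i _.
  by apply: (le_trans (Ex_sigma_sqr (lt_n i))); rewrite le_eqVlt; apply/orP; left; apply/eqP; ring.
have kT : 0 <= k%:R * delta <= T := grid_le_T kn.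
have dT : delta <= T.
  by have := grid_le_T n_gt0; rewrite mul1r => /andP[].
have M0 : 0 <= \sum_(i < k) mse i by apply: sumr_ge0 => i _; exact: mse_ge0.
have e1 : eps <= 1 by rewrite ltW //; case/andP: eps01.
have L2 := sqr_ge0 L; have X2 := sqr_ge0 LX; have A2 := sqr_ge0 A0.
by apply: (mse_arith _ _ (ltW T_gt0) (ltW d0) e0 L2 X2 A2 M0 kT dT e1 E1 E2); exact: ler0n.
Qed.

Lemma gron_const_ge0 : 0 <= gron_const.
Proof.
have L2 := sqr_ge0 L; have X2 := sqr_ge0 LX; have A2 := sqr_ge0 A0; have T0 := ltW T_gt0.
apply: mulr_ge0 (expR_ge0 _).
have h : 0 <= 3 * A0 ^+ 2 + 12 * L ^+ 2 * LX ^+ 2 * T ^+ 2.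
  apply: addr_ge0; first by apply: mulr_ge0 => //; exact: ler0n.
  by apply: mulr_ge0 (sqr_ge0 T); apply: mulr_ge0 X2; apply: mulr_ge0 L2; exact: ler0n.
apply: addr_ge0; last first.
  by apply: mulr_ge0 h; apply: mulr_ge0 T0; apply: mulr_ge0; exact: ler0n.
apply: mulr_ge0 X2; apply: mulr_ge0 L2; apply: mulr_ge0 (sqr_ge0 T).
by apply: mulr_ge0; exact: ler0n.
Qed.

Lemma scheme_error : mse n <= gron_const * (delta ^+ 2 + eps ^+ 2).
Proof.
have d0 := delta_gt0.
have L2 := sqr_ge0 L; have T0 := ltW T_gt0.
have c0 : 0 <= gron_rate.
  apply: addr_ge0; apply: mulr_ge0 L2.
    by apply: mulr_ge0 T0; apply: mulr_ge0; exact: ler0n.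
  by apply: mulr_ge0; exact: ler0n.
have D0 := gron_const_ge0; rewrite /gron_const pmulr_lge0 ?expR_gt0 // in D0.
have s0 : 0 <= delta ^+ 2 + eps ^+ 2 by rewrite addr_ge0 // sqr_ge0.
have := discrete_gronwall c0 (mulr_ge0 D0 s0) (ltW d0) mse_recursion (leqnn n).
by rewrite nT /gron_const mulrAC.
Qed.

End scheme_analysis.

(** * Stochastic sums and the Ito integral *)

Section brownian_sums.
Context {d} {O : measurableType d} {R : realType}.
Variables (P : probability O R) (F : R -> set (set O)).
Context {m : nat} (B : R -> O -> 'cV[R]_m).
Hypotheses (uF : usual_filtration P F) (bB : brownian P F B).
Variables (n : nat) (delta : R).
Hypothesis delta_gt0 : 0 < delta.

Definition grid_incr (k : nat) (w : O) : 'cV[R]_m :=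
  B (k.+1%:R * delta) w - B (k%:R * delta) w.

Definition mxsum a (f : nat -> O -> 'M[R]_(a, m)) (w : O) : 'cV[R]_a :=
  \sum_(k < n) f k w *m grid_incr k w.

Lemma mxsum_entry a (f : nat -> O -> 'M[R]_(a, m)) w l : mxsum f w l 0 =
  \sum_i msum (fun k w => grid_incr k w i 0) (fun k w => f k w l i) n w.
Proof.
rewrite summxE exchange_big /=; apply: eq_bigr => k _.
by rewrite mxE.
Qed.

Section adapted_integrand.
Variables (a : nat) (f : nat -> O -> 'M[R]_(a, m)).
Hypothesis fG : forall k l i, (k < n)%N -> adapted (F (k%:R * delta)) (fun w => f k w l i).

Lemma measurable_mxsum : measurable_mx (mxsum f).
Proof.
move=> l j; rewrite ord1; under eq_fun do rewrite mxsum_entry.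
apply: measurable_sum => i.
have noise := brownian_gaussian_noise uF bB n i delta_gt0.
have [_ Gs _ _ _] := noise; have [sG Gm] := Gs n (leqnn n).
by apply: (adapted_measurable sG Gm); apply: (msum_adapted noise _ (leqnn n)) => k kn; exact: fG.
Qed.

Lemma mxsum_sqr : (forall k l i, (k < n)%N -> sqint P (fun w => f k w l i)) ->
  intble P (fun w => hsnorm (mxsum f w) ^+ 2) /\
  Ex P (fun w => hsnorm (mxsum f w) ^+ 2) <=
    m%:R * (delta * \sum_(k < n) Ex P (fun w => hsnorm (f k w) ^+ 2)).
Proof.
move=> f2.
pose I l i := msum (fun k w => grid_incr k w i 0) (fun k w => f k w l i) n.
have iso l i : sqint P (I l i) /\
    Ex P (fun w => I l i w ^+ 2) = delta * \sum_(k < n) Ex P (fun w => f k w l i ^+ 2).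
  have := msum_sqr (brownian_gaussian_noise uF bB n i delta_gt0)
    (fun k kn => fG l i kn) (fun k kn => f2 k l i kn) (leqnn n).
  by rewrite sqr_sqrtr // ltW.
have ub w : hsnorm (mxsum f w) ^+ 2 <= m%:R * \sum_l \sum_i I l i w ^+ 2.
  rewrite sqr_hsnorm mulr_sumr; apply: ler_sum => l _; rewrite big_ord1 mxsum_entry.
  have := sum_cauchy_schwarz (fun=> 1 : R) (fun i : 'I_m => I l i w).
  under eq_bigr do rewrite mul1r; move=> /le_trans; apply.
  by under eq_bigr do rewrite expr1n; rewrite sumr_const card_ord.
have iub : intble P (fun w => m%:R * \sum_l \sum_i I l i w ^+ 2).
  apply: intbleZ; apply: intble_sum => l; apply: intble_sum => i.
  exact: (iso l i).1.2.
have i1 : intble P (fun w => hsnorm (mxsum f w) ^+ 2).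
  apply: (intble_le _ _ iub) => [|w]; last by rewrite ger0_norm ?sqr_ge0.
  by apply: measurable_funX; apply: measurable_hsnorm; exact: measurable_mxsum.
split=> //; apply: (le_trans (Ex_le i1 iub ub)).
rewrite ExZ; last first.
  by apply: intble_sum => l; apply: intble_sum => i; exact: (iso l i).1.2.
rewrite ler_wpM2l // Ex_sum; last first.
  by move=> l; apply: intble_sum => i; exact: (iso l i).1.2.
have -> : \sum_(k < n) Ex P (fun w => hsnorm (f k w) ^+ 2) =
    \sum_(k < n) \sum_l \sum_i Ex P (fun w => f k w l i ^+ 2).
  apply: eq_bigr => k _; under [X in Ex _ X]eq_fun do rewrite sqr_hsnorm.
  rewrite Ex_sum => [|l]; last by apply: intble_sum => i; exact: (f2 k l i (ltn_ord k)).2.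
  by apply: eq_bigr => l _; rewrite Ex_sum // => i; exact: (f2 k l i (ltn_ord k)).2.
rewrite exchange_big mulr_sumr; apply: ler_sum => l _ /=.
rewrite Ex_sum => [|i]; last exact: (iso l i).1.2.
rewrite exchange_big mulr_sumr; apply: ler_sum => i _ /=.
by rewrite (iso l i).2.
Qed.

Lemma mxsum_bounded (c : R) : (forall k w, (k < n)%N -> hsnorm (f k w) <= c) ->
  intble P (fun w => hsnorm (mxsum f w) ^+ 2) /\
  Ex P (fun w => hsnorm (mxsum f w) ^+ 2) <= m%:R * (n%:R * delta * c ^+ 2).
Proof.
move=> fc.
have mf k l i : (k < n)%N -> measurable_fun setT (fun w => f k w l i).
  move=> kn; have [_ Gs _ _ _] := brownian_gaussian_noise uF bB n i delta_gt0.
  have [sG Gm] := Gs k (ltnW kn); exact: (adapted_measurable sG Gm (fG l i kn)).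
have f2 k l i : (k < n)%N -> sqint P (fun w => f k w l i).
  move=> kn; apply: (@sqint_le _ _ _ P _ (fun=> c)); first exact: mf.
    by move=> w; apply: (le_trans (hsnorm_entry _ _ _)); exact: fc.
  exact: sqint_cst.
have [i1 E1] := mxsum_sqr f2; split=> //; apply: (le_trans E1).
rewrite ler_wpM2l // [leRHS]mulrAC [leRHS]mulrC; apply: ler_wpM2l; first exact: ltW.
apply: (@le_trans _ _ (\sum_(k < n) c ^+ 2)); last by rewrite sumr_const card_ord mulr_natl.
apply: ler_sum => k _; rewrite -[leRHS](Ex_cst P); apply: Ex_le; last first.
- move=> w; have h := fc k w (ltn_ord k).
  by rewrite lerXn2r ?nnegrE // (le_trans _ h).
- exact: intble_cst.
under eq_fun do rewrite sqr_hsnorm.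
by apply: intble_sum => l; apply: intble_sum => i; exact: (f2 k l i (ltn_ord k)).2.
Qed.

End adapted_integrand.

Lemma mxsum_grid_step a (f : R -> 'M[R]_(a, m)) w :
  mxsum (fun k _ => f (k%:R * delta)) w =
  step_integral B [seq ((k%:R * delta, k.+1%:R * delta), f (k%:R * delta)) | k <- iota 0 n] w.
Proof.
have e : iota 0 n = index_iota 0 n by rewrite /index_iota subn0.
by rewrite /step_integral big_map e big_mkord.
Qed.

Lemma step_fun_grid a (f : R -> 'M[R]_(a, m)) t : 0 < t <= n%:R * delta ->
  exists2 k, (k < n)%N & k%:R * delta < t <= k.+1%:R * delta /\
  step_fun [seq ((k%:R * delta, k.+1%:R * delta), f (k%:R * delta)) | k <- iota 0 n] t =
    f (k%:R * delta).
Proof.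
move=> /andP[t0 tn].
have ex : exists k, t <= k%:R * delta by exists n.
(* The least grid index not before [t]; the cell that ends there is the only one containing [t]. *)
pose K := ex_minn ex.
have [tK Kmin] : t <= K%:R * delta /\ forall j, t <= j%:R * delta -> (K <= j)%N.
  by rewrite /K; case: ex_minnP.
have K0 : (0 < K)%N.
  rewrite lt0n; apply/eqP => e; move: tK; rewrite e mul0r; lra.
have Kn : (K <= n)%N by exact: Kmin.
have lK : K.-1%:R * delta < t.
  rewrite ltNge; apply/negP => /Kmin; rewrite leqNgt => /negP; apply.
  by rewrite prednK.
exists K.-1; first by rewrite prednK.
rewrite prednK //; split; first by rewrite lK tK.
have Kio : K.-1 \in iota 0 n by rewrite mem_iota /= prednK.
rewrite /step_fun big_map /= big_mkcond /= (bigD1_seq _ Kio (iota_uniq _ _)) /=.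
rewrite prednK // lK tK /= big1_seq ?addr0 // => j /andP[jK _].
case: ifP => // /andP[jt tj]; case/negP: jK.
rewrite -eqSS prednK //; apply/eqP/anti_leq; rewrite Kmin // andbT.
have : j%:R < K%:R :> R by rewrite -(ltr_pM2r delta_gt0) (lt_le_trans jt).
by rewrite ltr_nat.
Qed.

End brownian_sums.

(** * Riemann sums for the Ito integral *)

Section ito_riemann.
Context {d} {O : measurableType d} {R : realType}.
Variables (P : probability O R) (F : R -> set (set O)).
Context {m : nat} (B : R -> O -> 'cV[R]_m).
Hypotheses (uF : usual_filtration P F) (bB : brownian P F B).

Lemma step_fun_cat a (S S' : seq (R * R * 'M[R]_(a, m))) t :
  step_fun (S ++ S') t = step_fun S t + step_fun S' t.
Proof. by rewrite /step_fun big_cat. Qed.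

Lemma step_integral_cat a (S S' : seq (R * R * 'M[R]_(a, m))) w :
  step_integral B (S ++ S') w = step_integral B S w + step_integral B S' w.
Proof. by rewrite /step_integral big_cat. Qed.

Definition step_opp a (S : seq (R * R * 'M[R]_(a, m))) : seq (R * R * 'M[R]_(a, m)) :=
  [seq (q.1, - q.2) | q <- S].

Lemma step_fun_opp a (S : seq (R * R * 'M[R]_(a, m))) t :
  step_fun (step_opp S) t = - step_fun S t.
Proof. by rewrite /step_fun big_map /= sumrN. Qed.

Lemma step_integral_opp a (S : seq (R * R * 'M[R]_(a, m))) w :
  step_integral B (step_opp S) w = - step_integral B S w.
Proof.
by rewrite /step_integral big_map -sumrN; apply: eq_bigr => q _; rewrite mulNmx.
Qed.

Lemma measurable_step_fun a (S : seq (R * R * 'M[R]_(a, m))) i j :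
  measurable_fun setT (fun t => step_fun S t i j).
Proof.
have -> : (fun t => step_fun S t i j) =
    (fun t => \sum_(q <- S) q.2 i j * (q.1.1 < t <= q.1.2)%R%:R).
  apply: funext => t; rewrite /step_fun summxE big_mkcond /=; apply: eq_bigr => q _.
  by case: ifP => _; rewrite ?mulr1 ?mulr0.
apply: measurable_sum => q; apply: measurable_funM => //.
rewrite (_ : (fun t => _) = \1_`]q.1.1, q.1.2]); first exact: measurable_indic.
by apply: funext => t; rewrite indicE mem_setE in_itv.
Qed.

(** The grid sum is itself the integral of a step function; its difference with the k-th
    approximation of [f] is again one, and the isometry bound applies to it. Letting k tend to
    infinity leaves the grid error alone: the constant is [2 * m * 2], one 2 for each splitting of a
    square. *)
Lemma ito_riemann a (T delta Lf : R) (n : nat) (f : R -> 'M[R]_(a, m)) (Z : O -> 'cV[R]_a) :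
  0 < delta -> n%:R * delta = T -> 0 <= Lf ->
  (forall s t, 0 <= s <= T -> 0 <= t <= T -> hsnorm (f s - f t) <= Lf * `|s - t|) ->
  is_ito_integral P B T f Z ->
  (\int[P]_w (hsnorm (mxsum B n delta (fun k _ => f (k%:R * delta)) w - Z w) ^+ 2)%:E <=
    (4 * m%:R * T * (Lf * delta) ^+ 2)%:E)%E.
Proof.
move=> d0 nT Lf0 fL [mZ [S [aS Sf SZ]]].
have T0 : 0 <= T by rewrite -nT mulr_ge0 // ltW.
pose G := [seq ((k%:R * delta, k.+1%:R * delta), f (k%:R * delta)) | k <- iota 0 n].
have aG : all (fun q : R * R * 'M[R]_(a, m) => [&& 0 <= q.1.1, q.1.1 <= q.1.2 & q.1.2 <= T]) G.
  apply/allP => _ /mapP[k + ->] /=; rewrite mem_iota /= add0n => kn.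
  by rewrite mulr_ge0 ?(ltW d0) // ler_pM2r // ler_nat leqnSn -nT ler_pM2r // ler_nat.
have Gf t : 0 < t <= T -> hsnorm (step_fun G t - f t) <= Lf * delta.
  rewrite -nT => tI; have [k kn [/andP[k1 k2] ->]] := step_fun_grid d0 f tI.
  have kk : k%:R * delta <= n%:R * delta by rewrite ler_pM2r // ler_nat ltnW.
  case/andP: tI => t0 tn; rewrite -nT in fL; apply: (le_trans (fL _ _ _ _)).
  - by rewrite kk mulr_ge0 // ltW.
  - by rewrite (ltW t0).
  rewrite ler_wpM2l // distrC ger0_norm ?subr_ge0 ?(ltW k1) //.
  by move: k2; rewrite -natr1 mulrDl mul1r; lra.
have mf i j : measurable_fun (`]0, T]%classic : set R) (fun t => f t i j).
  apply: (@measurable_funS _ _ _ _ `[0, T]%classic) => //.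
    by move=> t /=; rewrite !in_itv /= => /andP[/ltW -> ->].
  apply: subspace_continuous_measurable_fun => //.
  by apply: lip_on_continuous; exists Lf.
have mSf (U : seq (R * R * 'M[R]_(a, m))) :
    measurable_fun (`]0, T]%classic : set R) (fun t => (hsnorm (step_fun U t - f t) ^+ 2)%:E).
  apply/measurable_EFinP.
  rewrite (_ : (fun t => _) = (fun t => \sum_i \sum_j (step_fun U t i j - f t i j) ^+ 2)); last first.
    apply: funext => t; rewrite sqr_hsnorm; apply: eq_bigr => i _; apply: eq_bigr => j _.
    by rewrite !mxE.
  apply: measurable_sum => i; apply: measurable_sum => j; apply: measurable_funX.
  apply: measurable_funB => //.
  by apply: measurable_funTS; exact: measurable_step_fun.
have mSS (U : seq (R * R * 'M[R]_(a, m))) :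
    measurable_fun setT (fun t => (hsnorm (step_fun U t) ^+ 2)%:E).
  apply/measurable_EFinP; apply: measurable_funX; apply: measurable_hsnorm => i j.
  exact: measurable_step_fun.
have c0 : 0 <= 2 * (Lf * delta) ^+ 2 by rewrite mulr_ge0 // sqr_ge0.
have est k : (\int[P]_w (hsnorm (mxsum B n delta (fun k _ => f (k%:R * delta)) w - Z w) ^+ 2)%:E
    <= 2%:E * (m%:R%:E * ((2 * (Lf * delta) ^+ 2 * T)%:E +
     2%:E * \int[lebesgue_measure]_(t in `[0%R, T]) (hsnorm (step_fun (S k) t - f t) ^+ 2)%:E))
     + 2%:E * \int[P]_w ((hsnorm (step_integral B (S k) w - Z w) ^+ 2)%:E))%E.
  have aU : all (fun q : R * R * 'M[R]_(a, m) => [&& 0 <= q.1.1, q.1.1 <= q.1.2 & q.1.2 <= T])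
      (G ++ step_opp (S k)) by rewrite all_cat aG /= all_map; exact: aS.
  have [iU EU] := step_integral_sqr uF bB aU.
  have [iS _] := step_integral_sqr uF bB (aS k).
  have mstep (U : seq (R * R * 'M[R]_(a, m))) :
      all (fun q : R * R * 'M[R]_(a, m) => [&& 0 <= q.1.1, q.1.1 <= q.1.2 & q.1.2 <= T]) U ->
      measurable_mx (step_integral B U).
    move=> /allP aUU i j; rewrite ord1 /step_integral.
    rewrite (_ : (fun w => _) = (fun w => \sum_(q <- U) (if q \in U then (q.2 *m (B q.1.2 w - B q.1.1 w)) i 0 else 0))); last first.
      by apply: funext => w; rewrite summxE !big_seq; apply: eq_bigr => q ->.
    apply: measurable_sum => q; have [/aUU /and3P[q0 q1 q2]|_] := boolP (q \in U); last exact: measurable_cst.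
    under eq_fun do rewrite mxE.
    apply: measurable_sum => l; apply: measurable_funM => //.
    have q3 := le_trans q0 q1; have [sG Gm] := filtration_sigma uF q3.
    exact: (adapted_measurable sG Gm (brownian_increment_adapted uF bB l q0 q1)).
  have mZ' : measurable_mx Z by move=> i j; rewrite ord1.
  have m1 : measurable_fun setT (fun w => (hsnorm (step_integral B (G ++ step_opp (S k)) w) ^+ 2)%:E).
    by apply/measurable_EFinP; exact: intble_meas iU.
  have m2 : measurable_fun setT (fun w => (hsnorm (step_integral B (S k) w - Z w) ^+ 2)%:E).
    apply/measurable_EFinP; apply: measurable_funX; apply: measurable_hsnorm.
    by apply: measurable_mxB => //; exact: mstep.
  apply: (@le_trans _ _ (\int[P]_w (2%:E * (hsnorm (step_integral B (G ++ step_opp (S k)) w) ^+ 2)%:E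
      + 2%:E * (hsnorm (step_integral B (S k) w - Z w) ^+ 2)%:E))%E).
    apply: ge0_le_integral => //.
    - by move=> w _; rewrite lee_fin sqr_ge0.
    - apply/measurable_EFinP; apply: measurable_funX; apply: measurable_hsnorm.
      apply: measurable_mxB => //; rewrite (_ : mxsum B n delta _ = step_integral B G); first exact: mstep.
      by apply: funext => w; exact: mxsum_grid_step.
    - by apply: emeasurable_funD; apply: measurable_funeM.
    move=> w _; rewrite -!EFinM -EFinD lee_fin mxsum_grid_step.
    rewrite step_integral_cat step_integral_opp.
    set x := step_integral B _ w; set y := step_integral B _ w.
    have -> : x - Z w = (x - y) + (y - Z w) by rewrite addrA subrK.
    exact: sqr_hsnormD_le.
  rewrite ge0_integralD //; last first.
  - exact: measurable_funeM.
  - by move=> w _; rewrite -EFinM lee_fin mulr_ge0 // sqr_ge0.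
  - exact: measurable_funeM.
  - by move=> w _; rewrite -EFinM lee_fin mulr_ge0 // sqr_ge0.
  apply: leeD; last first.
    by rewrite ge0_integralZl_EFin // => w _; rewrite lee_fin sqr_ge0.
  rewrite ge0_integralZl_EFin //; last by move=> w _; rewrite lee_fin sqr_ge0.
  apply: lee_wpmul2l; first by rewrite lee_fin.
  rewrite Ex_EFin //; apply: (le_trans EU); apply: lee_wpmul2l; first by rewrite lee_fin.
  (* The time 0 is removed: step functions vanish there, their intervals being open on the left, so
     the grid step function need not be close to [f] at 0. *)
  rewrite -!integral_itv_obnd_cbnd; [|exact: mSf|by apply: measurable_funTS; exact: mSS].
  have -> : (2 * (Lf * delta) ^+ 2 * T)%:E =
      (\int[lebesgue_measure]_(t in `]0%R, T]) (2 * (Lf * delta) ^+ 2)%:E)%E.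
    rewrite integral_cst //= lebesgue_measure_itv /= lte_fin.
    case: ltP => h; first by rewrite -EFinB subr0 -EFinM.
    have -> : T = 0 by apply/eqP; rewrite eq_le h.
    by rewrite mulr0 mule0.
  rewrite -ge0_integralZl_EFin //; [|by move=> t _; rewrite lee_fin sqr_ge0|exact: mSf].
  rewrite -ge0_integralD //; last first.
  - by apply: measurable_funeM; exact: mSf.
  - by move=> t _; rewrite -EFinM lee_fin mulr_ge0 // sqr_ge0.
  apply: ge0_le_integral => //.
  - by move=> t _; rewrite lee_fin sqr_ge0.
  - by apply: measurable_funTS; exact: mSS.
  - by apply: emeasurable_funD => //; apply: measurable_funeM; exact: mSf.
  move=> t; rewrite /= in_itv /= => tI; rewrite -EFinM -EFinD lee_fin.
  rewrite step_fun_cat step_fun_opp.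
  have -> : step_fun G t - step_fun (S k) t = (step_fun G t - f t) - (step_fun (S k) t - f t).
    by rewrite opprB addrA subrK.
  apply: (le_trans (sqr_hsnormD_le _ _)); rewrite hsnormN lerD2r ler_wpM2l //.
  by rewrite lerXn2r ?nnegrE ?mulr_ge0 ?(ltW d0) // Gf.
have lim : (2%:E * (m%:R%:E * ((2 * (Lf * delta) ^+ 2 * T)%:E +
     2%:E * \int[lebesgue_measure]_(t in `[0%R, T]) (hsnorm (step_fun (S k) t - f t) ^+ 2)%:E))
     + 2%:E * \int[P]_w ((hsnorm (step_integral B (S k) w - Z w) ^+ 2)%:E))%E @[k --> \oo] -->
     (2%:E * (m%:R%:E * ((2 * (Lf * delta) ^+ 2 * T)%:E + 2%:E * 0)) + 2%:E * 0)%E.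
  apply: cvgeD; first by rewrite !mule0 // adde0.
    apply: cvgeZl => //; apply: cvgeZl => //; apply: cvgeD => //.
      exact: cvg_cst.
    exact: cvgeZl.
  exact: cvgeZl.
have -> : (4 * m%:R * T * (Lf * delta) ^+ 2)%:E =
    (2%:E * (m%:R%:E * ((2 * (Lf * delta) ^+ 2 * T)%:E + 2%:E * 0)) + 2%:E * 0)%E.
  by rewrite !mule0 !adde0 -!EFinM; congr (_%:E); ring.
apply: (cvge_to_ge lim); exact: nearW.
Qed.

End ito_riemann.

(** * Quadratic forms and integrals *)

Section quadratic_forms.
Context {R : realType}.

Definition form {a} (A : 'M[R]_a) (x y : 'cV[R]_a) : R := (x^T *m A *m y) 0 0.

Lemma formDl a (A : 'M[R]_a) x y z : form A (x + y) z = form A x z + form A y z.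
Proof. by rewrite /form linearD /= !mulmxDl mxE. Qed.

Lemma formDr a (A : 'M[R]_a) x y z : form A x (y + z) = form A x y + form A x z.
Proof. by rewrite /form mulmxDr mxE. Qed.

Lemma formZl a (A : 'M[R]_a) k x y : form A (k *: x) y = k * form A x y.
Proof. by rewrite /form linearZ /= -!scalemxAl mxE. Qed.

Lemma formZr a (A : 'M[R]_a) k x y : form A x (k *: y) = k * form A x y.
Proof. by rewrite /form -scalemxAr mxE. Qed.

Lemma formN a (A : 'M[R]_a) x : form A (- x) (- x) = form A x x.
Proof. by rewrite -scaleN1r formZl formZr !mulN1r opprK. Qed.

Lemma formBl a (A : 'M[R]_a) x y z : form A (x - y) z = form A x z - form A y z.
Proof. by rewrite formDl -scaleN1r formZl mulN1r. Qed.

Lemma formBr a (A : 'M[R]_a) x y z : form A x (y - z) = form A x y - form A x z.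
Proof. by rewrite formDr -scaleN1r formZr mulN1r. Qed.

Lemma formBA a (A A' : 'M[R]_a) x y : form (A - A') x y = form A x y - form A' x y.
Proof. by rewrite /form mulmxBr mulmxBl !mxE. Qed.

Lemma form_sym a (A : 'M[R]_a) x y : A^T = A -> form A x y = form A y x.
Proof.
move=> AT; rewrite /form; transitivity ((x^T *m A *m y)^T 0 0); first by rewrite [RHS]mxE.
by rewrite !trmx_mul trmxK AT mulmxA.
Qed.

Lemma form_norm_le a (A : 'M[R]_a) x y : `|form A x y| <= hsnorm x * hsnorm A * hsnorm y.
Proof. exact: hsnorm_bilin. Qed.

Lemma form_dist a (A A' : 'M[R]_a) x y : `|form A x x - form A' y y| <=
  hsnorm (x - y) * hsnorm A * (hsnorm x + hsnorm y) + hsnorm (A - A') * hsnorm y ^+ 2.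
Proof.
have -> : form A x x - form A' y y =
    form A x (x - y) + form A (x - y) y + form (A - A') y y.
  by rewrite formBl formBr formBA; ring.
have h1 := form_norm_le A x (x - y); have h2 := form_norm_le A (x - y) y.
have h3 := form_norm_le (A - A') y y.
apply: (le_trans (ler_normD _ _)); apply: lerD; last first.
  by apply: (le_trans h3); rewrite expr2 mulrA [X in X * _]mulrC.
apply: (le_trans (ler_normD _ _)); move: h1 h2.
move: (hsnorm _) (hsnorm _) (hsnorm _) (hsnorm _) => *; lra.
Qed.

Section positive_semidefinite.
Variables (a : nat) (A : 'M[R]_a).
Hypotheses (A_sym : A^T = A) (A_ge0 : forall x, 0 <= form A x x).

Lemma form_cauchy_schwarz x y : form A x y ^+ 2 <= form A x x * form A y y.
Proof.
have key (s : R) : 0 <= form A x x + 2 * s * form A x y + s ^+ 2 * form A y y.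
  have := A_ge0 (x + s *: y); rewrite formDl !formDr !formZl !formZr.
  by rewrite (form_sym y x A_sym); lra.
have c0 := A_ge0 y; have [c1|c1] := ltP 0 (form A y y).
  have := key (- (form A x y / form A y y)).
  set t := form A x y / _ => h.
  have tE : t * form A y y = form A x y by rewrite divfK ?gt_eqF.
  have := mulr_ge0 h c0; rewrite -tE; nra.
(* In the degenerate case the quadratic in [s] is affine, and an affine function that stays
   nonnegative has slope 0. *)
have c2 : form A y y = 0 by apply/eqP; rewrite eq_le c1 c0.
rewrite c2 mulr0 in key *; rewrite leNgt; apply/negP => h.
have h0 : form A x y != 0 by move: h; rewrite exprn_even_gt0.
have := key (- (form A x x + 1) / (2 * form A x y)).
have -> : 2 * (- (form A x x + 1) / (2 * form A x y)) * form A x y = - (form A x x + 1).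
  by field.
rewrite mulr0; lra.
Qed.

(** No spectral theory: Cauchy-Schwarz for the form with [y = A x] gives
    [|A x| ^ 2 <= |A| form x x], and [|x| <= |A ^-1| |A x|]. The added 1 keeps the constant
    positive. *)
Lemma form_coercive : A \in unitmx ->
  exists2 c : R, 0 < c & forall x, c * hsnorm x ^+ 2 <= form A x x.
Proof.
move=> uA; pose k := hsnorm (invmx A) ^+ 2 * hsnorm A + 1.
have k0 : 0 < k by rewrite ltr_wpDl // mulr_ge0 // sqr_ge0.
exists k^-1; first by rewrite invr_gt0.
move=> x; rewrite ler_pdivrMl //.
have h1 : hsnorm (A *m x) ^+ 2 <= hsnorm A * form A x x.
  have [->|nz] := eqVneq (hsnorm (A *m x)) 0; first by rewrite expr0n mulr_ge0.
  have y0 : 0 < hsnorm (A *m x) by rewrite lt_neqAle eq_sym nz hsnorm_ge0.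
  have := form_cauchy_schwarz x (A *m x).
  have -> : form A x (A *m x) = hsnorm (A *m x) ^+ 2.
    by rewrite -sqr_hsnorm_dot trmx_mul A_sym.
  have := form_norm_le A (A *m x) (A *m x); rewrite ger0_norm // => h2 h3.
  have f0 := A_ge0 x; have y2 : 0 < hsnorm (A *m x) ^+ 2 by rewrite exprn_gt0.
  rewrite -(ler_pM2r y2) -expr2; apply: (le_trans h3).
  by have := ler_wpM2l f0 h2; lra.
have h2 : hsnorm x ^+ 2 <= hsnorm (invmx A) ^+ 2 * hsnorm (A *m x) ^+ 2.
  rewrite -exprMn lerXn2r ?nnegrE ?mulr_ge0 // -{1}[x](mulKmx uA).
  exact: hsnormM.
apply: (le_trans h2); have := ler_wpM2l (sqr_ge0 (hsnorm (invmx A))) h1.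
by have := A_ge0 x; rewrite /k; lra.
Qed.

End positive_semidefinite.

Lemma inv_gram_sym a c (s : 'M[R]_(a, c)) : (invmx (s *m s^T))^T = invmx (s *m s^T).
Proof. by rewrite trmx_inv trmx_mul trmxK. Qed.

Lemma inv_gram_ge0 a c (s : 'M[R]_(a, c)) x : s *m s^T \in unitmx ->
  0 <= form (invmx (s *m s^T)) x x.
Proof.
move=> u; rewrite -[x](mulKVmx u) /form; set y := invmx _ *m x.
have -> : (s *m s^T *m y)^T *m invmx (s *m s^T) *m (s *m s^T *m y) = (s^T *m y)^T *m (s^T *m y).
  by rewrite -mulmxA mulKmx // !trmx_mul !trmxK !mulmxA.
by rewrite sqr_hsnorm_dot sqr_ge0.
Qed.

End quadratic_forms.

Section integral_bounds.
Context {R : realType} (T : R).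
Hypothesis T_ge0 : 0 <= T.
Local Notation mu := (@lebesgue_measure R).

Lemma integral_dist (f g : R -> R) (tau : R) :
  {within `[0, T], continuous f} -> {within `[0, T], continuous g} ->
  (forall t, 0 <= t <= T -> `|f t - g t| <= tau) ->
  `|\int[mu]_(t in `[0, T]) f t - \int[mu]_(t in `[0, T]) g t| <= tau * T.
Proof.
move=> cf cg fg.
have iF := continuous_integrable cf (lexx 0) (lexx T).
have iG := continuous_integrable cg (lexx 0) (lexx T).
rewrite -RintegralB //.
have cfg := within_continuousB cf cg.
have := @integral_increment R T (fun t => f t - g t) cfg 0 T 0 tau (lexx 0) T_ge0 (lexx T).
rewrite set_itv1 Rintegral_set1 !subr0 mul0r subr0; apply=> u uT.
by rewrite subr0; exact: fg.
Qed.

Lemma mx_integral_form a (f : R -> 'M[R]_a) x y :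
  (forall i j, {within `[0, T], continuous (fun t => f t i j)}) ->
  form (mx_integral T f) x y = \int[mu]_(t in `[0, T]) form (f t) x y.
Proof.
move=> cf.
have E t : form (f t) x y = \sum_i \sum_j (x i 0 * y j 0) * f t i j.
  rewrite /form mxE exchange_big /=; apply: eq_bigr => j _; rewrite mxE big_distrl /=.
  by apply: eq_bigr => i _; rewrite !mxE mulrAC.
have iF i j : mu.-integrable `[0, T] (EFin \o (fun t => f t i j)).
  exact: (@continuous_integrable R T (fun t => f t i j) (cf i j) 0 T (lexx 0) (lexx T)).
have iZ i j : mu.-integrable `[0, T] (EFin \o (fun t => x i 0 * y j 0 * f t i j)).
  exact: (integrableZl _ _ (iF i j)).
have sumI (I : Type) (r : seq I) (g : I -> R -> R) :
    (forall i, mu.-integrable `[0, T] (EFin \o g i)) ->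
    mu.-integrable `[0, T] (EFin \o (fun t => \sum_(i <- r) g i t)) /\
    \int[mu]_(t in `[0, T]) \sum_(i <- r) g i t = \sum_(i <- r) \int[mu]_(t in `[0, T]) g i t.
  move=> ig; elim: r => [|i r [ih1 ih2]].
    rewrite big_nil; split.
      rewrite (_ : _ \o _ = cst 0%E); first exact: integrable0.
      by apply: funext => t; rewrite /= big_nil.
    by rewrite -[RHS](mul0r (fine (mu `[0, T]%classic))) -Rintegral_cst //;
      apply: eq_Rintegral => t _; rewrite big_nil.
  have e : (fun t => \sum_(i <- i :: r) g i t) = (fun t => g i t + \sum_(i <- r) g i t).
    by apply: funext => t; rewrite big_cons.
  by rewrite e; split; [exact: (integrableD _ (ig i) ih1)|rewrite RintegralD // ih2 big_cons].
transitivity (\sum_i \sum_j x i 0 * y j 0 * \int[mu]_(t in `[0, T]) f t i j).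
  rewrite /form mxE exchange_big /=; apply: eq_bigr => j _; rewrite mxE big_distrl /=.
  by apply: eq_bigr => i _; rewrite !mxE mulrAC.
under [RHS]eq_Rintegral do rewrite E.
rewrite (sumI _ _ _ (fun i => (sumI _ _ _ (iZ i)).1)).2; apply: eq_bigr => i _.
rewrite (sumI _ _ _ (iZ i)).2; apply: eq_bigr => j _.
by rewrite RintegralZl.
Qed.

End integral_bounds.

(** * Limit contrast *)

(** Index 0 of [b], [c] and [x] refers to [theta0]; the [b] are drifts at the initial segment and
    the [c] those at another one. The variation of [Lambda] in theta at the other segment becomes
    the variation at the initial one plus terms with a uniform Lipschitz bound in theta. *)
Lemma lambda_diff {R : realType} {d p : nat} (b0 b1 b2 c0 c1 c2 : 'cV[R]_d)
    (g h : 'M[R]_(d, p)) (x0 x1 x2 : 'cV[R]_p) :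
  c0 - c2 - (c0 - c1) = (b1 - b2) + ((g - h) *m (x2 - x1)
    - (c2 - c0 - h *m (x2 - x0) - (b2 - b0 - g *m (x2 - x0))
      - (c1 - c0 - h *m (x1 - x0) - (b1 - b0 - g *m (x1 - x0))))).
Proof.
rewrite !(mulmxBr, mulmxBl); move: (g *m x0) (g *m x1) (g *m x2) (h *m x0) (h *m x1) (h *m x2).
by move=> *; apply/matrixP => i j; rewrite !mxE; ring.
Qed.

Section limit_contrast.
Context {R : realType} {r0 : R} {d m p : nat}.
Local Notation C := (cpath r0 d).
Local Notation PC := (probability C R).
Variables (Theta : set 'cV[R]_p) (theta0 : 'cV[R]_p).
Variables (b : C -> PC -> 'cV[R]_p -> 'cV[R]_d) (sigma : C -> PC -> 'M[R]_(d, m)).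
Variable gradb : C -> PC -> 'cV[R]_p -> 'M[R]_(d, p).
Variable hessb : C -> PC -> 'cV[R]_p -> 'I_p -> 'M[R]_(p, d).
Variables (T : R) (X0 : R -> 'cV[R]_d).
Hypotheses (r0_gt0 : 0 < r0) (T_gt0 : 0 < T).
Hypothesis cvTheta : convex_set (Theta : set (convex_lmodType 'cV[R]_p)).
Hypotheses (Theta0 : Theta theta0) (bdTheta : bounded_set Theta).
Hypothesis derb : theta_derivatives Theta b gradb hessb.
Variables (L LX : R).
Hypotheses (L_ge0 : 0 <= L) (LX_ge0 : 0 <= LX).
Hypothesis lipb : forall theta, closure Theta theta -> lip_coef (fun x mu => b x mu theta) L.
Hypothesis lipg : lip_coef (fun x mu => gradb x mu theta0) L.
Hypothesis liph : forall (x y : C) (mu nu : PC), finite_moment2 mu -> finite_moment2 nu ->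
  forall theta, closure Theta theta ->
  block_norm (fun k => hessb x mu theta k - hessb y nu theta k) <= L * (path_dist x y + W2 mu nu).
Hypothesis lipS : forall (x y : C) (mu nu : PC), finite_moment2 mu -> finite_moment2 nu ->
  sigma2 sigma x mu \in unitmx -> sigma2 sigma y nu \in unitmx ->
  hsnorm (sigma_hat sigma x mu - sigma_hat sigma y nu) <= L * (path_dist x y + W2 mu nu).
Hypothesis unit0 : forall x : C, sigma2 sigma x (dirac_law x) \in unitmx.
Hypothesis cX0 : {within `[- r0, T], continuous X0}.
Hypothesis lipX : forall s t, - r0 <= s <= T -> - r0 <= t <= T ->
  hsnorm (X0 s - X0 t) <= LX * `|s - t|.

Local Notation seg := (segment r0 X0).
Local Notation dseg t := (dirac_law (seg t)).
Local Notation rm := (rem theta0 b gradb).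
Let h (theta : 'cV[R]_p) := hsnorm (theta - theta0).

Let h_ge0 theta : 0 <= h theta.
Proof. exact: hsnorm_ge0. Qed.

#[local] Hint Resolve h_ge0 : core.

Lemma seg_dist s t : 0 <= s <= T -> 0 <= t <= T ->
  path_dist (seg s) (seg t) <= LX * `|s - t|.
Proof.
move=> sT tT; apply: (segment_dist_le r0_gt0 cX0 sT tT) => u uI.
apply: (le_trans (lipX (shift_in sT uI) (shift_in tT uI))).
by rewrite opprD addrACA subrr addr0.
Qed.

Lemma seg_kap s t : 0 <= s <= T -> 0 <= t <= T ->
  path_dist (seg s) (seg t) + W2 (dseg s) (dseg t) <= 2 * LX * `|s - t|.
Proof.
move=> sT tT; have := seg_dist sT tT; have := W2_dirac r0_gt0 (seg s) (seg t); lra.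
Qed.

Lemma seg_lip_on a c (f : C -> PC -> 'M[R]_(a, c)) : lip_coef f L ->
  lip_on T (fun t => f (seg t) (dseg t)).
Proof.
move=> fL; exists (2 * L * LX); first by rewrite !mulr_ge0.
move=> s t sT tT; apply: (le_trans (dirac_coef r0_gt0 _ _ L_ge0 fL)).
by rewrite -[leRHS]mulrA ler_wpM2l ?mulr_ge0 //; exact: seg_dist.
Qed.

Lemma S_lip_on : lip_on T (fun t => sigma_hat sigma (seg t) (dseg t)).
Proof.
exists (2 * L * LX); first by rewrite !mulr_ge0.
move=> s t sT tT; apply: (le_trans (lipS _ _ _ _)) => //; try exact: finite_moment2_dirac.
by have := ler_wpM2l L_ge0 (seg_kap sT tT); lra.
Qed.

Lemma Lambda_lip_on theta : closure Theta theta ->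
  lip_on T (fun t => Lambda b (seg t) (dseg t) theta theta0).
Proof.
move=> ct; apply: lip_onB; first exact: seg_lip_on (lipb (closure_theta0 Theta0)).
exact: seg_lip_on (lipb ct).
Qed.

Lemma LambdaE x mu theta :
  Lambda b x mu theta theta0 = - (gradb x mu theta0 *m (theta - theta0) + rm x mu theta).
Proof. by rewrite /rem /Lambda (addrC (_ *m _)) subrK opprB. Qed.

Lemma diameter : exists2 D : R, 0 < D & forall theta, closure Theta theta -> h theta <= D.
Proof.
have [|N NP] := @compact_uniform R p (closure Theta) (fun n theta => h theta <= n%:R)
  (closed_bounded_compact bdTheta).
  move=> theta ct; exists 1, (Num.truncn (h theta + 1)).+1; split=> // n y hn yt.
  have h0 : 0 <= h theta + 1 by rewrite addr_ge0.
  have /andP[_ /ltW h1] := truncn_itv h0.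
  have h2 := hsnorm_triB y theta theta0.
  have h3 : h theta + 1 <= n%:R by rewrite (le_trans h1) // ler_nat.
  by move: h2 yt h3; rewrite /h; lra.
by exists N.+1%:R => [|theta]; [rewrite ltr0n|exact: NP].
Qed.

Lemma rem_seg_dist s t theta : 0 <= s <= T -> 0 <= t <= T -> closure Theta theta ->
  hsnorm (rm (seg s) (dseg s) theta - rm (seg t) (dseg t) theta) <=
    2 * L * LX * `|s - t| * h theta ^+ 2.
Proof.
move=> sT tT ct.
have fm x := finite_moment2_dirac r0_gt0 (d := d) x.
apply: (le_trans (rem_diff_le r0_gt0 cvTheta Theta0 derb L_ge0 liph _ _ (fm _) (fm _) ct)).
rewrite ler_wpM2r ?sqr_ge0 //.
by have := ler_wpM2l L_ge0 (seg_kap sT tT); lra.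
Qed.

(** The bound is known at the initial segment; the difference of remainders between segments is
    quadratic in [h theta], and one factor is absorbed by the diameter [D]. *)
Lemma rem_seg_bound : exists2 c : R, 0 < c & forall t theta, 0 <= t <= T ->
  closure Theta theta -> hsnorm (rm (seg t) (dseg t) theta) <= c * h theta.
Proof.
have [c c0 cP] := rem_bound Theta0 derb (seg 0) bdTheta (finite_moment2_dirac r0_gt0 (seg 0)).
have [D D0 DP] := diameter.
exists (c + 2 * L * LX * T * D).
  by rewrite ltr_wpDr // mulr_ge0 ?(ltW D0) // mulr_ge0 ?(ltW T_gt0) // !mulr_ge0.
move=> t theta tT ct; have T0 := ltW T_gt0.
have z0 : 0 <= (0 : R) <= T by apply/andP; split.
apply: (le_trans (hsnorm_sub_le _ (rm (seg 0) (dseg 0) theta))).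
rewrite addrC mulrDl; apply: lerD; first exact: cP.
apply: (le_trans (rem_seg_dist tT z0 ct)).
case/andP: tT => t0 tT; rewrite subr0 ger0_norm // expr2 mulrA.
rewrite ler_wpM2r ?hsnorm_ge0 //; apply: ler_pM; rewrite ?hsnorm_ge0 ?DP //.
  by rewrite !mulr_ge0.
by rewrite ler_wpM2l // !mulr_ge0.
Qed.

Lemma rem_seg_small (e : R) : 0 < e -> exists2 r : R, 0 < r & forall t theta, 0 <= t <= T ->
  closure Theta theta -> h theta < r -> hsnorm (rm (seg t) (dseg t) theta) <= e * h theta.
Proof.
move=> e0; have e2 : 0 < e / 2 by rewrite divr_gt0.
have [r r_gt0 rP] := rem_small Theta0 derb (seg 0) (finite_moment2_dirac r0_gt0 (seg 0)) e2.
have T0 := ltW T_gt0.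
pose c := 2 * L * LX * T; have c0 : 0 <= c by rewrite !mulr_ge0.
exists (Num.min r (e / 2 / (c + 1))).
  by rewrite lt_min r_gt0 divr_gt0 // ltr_wpDl.
move=> t theta tT ct; rewrite lt_min => /andP[h1 h2].
have z0 : 0 <= (0 : R) <= T by apply/andP; split.
apply: (le_trans (hsnorm_sub_le _ (rm (seg 0) (dseg 0) theta))).
have -> : e * h theta = e / 2 * h theta + e / 2 * h theta by rewrite -mulrDl -splitr.
apply: lerD; last exact: rP.
apply: (le_trans (rem_seg_dist tT z0 ct)).
have h0 : 0 <= h theta by exact: hsnorm_ge0.
rewrite expr2 mulrA ler_wpM2r //.
move: h2; rewrite ltr_pdivlMr ?ltr_wpDl // => h2.
case/andP: tT => t0 tT; rewrite subr0 ger0_norm //.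
have : 2 * L * LX * t * h theta <= c * h theta by rewrite ler_wpM2r // ler_wpM2l // !mulr_ge0.
lra.
Qed.

Lemma S_bound : exists2 c : R, 0 < c & forall t, 0 <= t <= T ->
  hsnorm (sigma_hat sigma (seg t) (dseg t)) <= c.
Proof.
have [c c0 cP] := lip_on_bounded (ltW T_gt0) S_lip_on.
by exists (c + 1) => [|t /cP h1]; [rewrite ltr_wpDl|rewrite (le_trans h1) // lerDl].
Qed.

Lemma G_bound : exists2 c : R, 0 < c & forall t, 0 <= t <= T ->
  hsnorm (gradb (seg t) (dseg t) theta0) <= c.
Proof.
have [c c0 cP] := lip_on_bounded (ltW T_gt0) (seg_lip_on lipg).
by exists (c + 1) => [|t /cP h1]; [rewrite ltr_wpDl|rewrite (le_trans h1) // lerDl].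
Qed.

Let integrand theta t := form (sigma_hat sigma (seg t) (dseg t))
  (Lambda b (seg t) (dseg t) theta theta0) (Lambda b (seg t) (dseg t) theta theta0).

Lemma XiE theta : Xi b sigma theta0 T X0 theta =
  \int[lebesgue_measure]_(t in `[0, T]) integrand theta t.
Proof. by []. Qed.

Lemma integrand_continuous theta : closure Theta theta ->
  {within `[0, T], continuous (integrand theta)}.
Proof.
move=> ct; have T0 := ltW T_gt0.
apply: (@lip_on_continuous R T 1 1 (fun t => (Lambda b (seg t) (dseg t) theta theta0)^T
  *m sigma_hat sigma (seg t) (dseg t) *m Lambda b (seg t) (dseg t) theta theta0) 0 0).
apply: lip_onM => //; last exact: Lambda_lip_on.
apply: lip_onM => //; last exact: S_lip_on.
by apply: lip_onT; exact: Lambda_lip_on.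
Qed.

Let Imat := Imx gradb sigma T X0 theta0.
Let gram t := (gradb (seg t) (dseg t) theta0)^T *m sigma_hat sigma (seg t) (dseg t)
  *m gradb (seg t) (dseg t) theta0.

Lemma gram_lip_on : lip_on T gram.
Proof.
have T0 := ltW T_gt0; apply: lip_onM => //; last exact: (seg_lip_on lipg).
by apply: lip_onM => //; [apply: lip_onT; exact: (seg_lip_on lipg)|exact: S_lip_on].
Qed.

Lemma form_Imx x : form Imat x x =
  \int[lebesgue_measure]_(t in `[0, T]) form (gram t) x x.
Proof.
apply: mx_integral_form => i j; apply: lip_on_continuous; exact: gram_lip_on.
Qed.

Lemma form_gram t x : form (gram t) x x = form (sigma_hat sigma (seg t) (dseg t))
  (gradb (seg t) (dseg t) theta0 *m x) (gradb (seg t) (dseg t) theta0 *m x).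
Proof. by rewrite /form trmx_mul !mulmxA. Qed.

Lemma Imx_sym : Imat^T = Imat.
Proof.
apply/matrixP => i j; rewrite !mxE; apply: eq_Rintegral => t _.
transitivity ((gram t)^T i j); first by rewrite [RHS]mxE.
by rewrite /gram !trmx_mul trmxK inv_gram_sym mulmxA.
Qed.

Lemma Imx_ge0 x : 0 <= form Imat x x.
Proof.
rewrite form_Imx; apply: Rintegral_ge0 => t _; rewrite form_gram.
by apply: inv_gram_ge0; exact: unit0.
Qed.

(** [Lambda] is minus the linear part plus a remainder that is o(|h|) uniformly in time, so the
    quadratic form of the linear part, which integrates to that of [Imat], is the leading term. *)
Lemma Xi_expansion (tau : R) : 0 < tau -> exists2 r : R, 0 < r & forall theta,
  closure Theta theta -> h theta < r ->
  `|Xi b sigma theta0 T X0 theta - form Imat (theta - theta0) (theta - theta0)| <=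
    tau * h theta ^+ 2.
Proof.
move=> tau0; have T0 := ltW T_gt0.
have [cS cS0 cSP] := S_bound; have [cG cG0 cGP] := G_bound.
(* Makes the error density at most [tau / T]; the bound 1 lets the remainder be counted as one more
   [h theta] in the sum of norms. *)
pose e := Num.min 1 (tau / T / (cS * (2 * cG + 1))).
have e_gt0 : 0 < e by rewrite lt_min ltr01 !divr_gt0 // mulr_gt0 // addr_gt0 // mulr_gt0.
have [r r_gt0 rP] := rem_seg_small e_gt0; exists r => // theta ct hr.
rewrite form_Imx XiE.
have -> : tau * h theta ^+ 2 = tau / T * h theta ^+ 2 * T by field; rewrite gt_eqF.
apply: (integral_dist T0).
- exact: integrand_continuous.
- apply: (@lip_on_continuous R T 1 1
    (fun t => (theta - theta0)^T *m gram t *m (theta - theta0)) 0 0).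
  apply: lip_onM => //; last exact: lip_on_cst.
  by apply: lip_onM => //; [exact: lip_on_cst|exact: gram_lip_on].
move=> t tT; rewrite form_gram /integrand LambdaE formN.
set u := _ *m (theta - theta0); set v := rm _ _ _; set S := sigma_hat _ _ _.
have h0 : 0 <= h theta by exact: hsnorm_ge0.
have hv : hsnorm v <= e * h theta by exact: rP.
have hu : hsnorm u <= cG * h theta.
  by apply: (le_trans (hsnormM _ _)); rewrite ler_wpM2r ?hsnorm_ge0 // cGP.
have hS : hsnorm S <= cS by exact: cSP.
apply: (le_trans (form_dist _ _ _ _)); rewrite subrr hsnorm0 mul0r addr0.
have -> : u + v - u = v by rewrite addrC addKr.
have huv := hsnormD u v.
have e1 : e <= 1 by rewrite ge_min lexx.
have h1 : hsnorm (u + v) + hsnorm u <= (2 * cG + 1) * h theta.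
  have : e * h theta <= 1 * h theta by rewrite ler_wpM2r.
  lra.
apply: (@le_trans _ _ (e * h theta * cS * ((2 * cG + 1) * h theta))).
  apply: ler_pM => //; [exact: mulr_ge0|exact: addr_ge0|].
  by apply: ler_pM.
have -> : e * h theta * cS * ((2 * cG + 1) * h theta) = e * (cS * (2 * cG + 1)) * h theta ^+ 2 by ring.
rewrite ler_wpM2r ?sqr_ge0 // -ler_pdivlMr; first by rewrite ge_min lexx orbT.
by rewrite mulr_gt0 // addr_gt0 // mulr_gt0.
Qed.

(** Continuity in theta of the integrand must be uniform in time. [lambda_diff] reduces it to
    continuity of the drift at the single initial segment. *)
Lemma Xi_continuous theta (e : R) : closure Theta theta -> 0 < e ->
  exists2 r : R, 0 < r & forall theta', closure Theta theta' -> hsnorm (theta' - theta) < r ->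
    `|Xi b sigma theta0 T X0 theta' - Xi b sigma theta0 T X0 theta| <= e.
Proof.
move=> ct e0; have T0 := ltW T_gt0.
have [cS cS0 cSP] := S_bound; have [cG cG0 cGP] := G_bound.
have [c c0 cP] := rem_seg_bound; have [D D0 DP] := diameter.
have fm x := finite_moment2_dirac r0_gt0 (d := d) x.
pose A := 2 * cG + L * (2 * LX * T) * D.
have LL0 : 0 <= L * (2 * LX * T) by apply: mulr_ge0 => //; rewrite !mulr_ge0.
have A0 : 0 < A by rewrite ltr_wpDr ?mulr_gt0 // mulr_ge0 // ltW.
pose M := cS * (2 * ((cG + c) * D)).
have M0 : 0 < M by rewrite !mulr_gt0 // addr_gt0.
pose s := e / T / M / 2.
have s0 : 0 < s by rewrite !divr_gt0.
have [r r_gt0 rP] := b_theta_continuous derb (seg 0) (fm (seg 0)) ct s0.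
exists (Num.min r (s / A)); first by rewrite lt_min r_gt0 divr_gt0.
move=> theta' ct'; rewrite lt_min => /andP[h1 h2].
rewrite !XiE.
have -> : e = e / T * T by rewrite divfK // gt_eqF.
apply: (integral_dist T0); try exact: integrand_continuous.
move=> t tT; rewrite /integrand.
set u := Lambda _ _ _ theta' _; set v := Lambda _ _ _ theta _; set S := sigma_hat _ _ _.
have hL th : closure Theta th -> hsnorm (Lambda b (seg t) (dseg t) th theta0) <= (cG + c) * D.
  move=> cth; rewrite LambdaE hsnormN; apply: (le_trans (hsnormD _ _)).
  have hD := DP _ cth; have h0 : 0 <= h th by exact: hsnorm_ge0.
  have g1 := hsnormM (gradb (seg t) (dseg t) theta0) (th - theta0).
  have g2 : hsnorm (gradb (seg t) (dseg t) theta0) * h th <= cG * D.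
    by apply: ler_pM; rewrite ?hsnorm_ge0 ?cGP.
  have g3 := cP _ _ tT cth.
  have g4 : c * h th <= c * D by rewrite ler_wpM2l // ltW.
  by move: g1 g2 g3 g4; rewrite /h; lra.
apply: (le_trans (form_dist _ _ _ _)); rewrite subrr hsnorm0 mul0r addr0.
have huv : hsnorm (u - v) <= s + s.
  have -> : u - v = (b (seg 0) (dseg 0) theta - b (seg 0) (dseg 0) theta')
    + ((gradb (seg 0) (dseg 0) theta0 - gradb (seg t) (dseg t) theta0) *m (theta' - theta)
    - (rm (seg t) (dseg t) theta' - rm (seg 0) (dseg 0) theta' -
       (rm (seg t) (dseg t) theta - rm (seg 0) (dseg 0) theta))).
    exact: (lambda_diff (b (seg 0) (dseg 0) theta0) (b (seg 0) (dseg 0) theta)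
      (b (seg 0) (dseg 0) theta') (b (seg t) (dseg t) theta0) (b (seg t) (dseg t) theta)
      (b (seg t) (dseg t) theta') (gradb (seg 0) (dseg 0) theta0)
      (gradb (seg t) (dseg t) theta0) theta0 theta theta').
  apply: (le_trans (hsnormD _ _)); apply: lerD.
    by rewrite hsnormBC; exact: rP.
  apply: (le_trans (hsnormB _ _)).
  have z0 : 0 <= (0 : R) <= T by apply/andP; split.
  have g1 : hsnorm ((gradb (seg 0) (dseg 0) theta0 - gradb (seg t) (dseg t) theta0) *m
     (theta' - theta)) <= 2 * cG * hsnorm (theta' - theta).
    apply: (le_trans (hsnormM _ _)); apply: ler_wpM2r; first exact: hsnorm_ge0.
    apply: (le_trans (hsnormB _ _)); have -> : 2 * cG = cG + cG by ring.
    by apply: lerD; exact: cGP.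
  have g2 := rem_diff_lip r0_gt0 cvTheta Theta0 derb L_ge0 liph (seg t) (seg 0) (fm (seg t)) (fm (seg 0))
    ct' ct (DP _ ct') (DP _ ct).
  have g3 : L * (path_dist (seg t) (seg 0) + W2 (dseg t) (dseg 0)) <= L * (2 * LX * T).
    rewrite ler_wpM2l //; apply: (le_trans (seg_kap tT z0)).
    by rewrite ler_wpM2l ?mulr_ge0 // subr0; case/andP: tT => t0 tT; rewrite ger0_norm.
  have g4 : L * (path_dist (seg t) (seg 0) + W2 (dseg t) (dseg 0)) * D * hsnorm (theta' - theta)
     <= L * (2 * LX * T) * D * hsnorm (theta' - theta).
    by rewrite ler_wpM2r ?hsnorm_ge0 // ler_wpM2r // ltW.
  move: h2; rewrite ltr_pdivlMr // => h2.
  by move: g1 g2 g4 h2; rewrite /A; lra.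
have uv : hsnorm u + hsnorm v <= 2 * ((cG + c) * D).
  by have := hL _ ct'; have := hL _ ct; rewrite -/u -/v; lra.
apply: (@le_trans _ _ ((s + s) * cS * (2 * ((cG + c) * D)))).
  by apply: ler_pM; rewrite ?mulr_ge0 ?addr_ge0 ?hsnorm_ge0 //;
    apply: ler_pM; rewrite ?hsnorm_ge0 // cSP.
rewrite -mulrA -/M /s -splitr divfK // gt_eqF //.
Qed.

(** Two regimes: at [theta0] the expansion and the coercivity of [Imat] give half of its constant;
    elsewhere [Xi] is positive and continuous and [h] is bounded by the diameter. *)
Lemma Xi_coercive : (forall theta, closure Theta theta -> theta <> theta0 ->
    0 < Xi b sigma theta0 T X0 theta) -> Imat \in unitmx ->
  exists2 c : R, 0 < c & forall theta, closure Theta theta ->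
    c * h theta ^+ 2 <= Xi b sigma theta0 T X0 theta.
Proof.
move=> Xi_gt0 uI.
have [c c0 cP] := form_coercive Imx_sym Imx_ge0 uI.
have [D D0 DP] := diameter.
have c2 : 0 < c / 2 by rewrite divr_gt0.
have arch (x : R) : 0 <= x -> exists N : nat, forall n, (N <= n)%N -> x <= n%:R.
  move=> x0; exists (Num.truncn x).+1 => n hn; have /andP[_ /ltW h1] := truncn_itv x0.
  by rewrite (le_trans h1) // ler_nat.
(* The integer plays the role of the inverse of the coercivity constant. *)
have [|N NP] := @compact_uniform R p (closure Theta) (fun n theta => closure Theta theta ->
  h theta ^+ 2 <= n%:R * Xi b sigma theta0 T X0 theta) (closed_bounded_compact bdTheta).
  move=> theta ct; have [->|tn] := eqVneq theta theta0.
    have [r r_gt0 rP] := Xi_expansion c2.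
    have [N NP] := arch (2 / c) (ltW (divr_gt0 (ltr0Sn R 1) c0)).
    exists r, N; split=> // n th hn thr cth.
    have := rP _ cth thr; rewrite ler_norml => /andP[h1 _].
    have := cP (th - theta0) => h3.
    have h4 : c / 2 * h th ^+ 2 <= Xi b sigma theta0 T X0 th.
      by rewrite /h in h1 *; lra.
    have h5 : 0 <= Xi b sigma theta0 T X0 th.
      by apply: le_trans _ h4; rewrite mulr_ge0 ?(ltW c2) // sqr_ge0.
    apply: (@le_trans _ _ (2 / c * Xi b sigma theta0 T X0 th)); last by rewrite ler_wpM2r // NP.
    have := ler_wpM2l (ltW (divr_gt0 (ltr0Sn R 1) c0)) h4.
    by rewrite mulrA (_ : 2 / c * (c / 2) = 1) ?mul1r //; field; rewrite gt_eqF.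
  have X0_gt0 := Xi_gt0 _ ct (elimN eqP tn).
  set x := Xi b sigma theta0 T X0 theta in X0_gt0.
  have x2 : 0 < x / 2 by rewrite divr_gt0.
  have [r r_gt0 rP] := Xi_continuous ct x2.
  have [N NP] := arch (D ^+ 2 / (x / 2)) (divr_ge0 (sqr_ge0 _) (ltW x2)).
  exists r, N; split=> // n th hn thr cth.
  have := rP _ cth thr; rewrite -/x ler_norml => /andP[h1 _].
  have h2 : x / 2 <= Xi b sigma theta0 T X0 th by lra.
  apply: (@le_trans _ _ (D ^+ 2)); first by rewrite lerXn2r ?nnegrE ?hsnorm_ge0 ?(ltW D0) // DP.
  have := NP _ hn; rewrite ler_pdivrMr // => h3; apply: (le_trans h3).
  by rewrite ler_wpM2l.
exists N.+1%:R^-1; first by rewrite invr_gt0 ltr0n.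
move=> theta ct; rewrite ler_pdivrMl ?ltr0n //; exact: NP.
Qed.

(** The factor [h theta ^+ 2] is what makes the estimate usable when theta is within O(eps) of
    [theta0]. It appears because [Lambda] is O(h) and its error is O(kap * h). The sequences [x] and
    [mu] are arbitrary, so the estimate applies to each outcome separately. *)
Lemma contrast_riemann : exists2 c : R, 0 < c &
  forall (delta kap : R) (n : nat) (x : nat -> C) (mu : nat -> PC),
    0 < delta -> n%:R * delta = T -> kap <= 1 ->
    (forall k, (k < n)%N -> [/\ finite_moment2 (mu k), sigma2 sigma (x k) (mu k) \in unitmx &
      path_dist (x k) (seg (k%:R * delta)) + W2 (mu k) (dseg (k%:R * delta)) + 2 * LX * delta
        <= kap]) ->
    forall theta, closure Theta theta ->
    `|delta * \sum_(k < n) form (sigma_hat sigma (x k) (mu k))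
        (Lambda b (x k) (mu k) theta theta0) (Lambda b (x k) (mu k) theta theta0)
      - Xi b sigma theta0 T X0 theta| <= c * kap * h theta ^+ 2.
Proof.
have T0 := ltW T_gt0.
have [cS cS0 cSP] := S_bound; have [cG cG0 cGP] := G_bound.
have [c c0 cP] := rem_seg_bound; have [D D0 DP] := diameter.
have fm x := finite_moment2_dirac r0_gt0 (d := d) x.
(* [E] bounds the error of [Lambda] per unit of [kap * h]: 1 for the gradient, [D] for the
   remainder. [A] bounds [Lambda] itself per unit of [h] on the limit path. *)
pose E := L * (1 + D); have E0 : 0 <= E by rewrite mulr_ge0 // addr_ge0 // ltW.
pose A := cG + c; have A0 : 0 < A by rewrite addr_gt0.
pose K := E * cS * (2 * A + E) + L * (A + E) ^+ 2 + 1.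
have K1 : 0 <= E * cS * (2 * A + E) + L * (A + E) ^+ 2.
  apply: addr_ge0; last by rewrite mulr_ge0 // sqr_ge0.
  apply: mulr_ge0; first exact: mulr_ge0 E0 (ltW cS0).
  by apply: addr_ge0 E0; apply: mulr_ge0 (ltW A0).
exists (K * T); first by rewrite mulr_gt0 // ltr_wpDl.
move=> delta kap n x mu d0 nT kap1 good theta ct.
have h0 : 0 <= h theta by exact: hsnorm_ge0.
have hD := DP _ ct.
pose ax k := form (sigma_hat sigma (x k) (mu k))
  (Lambda b (x k) (mu k) theta theta0) (Lambda b (x k) (mu k) theta theta0).
have := @riemann_sum_bound R T (integrand theta) (integrand_continuous ct) delta n ax
  (fun=> K * kap * h theta ^+ 2) d0.
rewrite nT lexx => /(_ isT); move=> /(_ _)/wrap[]; last first.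
  move=> /(_ n (leqnn n)); rewrite nT sumr_const card_ord distrC -XiE => /le_trans; apply.
  by rewrite -mulrnAl -mulrnAl -mulr_natl -[X in _ <= X](mulrC (h theta ^+ 2)) -nT; lra.
move=> k u kn uI; have [fmk uk kapk] := good k kn.
have tk : 0 <= k%:R * delta <= T.
  by rewrite mulr_ge0 ?(ltW d0) // -nT ler_pM2r // ler_nat ltnW.
have uT : 0 <= u <= T.
  case/andP: uI => u1 u2; have [tk1 _] := andP tk; rewrite (le_trans tk1) //=.
  by rewrite (le_trans u2) // -nT ler_pM2r // ler_nat.
have du : `|k%:R * delta - u| <= delta.
  case/andP: uI => u1; rewrite -natr1 mulrDl mul1r => u2.
  by rewrite distrC ger0_norm ?subr_ge0 //; lra.
set kk := path_dist _ _ + W2 _ _ in kapk.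
have kk0 : 0 <= kk by rewrite addr_ge0 ?path_dist_ge0 ?W2_ge0.
have skap : path_dist (seg (k%:R * delta)) (seg u) + W2 (dseg (k%:R * delta)) (dseg u)
    <= 2 * LX * delta.
  by apply: (le_trans (seg_kap tk uT)); rewrite ler_wpM2l // mulr_ge0.
have kap0 : 0 <= kap.
  by apply: le_trans _ kapk; rewrite addr_ge0 // !mulr_ge0 // ltW.
(* Passes from the scheme at the grid time to the limit at time [u] through the limit at the grid
   time; both distances fit in [kap]. *)
have two (a c' : nat) (f1 f2 f3 : 'M[R]_(a, c')) (e : R) : 0 <= e ->
    hsnorm (f1 - f2) <= e * kk ->
    hsnorm (f2 - f3) <= e * (path_dist (seg (k%:R * delta)) (seg u) + W2 (dseg (k%:R * delta)) (dseg u)) ->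
    hsnorm (f1 - f3) <= e * kap.
  move=> e0 g1 g2; apply: (le_trans (hsnorm_triB _ f2 _)).
  have g4 : e * kk + e * (2 * LX * delta) <= e * kap.
    by rewrite -mulrDr; exact: ler_wpM2l e0 _ _ kapk.
  apply: le_trans _ g4; apply: (lerD g1); apply: (le_trans g2); exact: ler_wpM2l e0 _ _ skap.
have hS : hsnorm (sigma_hat sigma (x k) (mu k) - sigma_hat sigma (seg u) (dseg u)) <= L * kap.
  apply: (two _ _ _ (sigma_hat sigma (seg (k%:R * delta)) (dseg (k%:R * delta)))) => //;
    exact: lipS.
have hG : hsnorm (gradb (x k) (mu k) theta0 - gradb (seg u) (dseg u) theta0) <= L * kap.
  by apply: (two _ _ _ (gradb (seg (k%:R * delta)) (dseg (k%:R * delta)) theta0)) => //; exact: lipg.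
have hR : hsnorm (rm (x k) (mu k) theta - rm (seg u) (dseg u) theta) <= L * h theta ^+ 2 * kap.
  apply: (two _ _ _ (rm (seg (k%:R * delta)) (dseg (k%:R * delta)) theta)).
  - by rewrite mulr_ge0 // sqr_ge0.
  - by rewrite mulrAC; exact: (rem_diff_le r0_gt0 cvTheta Theta0 derb L_ge0 liph).
  - by rewrite mulrAC; exact: (rem_diff_le r0_gt0 cvTheta Theta0 derb L_ge0 liph).
rewrite /ax /integrand.
set y := Lambda b (x k) _ _ _; set z := Lambda b (seg u) _ _ _.
have hz : hsnorm z <= A * h theta.
  rewrite /z LambdaE hsnormN; apply: (le_trans (hsnormD _ _)); rewrite mulrDl; apply: lerD.
    by apply: (le_trans (hsnormM _ _)); rewrite ler_wpM2r ?hsnorm_ge0 // cGP.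
  exact: cP.
have hyz : hsnorm (y - z) <= E * kap * h theta.
  rewrite /y /z !LambdaE.
  have -> : - (gradb (x k) (mu k) theta0 *m (theta - theta0) + rm (x k) (mu k) theta) -
     - (gradb (seg u) (dseg u) theta0 *m (theta - theta0) + rm (seg u) (dseg u) theta) =
     - ((gradb (x k) (mu k) theta0 - gradb (seg u) (dseg u) theta0) *m (theta - theta0)
      + (rm (x k) (mu k) theta - rm (seg u) (dseg u) theta)).
    by rewrite mulmxBl !opprD !opprK addrACA.
  rewrite hsnormN; apply: (le_trans (hsnormD _ _)).
  have g1 := hsnormM (gradb (x k) (mu k) theta0 - gradb (seg u) (dseg u) theta0) (theta - theta0).
  have g2 : hsnorm (gradb (x k) (mu k) theta0 - gradb (seg u) (dseg u) theta0) * h theta <=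
    L * kap * h theta by rewrite ler_wpM2r.
  have g3 : L * h theta ^+ 2 * kap <= L * kap * h theta * D.
    rewrite expr2 (_ : L * (h theta * h theta) * kap = L * kap * h theta * h theta); last by ring.
    by rewrite ler_wpM2l // !mulr_ge0.
  by rewrite /E; move: g1 g2 hR g3; rewrite /h; lra.
have hyE : hsnorm y <= (A + E) * h theta.
  apply: (le_trans (hsnorm_sub_le y z)).
  have : E * kap * h theta <= E * 1 * h theta by rewrite ler_wpM2r // ler_wpM2l.
  lra.
apply: (le_trans (form_dist _ _ _ _)).
rewrite [hsnorm (z - y)]hsnormBC [hsnorm (_ - sigma_hat sigma (x k) _)]hsnormBC.
have g1 : hsnorm (y - z) * hsnorm (sigma_hat sigma (seg u) (dseg u)) * (hsnorm z + hsnorm y)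
   <= E * kap * h theta * cS * ((2 * A + E) * h theta).
  apply: ler_pM; rewrite ?mulr_ge0 ?addr_ge0 ?hsnorm_ge0 //; last by lra.
  by apply: ler_pM; rewrite ?hsnorm_ge0 // cSP.
have g2 : hsnorm (sigma_hat sigma (x k) (mu k) - sigma_hat sigma (seg u) (dseg u)) * hsnorm y ^+ 2
   <= L * kap * ((A + E) * h theta) ^+ 2.
  apply: ler_pM; rewrite ?sqr_ge0 ?hsnorm_ge0 // lerXn2r ?nnegrE ?hsnorm_ge0 //.
  by apply: le_trans _ hyE.
apply: (le_trans (lerD g1 g2)).
have -> : E * kap * h theta * cS * ((2 * A + E) * h theta) + L * kap * ((A + E) * h theta) ^+ 2
  = (E * cS * (2 * A + E) + L * (A + E) ^+ 2) * (kap * h theta ^+ 2) by ring.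
rewrite -[leRHS]mulrA ler_wpM2r ?mulr_ge0 ?sqr_ge0 // /K lerDl //.
Qed.

End limit_contrast.

(** * Truncated stochastic terms of the contrast *)

Section brownian_sum_tail.
Context {d} {O : measurableType d} {R : realType}.
Variables (P : probability O R) (F : R -> set (set O)).
Context {m : nat} (B : R -> O -> 'cV[R]_m).
Hypotheses (uF : usual_filtration P F) (bB : brownian P F B).
Variables (n : nat) (delta T : R).
Hypotheses (m_gt0 : (0 < m)%N) (delta_gt0 : 0 < delta) (nT : n%:R * delta = T).

(** The parameter of the Chernoff bound is the inverse of [c], which turns the Gaussian exponent
    into [T / 2]. The sum over the [m] coordinates is cut into parts of size [u / m]. *)
Lemma mxsum_tail (f : nat -> O -> 'M[R]_(1, m)) (c u : R) : 0 < c ->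
  (forall k l i, (k < n)%N -> adapted (F (k%:R * delta)) (fun w => f k w l i)) ->
  (forall k w, (k < n)%N -> hsnorm (f k w) <= c) ->
  (P [set w | u <= `|mxsum B n delta f w 0 0|]%R <=
    (2 * m%:R * expR (T / 2) * expR (- (u / (m%:R * c))))%:E)%E.
Proof.
move=> c0 fG fc; have m0 : 0 < m%:R :> R by rewrite ltr0n.
pose I i := msum (fun k w => grid_incr B delta k w i 0) (fun k w => f k w 0 i) n.
pose E i := [set w | u / m%:R <= `|I i w|]%R.
have tail i : (P (E i) <= (2 * (expR (T / 2) * expR (- (u / (m%:R * c)))))%:E)%E.
  have noise := brownian_gaussian_noise uF bB n i delta_gt0.
  have c1 : 0 < c^-1 by rewrite invr_gt0.
  have fc' k w : (k < n)%N -> `|f k w 0 i| <= c.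
    by move=> kn; apply: (le_trans (hsnorm_entry _ _ _)); exact: fc.
  apply: (le_trans (msum_tail noise (fun k kn => fG k 0 i kn) (u / m%:R) c1 fc')).
  rewrite lee_fin ler_wpM2l // -expRD sqr_sqrtr ?(ltW delta_gt0) // mulVf ?gt_eqF //.
  rewrite expr1n mul1r mulrA nT (_ : c^-1 * (u / m%:R) = u / (m%:R * c)) //.
  by field; rewrite !gt_eqF.
have mI i : measurable (E i).
  have mIi : measurable_fun setT (I i).
    have noise := brownian_gaussian_noise uF bB n i delta_gt0.
    have [_ Gs _ _ _] := noise; have [sG Gm] := Gs n (leqnn n).
    by apply: (adapted_measurable sG Gm); apply: (msum_adapted noise _ (leqnn n)) => k kn; exact: fG.
  rewrite -[E i]setTI; apply: (@measurable_fun_le _ _ _ setT (cst (u / m%:R)) (fun w => `|I i w|)) => //.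
  exact: measurableT_comp.
have [mU PU] := finite_Boole mI tail.
have mS : measurable [set w | u <= `|mxsum B n delta f w 0 0|].
  rewrite -[X in measurable X]setTI.
  apply: (@measurable_fun_le _ _ _ setT (cst u) (fun w => `|mxsum B n delta f w 0 0|)) => //.
  by apply: measurableT_comp => //; exact: (measurable_mxsum uF bB delta_gt0 fG).
apply: (@le_trans _ _ (P (\bigcup_i E i))).
  apply: le_measure; rewrite ?inE // => w /= uw; apply: contrapT => nE.
  have lt i : `|I i w| < u / m%:R by rewrite ltNge; apply/negP => h; apply: nE; exists i.
  move: uw; rewrite mxsum_entry leNgt => /negP; apply.
  apply: (le_lt_trans (ler_norm_sum _ _ _)).
  have -> : u = \sum_(i < m) u / m%:R.
    by rewrite sumr_const card_ord -[RHS]mulr_natr divfK // gt_eqF.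
  by apply: ltr_sum => [|i _]; [apply/hasP; exists (Ordinal m_gt0); rewrite ?mem_index_enum|exact: lt].
apply: (le_trans PU); rewrite lee_fin card_ord le_eqVlt; apply/orP; left; apply/eqP; ring.
Qed.

End brownian_sum_tail.

(** [r] is the remainder at the initial segment and [c *: v] its change to the current one; the
    three terms are the summands of [zeta], [mvec] and [noise]. *)
Lemma cross_term {R : realType} {d m p : nat} (G : 'M[R]_(d, p)) (h : 'cV[R]_p)
    (r v : 'cV[R]_d) (S : 'M[R]_d) (V : 'M[R]_(d, m)) (x : 'cV[R]_m) (c : R) :
  ((- (G *m h + (r + c *: v)))^T *m S *m (V *m x)) 0 0 =
  - ((h^T *m (G^T *m S *m V *m x)) 0 0 + (r^T *m (S *m V *m x)) 0 0
     + c * (v^T *m (S *m V) *m x) 0 0).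
Proof.
have -> : (- (G *m h + (r + c *: v)))^T = - ((G *m h)^T + (r^T + c *: v^T)).
  by apply/matrixP => i j; rewrite !mxE.
rewrite trmx_mul !mulmxA !mulNmx !mulmxDl -!scalemxAl.
move: (h^T *m _ *m _ *m _ *m _) (r^T *m _ *m _ *m _) (v^T *m _ *m _ *m _) => A1 A2 A3.
by rewrite !mxE addrA.
Qed.

Section truncated_scheme.
Context {R : realType} {r0 : R} {d m p : nat}.
Context {dO : measure_display} {O : measurableType dO} {P : probability O R}.
Local Notation C := (cpath r0 d).
Local Notation PC := (probability C R).
Variables (F : R -> set (set O)) (B : R -> O -> 'cV[R]_m).
Hypotheses (uF : usual_filtration P F) (bB : brownian P F B).
Variables (Theta : set 'cV[R]_p) (theta0 : 'cV[R]_p).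
Variables (T : R) (b : C -> PC -> 'cV[R]_p -> 'cV[R]_d) (sigma : C -> PC -> 'M[R]_(d, m)).
Variable gradb : C -> PC -> 'cV[R]_p -> 'M[R]_(d, p).
Variable hessb : C -> PC -> 'cV[R]_p -> 'I_p -> 'M[R]_(p, d).
Variables (xi : C) (X0 : R -> 'cV[R]_d).
Hypotheses (r0_gt0 : 0 < r0) (T_gt0 : 0 < T) (m_gt0 : (0 < m)%N).
Hypothesis cvTheta : convex_set (Theta : set (convex_lmodType 'cV[R]_p)).
Hypothesis Theta0 : Theta theta0.
Hypothesis derb : theta_derivatives Theta b gradb hessb.
Hypothesis ode : limit_ode b theta0 xi T X0.
Variables (L LX A0 : R).
Hypotheses (L_ge0 : 0 <= L) (LX_ge0 : 0 <= LX) (A0_ge0 : 0 <= A0).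
Hypothesis lipb : forall theta, closure Theta theta -> lip_coef (fun x mu => b x mu theta) L.
Hypothesis lips : lip_coef sigma L.
Hypothesis lipg : lip_coef (fun x mu => gradb x mu theta0) L.
Hypothesis liph : forall (x y : C) (mu nu : PC), finite_moment2 mu -> finite_moment2 nu ->
  forall theta, closure Theta theta ->
  block_norm (fun k => hessb x mu theta k - hessb y nu theta k) <= L * (path_dist x y + W2 mu nu).
Hypothesis lipS : forall (x y : C) (mu nu : PC), finite_moment2 mu -> finite_moment2 nu ->
  sigma2 sigma x mu \in unitmx -> sigma2 sigma y nu \in unitmx ->
  hsnorm (sigma_hat sigma x mu - sigma_hat sigma y nu) <= L * (path_dist x y + W2 mu nu).
Hypothesis unit0 : forall x : C, sigma2 sigma x (dirac_law x) \in unitmx.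
Hypothesis lipX : forall s t, - r0 <= s <= T -> - r0 <= t <= T ->
  hsnorm (X0 s - X0 t) <= LX * `|s - t|.
Local Notation seg := (segment r0 X0).
Local Notation dseg t := (dirac_law (seg t)).
Hypothesis sig0 : forall t, 0 <= t <= T -> hsnorm (sigma (seg t) (dseg t)) <= A0.
Hypothesis hat0 : forall t, 0 <= t <= T -> hsnorm (sigma_hat sigma (seg t) (dseg t)) <= A0.
Hypothesis grad0 : forall t, 0 <= t <= T -> hsnorm (gradb (seg t) (dseg t) theta0) <= A0.
Variables (eps delta : R) (n M : nat).
Hypotheses (eps01 : 0 < eps < 1) (n_gt0 : (0 < n)%N) (M_gt0 : (0 < M)%N).
Hypotheses (nT : n%:R * delta = T) (Mr0 : M%:R * delta = r0).
Variables (Y : int -> O -> 'cV[R]_d) (Yhat : nat -> {RV P >-> C}).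
Hypothesis Yinit : forall (j : int) w, - M%:Z <= j <= 0 -> Y j w = xi (j%:~R * delta).
Hypothesis Ystep : forall (k : nat) w, (k < n)%N ->
  Y k.+1%:Z w = Y k%:Z w + delta *: b (Yhat k w) (law (Yhat k)) theta0
    + eps *: (sigma (Yhat k w) (law (Yhat k))
                *m (B (k.+1%:R * delta) w - B (k%:R * delta) w)).
Hypothesis Yinterp : forall (k i : nat) w (s : R), (k < n)%N -> (i < M)%N ->
  - (i.+1%:R * delta) <= s <= - (i%:R * delta) ->
  Yhat k w s = Y (k%:Z - i%:Z) w
    + ((s + i%:R * delta) / delta) *: (Y (k%:Z - i%:Z) w - Y (k%:Z - i%:Z - 1) w).

Local Notation tt k := (k%:R * delta).
Local Notation mu k := (law (Yhat k)).
Local Notation perr w k := (pmax (err X0 delta Y w) k).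

Let d0 : 0 < delta := delta_gt0 T_gt0 n_gt0 nT.
Let cX0 : {within `[- r0, T], continuous X0}.
Proof. by have [] := ode. Qed.
Let fm (x : C) := finite_moment2_dirac r0_gt0 x.
Let lipb0 := lipb (closure_theta0 Theta0).
Let good k (kn : (k < n)%N) := good_upto uF bB r0_gt0 T_gt0 ode L_ge0 LX_ge0 A0_ge0 lipb0 lips
  lipX eps01 n_gt0 M_gt0 nT Mr0 Yinit Ystep Yinterp kn.
Let moment k (kn : (k < n)%N) : finite_moment2 (mu k) :=
  Yhat_moment uF r0_gt0 T_gt0 ode L_ge0 LX_ge0 A0_ge0 lipX eps01 n_gt0 M_gt0 nT Mr0
    Yinit Yinterp kn (good kn).
Let cadapted k (kn : (k < n)%N) a c (f : C -> PC -> 'M[R]_(a, c)) i j (fL : lip_coef f L) :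
    adapted (F (tt k)) (fun w => f (Yhat k w) (mu k) i j) :=
  coef_adapted uF r0_gt0 T_gt0 ode L_ge0 LX_ge0 A0_ge0 lipX eps01 n_gt0 M_gt0 nT Mr0
    Yinit Yinterp kn (good kn) i j fL.
Let W k := W2 (mu k) (dseg (tt k)).
Let kapd k w := path_dist (Yhat k w) (seg (tt k)) + W k.

Let tk_in k : (k < n)%N -> 0 <= tt k <= T.
Proof. by move=> kn; exact: (grid_le_T T_gt0 n_gt0 nT (ltnW kn)). Qed.

Definition gron : R := @gron_const R d m T L LX A0.

Lemma gron_ge0 : 0 <= gron.
Proof. exact: gron_const_ge0 T_gt0 L LX A0. Qed.

Lemma mse_le k : (k <= n)%N -> mse (P := P) X0 delta Y k <= gron * (delta ^+ 2 + eps ^+ 2).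
Proof.
move=> kn.
apply: (le_trans _ (scheme_error uF bB r0_gt0 T_gt0 ode L_ge0 LX_ge0 A0_ge0 lipb0 lips lipX sig0
  eps01 n_gt0 M_gt0 nT Mr0 Yinit Ystep Yinterp)).
have sq j (jn : (j <= n)%N) := pmax_err_sqint_all uF bB r0_gt0 T_gt0 ode L_ge0 LX_ge0 A0_ge0
  lipb0 lips lipX eps01 n_gt0 M_gt0 nT Mr0 Yinit Ystep Yinterp jn.
apply: Ex_le; [exact: (sq k kn).2|exact: (sq n (leqnn n)).2|] => w.
have h0 j : 0 <= perr w j by apply: le_trans (le_pmax _ (leq0n j)); exact: hsnorm_ge0.
by rewrite lerXn2r ?nnegrE // pmax_mono.
Qed.

Lemma pmax_err_prob (kap : R) : 0 < kap ->
  measurable [set w | kap <= perr w n] /\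
  (P [set w | kap <= perr w n]%R <= (gron * (delta ^+ 2 + eps ^+ 2) / kap ^+ 2)%:E)%E.
Proof.
move=> k0.
have sq := pmax_err_sqint_all uF bB r0_gt0 T_gt0 ode L_ge0 LX_ge0 A0_ge0
  lipb0 lips lipX eps01 n_gt0 M_gt0 nT Mr0 Yinit Ystep Yinterp (leqnn n).
have h0 w : 0 <= perr w n by apply: le_trans (le_pmax _ (leq0n n)); exact: hsnorm_ge0.
have e : [set w | kap <= perr w n] = [set w | kap ^+ 2 <= perr w n ^+ 2].
  by apply/seteqP; split => w /=; rewrite ler_pXn2r ?nnegrE ?h0 ?(ltW k0).
split.
  rewrite -[X in measurable X]setTI.
  apply: (@measurable_fun_le _ _ _ setT (cst kap) (fun w => perr w n)) => //.
  exact: sq.1.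
rewrite e; apply: markov_prob; [exact: sq.2|by move=> w; exact: sqr_ge0|by rewrite exprn_gt0|].
exact: mse_le.
Qed.

Lemma W_sqr k : (k < n)%N -> W k ^+ 2 <= 2 * (gron + LX ^+ 2) * (delta ^+ 2 + eps ^+ 2).
Proof.
move=> kn.
have h := W_sqr_le uF bB r0_gt0 T_gt0 ode L_ge0 LX_ge0 A0_ge0 lipb0 lips lipX eps01 n_gt0 M_gt0
  nT Mr0 Yinit Ystep Yinterp kn.
have h1 := mse_le (ltnW kn).
apply: (le_trans h); have : 0 <= LX ^+ 2 * eps ^+ 2 by rewrite mulr_ge0 // sqr_ge0.
lra.
Qed.

Lemma kapd_le k w : (k < n)%N -> kapd k w <= perr w k + LX * delta + W k.
Proof.
move=> kn; rewrite lerD2r; exact: (Yhat_dist r0_gt0 T_gt0 ode LX_ge0 lipX n_gt0 M_gt0 nT Mr0 Yinit Yinterp).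
Qed.

Lemma kapd_ge0 k w : 0 <= kapd k w.
Proof. by rewrite addr_ge0 ?path_dist_ge0 ?W2_ge0. Qed.

Lemma Ex_kapd k : (k < n)%N -> intble P (fun w => kapd k w ^+ 2) /\
  Ex P (fun w => kapd k w ^+ 2) <= 8 * (gron + LX ^+ 2) * (delta ^+ 2 + eps ^+ 2).
Proof.
move=> kn.
have sd := dist_sqint uF r0_gt0 T_gt0 ode L_ge0 LX_ge0 A0_ge0 lipX eps01 n_gt0 M_gt0 nT Mr0
  Yinit Yinterp kn (good kn).
have sk : sqint P (kapd k) by apply: sqintD => //; exact: sqint_cst.
split; first exact: sk.2.
have h1 := Ex_dist_le uF bB r0_gt0 T_gt0 ode L_ge0 LX_ge0 A0_ge0 lipb0 lips lipX eps01 n_gt0 M_gt0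
  nT Mr0 Yinit Ystep Yinterp kn.
have h2 := W_sqr kn; have h3 := mse_le (ltnW kn).
apply: (@le_trans _ _ (Ex P (fun w => 2 * path_dist (Yhat k w) (seg (tt k)) ^+ 2 + 2 * W k ^+ 2))).
  apply: Ex_le; [exact: sk.2|apply: intbleD; [exact: intbleZ sd.2|exact: intble_cst]|].
  move=> w; rewrite /kapd; set x := path_dist _ _.
  by have := sqr_ge0 (x - W k); lra.
rewrite ExD; [|exact: intbleZ sd.2|exact: intble_cst].
rewrite ExZ ?Ex_cst; last exact: sd.2.
have : 0 <= LX ^+ 2 * eps ^+ 2 by rewrite mulr_ge0 // sqr_ge0.
lra.
Qed.

(** On the truncation event: 1 for the path error, [LX * T] for the mesh, and [W <= W ^ 2 + 1] for
    the law, with [W ^ 2] bounded by [W_sqr] at [delta <= T] and [eps <= 1]. *)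
Definition kapmax : R := 2 + LX * T + 2 * (gron + LX ^+ 2) * (T ^+ 2 + 1).

Lemma kapmax_ge0 : 0 <= kapmax.
Proof.
have g0 := gron_ge0; have T0 := ltW T_gt0.
have h1 : 0 <= LX * T by exact: mulr_ge0.
have h2 : 0 <= 2 * (gron + LX ^+ 2) * (T ^+ 2 + 1).
  by rewrite !mulr_ge0 // addr_ge0 // sqr_ge0.
by rewrite /kapmax; lra.
Qed.

(* The noise is truncated to keep the coefficients of the martingales bounded;
   with high probability nothing is cut off. *)
Definition chi k w : bool := (perr w k <= 1) && (sigma2 sigma (Yhat k w) (mu k) \in unitmx).

Definition trunc a c (f : C -> PC -> 'M[R]_(a, c)) k w : 'M[R]_(a, c) :=
  (chi k w)%:R *: f (Yhat k w) (mu k).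

Lemma delta_le_T : delta <= T.
Proof.
by rewrite -nT ler_peMl ?(ltW d0) // ler1n.
Qed.

Lemma kapd_chi k w : (k < n)%N -> chi k w -> kapd k w <= kapmax.
Proof.
move=> kn /andP[e1 _]; apply: (le_trans (kapd_le w kn)).
have h1 := W_sqr kn; have dT := delta_le_T; have g0 := gron_ge0.
have h2 : LX * delta <= LX * T by rewrite ler_wpM2l.
have d2 : delta ^+ 2 + eps ^+ 2 <= T ^+ 2 + 1.
  case/andP: eps01 => e0 e11; apply: lerD.
    by rewrite lerXn2r ?nnegrE ?(ltW d0) ?(ltW T_gt0).
  by apply: exprn_ile1; exact: ltW.
have h3 : 2 * (gron + LX ^+ 2) * (delta ^+ 2 + eps ^+ 2) <= 2 * (gron + LX ^+ 2) * (T ^+ 2 + 1).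
  by rewrite ler_wpM2l // mulr_ge0 // addr_ge0 // sqr_ge0.
have h4 : W k <= W k ^+ 2 + 1 by have := sqr_ge0 (W k - 1); have := W2_ge0 (mu k) (dseg (tt k)); rewrite -/(W k); lra.
by rewrite /kapmax; move: h1 h2 h3 h4 e1; lra.
Qed.

Lemma chi_adapted k : (k < n)%N -> adapted (F (tt k)) (fun w => (chi k w)%:R : R).
Proof.
move=> kn.
have m1 : @measurable_fun _ _ (g_sigma_algebraType (F (tt k))) bool setT (fun w => perr w k <= 1).
  apply: (@measurable_fun_ler _ (g_sigma_algebraType (F (tt k))) R setT (fun w => perr w k) (cst 1)).
    exact: (pmax_err_adapted uF X0 T_gt0 n_gt0 nT (good kn) (leqnn k)).
  exact: measurable_cst.
have m2 : @measurable_fun _ _ (g_sigma_algebraType (F (tt k))) bool setT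
    (fun w => sigma2 sigma (Yhat k w) (mu k) \in unitmx).
  apply: measurable_unitmx; apply: measurable_mxM; last apply: measurable_mxT;
    by move=> i j; exact: (cadapted kn).
apply: (measurableT_comp (f := fun c : bool => c%:R : R)) => //.
exact: measurable_and.
Qed.

Lemma trunc_adapted a c (f : C -> PC -> 'M[R]_(a, c)) k :
  (k < n)%N -> measurable_mx (O := g_sigma_algebraType (F (tt k))) (fun w => f (Yhat k w) (mu k)) ->
  forall i j, adapted (F (tt k)) (fun w => trunc f k w i j).
Proof.
move=> kn mf i j; apply: measurable_mxZ => //; exact: chi_adapted.
Qed.

Lemma trunc_le a c (f : C -> PC -> 'M[R]_(a, c)) k w (e : R) : 0 <= e ->
  (chi k w -> hsnorm (f (Yhat k w) (mu k)) <= e) -> hsnorm (trunc f k w) <= e.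
Proof.
move=> e0; rewrite /trunc; case: (chi k w) => [h|_].
  by rewrite scale1r; exact: h.
by rewrite scale0r hsnorm0.
Qed.

(** Bound [A0] along the limit path plus the Lipschitz deviation allowed by the truncation. *)
Definition cmax : R := A0 + L * kapmax.

Lemma cmax_ge0 : 0 <= cmax.
Proof. by rewrite addr_ge0 // mulr_ge0 // kapmax_ge0. Qed.

Lemma A0_cmax : A0 <= cmax.
Proof. by rewrite lerDl mulr_ge0 // kapmax_ge0. Qed.

Section on_chi.
Variables (k : nat) (w : O).
Hypotheses (kn : (k < n)%N) (chik : chi k w).

Lemma chi_unit : sigma2 sigma (Yhat k w) (mu k) \in unitmx.
Proof. by have /andP[] := chik. Qed.

Lemma chi_sigma_dist : hsnorm (sigma (Yhat k w) (mu k) - sigma (seg (tt k)) (dseg (tt k))) <=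
  L * kapd k w.
Proof. by apply: lips; [exact: moment|exact: fm]. Qed.

Lemma chi_hat_dist : hsnorm (sigma_hat sigma (Yhat k w) (mu k)
  - sigma_hat sigma (seg (tt k)) (dseg (tt k))) <= L * kapd k w.
Proof. by apply: lipS; [exact: moment|exact: fm|exact: chi_unit|exact: unit0]. Qed.

Lemma chi_grad_dist : hsnorm (gradb (Yhat k w) (mu k) theta0 - gradb (seg (tt k)) (dseg (tt k)) theta0)
  <= L * kapd k w.
Proof. by apply: lipg; [exact: moment|exact: fm]. Qed.

Let bound a c (x y : 'M[R]_(a, c)) : hsnorm (x - y) <= L * kapd k w -> hsnorm y <= A0 ->
  hsnorm x <= cmax.
Proof.
move=> h1 h2; apply: (le_trans (hsnorm_sub_le x y)); rewrite addrC; apply: lerD => //.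
by apply: (le_trans h1); rewrite ler_wpM2l // kapd_chi.
Qed.

Lemma chi_sigma : hsnorm (sigma (Yhat k w) (mu k)) <= cmax.
Proof. exact: bound chi_sigma_dist (sig0 (tk_in kn)). Qed.

Lemma chi_hat : hsnorm (sigma_hat sigma (Yhat k w) (mu k)) <= cmax.
Proof. exact: bound chi_hat_dist (hat0 (tk_in kn)). Qed.

Lemma chi_grad : hsnorm (gradb (Yhat k w) (mu k) theta0) <= cmax.
Proof. exact: bound chi_grad_dist (grad0 (tk_in kn)). Qed.

Lemma chi_Upsilon_dist : hsnorm (Upsilon gradb sigma (Yhat k w) (mu k) theta0
   - Upsilon gradb sigma (seg (tt k)) (dseg (tt k)) theta0) <= 3 * L * cmax ^+ 2 * kapd k w.
Proof.
rewrite /Upsilon.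
have g1 := chi_grad_dist; have s1 := chi_hat_dist; have r1 := chi_sigma_dist.
have g2 := chi_grad; have s2 := chi_hat; have A1 := A0_cmax.
have s3 := le_trans (hat0 (tk_in kn)) A1; have r3 := le_trans (sig0 (tk_in kn)) A1.
move: g1 s1 r1 g2 s2 s3 r3.
set G := gradb (Yhat k w) _ _; set G' := gradb (seg _) _ _.
set S := sigma_hat _ (Yhat k w) _; set S' := sigma_hat _ (seg _) _.
set V := sigma (Yhat k w) _; set V' := sigma (seg _) _; set e := L * kapd k w.
move=> g1 s1 r1 g2 s2 s3 r3.
have e0 : 0 <= e by rewrite mulr_ge0 ?kapd_ge0.
have c0 := cmax_ge0.
(* Telescoping, one factor changed at a time. *)
have -> : G^T *m S *m V - G'^T *m S' *m V' =
  (G - G')^T *m S' *m V' + G^T *m (S - S') *m V' + G^T *m S *m (V - V').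
  have -> : (G - G')^T = G^T - G'^T by exact: linearB.
  rewrite !mulmxBr !mulmxBl; move: (G^T *m S *m V) (G^T *m S *m V') (G^T *m S' *m V') (G'^T *m _ *m _).
  by move=> *; apply/matrixP => i j; rewrite !mxE; ring.
have prod3 a1 a2 a3 a4 (x : 'M[R]_(a1, a2)) (y : 'M[R]_(a2, a3)) (z : 'M[R]_(a3, a4)) (u v t : R) :
    hsnorm x <= u -> hsnorm y <= v -> hsnorm z <= t -> hsnorm (x *m y *m z) <= u * v * t.
  move=> hx hy hz; apply: (le_trans (hsnormM _ _)); apply: ler_pM; rewrite ?hsnorm_ge0 //.
  by apply: (le_trans (hsnormM _ _)); apply: ler_pM; rewrite ?hsnorm_ge0.
apply: (le_trans (hsnormD _ _)).
have -> : 3 * L * cmax ^+ 2 * kapd k w = e * cmax * cmax + cmax * e * cmax + cmax * cmax * e.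
  by rewrite /e; ring.
apply: lerD; last by apply: prod3; rewrite ?hsnorm_tr.
apply: (le_trans (hsnormD _ _)).
by apply: lerD; apply: prod3; rewrite ?hsnorm_tr.
Qed.

Lemma chi_Upsilon : hsnorm (Upsilon gradb sigma (Yhat k w) (mu k) theta0) <= cmax ^+ 3.
Proof.
have c0 := cmax_ge0; rewrite !exprS expr0 mulr1 mulrA.
apply: (le_trans (hsnormM _ _)); apply: ler_pM => //; last exact: chi_sigma.
apply: (le_trans (hsnormM _ _)); apply: ler_pM => //; last exact: chi_hat.
by rewrite hsnorm_tr; exact: chi_grad.
Qed.

Lemma chi_weight : hsnorm (sigma_hat sigma (Yhat k w) (mu k) *m sigma (Yhat k w) (mu k)) <= cmax ^+ 2.
Proof.
have c0 := cmax_ge0; rewrite expr2; apply: (le_trans (hsnormM _ _)).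
by apply: ler_pM => //; [exact: chi_hat|exact: chi_sigma].
Qed.

Definition clip : R := 2 * L * (kapmax + 2 * LX * T).

Let nrk := nrem theta0 b gradb (Yhat k w) (seg 0) (mu k) (dseg 0).

Lemma chi_nrem_lip theta theta' : closure Theta theta -> closure Theta theta' ->
  hsnorm (nrk theta - nrk theta') <= clip * hsnorm (theta - theta').
Proof.
move=> ct ct'; have z0 : 0 <= (0 : R) <= T by rewrite lexx ltW.
(* The comparison with the initial segment passes through the limit segment at the grid time, so the
   Lipschitz bound adds the truncated error and the total motion of the limit. *)
have e th : nrk th = nrem theta0 b gradb (Yhat k w) (seg (tt k)) (mu k) (dseg (tt k)) th
    + nrem theta0 b gradb (seg (tt k)) (seg 0) (dseg (tt k)) (dseg 0) th.
  by rewrite /nrk /nrem -scalerDr addrA subrK.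
rewrite !e opprD addrACA; apply: (le_trans (hsnormD _ _)).
have h1 := nrem_lip r0_gt0 cvTheta Theta0 derb L_ge0 liph (Yhat k w) (seg (tt k))
  (moment kn) (fm (seg (tt k))) ct ct'.
have h2 := nrem_lip r0_gt0 cvTheta Theta0 derb L_ge0 liph (seg (tt k)) (seg 0)
  (fm (seg (tt k))) (fm (seg 0)) ct ct'.
apply: (le_trans (lerD h1 h2)); rewrite -mulrDl; apply: ler_wpM2r => //.
have -> : clip = 2 * (L * kapmax) + 2 * (L * (2 * LX * T)) by rewrite /clip; ring.
apply: lerD; apply: ler_wpM2l => //; apply: ler_wpM2l => //.
  exact: kapd_chi.
apply: (le_trans (seg_kap r0_gt0 cX0 lipX (tk_in kn) z0)).
apply: ler_wpM2l; first exact: mulr_ge0.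
by case/andP: (tk_in kn) => t0 tT; rewrite subr0 ger0_norm.
Qed.

End on_chi.

Lemma clip_ge0 : 0 <= clip.
Proof.
apply: mulr_ge0; first exact: mulr_ge0.
apply: addr_ge0; first exact: kapmax_ge0.
by apply: mulr_ge0 (ltW T_gt0); exact: mulr_ge0.
Qed.

Let sigma_meas k (kn : (k < n)%N) :
  measurable_mx (O := g_sigma_algebraType (F (tt k))) (fun w => sigma (Yhat k w) (mu k)).
Proof. by move=> i j; exact: (cadapted kn i j lips). Qed.

Let hat_meas k (kn : (k < n)%N) :
  measurable_mx (O := g_sigma_algebraType (F (tt k))) (fun w => sigma_hat sigma (Yhat k w) (mu k)).
Proof.
by apply: measurable_invmx; apply: measurable_mxM; last apply: measurable_mxT; exact: sigma_meas.
Qed.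

Let grad_meas k (kn : (k < n)%N) :
  measurable_mx (O := g_sigma_algebraType (F (tt k))) (fun w => gradb (Yhat k w) (mu k) theta0).
Proof. by move=> i j; exact: (cadapted kn i j lipg). Qed.

Let rem_meas k (kn : (k < n)%N) theta : closure Theta theta ->
  measurable_mx (O := g_sigma_algebraType (F (tt k)))
    (fun w => rem theta0 b gradb (Yhat k w) (mu k) theta).
Proof.
move=> ct; apply: measurable_mxB; last first.
  by apply: measurable_mxM; [exact: grad_meas|exact: measurable_mx_cst].
apply: measurable_mxB => i j; first exact: (cadapted kn i j (lipb ct)).
exact: (cadapted kn i j lipb0).
Qed.

Let Ups_meas k (kn : (k < n)%N) :
  measurable_mx (O := g_sigma_algebraType (F (tt k)))
    (fun w => Upsilon gradb sigma (Yhat k w) (mu k) theta0).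
Proof.
apply: measurable_mxM; last exact: sigma_meas.
by apply: measurable_mxM; [apply: measurable_mxT; exact: grad_meas|exact: hat_meas].
Qed.

Definition weight (x : C) (nu : PC) := sigma_hat sigma x nu *m sigma x nu.

Let weight_meas k (kn : (k < n)%N) :
  measurable_mx (O := g_sigma_algebraType (F (tt k))) (fun w => weight (Yhat k w) (mu k)).
Proof. by apply: measurable_mxM; [exact: hat_meas|exact: sigma_meas]. Qed.

Definition zeta : O -> 'cV[R]_p :=
  mxsum B n delta (trunc (fun x nu => Upsilon gradb sigma x nu theta0)).

(** Receives the remainder at the initial segment: that remainder is deterministic and the same at
    every step, so it factors out of the stochastic sum and only a second moment of this vector is
    needed. *)
Definition mvec : O -> 'cV[R]_d := mxsum B n delta (trunc weight).

Definition noise_coef theta : nat -> O -> 'M[R]_(1, m) :=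
  trunc (fun x nu => (nrem theta0 b gradb x (seg 0) nu (dseg 0) theta)^T *m weight x nu).

Definition noise theta (w : O) : R := mxsum B n delta (noise_coef theta) w 0 0.

Lemma zeta_moment : intble P (fun w => hsnorm (zeta w) ^+ 2) /\
  Ex P (fun w => hsnorm (zeta w) ^+ 2) <= m%:R * (T * (cmax ^+ 3) ^+ 2).
Proof.
rewrite -nT; apply: (mxsum_bounded uF bB d0) => k.
  by move=> l i kn; apply: trunc_adapted => //; exact: Ups_meas.
by move=> w kn; apply: trunc_le; [exact: exprn_ge0 cmax_ge0|exact: chi_Upsilon].
Qed.

Lemma mvec_moment : intble P (fun w => hsnorm (mvec w) ^+ 2) /\
  Ex P (fun w => hsnorm (mvec w) ^+ 2) <= m%:R * (T * (cmax ^+ 2) ^+ 2).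
Proof.
rewrite -nT; apply: (mxsum_bounded uF bB d0) => k.
  by move=> l i kn; apply: trunc_adapted => //; exact: weight_meas.
by move=> w kn; apply: trunc_le; [exact: exprn_ge0 cmax_ge0|exact: chi_weight].
Qed.

(** What separates [zeta] from the sum of the deterministic integrand along the limit path, when
    nothing is truncated; its second moment is O(delta ^ 2 + eps ^ 2). *)
Definition zeta_diff : O -> 'cV[R]_p := mxsum B n delta (fun k w => (chi k w)%:R *:
  (Upsilon gradb sigma (Yhat k w) (mu k) theta0 - Upsilon gradb sigma (seg (tt k)) (dseg (tt k)) theta0)).

Lemma zeta_diff_moment : intble P (fun w => hsnorm (zeta_diff w) ^+ 2) /\
  Ex P (fun w => hsnorm (zeta_diff w) ^+ 2) <=
    m%:R * (T * ((3 * L * cmax ^+ 2) ^+ 2 * (8 * (gron + LX ^+ 2)))) * (delta ^+ 2 + eps ^+ 2).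
Proof.
set e := delta ^+ 2 + eps ^+ 2; set c := 3 * L * cmax ^+ 2.
have c0 : 0 <= c by apply: mulr_ge0 (sqr_ge0 cmax); exact: mulr_ge0.
rewrite /zeta_diff; set f : nat -> O -> 'M[R]_(p, m) := (X in mxsum _ _ _ X).
have fa k l i : (k < n)%N -> adapted (F (tt k)) (fun w => f k w l i).
  move=> kn; apply: (measurable_mxZ (chi_adapted kn)).
  by apply: measurable_mxB; [exact: Ups_meas|exact: measurable_mx_cst].
have fk k w : (k < n)%N -> hsnorm (f k w) <= c * kapd k w.
  move=> kn; rewrite /f; have [ck|_] := boolP (chi k w).
    by rewrite scale1r; exact: chi_Upsilon_dist.
  by rewrite scale0r hsnorm0 mulr_ge0 // kapd_ge0.
have f2 k l i : (k < n)%N -> sqint P (fun w => f k w l i).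
  move=> kn; have [sG Gm] := F_grid_sigma uF T_gt0 n_gt0 nT k.
  apply: (@sqint_le _ _ _ P _ (fun w => c * kapd k w)).
  - exact: adapted_measurable sG Gm (fa k l i kn).
  - by move=> w; apply: (le_trans (hsnorm_entry _ _ _)); exact: fk.
  apply: sqintZ; split; last exact: (Ex_kapd kn).1.
  have sd := dist_sqint uF r0_gt0 T_gt0 ode L_ge0 LX_ge0 A0_ge0 lipX eps01 n_gt0 M_gt0 nT Mr0
    Yinit Yinterp kn (good kn).
  by apply: measurable_funD; [exact: sd.1|exact: measurable_cst].
have [i1 E1] := mxsum_sqr uF bB d0 fa f2; split=> //; apply: (le_trans E1).
rewrite -[leRHS]mulrA; apply: ler_wpM2l => //.
have -> : T * (c ^+ 2 * (8 * (gron + LX ^+ 2))) * e = delta * \sum_(k < n) c ^+ 2 * (8 * (gron + LX ^+ 2) * e).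
  by rewrite sumr_const card_ord -[X in delta * X]mulr_natr -nT; ring.
apply: ler_wpM2l; first exact: ltW; apply: ler_sum => k _.
have kn := ltn_ord k; have [ik Ek] := Ex_kapd kn.
apply: (@le_trans _ _ (Ex P (fun w => c ^+ 2 * kapd k w ^+ 2))); last first.
  by rewrite ExZ // ler_wpM2l // sqr_ge0.
apply: Ex_le; last 2 first.
- exact: intbleZ.
- move=> w; rewrite -exprMn; have h := fk k w kn.
  by apply: lerXn2r => //; rewrite nnegrE //; exact: le_trans h.
rewrite (_ : (fun w => _) = (fun w => \sum_l \sum_i f k w l i ^+ 2)); last first.
  by apply: funext => w; exact: sqr_hsnorm.
by apply: intble_sum => l; apply: intble_sum => i; exact: (f2 k l i kn).2.
Qed.

Lemma nrem_theta0 x y nu nu' : nrem theta0 b gradb x y nu nu' theta0 = 0.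
Proof. by rewrite /nrem !rem0 subr0 scaler0. Qed.

Lemma noise_theta0 w : noise theta0 w = 0.
Proof.
rewrite /noise /mxsum big1 ?mxE // => k _.
by rewrite /noise_coef /trunc nrem_theta0 trmx0 mul0mx scaler0 mul0mx.
Qed.

Lemma noise_coef_adapted theta k l i : closure Theta theta -> (k < n)%N ->
  adapted (F (tt k)) (fun w => noise_coef theta k w l i).
Proof.
move=> ct kn; apply: trunc_adapted => //; apply: measurable_mxM; last exact: weight_meas.
apply: measurable_mxT; apply: measurable_mxZ; first exact: measurable_cst.
by apply: measurable_mxB; [exact: rem_meas|exact: measurable_mx_cst].
Qed.

Lemma measurable_noise_theta theta : closure Theta theta -> measurable_fun setT (noise theta).
Proof.
move=> ct; apply: (measurable_mxsum uF bB d0) => k l i kn; exact: noise_coef_adapted.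
Qed.

Definition cnoise : R := clip * cmax ^+ 2 + 1.

Lemma cnoise_gt0 : 0 < cnoise.
Proof. by rewrite ltr_wpDl // mulr_ge0 ?clip_ge0 // sqr_ge0. Qed.

Lemma noise_coef_lip theta theta' k w : closure Theta theta -> closure Theta theta' -> (k < n)%N ->
  hsnorm (noise_coef theta k w - noise_coef theta' k w) <= cnoise * hsnorm (theta - theta').
Proof.
move=> ct ct' kn; rewrite /noise_coef /trunc -scalerBr -mulmxBl.
have [ck|_] := boolP (chi k w); last first.
  by rewrite scale0r hsnorm0 mulr_ge0 // ltW // cnoise_gt0.
rewrite scale1r; apply: (le_trans (hsnormM _ _)).
rewrite /cnoise mulrDl mul1r; apply: ler_wpDr => //.
rewrite mulrAC; apply: ler_pM => //; last exact: chi_weight.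
by rewrite -linearB /= hsnorm_tr; exact: chi_nrem_lip.
Qed.

Lemma noiseB theta theta' w : noise theta w - noise theta' w =
  mxsum B n delta (fun k w => noise_coef theta k w - noise_coef theta' k w) w 0 0.
Proof.
rewrite /noise /mxsum; under [in RHS]eq_bigr do rewrite mulmxBl.
by rewrite sumrB !mxE.
Qed.

(** A pathwise constant without quantitative control, as [chaining] asks for to leave the countable
    net. *)
Lemma noise_lipschitz w : exists K, forall theta theta',
  closure Theta theta -> closure Theta theta' ->
  `|noise theta w - noise theta' w| <= K * hsnorm (theta - theta').
Proof.
exists (\sum_(k < n) cnoise * hsnorm (grid_incr B delta k w)) => theta theta' ct ct'.
rewrite noiseB; apply: (le_trans (hsnorm_entry _ _ _)); apply: (le_trans (hsnorm_sum _ _ _)).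
rewrite big_distrl /=; apply: ler_sum => k _; apply: (le_trans (hsnormM _ _)).
by rewrite mulrAC; apply: ler_wpM2r => //; exact: noise_coef_lip.
Qed.

Lemma noise_tail theta theta' rho u : closure Theta theta -> closure Theta theta' ->
  0 < rho -> hsnorm (theta - theta') <= rho ->
  (P [set w | u <= `|noise theta w - noise theta' w|]%R <=
    (2 * m%:R * expR (T / 2) * expR (- (u / (m%:R * cnoise * rho))))%:E)%E.
Proof.
move=> ct ct' rho0 hr.
have := @mxsum_tail _ _ _ P F m B uF bB n delta T m_gt0 d0 nT
  (fun k w => noise_coef theta k w - noise_coef theta' k w) (cnoise * rho) u.
rewrite mulr_gt0 ?cnoise_gt0 // [m%:R * (_ * _)]mulrA => /(_ isT).
move=> /(_ _)/wrap[].
  by move=> k l i kn; apply: measurable_mxB => l' i'; exact: noise_coef_adapted.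
move=> /(_ _)/wrap[].
  move=> k w kn; apply: (le_trans (noise_coef_lip _ _ _ _)) => //.
  by rewrite ler_wpM2l // ltW // cnoise_gt0.
rewrite (_ : [set w | u <= `|mxsum _ _ _ _ w _ _|] = [set w | u <= `|noise theta w - noise theta' w|]) //.
by apply/seteqP; split=> w /=; rewrite noiseB.
Qed.

Section decomposition.
Variable w : O.
Hypothesis chi_all : forall k, (k < n)%N -> chi k w.

Lemma zeta_split : zeta w =
  zeta_diff w + mxsum B n delta (fun k _ => Upsilon gradb sigma (seg (tt k)) (dseg (tt k)) theta0) w.
Proof.
rewrite -big_split /=; apply: eq_bigr => k _.
by rewrite /trunc chi_all // !scale1r mulmxBl subrK.
Qed.

Definition jump theta : R := delta * \sum_(k < n) form (sigma_hat sigma (Yhat k w) (mu k))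
  (Lambda b (Yhat k w) (mu k) theta theta0) (Lambda b (Yhat k w) (mu k) theta theta0).

(** When nothing is truncated the identity is exact. The residual is [eps] times the noise plus
    [delta] times [Lambda], and [Lambda] vanishes at [theta0]; so the squares of the noise cancel
    and the cross terms remain. *)
Lemma contrast_diff theta :
  contrast b sigma T eps n Y Yhat theta w - contrast b sigma T eps n Y Yhat theta0 w =
  eps ^- 2 * (jump theta - 2 * eps * (((theta - theta0)^T *m zeta w) 0 0
    + ((rem theta0 b gradb (seg 0) (dseg 0) theta)^T *m mvec w) 0 0
    + hsnorm (theta - theta0) * noise theta w)).
Proof.
have e0 : eps != 0 by rewrite gt_eqF //; case/andP: eps01.
have dn : delta != 0 by rewrite gt_eqF.
have Td : T / n%:R = delta by rewrite -nT mulrC mulKf // pnatr_eq0 -lt0n.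
rewrite /contrast Td -mulrBr -sumrB.
pose G k := grid_incr B delta k w.
pose V k := sigma (Yhat k w) (mu k) *m G k.
pose Lm k := Lambda b (Yhat k w) (mu k) theta theta0.
pose S k := sigma_hat sigma (Yhat k w) (mu k).
have res th k : (k < n)%N -> residual b delta Y Yhat k th w =
    eps *: V k + delta *: Lambda b (Yhat k w) (mu k) th theta0.
  move=> kn; rewrite /residual Ystep // /V /G /grid_incr /Lambda.
  by apply/matrixP => i j; rewrite !mxE; ring.
have term k : (k < n)%N -> form (S k) (residual b delta Y Yhat k theta w) (residual b delta Y Yhat k theta w)
   - form (S k) (residual b delta Y Yhat k theta0 w) (residual b delta Y Yhat k theta0 w) =
   delta ^+ 2 * form (S k) (Lm k) (Lm k) + 2 * delta * eps * form (S k) (Lm k) (V k).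
  move=> kn; have sy : form (S k) (V k) (Lm k) = form (S k) (Lm k) (V k).
    by apply: form_sym; exact: inv_gram_sym.
  have L0 : Lambda b (Yhat k w) (mu k) theta0 theta0 = 0 by exact: subrr.
  rewrite !res // L0 scaler0 addr0 -/(Lm k); move: (Lm k) sy => l sy.
  by rewrite formDl !formDr !formZl !formZr sy; ring.
rewrite (eq_bigr (fun k : 'I_n => delta ^+ 2 * form (S k) (Lm k) (Lm k)
    + 2 * delta * eps * form (S k) (Lm k) (V k))); last by move=> k _; exact: term.
rewrite big_split /= -!mulr_sumr.
have cross : \sum_(k < n) form (S k) (Lm k) (V k) = - (((theta - theta0)^T *m zeta w) 0 0
    + ((rem theta0 b gradb (seg 0) (dseg 0) theta)^T *m mvec w) 0 0
    + hsnorm (theta - theta0) * noise theta w).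
  rewrite /zeta /mvec /noise /mxsum !mulmx_sumr !summxE mulr_sumr -!big_split -sumrN /=.
  apply: eq_bigr => k _; rewrite /noise_coef /trunc chi_all // !scale1r.
  rewrite /form /Lm (LambdaE theta0 b gradb).
  have -> : rem theta0 b gradb (Yhat k w) (mu k) theta = rem theta0 b gradb (seg 0) (dseg 0) theta
      + hsnorm (theta - theta0) *: nrem theta0 b gradb (Yhat k w) (seg 0) (mu k) (dseg 0) theta.
    by rewrite -nremE addrC subrK.
  exact: cross_term.
rewrite cross /jump -/S -/Lm; field.
by rewrite e0.
Qed.

End decomposition.

End truncated_scheme.

(** * Stability of minimizers *)

Section minimizers.
Context {R : realType} {d p : nat}.
Variables (theta0 : 'cV[R]_p) (J N : 'cV[R]_p -> R) (r : 'cV[R]_p -> 'cV[R]_d).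
Variables (zeta : 'cV[R]_p) (mv : 'cV[R]_d) (eps : R).
Hypothesis eps_gt0 : 0 < eps.

Definition linear_part theta : R := ((theta - theta0)^T *m zeta) 0 0 + ((r theta)^T *m mv) 0 0
  + hsnorm (theta - theta0) * N theta.

(** [eps ^ 2] times the difference of the contrasts at [theta] and [theta0], so that minimizing the
    contrast is minimizing [gap]. *)
Definition gap theta : R := J theta - 2 * eps * linear_part theta.

Lemma linear_part_le theta (A C K : R) : hsnorm zeta <= A -> hsnorm mv <= A ->
  hsnorm (r theta) <= C * hsnorm (theta - theta0) -> `|N theta| <= K ->
  `|linear_part theta| <= (A + C * A + K) * hsnorm (theta - theta0).
Proof.
set h := hsnorm (theta - theta0) => zA mA rC NK.
have h0 : 0 <= h by exact: hsnorm_ge0.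
have h1 := hsnorm_dot (theta - theta0) zeta; have h2 := hsnorm_dot (r theta) mv.
have h3 : h * hsnorm zeta <= h * A by exact: ler_wpM2l.
have h4 : hsnorm (r theta) * hsnorm mv <= C * h * A by apply: ler_pM.
have h5 : h * `|N theta| <= h * K by exact: ler_wpM2l.
apply: (le_trans (ler_normD _ _)); rewrite mulrDl; apply: lerD; last first.
  by rewrite normrM ger0_norm // [leRHS]mulrC.
apply: (le_trans (ler_normD _ _)); rewrite mulrDl; apply: lerD.
  by rewrite mulrC; apply: le_trans h3.
by rewrite mulrAC; apply: le_trans h4.
Qed.

(** With [B] the constant of [linear_part_le], a nonpositive gap gives
    [c / 2 * h ^ 2 <= J <= 2 * eps * B * h]; one factor [h] cancels. The case [h = 0] is
    separate. *)
Lemma minimizer_rate theta (Xi c A C K : R) : 0 < c -> 0 <= C ->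
  c * hsnorm (theta - theta0) ^+ 2 <= Xi ->
  `|J theta - Xi| <= c / 2 * hsnorm (theta - theta0) ^+ 2 ->
  hsnorm zeta <= A -> hsnorm mv <= A ->
  hsnorm (r theta) <= C * hsnorm (theta - theta0) -> `|N theta| <= K ->
  gap theta <= 0 ->
  hsnorm (theta - theta0) <= eps * (4 * (A + C * A + K) / c).
Proof.
move=> c0 C0 cX JX zA mA rC NK; have := linear_part_le zA mA rC NK.
rewrite /gap; move: (linear_part theta) => X.
set B := A + C * A + K; set h := hsnorm (theta - theta0) in cX JX * => XB g.
have h0 : 0 <= h by exact: hsnorm_ge0.
have [hz|hp] := eqVneq h 0.
  rewrite hz; have B0 : 0 <= B.
    have A0 : 0 <= A := le_trans (hsnorm_ge0 _) zA.
    have K0 : 0 <= K := le_trans (normr_ge0 _) NK.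
    by rewrite /B !addr_ge0 // mulr_ge0.
  by rewrite mulr_ge0 ?(ltW eps_gt0) // divr_ge0 ?mulr_ge0 ?(ltW c0).
have hp' : 0 < h by rewrite lt_neqAle eq_sym hp h0.
rewrite -(ler_pM2l hp') -(ler_pM2l c0).
have -> : c * (h * (eps * (4 * B / c))) = 4 * eps * (B * h) by field; rewrite gt_eqF.
have XB' : X <= B * h by apply: le_trans XB; exact: ler_norm.
have := ler_wpM2l (ltW eps_gt0) XB'; move: JX; rewrite ler_norml => /andP[j1 _].
by rewrite -expr2; lra.
Qed.

Variables (A : 'M[R]_p).
Hypothesis A_sym : A^T = A.

(** At scale [eps] the gap is [eps ^ 2] times [form A x x - 2 * form A x v], up to an error
    proportional to [tau]. Completing the square, its values at [u] and at [v] differ by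
    [form A (u - v) (u - v)], so coercivity bounds [u - v]. *)
Lemma minimizer_local u v (c tau a K : R) : 0 <= tau -> 0 <= a -> 0 <= K ->
  (forall x, c * hsnorm x ^+ 2 <= form A x x) ->
  A *m v = zeta -> hsnorm mv <= a ->
  (forall x, x = u \/ x = v -> let theta := theta0 + eps *: x in [/\ hsnorm x <= K,
     `|J theta - form A (theta - theta0) (theta - theta0)| <= tau * hsnorm (theta - theta0) ^+ 2,
     hsnorm (r theta) <= tau * hsnorm (theta - theta0) & `|N theta| <= tau]) ->
  gap (theta0 + eps *: u) <= gap (theta0 + eps *: v) ->
  c * hsnorm (u - v) ^+ 2 <= 2 * tau * (K ^+ 2 + 2 * K * a + 2 * K).
Proof.
move=> tau0 a0 K0 cA Av ma hx g.
have key x : x = u \/ x = v ->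
    `|gap (theta0 + eps *: x) - eps ^+ 2 * (form A x x - 2 * form A x v)| <=
     eps ^+ 2 * (tau * (K ^+ 2 + 2 * K * a + 2 * K)).
  move=> /hx [xK]; rewrite /gap /linear_part.
  have -> : theta0 + eps *: x - theta0 = eps *: x by rewrite addrC addKr.
  have -> : ((eps *: x)^T *m zeta) 0 0 = eps * form A x v.
    by rewrite -Av /form linearZ /= -scalemxAl mxE mulmxA.
  rewrite hsnormZ (gtr0_norm eps_gt0) formZl formZr.
  have h2 := hsnorm_dot (r (theta0 + eps *: x)) mv.
  move: (J _) (N _) (form A x x) (form A x v) h2 => j q f1 f2 h2 h3 h4 h5.
  have x0 := hsnorm_ge0 x.
  have h6 : hsnorm (r (theta0 + eps *: x)) * hsnorm mv <= tau * (eps * K) * a.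
    apply: ler_pM => //; apply: (le_trans h4); apply: ler_wpM2l => //.
    by apply: ler_wpM2l => //; exact: ltW.
  have h7 : `|eps * hsnorm x * q| <= eps * K * tau.
    rewrite normrM ger0_norm; last by rewrite mulr_ge0 // ltW.
    by apply: ler_pM => //; [rewrite mulr_ge0 // ltW|apply: ler_wpM2l => //; exact: ltW].
  have h8 : tau * (eps * hsnorm x) ^+ 2 <= tau * (eps * K) ^+ 2.
    apply: ler_wpM2l => //; rewrite lerXn2r ?nnegrE ?mulr_ge0 ?(ltW eps_gt0) //.
    by apply: ler_wpM2l => //; exact: ltW.
  have h9 := le_trans h3 h8; have h10 := le_trans h2 h6.
  move: h9 h10 h7; set y := ((r _)^T *m mv) 0 0; set z := eps * hsnorm x * q => h9 h10 h7.
  have -> : j - 2 * eps * (eps * f2 + y + z) - eps ^+ 2 * (f1 - 2 * f2) =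
    (j - eps * (eps * f1)) - 2 * (eps * (y + z)) by ring.
  have -> : eps ^+ 2 * (tau * (K ^+ 2 + 2 * K * a + 2 * K)) = tau * (eps * K) ^+ 2 +
    2 * (eps * (tau * (eps * K) * a + eps * K * tau)) by ring.
  apply: (le_trans (ler_normB _ _)); apply: lerD => //.
  rewrite normrM (ger0_norm (ler0n _ 2)); apply: ler_wpM2l => //.
  rewrite normrM gtr0_norm //; apply: ler_wpM2l; first exact: ltW.
  by apply: (le_trans (ler_normD _ _)); apply: lerD.
have e2 : 0 < eps ^+ 2 by rewrite exprn_gt0.
apply: (le_trans (cA _)).
have := key u (or_introl erefl); have := key v (or_intror erefl).
move: g; move: (gap _) (gap _) (K ^+ 2 + _ + _) => g1 g2 E g12.
rewrite !ler_norml => /andP[_ k1] /andP[k2 _].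
rewrite -(ler_pM2l e2) formBl !formBr (form_sym v u A_sym); lra.
Qed.

End minimizers.

(** * Deterministic stability of the rescaled minimizer *)

Section stability.
Context {R : realType} {r0 : R} {d m p : nat}.
Local Notation C := (cpath r0 d).
Local Notation PC := (probability C R).
Variables (Theta : set 'cV[R]_p) (theta0 : 'cV[R]_p).
Variables (b : C -> PC -> 'cV[R]_p -> 'cV[R]_d) (sigma : C -> PC -> 'M[R]_(d, m)).
Variable gradb : C -> PC -> 'cV[R]_p -> 'M[R]_(d, p).
Variable hessb : C -> PC -> 'cV[R]_p -> 'I_p -> 'M[R]_(p, d).
Variables (T : R) (X0 : R -> 'cV[R]_d).
Hypotheses (r0_gt0 : 0 < r0) (T_gt0 : 0 < T).
Hypothesis cvTheta : convex_set (Theta : set (convex_lmodType 'cV[R]_p)).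
Hypotheses (Theta0 : Theta theta0) (bdTheta : bounded_set Theta).
Hypothesis derb : theta_derivatives Theta b gradb hessb.
Variables (L LX : R).
Hypotheses (L_ge0 : 0 <= L) (LX_ge0 : 0 <= LX).
Hypothesis lipb : forall theta, closure Theta theta -> lip_coef (fun x mu => b x mu theta) L.
Hypothesis lipg : lip_coef (fun x mu => gradb x mu theta0) L.
Hypothesis liph : forall (x y : C) (mu nu : PC), finite_moment2 mu -> finite_moment2 nu ->
  forall theta, closure Theta theta ->
  block_norm (fun k => hessb x mu theta k - hessb y nu theta k) <= L * (path_dist x y + W2 mu nu).
Hypothesis lipS : forall (x y : C) (mu nu : PC), finite_moment2 mu -> finite_moment2 nu ->
  sigma2 sigma x mu \in unitmx -> sigma2 sigma y nu \in unitmx ->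
  hsnorm (sigma_hat sigma x mu - sigma_hat sigma y nu) <= L * (path_dist x y + W2 mu nu).
Hypothesis unit0 : forall x : C, sigma2 sigma x (dirac_law x) \in unitmx.
Hypothesis cX0 : {within `[- r0, T], continuous X0}.
Hypothesis lipX : forall s t, - r0 <= s <= T -> - r0 <= t <= T ->
  hsnorm (X0 s - X0 t) <= LX * `|s - t|.

Local Notation seg := (segment r0 X0).
Local Notation dseg t := (dirac_law (seg t)).
Hypothesis openTheta : open Theta.
Hypothesis Xi_gt0 : forall theta, closure Theta theta -> theta <> theta0 ->
  0 < Xi b sigma theta0 T X0 theta.
Local Notation Imat := (Imx gradb sigma T X0 theta0).
Hypothesis I_unit : Imat \in unitmx.
Local Notation base_rem := (rem theta0 b gradb (seg 0) (dseg 0)).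
Local Notation jump_at x mu n delta := (fun theta => delta * \sum_(k < n)
  form (sigma_hat sigma (x k) (mu k)) (Lambda b (x k) (mu k) theta theta0)
    (Lambda b (x k) (mu k) theta theta0)).

Lemma gap_theta0 (x : nat -> C) (mu : nat -> PC) n delta N zeta mv eps :
  gap theta0 (jump_at x mu n delta) N base_rem zeta mv eps theta0 = 0.
Proof.
rewrite /gap.
have -> : linear_part theta0 N base_rem zeta mv theta0 = 0.
  by rewrite /linear_part subrr hsnorm0 mul0r rem0 !trmx0 !mul0mx !mxE !addr0.
rewrite mulr0 subr0.
by rewrite big1 ?mulr0 // => k _; rewrite /Lambda subrr /form mulmx0 mxE.
Qed.

(** The order of the quantifiers follows the later use: [tau] decides how small the noise must be,
    chaining answers with the radius [rhoN] on which it is so small, and only then are the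
    thresholds on [eps] and on the scheme error chosen. *)
Lemma minimizer_stability (eta A K : R) : 0 < eta -> 0 <= A -> 0 <= K ->
  exists tau kz : R, [/\ 0 < tau, 0 < kz & forall rhoN : R, 0 < rhoN ->
  exists s1 kap : R, [/\ 0 < s1, 0 < kap <= 1 &
  forall (eps delta : R) (n : nat) (x : nat -> C) (mu : nat -> PC) (N : 'cV[R]_p -> R)
    (zeta z : 'cV[R]_p) (mv : 'cV[R]_d) (that : 'cV[R]_p),
    0 < eps < s1 -> 0 < delta -> n%:R * delta = T ->
    (forall k, (k < n)%N -> [/\ finite_moment2 (mu k), sigma2 sigma (x k) (mu k) \in unitmx &
      path_dist (x k) (seg (k%:R * delta)) + W2 (mu k) (dseg (k%:R * delta)) + 2 * LX * delta
        <= kap]) ->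
    hsnorm zeta <= A -> hsnorm mv <= A ->
    (forall theta, closure Theta theta -> `|N theta| <= K) ->
    (forall theta, closure Theta theta -> hsnorm (theta - theta0) <= rhoN -> `|N theta| <= tau) ->
    hsnorm (zeta - z) <= kz -> Theta that ->
    (forall theta, Theta theta ->
      gap theta0 (jump_at x mu n delta) N base_rem zeta mv eps that <=
      gap theta0 (jump_at x mu n delta) N base_rem zeta mv eps theta) ->
    hsnorm (eps^-1 *: (that - theta0) - invmx Imat *m z) <= eta]].
Proof.
move=> eta0 A_ge0 K_ge0; have T0 := ltW T_gt0.
have z0 : 0 <= (0 : R) <= T by rewrite lexx T0.
have Isym := Imx_sym theta0 sigma gradb T X0.
have Ige0 := Imx_ge0 r0_gt0 T_gt0 L_ge0 LX_ge0 lipg lipS unit0 cX0 lipX.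
have [c1 c10 c1P] := form_coercive Isym Ige0 I_unit.
have [c c0 cP] := Xi_coercive r0_gt0 T_gt0 cvTheta Theta0 bdTheta derb L_ge0 LX_ge0 lipb lipg
  liph lipS unit0 cX0 lipX Xi_gt0 I_unit.
have [C C0 CP] := rem_seg_bound r0_gt0 T_gt0 cvTheta Theta0 bdTheta derb L_ge0 LX_ge0 liph cX0 lipX.
have [cR cR0 cRP] := contrast_riemann r0_gt0 T_gt0 cvTheta Theta0 bdTheta derb L_ge0 LX_ge0 lipb
  lipg liph lipS unit0 cX0 lipX.
pose iI := hsnorm (invmx Imat); have iI0 : 0 <= iI by exact: hsnorm_ge0.
(* The constant of [minimizer_rate]. *)
pose K2 := 4 * (A + C * A + K) / c.
have K20 : 0 <= K2.
  by rewrite divr_ge0 ?(ltW c0) // mulr_ge0 // !addr_ge0 // mulr_ge0 // ltW.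
(* Bounds both the rescaled minimizer and the candidate [invmx Imat *m zeta]; the 1 allows the
   division by [K3]. *)
pose K3 := K2 + iI * A + 1.
have K31 : 1 <= K3 by rewrite lerDr addr_ge0 // mulr_ge0.
have K30 : 0 < K3 := lt_le_trans ltr01 K31.
pose E := K3 ^+ 2 + 2 * K3 * A + 2 * K3.
have E0 : 0 < E.
  by rewrite ltr_wpDl ?mulr_gt0 // addr_ge0 ?sqr_ge0 // !mulr_ge0 // ltW.
(* Makes the bound of [minimizer_local] equal to [c1 * (eta / 2) ^+ 2]; the other half of [eta] is
   spent on replacing [zeta] by [z]. *)
pose tau := c1 * (eta / 2) ^+ 2 / (2 * E).
have tau0 : 0 < tau by rewrite divr_gt0 ?mulr_gt0 ?exprn_gt0 ?divr_gt0.
pose kz := eta / 2 / (iI + 1).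
have iI1 : 0 < iI + 1 by rewrite ltr_wpDl.
exists tau, kz; split=> //; first by rewrite !divr_gt0.
move=> rhoN rhoN0.
have tau2 : 0 < tau / 2 by rewrite divr_gt0.
have [r1 r10 r1P] := Xi_expansion r0_gt0 T_gt0 cvTheta Theta0 derb L_ge0 LX_ge0 lipb lipg
  liph lipS unit0 cX0 lipX tau2.
have [r2 r20 r2P] := rem_seg_small r0_gt0 T_gt0 cvTheta Theta0 derb L_ge0 LX_ge0 liph cX0 lipX tau0.
have [r3 r30 r3P] : exists2 e : R, 0 < e & forall y, hsnorm (y - theta0) < e -> Theta y.
  by apply: nbhs_hsnormP; exact: open_nbhs_nbhs.
pose rho := Num.min (Num.min r1 r2) (Num.min r3 rhoN).
have rho0 : 0 < rho by rewrite !lt_min r10 r20 r30.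
pose kap := Num.min 1 (Num.min (c / 2 / cR) (tau / 2 / cR)).
have kap0 : 0 < kap by rewrite !lt_min ltr01 /=; apply/andP; split; apply: divr_gt0 => //; exact: divr_gt0.
exists (rho / K3), kap; split; [exact: divr_gt0|by rewrite kap0 ge_min lexx|].
move=> eps delta n x mu N zeta z mv that /andP[e0 es] d0 nT good zA mA NK Ntau zz Tth min.
have kap1 : kap <= 1 by rewrite ge_min lexx.
have cth := subset_closure Tth.
set J := jump_at x mu n delta in min *.
have JX th : closure Theta th -> `|J th - Xi b sigma theta0 T X0 th| <=
    cR * kap * hsnorm (th - theta0) ^+ 2 by exact: (cRP _ _ _ _ _ d0 nT kap1 good).
have kc : cR * kap <= c / 2.
  by rewrite mulrC -ler_pdivlMr // !ge_min lexx orbT.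
have kt : cR * kap <= tau / 2.
  by rewrite mulrC -ler_pdivlMr // !ge_min lexx !orbT.
have g0 : gap theta0 J N base_rem zeta mv eps that <= 0.
  have e := gap_theta0 x mu n delta N zeta mv eps; rewrite -/J in e.
  by apply: (le_trans (min _ Theta0)); rewrite e.
have rate : hsnorm (that - theta0) <= eps * K2.
  apply: (minimizer_rate e0 c0 (ltW C0) (cP _ cth) _ zA mA (CP _ _ z0 cth) (NK _ cth) g0).
  by apply: (le_trans (JX _ cth)); apply: ler_wpM2r => //; exact: sqr_ge0.
pose u := eps^-1 *: (that - theta0); pose v := invmx Imat *m zeta.
have uE : theta0 + eps *: u = that.
  by rewrite /u scalerA divff ?gt_eqF // scale1r addrC subrK.
have uK : hsnorm u <= K3.
  rewrite /u hsnormZ normfV gtr0_norm // ler_pdivrMl //; apply: (le_trans rate).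
  by apply: ler_wpM2l; [exact: ltW|rewrite /K3 -addrA lerDl addr_ge0 // mulr_ge0].
have vK : hsnorm v <= K3.
  apply: (le_trans (hsnormM _ _)).
  apply: (@le_trans _ _ (iI * A)); first exact: ler_wpM2l.
  by rewrite /K3 addrAC lerDr addr_ge0.
have near y : hsnorm y <= K3 -> hsnorm (theta0 + eps *: y - theta0) < rho.
  move=> yK; rewrite addrC addKr hsnormZ gtr0_norm //.
  apply: (@le_lt_trans _ _ (eps * K3)); first by apply: ler_wpM2l => //; exact: ltW.
  by rewrite -ltr_pdivlMr.
(* The competitor must lie in [Theta] for minimality to apply to it; this holds for small [eps]
   because [Theta] is open. *)
have vT : Theta (theta0 + eps *: v).
  by apply: r3P; have := near _ vK; rewrite !lt_min => /andP[_ /andP[]].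
have main : c1 * hsnorm (u - v) ^+ 2 <= 2 * tau * (K3 ^+ 2 + 2 * K3 * A + 2 * K3).
  apply: (minimizer_local (theta0 := theta0) (J := J) (N := N) (r := base_rem) e0 Isym (ltW tau0) A_ge0 (ltW K30) c1P
    (zeta := zeta) (mv := mv)) => //; first by rewrite mulKVmx.
    move=> y yuv th.
    have yK : hsnorm y <= K3 by case: yuv => ->.
    have cy : closure Theta th.
      by apply: subset_closure; rewrite /th; case: yuv => ->; rewrite ?uE //.
    have := near _ yK; rewrite -/th !lt_min => /andP[/andP[y1 y2] /andP[_ y3]].
    split=> //; [|exact: r2P|by apply: Ntau => //; exact: ltW].
    have h1 := JX _ cy; have h2 := r1P _ cy y1.
    have h3 : cR * kap * hsnorm (th - theta0) ^+ 2 <= tau / 2 * hsnorm (th - theta0) ^+ 2.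
      by apply: ler_wpM2r => //; exact: sqr_ge0.
    rewrite -(subrKA (Xi b sigma theta0 T X0 th)); apply: (le_trans (ler_normD _ _)).
    by rewrite [tau]splitr mulrDl; apply: lerD => //; exact: le_trans h1 h3.
  by rewrite uE; exact: min.
have uv : hsnorm (u - v) <= eta / 2.
  rewrite -(@ler_pXn2r _ 2) ?nnegrE ?divr_ge0 ?(ltW eta0) //.
  rewrite -(ler_pM2l c10); apply: (le_trans main).
  have -> : 2 * tau * (K3 ^+ 2 + 2 * K3 * A + 2 * K3) = tau * (2 * E) by rewrite /E; ring.
  by rewrite /tau divfK // mulf_neq0 ?gt_eqF.
rewrite -/u -(subrKA v); apply: (le_trans (hsnormD _ _)).
rewrite [leRHS]splitr; apply: lerD => //.
rewrite /v -mulmxBr; apply: (le_trans (hsnormM _ _)).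
apply: (@le_trans _ _ (iI * kz)); first exact: ler_wpM2l.
rewrite /kz mulrCA -[leRHS]mulr1; apply: ler_wpM2l; first by rewrite divr_ge0 // ltW.
by rewrite ler_pdivrMr // mul1r lerDl.
Qed.

End stability.

(** * Asymptotics of the estimator *)

Lemma small_sqr {R : realType} (C t : R) : 0 <= C -> 0 < t -> exists2 s : R, 0 < s &
  forall x y, 0 <= x -> 0 <= y -> x < s -> y < s -> C * (x ^+ 2 + y ^+ 2) <= t.
Proof.
move=> C0 t0; have c0 : 0 < 2 * C + 1 by rewrite ltr_wpDl // mulr_ge0.
exists (Num.min 1 (t / (2 * C + 1))); first by rewrite lt_min ltr01 divr_gt0.
move=> x y x0 y0; rewrite !lt_min !ltr_pdivlMr // => /andP[x1 xt] /andP[y1 yt].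
have hx : C * x ^+ 2 <= C * x by rewrite ler_wpM2l // expr2 ler_piMl // ltW.
have hy : C * y ^+ 2 <= C * y by rewrite ler_wpM2l // expr2 ler_piMl // ltW.
have := mulr_ge0 C0 x0; have := mulr_ge0 C0 y0; lra.
Qed.

(** Hypothesis and conclusion on the second set have the same paired form, so that the lemma can be
    applied repeatedly to a nested union. *)
Lemma probability_setU {d} {O : measurableType d} {R : realType} (P : probability O R)
    (A B : set O) (a b : R) : measurable A -> (P A <= a%:E)%E ->
  (P B <= b%:E)%E /\ measurable B -> (P (A `|` B) <= (a + b)%:E)%E /\ measurable (A `|` B).
Proof.
move=> mA PA [PB mB]; split; last exact: measurableU.
by apply: (le_trans (measureU2 _ _ _)) => //; rewrite EFinD; exact: leeD.
Qed.

Lemma entry_sub_le {R : realType} {p : nat} (x y : 'cV[R]_p) i :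
  `|x i 0 - y i 0| <= hsnorm (x - y).
Proof. by have := hsnorm_entry (x - y) i 0; rewrite !mxE. Qed.

(** The 0 is for the null set, the six equal parts for the six events of [estimator_deviation]. *)
Lemma split_six {R : realType} (x : R) :
  x = 0 + (x / 6 + (x / 6 + (x / 6 + (x / 6 + (x / 6 + x / 6))))).
Proof. lra. Qed.

Lemma quarter_le1 {R : realType} (x : R) : x <= 1 -> x / 4 <= 1.
Proof. by move=> x1; rewrite ler_pdivrMr //; lra. Qed.

Lemma half_sum_le {R : realType} (a e w k l t : R) : a <= e + l * t + w -> e <= k / 4 ->
  w <= k / 4 -> 0 <= t -> t * (3 * l + 1) < k / 2 -> a + 2 * l * t <= k.
Proof. lra. Qed.

Section consistency.
Context {R : realType} {r0 : R} {d m p : nat}.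
Context {dO : measure_display} {O : measurableType dO} (P : probability O R).
Local Notation C := (cpath r0 d).
Local Notation PC := (probability C R).
Variables (F : R -> set (set O)) (B : R -> O -> 'cV[R]_m).
Hypotheses (uF : usual_filtration P F) (bB : brownian P F B).
Variables (Theta : set 'cV[R]_p) (theta0 : 'cV[R]_p).
Variables (b : C -> PC -> 'cV[R]_p -> 'cV[R]_d) (sigma : C -> PC -> 'M[R]_(d, m)).
Variable gradb : C -> PC -> 'cV[R]_p -> 'M[R]_(d, p).
Variable hessb : C -> PC -> 'cV[R]_p -> 'I_p -> 'M[R]_(p, d).
Variables (T : R) (xi : C) (X0 : R -> 'cV[R]_d).
Hypotheses (r0_gt0 : 0 < r0) (T_gt0 : 0 < T) (m_gt0 : (0 < m)%N) (p_gt0 : (0 < p)%N).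
Hypothesis cvTheta : convex_set (Theta : set (convex_lmodType 'cV[R]_p)).
Hypotheses (Theta0 : Theta theta0) (bdTheta : bounded_set Theta).
Hypothesis derb : theta_derivatives Theta b gradb hessb.
Variables (L LX A0 Lf : R).
Hypotheses (L_ge0 : 0 <= L) (LX_ge0 : 0 <= LX) (A0_ge0 : 0 <= A0) (Lf_ge0 : 0 <= Lf).
Hypothesis lipb : forall theta, closure Theta theta -> lip_coef (fun x mu => b x mu theta) L.
Hypothesis lips : lip_coef sigma L.
Hypothesis lipg : lip_coef (fun x mu => gradb x mu theta0) L.
Hypothesis liph : forall (x y : C) (mu nu : PC), finite_moment2 mu -> finite_moment2 nu ->
  forall theta, closure Theta theta ->
  block_norm (fun k => hessb x mu theta k - hessb y nu theta k) <= L * (path_dist x y + W2 mu nu).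
Hypothesis lipS : forall (x y : C) (mu nu : PC), finite_moment2 mu -> finite_moment2 nu ->
  sigma2 sigma x mu \in unitmx -> sigma2 sigma y nu \in unitmx ->
  hsnorm (sigma_hat sigma x mu - sigma_hat sigma y nu) <= L * (path_dist x y + W2 mu nu).
Hypothesis unit0 : forall x : C, sigma2 sigma x (dirac_law x) \in unitmx.
Hypothesis ode : limit_ode b theta0 xi T X0.
Hypothesis lipX : forall s t, - r0 <= s <= T -> - r0 <= t <= T ->
  hsnorm (X0 s - X0 t) <= LX * `|s - t|.

Local Notation seg := (segment r0 X0).
Local Notation dseg t := (dirac_law (seg t)).
Hypothesis openTheta : open Theta.
Hypothesis Xi_gt0 : forall theta, closure Theta theta -> theta <> theta0 ->
  0 < Xi b sigma theta0 T X0 theta.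
Local Notation Imat := (Imx gradb sigma T X0 theta0).
Hypothesis I_unit : Imat \in unitmx.
Hypothesis sig0 : forall t, 0 <= t <= T -> hsnorm (sigma (seg t) (dseg t)) <= A0.
Hypothesis hat0 : forall t, 0 <= t <= T -> hsnorm (sigma_hat sigma (seg t) (dseg t)) <= A0.
Hypothesis grad0 : forall t, 0 <= t <= T -> hsnorm (gradb (seg t) (dseg t) theta0) <= A0.
Hypothesis Ups_lip : forall s t, 0 <= s <= T -> 0 <= t <= T ->
  hsnorm (Upsilon gradb sigma (seg s) (dseg s) theta0 - Upsilon gradb sigma (seg t) (dseg t) theta0)
    <= Lf * `|s - t|.
Hypothesis ae_unit : forall X : {RV P >-> C}, finite_moment2 (law X) ->
  {ae P, forall w, sigma2 sigma (X w) (law X) \in unitmx}.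
Variables (Y : R -> nat -> int -> O -> 'cV[R]_d) (Yhat : R -> nat -> nat -> {RV P >-> C}).
Variables (thetahat : R -> nat -> O -> 'cV[R]_p) (Z : O -> 'cV[R]_p).
Hypothesis scheme : forall eps n M, 0 < eps < 1 -> admissible T r0 n M ->
  euler_scheme b sigma B theta0 xi T eps n M (Y eps n) (Yhat eps n) /\
  least_squares_estimator b sigma Theta T eps n (Y eps n) (Yhat eps n) (thetahat eps n).
Hypothesis ito : is_ito_integral P B T
  (fun s => Upsilon gradb sigma (seg s) (dseg s) theta0) Z.

Definition deviation (eta eps : R) (n : nat) : set O :=
  [set w | eta < hsnorm (eps^-1 *: (thetahat eps n w - theta0) - invmx Imat *m Z w)].

Lemma measurable_deviation eta eps n M : 0 < eps < 1 -> admissible T r0 n M ->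
  measurable (deviation eta eps n).
Proof.
move=> eps01 adm; have [_ [mth _ _]] := scheme eps01 adm; have [mZ _] := ito.
pose f w := hsnorm (eps^-1 *: (thetahat eps n w - theta0) - invmx Imat *m Z w).
have -> : deviation eta eps n = ~` [set w | f w <= eta].
  by apply/seteqP; split => w; rewrite /deviation /= ltNge => /negP.
apply: measurableC; rewrite -[X in measurable X]setTI.
apply: (@measurable_fun_le _ _ _ setT f (cst eta)) => //.
apply: measurable_hsnorm; apply: measurable_mxB.
  apply: measurable_mxZ => //; apply: measurable_mxB; last exact: measurable_mx_cst.
  by move=> i j; rewrite ord1; exact: mth.
apply: measurable_mxM; first exact: measurable_mx_cst.
by move=> i j; rewrite ord1; exact: mZ.
Qed.

(** The events excluded are: a large scheme error, a large [zeta] or [mvec], failure of the chaining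
    bound, and a large distance from [zeta] to the sum along the limit path or from that sum to [Z].
    On the rest [minimizer_stability] applies outcome by outcome. *)
Lemma estimator_deviation (eta gamma : R) : 0 < eta -> 0 < gamma -> exists2 s0 : R, 0 < s0 &
  forall eps n M, 0 < eps < 1 -> admissible T r0 n M -> eps < s0 -> T / n%:R < s0 ->
    (P (deviation eta eps n) <= gamma%:E)%E.
Proof.
move=> eta0 gamma0; have T0 := ltW T_gt0.
have [cX0 _ _] := ode.
have [D D0 DP] := diameter theta0 bdTheta.
pose g := gamma / 6; have g0 : 0 < g by rewrite divr_gt0.
pose cm := @cmax R d m T L LX A0; have cm0 : 0 <= cm := cmax_ge0 T_gt0 L_ge0 LX_ge0 A0_ge0.
pose gr := @gron R d m T L LX A0; have gr0 : 0 <= gr := gron_ge0 T_gt0 L LX A0.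
pose Mz := m%:R * (T * (cm ^+ 3) ^+ 2); pose Mm := m%:R * (T * (cm ^+ 2) ^+ 2).
have Mz0 : 0 <= Mz by rewrite !mulr_ge0 // sqr_ge0.
have Mm0 : 0 <= Mm by rewrite !mulr_ge0 // sqr_ge0.
(* Since [A <= A ^ 2], Markov's inequality bounds by [g] the probability that [zeta], or [mvec],
   exceeds [A]. *)
pose A := (Mz + Mm) / g + 1.
have A1 : 1 <= A by rewrite lerDr divr_ge0 ?addr_ge0 ?(ltW g0).
have A_gt0 : 0 < A := lt_le_trans ltr01 A1.
have A2 : (Mz + Mm) / A ^+ 2 <= g.
  rewrite ler_pdivrMr ?exprn_gt0 // mulrC -ler_pdivrMr //.
  have : A <= A ^+ 2 by rewrite expr2 ler_peMl // ltW.
  by apply: le_trans; rewrite lerDl.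
have C0 : 0 < 2 * m%:R * expR (T / 2) :> R by rewrite !mulr_gt0 ?expR_gt0 ?ltr0n.
pose cn := @cnoise R d m T L LX A0; have cn0 : 0 < cn := cnoise_gt0 T_gt0 A0 L_ge0 LX_ge0.
have k0 : 0 < m%:R * cn by rewrite mulr_gt0 ?ltr0n.
have [K K0 KP] := @chaining R dO O P p D _ _ g p_gt0 D0 C0 k0 g0.
have [tau [kz [tau0 kz0 stab]]] := minimizer_stability r0_gt0 T_gt0 cvTheta Theta0 bdTheta derb
  L_ge0 LX_ge0 lipb lipg liph lipS unit0 cX0 lipX openTheta Xi_gt0 I_unit eta0 (ltW A_gt0) (ltW K0).
(* The chaining level at which the noise falls below [tau]; the matching radius is the [rhoN] given
   to the stability lemma. *)
have [J JP] : exists J, K / 2 ^+ J <= tau.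
  have v0 : 0 <= K / tau by rewrite divr_ge0 // ltW.
  exists (Num.truncn (K / tau)).+1.
  rewrite ler_pdivrMr ?exprn_gt0 // mulrC -ler_pdivrMr //.
  have /andP[_ /ltW h] := truncn_itv v0; apply: (le_trans h).
  by rewrite -natrX ler_nat ltnW // ltn_expl.
have rN0 : 0 < p%:R * (2 * D) / 4 ^+ J by rewrite divr_gt0 ?mulr_gt0 ?exprn_gt0 ?ltr0n.
have {stab} [s1 [kap [s10 /andP[kap0 kap1] stab]]] := stab _ rN0.
pose Cd := m%:R * (T * ((3 * L * cm ^+ 2) ^+ 2 * (8 * (gr + LX ^+ 2)))).
have gL : 0 <= gr + LX ^+ 2 by rewrite addr_ge0 // sqr_ge0.
have Cd0 : 0 <= Cd.
  apply: mulr_ge0 => //; apply: mulr_ge0 => //; apply: mulr_ge0 (sqr_ge0 _) _; exact: mulr_ge0.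
have kap4 : 0 < kap / 4 by rewrite divr_gt0.
have kz2 : 0 < kz / 2 by rewrite divr_gt0.
have [sA sA0 sAP] := small_sqr gr0 (mulr_gt0 g0 (exprn_gt0 2 kap4)).
have [sB sB0 sBP] := small_sqr (mulr_ge0 (ler0n R 2) gL) (exprn_gt0 2 kap4).
have [sD sD0 sDP] := small_sqr Cd0 (mulr_gt0 g0 (exprn_gt0 2 kz2)).
have Ce0 : 0 <= 4 * m%:R * T * Lf ^+ 2 :> R by rewrite !mulr_ge0 // sqr_ge0.
have [sE sE0 sEP] := small_sqr Ce0 (mulr_gt0 g0 (exprn_gt0 2 kz2)).
pose sC := kap / 2 / (3 * LX + 1).
have c30 : 0 < 3 * LX + 1 by rewrite ltr_wpDl // mulr_ge0.
have sC0 : 0 < sC by rewrite !divr_gt0.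
exists (Num.min s1 (Num.min (Num.min sA sB) (Num.min sC (Num.min sD sE)))).
  by rewrite !lt_min s10 sA0 sB0 sC0 sD0.
move=> eps n M eps01 adm; have [n_gt0 M_gt0 eTM] := adm.
have [[Yi Ys Yp] [mth Tth aemin]] := scheme eps01 adm.
have [eps0 eps1] := andP eps01.
move: Yi Ys Yp aemin; rewrite /least_squares_estimator; set delta := T / n%:R.
move=> Yi Ys Yp aemin; rewrite !lt_min.
move=> /andP[es1 /andP[/andP[esA esB] /andP[esC /andP[esD esE]]]].
move=> /andP[ds1 /andP[/andP[dsA dsB] /andP[dsC /andP[dsD dsE]]]].
have d0 : 0 < delta by rewrite divr_gt0 ?ltr0n.
have nT : n%:R * delta = T by rewrite mulrC divfK // pnatr_eq0 -lt0n.
have Mr0 : M%:R * delta = r0 by rewrite /delta eTM mulrC divfK // pnatr_eq0 -lt0n.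
pose ups t := Upsilon gradb sigma (seg t) (dseg t) theta0.
pose zet := zeta B theta0 sigma gradb X0 delta n (Y eps n) (Yhat eps n).
pose mve := mvec B sigma X0 delta n (Y eps n) (Yhat eps n).
pose zdi := zeta_diff B theta0 sigma gradb X0 delta n (Y eps n) (Yhat eps n).
pose noi := noise B theta0 b sigma gradb X0 delta n (Y eps n) (Yhat eps n).
pose zri w := mxsum B n delta (fun k _ => ups (k%:R * delta)) w - Z w.
have [m1 P1] := pmax_err_prob uF bB r0_gt0 T_gt0 Theta0 ode L_ge0 LX_ge0 A0_ge0 lipb lips lipX sig0
  eps01 n_gt0 M_gt0 nT Mr0 Yi Ys Yp kap4.
have [iz Ez] := zeta_moment uF bB r0_gt0 T_gt0 Theta0 ode L_ge0 LX_ge0 A0_ge0 lipb lips lipg lipS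
  unit0 lipX sig0 hat0 grad0 eps01 n_gt0 M_gt0 nT Mr0 Yi Ys Yp.
have [im Em] := mvec_moment uF bB r0_gt0 T_gt0 Theta0 ode L_ge0 LX_ge0 A0_ge0 lipb lips lipS
  unit0 lipX sig0 hat0 eps01 n_gt0 M_gt0 nT Mr0 Yi Ys Yp.
have [id Ed] := zeta_diff_moment uF bB r0_gt0 T_gt0 Theta0 ode L_ge0 LX_ge0 A0_ge0 lipb lips lipg lipS
  unit0 lipX sig0 hat0 grad0 eps01 n_gt0 M_gt0 nT Mr0 Yi Ys Yp.
have Wk k (kn : (k < n)%N) := W_sqr uF bB r0_gt0 T_gt0 Theta0 ode L_ge0 LX_ge0 A0_ge0 lipb lips lipX
  sig0 eps01 n_gt0 M_gt0 nT Mr0 Yi Ys Yp kn.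
have noit th th' rho u (ct : closure Theta th) (ct' : closure Theta th') (rho0 : 0 < rho)
    (hr : hsnorm (th - th') <= rho) := noise_tail uF bB r0_gt0 T_gt0 m_gt0
  cvTheta Theta0 derb ode L_ge0 LX_ge0 A0_ge0 lipb lips lipg liph lipS unit0 lipX sig0 hat0
  eps01 n_gt0 M_gt0 nT Mr0 Yi Ys Yp u ct ct' rho0 hr.
have noil w := noise_lipschitz uF bB r0_gt0 T_gt0 cvTheta Theta0 derb ode L_ge0 LX_ge0 A0_ge0
  lipb lips liph lipS unit0 lipX sig0 hat0 eps01 n_gt0 M_gt0 nT Mr0 Yi Ys Yp w.
have noim th (ct : closure Theta th) : measurable_fun setT (noi th).
  exact: (measurable_noise_theta uF bB r0_gt0 T_gt0 Theta0 ode L_ge0 LX_ge0 A0_ge0 lipb lips lipg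
    lipX eps01 n_gt0 M_gt0 nT Mr0 Yi Ys Yp ct).
have moment k (kn : (k < n)%N) : finite_moment2 (law (Yhat eps n k)).
  have lb0 := lipb (closure_theta0 Theta0).
  apply: (Yhat_moment uF r0_gt0 T_gt0 ode L_ge0 LX_ge0 A0_ge0 lipX eps01 n_gt0 M_gt0 nT Mr0 Yi Yp kn).
  exact: (good_upto uF bB r0_gt0 T_gt0 ode L_ge0 LX_ge0 A0_ge0 lb0 lips lipX eps01 n_gt0 M_gt0 nT Mr0
    Yi Ys Yp kn).
(* Chaining is based at [theta0], where the noise vanishes, so its increments from there are the
   noise itself. *)
have [E4 [m4 P4 E4P]] := KP (closure Theta) theta0 noi (closure_theta0 Theta0)
  (fun a i ca => le_trans (entry_sub_le a theta0 i) (DP a ca)) noim noil noit.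
have Zr := ito_riemann uF bB d0 nT Lf_ge0 Ups_lip ito.
have mZr : measurable_mx zri.
  apply: measurable_mxB; last by move=> i j; rewrite ord1; case: ito.
  by apply: (measurable_mxsum uF bB d0) => k l i kn; exact: measurable_cst.
have mZ2 : measurable_fun setT (fun w => hsnorm (zri w) ^+ 2).
  by apply: measurable_funX; exact: measurable_hsnorm.
have [ir Er] := intble_ub mZ2 (fun w => sqr_ge0 _) Zr.
have A20 : 0 < A ^+ 2 by rewrite exprn_gt0.
have kz20 : 0 < (kz / 2) ^+ 2 by rewrite exprn_gt0.
have P2 := markov_prob iz (fun w => sqr_ge0 _) A20 Ez.
have P3 := markov_prob im (fun w => sqr_ge0 _) A20 Em.
have P5 := markov_prob id (fun w => sqr_ge0 _) kz20 Ed.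
have P6 := markov_prob ir (fun w => sqr_ge0 _) kz20 Er.
(* A single null set collects the outcomes where invertibility fails at some step or where
   minimality fails. *)
have [N [mN N0 NP]] : {ae P, forall w, (forall k, (k < n)%N ->
      sigma2 sigma (Yhat eps n k w) (law (Yhat eps n k)) \in unitmx) /\
    (forall theta, Theta theta -> contrast b sigma T eps n (Y eps n) (Yhat eps n) (thetahat eps n w) w
        <= contrast b sigma T eps n (Y eps n) (Yhat eps n) theta w)}.
  have aeu : {ae P, forall w, forall k, (k < n)%N ->
      sigma2 sigma (Yhat eps n k w) (law (Yhat eps n k)) \in unitmx}.
    apply: ae_foralln => k; have [kn|kn] := boolP (k < n)%N; last by apply: aeW.
    by apply: filterS (ae_unit (moment k kn)) => w h _.
  exact: filterI aeu aemin.
pose U := N `|` ([set w | kap / 4 <= pmax (err X0 delta (Y eps n) w) n] `|`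
    ([set w | A ^+ 2 <= hsnorm (zet w) ^+ 2] `|` ([set w | A ^+ 2 <= hsnorm (mve w) ^+ 2] `|`
    (E4 `|` ([set w | (kz / 2) ^+ 2 <= hsnorm (zdi w) ^+ 2] `|`
      [set w | (kz / 2) ^+ 2 <= hsnorm (zri w) ^+ 2]))))).
have [le_gamma mU] : (P U <= gamma%:E)%E /\ measurable U.
  rewrite [gamma]split_six -/g.
  have lev (f : O -> R) c : intble P f -> measurable [set w | c <= f w].
    by move=> /intble_meas mf; rewrite -[X in measurable X]setTI; exact: measurable_fun_le.
  apply: probability_setU => //; first by rewrite N0.
  apply: probability_setU => //.
    apply: (le_trans P1); rewrite lee_fin ler_pdivrMr ?exprn_gt0 //.
    by apply: sAP; rewrite ?(ltW d0) ?(ltW eps0).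
  apply: probability_setU; first exact: lev.
    apply: (le_trans P2); rewrite lee_fin; apply: le_trans A2.
    by rewrite ler_pM2r ?invr_gt0 // lerDl.
  apply: probability_setU; first exact: lev.
    apply: (le_trans P3); rewrite lee_fin; apply: le_trans A2.
    by rewrite ler_pM2r ?invr_gt0 // lerDr.
  apply: probability_setU => //.
  apply: probability_setU; first exact: lev.
    apply: (le_trans P5); rewrite lee_fin ler_pdivrMr //.
    by apply: sDP; rewrite ?(ltW d0) ?(ltW eps0).
  split; last exact: lev.
  apply: (le_trans P6); rewrite lee_fin ler_pdivrMr //.
  apply: (@le_trans _ _ (4 * m%:R * T * Lf ^+ 2 * (delta ^+ 2 + eps ^+ 2))).
    by rewrite exprMn mulrA ler_wpM2l // lerDl sqr_ge0.
  by apply: sEP; rewrite ?(ltW d0) ?(ltW eps0).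
apply: le_trans _ le_gamma; apply: le_measure; rewrite ?inE //.
  exact: measurable_deviation eps01 adm.
move=> w dev; apply: contrapT; rewrite !not_orP => -[nN [n1 [n2 [n3 [n4 [n5 n6]]]]]].
have {NP nN} [wunit wmin] : (forall k, (k < n)%N ->
      sigma2 sigma (Yhat eps n k w) (law (Yhat eps n k)) \in unitmx) /\
    (forall theta, Theta theta -> contrast b sigma T eps n (Y eps n) (Yhat eps n) (thetahat eps n w) w
        <= contrast b sigma T eps n (Y eps n) (Yhat eps n) theta w).
  by apply: contrapT => h; apply: nN; exact: NP.
have lt_of (x y : R) : 0 <= x -> 0 < y -> ~ (y ^+ 2 <= x ^+ 2) -> x <= y.
  by move=> x0 y0 h; apply: ltW; rewrite ltNge; apply/negP => yx; apply: h; rewrite lerXn2r ?nnegrE // ltW.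
have zA := lt_of _ _ (hsnorm_ge0 _) A_gt0 n2.
have mA := lt_of _ _ (hsnorm_ge0 _) A_gt0 n3.
have dK := lt_of _ _ (hsnorm_ge0 _) kz2 n5.
have rK := lt_of _ _ (hsnorm_ge0 _) kz2 n6.
have perr k : (k < n)%N -> pmax (err X0 delta (Y eps n) w) k <= kap / 4.
  move=> kn; apply: (le_trans (pmax_mono _ (ltnW kn))).
  by rewrite leNgt; apply/negP => h; apply: n1; exact: ltW.
(* As [kap <= 1], a scheme error below [kap / 4] leaves the truncation inactive, and the exact
   decomposition of the contrast is available. *)
have chi_all k : (k < n)%N -> chi sigma X0 delta (Y eps n) (Yhat eps n) k w.
  move=> kn; by rewrite /chi wunit // andbT; exact: (le_trans (perr k kn) (quarter_le1 kap1)).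
move: dev; rewrite /deviation /= ltNge => /negP; apply.
have near k : (k < n)%N -> [/\ finite_moment2 (law (Yhat eps n k)),
    sigma2 sigma (Yhat eps n k w) (law (Yhat eps n k)) \in unitmx &
    path_dist (Yhat eps n k w) (seg (k%:R * delta))
      + W2 (law (Yhat eps n k)) (dseg (k%:R * delta)) + 2 * LX * delta <= kap].
  move=> kn; split; [exact: moment|exact: wunit|].
  have h1 := kapd_le r0_gt0 T_gt0 ode LX_ge0 lipX n_gt0 M_gt0 nT Mr0 Yi Yp w kn.
  have h2 : W2 (law (Yhat eps n k)) (dseg (k%:R * delta)) <= kap / 4.
    rewrite -(@ler_pXn2r _ 2) ?nnegrE ?W2_ge0 ?(ltW kap4) //; apply: (le_trans (Wk k kn)).
    by apply: sBP; rewrite ?(ltW d0) ?(ltW eps0).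
  move: dsC; rewrite /sC ltr_pdivlMr // => dsC.
  exact: half_sum_le h1 (perr k kn) h2 (ltW d0) dsC.
have NK th : closure Theta th -> `|noi th w| <= K.
  move=> cth; have := E4P w n4 0%N th cth.
  rewrite expr0 divr1 /noi noise_theta0 subr0 divr1; apply.
  apply: (le_trans (DP th cth)); have p1 : 1 <= p%:R :> R by rewrite ler1n.
  have D2 : D <= 2 * D by rewrite ler_peMl ?(ltW D0) // ler1n.
  by apply: (le_trans D2); rewrite ler_peMl // mulr_ge0 // ltW.
have Ntau th : closure Theta th -> hsnorm (th - theta0) <= p%:R * (2 * D) / 4 ^+ J ->
    `|noi th w| <= tau.
  move=> cth hth; apply: le_trans JP.
  by have := E4P w n4 J th cth hth; rewrite /noi noise_theta0 subr0.
have zz : hsnorm (zet w - Z w) <= kz.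
  have := zeta_split B theta0 gradb chi_all; rewrite -/zet -/zdi -/ups => ->.
  by rewrite -addrA [kz]splitr; apply: (le_trans (hsnormD _ _)); exact: lerD.
have es : 0 < eps < s1 by rewrite eps0.
apply: (stab eps delta n (fun k => Yhat eps n k w) (fun k => law (Yhat eps n k))
  (fun th => noi th w) (zet w) (Z w) (mve w) (thetahat eps n w) es d0 nT near zA mA NK Ntau zz (Tth w)).
move=> th Tth'; have := wmin th Tth'.
have cd := contrast_diff gradb T_gt0 eps01 n_gt0 nT Ys chi_all.
have e2 : 0 < eps ^- 2 by rewrite invr_gt0 exprn_gt0.
rewrite -(lerD2r (- contrast b sigma T eps n (Y eps n) (Yhat eps n) theta0 w)) !cd.
by rewrite ler_pM2l.
Qed.

End consistency.

Lemma lip_coef_mono {R : realType} {r0 : R} {d a c : nat}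
    (f : cpath r0 d -> probability (cpath r0 d) R -> 'M[R]_(a, c)) (K L : R) :
  0 < r0 -> K <= L -> lip_coef f K -> lip_coef f L.
Proof.
move=> r0_gt0 KL fK x y mu nu fmu fnu; apply: (le_trans (fK x y _ _ fmu fnu)).
by apply: ler_wpM2r => //; rewrite addr_ge0 ?path_dist_ge0 ?W2_ge0.
Qed.

(** A property that does not depend on the outcome cannot fail on a null set only; this turns the
    almost sure invertibility of (A2) for a constant variable into invertibility. *)
Lemma ae_const {d} {O : measurableType d} {R : realType} (P : probability O R) (Q : Prop) :
  {ae P, forall w : O, Q} -> Q.
Proof.
move=> [N [mN N0 NP]]; apply: contrapT => nQ.
have : (P setT <= P N)%E by apply: le_measure; rewrite ?inE // => w _; exact: NP.
by rewrite N0 probability_setT lee_fin ler10.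
Qed.

(** Translates thresholds on [eps] and on the step [T / n] into the product filter restricted to
    admissible step numbers. *)
Lemma near_small_step {R : realType} (T r0 s : R) (Q : R * nat -> Prop) : 0 < s ->
  (forall eps n M, 0 < eps < 1 -> admissible T r0 n M -> eps < s -> T / n%:R < s ->
    Q (eps, n)) ->
  \forall q \near within [set q : R * nat | exists M, admissible T r0 q.2 M]
    (filter_prod 0^'+ \oo), Q q.
Proof.
move=> s0 h; exists ([set e | 0 < e < Num.min 1 s], [set n | (Num.truncn (`|T| / s) < n)%N]).
  split=> /=; last by exists (Num.truncn (`|T| / s)).+1.
  near=> e; apply/andP; split; first by near: e; exact: nbhs_right_gt.
  by near: e; apply: nbhs_right_lt; rewrite lt_min ltr01.
move=> [e n] /= [/andP[e0]]; rewrite lt_min => /andP[e1 es] ns [M adm].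
apply: (h e n M) => //; first by rewrite e0.
have v0 : 0 <= `|T| / s by rewrite divr_ge0 // ltW.
have n0 : 0 < n%:R :> R by rewrite ltr0n; exact: leq_ltn_trans ns.
rewrite ltr_pdivrMr // mulrC -ltr_pdivrMr //.
apply: (@le_lt_trans _ _ (`|T| / s)); first by rewrite ler_pM2r ?invr_gt0 // ler_norm.
have /andP[_ h1] := truncn_itv v0; apply: (lt_le_trans h1).
by rewrite ler_nat.
Unshelve. all: by end_near.
Qed.

Theorem theorem4p1 (R : realType) (d m p : nat) (r0 T : R)
    (dO : measure_display) (O : measurableType dO) (P : probability O R)
    (F : R -> set (set O)) (B : R -> O -> 'cV[R]_m)
    (Theta : set 'cV[R]_p) (theta0 : 'cV[R]_p) (xi : cpath r0 d)
    (b : cpath r0 d -> probability (cpath r0 d) R -> 'cV[R]_p -> 'cV[R]_d)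
    (sigma : cpath r0 d -> probability (cpath r0 d) R -> 'M[R]_(d, m))
    (gradb : cpath r0 d -> probability (cpath r0 d) R -> 'cV[R]_p ->
      'M[R]_(d, p))
    (hessb : cpath r0 d -> probability (cpath r0 d) R -> 'cV[R]_p ->
      'I_p -> 'M[R]_(p, d))
    (X0 : R -> 'cV[R]_d)
    (Y : R -> nat -> int -> O -> 'cV[R]_d)
    (Yhat : R -> nat -> nat -> {RV P >-> cpath r0 d})
    (thetahat : R -> nat -> O -> 'cV[R]_p)
    (Z : O -> 'cV[R]_p) :
  (0 < d)%N -> (0 < m)%N -> (0 < p)%N -> 0 < r0 -> 0 < T ->
  usual_filtration P F -> brownian P F B ->
  open Theta -> bounded_set Theta ->
  convex_set (Theta : set (convex_lmodType 'cV[R]_p)) -> Theta theta0 ->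
  theta_derivatives Theta b gradb hessb ->
  condA1 Theta b sigma -> condA2 P sigma -> condA3 xi ->
  condB1 Theta gradb -> condB2 Theta hessb ->
  limit_ode b theta0 xi T X0 ->
  (forall eps n M, 0 < eps < 1 -> admissible T r0 n M ->
     euler_scheme b sigma B theta0 xi T eps n M (Y eps n) (Yhat eps n) /\
     least_squares_estimator b sigma Theta T eps n (Y eps n) (Yhat eps n)
       (thetahat eps n)) ->
  (forall theta, closure Theta theta -> theta <> theta0 ->
     0 < Xi b sigma theta0 T X0 theta) ->
  {within Theta, continuous (Imx gradb sigma T X0)} ->
  {within Theta, continuous (Kmx b hessb sigma theta0 T X0)} ->
  Imx gradb sigma T X0 theta0 \in unitmx ->
  is_ito_integral P B T
    (fun s => Upsilon gradb sigma (segment r0 X0 s)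
                (dirac_law (segment r0 X0 s)) theta0) Z ->
  forall eta : R, 0 < eta ->
    P [set w | eta < hsnorm ((q.1)^-1 *: (thetahat q.1 q.2 w - theta0)
                             - invmx (Imx gradb sigma T X0 theta0) *m Z w)]
      @[q --> within [set q : R * nat | exists M, admissible T r0 q.2 M]
                (filter_prod 0^'+ \oo)] --> 0%E.
Proof.
move=> d_gt0 m_gt0 p_gt0 r0_gt0 T_gt0 uF bB openT bdT cvT T0 derb [a1 [a2 [b1 [b2 [a10 a20 b10 b20 A1]]]]].
move=> [aeu [L1 L10 A2]] A3 [K1 K10 B1] [K2 K20 B2] ode scheme Xi_gt0 _ _ uI ito eta eta0.
have Tge0 := ltW T_gt0.
pose La := Num.sqrt a1 + Num.sqrt a2; pose Lb := Num.sqrt b1 + Num.sqrt b2.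
have La0 : 0 <= La by rewrite addr_ge0 // sqrtr_ge0.
have Lb0 : 0 <= Lb by rewrite addr_ge0 // sqrtr_ge0.
(* One Lipschitz constant for all coefficients, obtained by adding the individual ones. *)
pose L := La + (Lb + (L1 + (K1 + K2))).
have l1 : 0 <= K1 + K2 := addr_ge0 (ltW K10) (ltW K20).
have l2 : 0 <= L1 + (K1 + K2) := addr_ge0 (ltW L10) l1.
have l3 : 0 <= Lb + (L1 + (K1 + K2)) := addr_ge0 Lb0 l2.
have L0 : 0 <= L by exact: addr_ge0.
have LaL : La <= L by rewrite lerDl.
have LbL : Lb <= L by rewrite /L addrCA lerDl; exact: addr_ge0.
have l4 : L1 + (K1 + K2) <= L by rewrite /L [leRHS]addrA lerDr; exact: addr_ge0.
have L1L : L1 <= L by apply: le_trans l4; rewrite lerDl.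
have K12 : K1 + K2 <= L by apply: le_trans l4; rewrite lerDr ltW.
have K1L : K1 <= L by apply: le_trans K12; rewrite lerDl ltW.
have K2L : K2 <= L by apply: le_trans K12; rewrite lerDr ltW.
have kap0 (x y : cpath r0 d) (mu nu : probability (cpath r0 d) R) :
    0 <= path_dist x y + W2 mu nu by rewrite addr_ge0 ?path_dist_ge0 ?W2_ge0.
have lipb theta : closure Theta theta -> lip_coef (fun x mu => b x mu theta) L.
  move=> ct; apply: (lip_coef_mono r0_gt0 LaL) => x y mu nu fmu fnu.
  apply: sqr_le_sum_lip; rewrite ?path_dist_ge0 ?W2_ge0 ?(ltW a10) ?(ltW a20) //.
  by have [h _] := A1 x y mu nu fmu fnu; exact: h.
have lips : lip_coef sigma L.
  apply: (lip_coef_mono r0_gt0 LbL) => x y mu nu fmu fnu.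
  apply: sqr_le_sum_lip; rewrite ?path_dist_ge0 ?W2_ge0 ?(ltW b10) ?(ltW b20) //.
  by have [_ h] := A1 x y mu nu fmu fnu.
have cT0 := closure_theta0 T0.
have lipg : lip_coef (fun x mu => gradb x mu theta0) L.
  by apply: (lip_coef_mono r0_gt0 K1L) => x y mu nu fmu fnu; exact: B1.
have liph (x y : cpath r0 d) (mu nu : probability (cpath r0 d) R) :
    finite_moment2 mu -> finite_moment2 nu -> forall theta, closure Theta theta ->
    block_norm (fun k => hessb x mu theta k - hessb y nu theta k) <= L * (path_dist x y + W2 mu nu).
  move=> fmu fnu th cth; apply: (le_trans (B2 x y mu nu fmu fnu th cth)).
  exact: ler_wpM2r.
have lipS (x y : cpath r0 d) (mu nu : probability (cpath r0 d) R) :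
    finite_moment2 mu -> finite_moment2 nu ->
    sigma2 sigma x mu \in unitmx -> sigma2 sigma y nu \in unitmx ->
    hsnorm (sigma_hat sigma x mu - sigma_hat sigma y nu) <= L * (path_dist x y + W2 mu nu).
  move=> fmu fnu ux uy; apply: (le_trans (A2 x y mu nu fmu fnu ux uy)).
  exact: ler_wpM2r.
(* (A2) applied to the constant variable [x], whose law is the Dirac mass. *)
have unit0 (x : cpath r0 d) : sigma2 sigma x (dirac_law x) \in unitmx.
  apply: (ae_const (P := P)).
  have := aeu (cst x : {RV P >-> cpath r0 d}); rewrite law_cst; apply.
  exact: finite_moment2_dirac.
have [LX LX0 lipX] := limit_ode_lipschitz r0_gt0 T_gt0 L0 (lipb _ cT0) A3 ode.
have [cX0 _ _] := ode.
have sL := seg_lip_on r0_gt0 L0 LX0 cX0 lipX lips.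
have gL := seg_lip_on r0_gt0 L0 LX0 cX0 lipX lipg.
have hL := S_lip_on r0_gt0 L0 LX0 lipS unit0 cX0 lipX.
have [c1 c10 sB] := lip_on_bounded Tge0 sL.
have [c2 c20 gB] := lip_on_bounded Tge0 gL.
have [c3 c30 hB] := lip_on_bounded Tge0 hL.
have A00 : 0 <= c1 + c2 + c3 by rewrite !addr_ge0.
have C1 : c1 <= c1 + c2 + c3 by rewrite -addrA lerDl addr_ge0.
have C2 : c2 <= c1 + c2 + c3 by rewrite addrAC lerDr addr_ge0.
have C3 : c3 <= c1 + c2 + c3 by rewrite lerDr addr_ge0.
have [Lf Lf0 uL] := lip_onM Tge0 (lip_onM Tge0 (lip_onT gL) hL) sL.
have tail gamma := estimator_deviation uF bB r0_gt0 T_gt0 m_gt0 p_gt0 cvT T0 bdT derb L0 LX0 A00 Lf0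
  lipb lips lipg liph lipS unit0 ode lipX openT Xi_gt0 uI
  (fun t tT => le_trans (sB t tT) C1)
  (fun t tT => le_trans (hB t tT) C3)
  (fun t tT => le_trans (gB t tT) C2)
  uL aeu scheme ito eta0 (gamma := gamma).
(* Convergence in the extended reals is reduced to the reals; along admissible pairs with [eps < 1]
   the deviation set is measurable, so its probability is finite. *)
apply/fine_cvgP; split.
  apply: (near_small_step ltr01) => eps n M eps01 adm _ _.
  by apply: fin_num_measure; exact: (measurable_deviation scheme ito eta eps01 adm).
apply/cvgrPdist_le => gamma gamma0.
have [s s0 sP] := tail gamma gamma0.
apply: (near_small_step s0) => eps n M eps01 adm es ds.
have mD := measurable_deviation scheme ito eta eps01 adm.
have := sP eps n M eps01 adm es ds; rewrite sub0r normrN /=.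
have fD : P (deviation theta0 sigma gradb T X0 thetahat Z eta eps n) \is a fin_num.
  exact: fin_num_measure.
rewrite -(fineK fD) lee_fin => h; rewrite ger0_norm //=.
by apply: fine_ge0; exact: measure_ge0.
Qed.
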